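(* The finite groups $G$ which act linearly, orientation-preservingly and pseudofreely on $S^2\times S^2$ are, up to isomorphism, exactly the groups listed in (1)--(4) below. Moreover, for each of the four possibilities for $\varphi(G)$ indicated, the groups which have such an action with that $\varphi(G)$ are exactly those in the corresponding item. (1) $A_4$, $S_4$, $A_5$ (the tetrahedral, octahedral and icosahedral groups), $\mathbb{Z}_n$, and $D_n$, acting homologically trivially ($\varphi(G)=1$). (2) $\mathbb{Z}_n\times\mathbb{Z}_2$ and $\mathbb{Z}_{2n}$, where $K=\ker\varphi\cong\mathbb{Z}_n$ and $\varphi(G)=\left\langle\begin{pmatrix}-1&0\\0&-1\end{pmatrix}\right\rangle$. (3) With $\varphi(G)=\left\langle\begin{pmatrix}0&1\\1&0\end{pmatrix}\right\rangle$, the groups (a) $(\mathbb{Z}_{m_-}\rtimes\mathbb{Z}_{2^{n_2+1}})\times\mathbb{Z}_{m_+}$; (b) $D^*_{2^{n_2-1}m_-}\times\mathbb{Z}_{m_+}$; (c) $\langle D_n,k\mid k^2=g_{k^2},\ kgk^{-1}=\gamma(g)\text{ for }g\in D_n\rangle$, where the extension $1\to D_n\to G\to\mathbb{Z}_2\to1$ does not split. (4) With $\varphi(G)=\left\langle\begin{pmatrix}-1&0\\0&-1\end{pmatrix},\begin{pmatrix}0&1\\1&0\end{pmatrix}\right\rangle\cong\mathbb{Z}_2\times\mathbb{Z}_2$, the groups (a) $D^*_{2^{n_2}m_-}\times\mathbb{Z}_{m_+}$; (b) $((\mathbb{Z}_{m_-}\rtimes\mathbb{Z}_{2^{n_2+1}})\times\mathbb{Z}_{m_+})\rtimes\mathbb{Z}_2$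 with $n_2>1$.
   Context: An action of a finite group on a compact space is pseudofree if only finitely many points have nontrivial isotropy. View $S^2\times S^2\subset\mathbb{R}^3\times\mathbb{R}^3=\mathbb{R}^6$ as the product of unit spheres. An orientation preserving action on $S^2\times S^2$ is linear if every group element acts as the restriction of an element of $O(6)$ mapping $S^2\times S^2$ to itself. For an orientation preserving action of $G$, $\varphi:G\to\operatorname{Aut}(H_2(S^2\times S^2;\mathbb{Z}))=GL(2,\mathbb{Z})$ denotes the induced action on homology with respect to the standard basis $x,y$ (classes of the two factors). Notation: $\mathbb{Z}_n$ ($n\ge1$) is cyclic of order $n$; $D_n$ is the dihedral group of order $2n$ ($n\ge2$); $D^*_m=\langle k,q\mid k^m=q^2,\ q^{-1}kq=k^{-1}\rangle$ is the binary dihedral group of order $4m$. In (3)(a),(b) and (4), $n_2\ge1$ is an integer and $m_-,m_+\ge1$ range over coprime odd integers. In $\mathbb{Z}_{m_-}\rtimes\mathbb{Z}_{2^{n_2+1}}$ a generator $u$ of $\mathbb{Z}_{2^{n_2+1}}$ acts on $\mathbb{Z}_{m_-}$ by inversion. In (4)(b), the generator of the last factor $\mathbb{Z}_2$ acts by the automorphism which is the identity on $\mathbb{Z}_{m_-}$ and $\mathbb{Z}_{m_+}$ and sends $u\mapsto u^{1+2^{n_2}}$. In (3)(c), $\gamma$ is an automorphism of $D_n$, $g_{k^2}\in D_n$ is fixed by $\gamma$, and $\gamma^2$ is conjugation $g\mapsto g_{k^2}\,g\,g_{k^2}^{-1}$, so that the presentation defines an extension of $\mathbb{Z}_2$ by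 $D_n$; $D_n=\ker\varphi$. *)

(* Defs.v *)
From HB Require Import structures.
From mathcomp Require Import all_boot all_order all_algebra all_fingroup all_solvable.
From mathcomp Require Import boolp classical_sets cardinality set_interval reals.
From mathcomp Require Import topology trigo.
From mathcomp Require Import freeg.

Set Implicit Arguments.
Unset Strict Implicit.
Unset Printing Implicit Defensive.

Import Order.TTheory GRing.Theory Num.Theory.
Import numFieldTopology.Exports.

Local Open Scope classical_set_scope.
Local Open Scope ring_scope.

(* Singular homology with integer coefficients, in its cubical form (Serre,
   Massey): chains are formal sums of continuous maps I^n -> X, taken modulo
   the degenerate ones. *)
Section CubicalSingularHomology.
Variable R : realType.

Definition unit_interval : set R := `[0, 1].

Lemma unit_interval0 : (0 : R) \in unit_interval.
Proof. by rewrite inE /unit_interval/= in_itv/= lexx ler01. Qed.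

Lemma unit_interval1 : (1 : R) \in unit_interval.
Proof. by rewrite inE /unit_interval/= in_itv/= lexx ler01. Qed.

Definition end0 : unit_interval := SigSub unit_interval0.
Definition end1 : unit_interval := SigSub unit_interval1.

Local Notation cube n X := ('rV[unit_interval]_n -> X).

Definition degenerate n X (s : cube n X) : Prop :=
  exists i : 'I_n, forall t t' : 'rV[unit_interval]_n,
    (forall j, j != i -> t 0 j = t' 0 j) -> s t = s t'.

Definition face n X (i : 'I_n.+1) (e : unit_interval)
    (s : cube n.+1 X) : cube n X :=
  fun t => s (\row_j (if unlift i j is Some k then t 0 k else e)).

(* Continuity of the cubes is not part of this type; it is imposed by
   [singular] below. *)
Definition chain n (X : choiceType) := {freeg (cube n X) / int}.

Definition singular n (X : topologicalType) (c : chain n X) : Prop :=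
  forall s, s \in dom c -> continuous s.

Definition degenerate_chain n (X : choiceType) (c : chain n X) : Prop :=
  forall s, s \in dom c -> degenerate s.

Definition boundary n (X : choiceType) (c : chain n.+1 X) : chain n X :=
  fglift (fun s : cube n.+1 X =>
    \sum_(i < n.+1) (-1) ^+ i *: (<< face i end1 s >> - << face i end0 s >>)) c.

Definition push_chain n (X Y : choiceType) (f : X -> Y) (c : chain n X) :
  chain n Y :=
  fglift (fun s : cube n X => << f \o s >>) c.

(* For singular cycles c and c': equality of their classes in H_n(X; Z). *)
Definition homologous n (X : topologicalType) (c c' : chain n X) : Prop :=
  exists w : chain n.+1 X, exists d : chain n X,
    [/\ singular w, degenerate_chain d & c - c' = boundary w + d].

End CubicalSingularHomology.

Arguments unit_interval R : clear implicits.

Section ProductOfSpheres.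
Variable R : realType.

Definition sphere2 : set 'rV[R]_3 := [set v | \sum_i v 0 i ^+ 2 = 1].

Definition S2xS2 : set 'rV[R]_(3 + 3) :=
  [set p | sphere2 (lsubmx p) /\ sphere2 (rsubmx p)].

Lemma S2xS2_row_mx (p q : sphere2) : row_mx (val p) (val q) \in S2xS2.
Proof.
by rewrite inE /S2xS2/= row_mxKl row_mxKr; split; apply/set_mem/valP.
Qed.

Definition sphere_pair (p q : sphere2) : S2xS2 := SigSub (S2xS2_row_mx p q).

Definition spherical_row (a b : R) : 'rV[R]_3 :=
  \row_j nth 0 [:: sin a * cos b; sin a * sin b; cos a] j.

Lemma spherical_row_sphere2 a b : spherical_row a b \in sphere2.
Proof.
rewrite inE /sphere2/= !big_ord_recr big_ord0 /= !mxE /= add0r.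
by rewrite !exprMn -mulrDr cos2Dsin2 mulr1 addrC cos2Dsin2.
Qed.

Definition spherical a b : sphere2 := SigSub (spherical_row_sphere2 a b).

(* Spherical coordinates (colatitude, longitude), as a single singular square.
   The two longitude faces agree and the two colatitude faces are constant, so
   it is a cycle modulo degenerate cubes; it represents the fundamental class
   of S^2. *)
Definition sphere_cube : 'rV[unit_interval R]_2 -> sphere2 :=
  fun t => spherical (pi * val (t 0 0)) (pi *+ 2 * val (t 0 1)).

(* The standard basis (x, y) of H_2(S^2 x S^2; Z). *)
Definition H2_basis (i : 'I_2) : chain R 2 S2xS2 :=
  let base := spherical 0 0 in
  if i == 0 then << (fun t => sphere_pair (sphere_cube t) base) >>
  else << (fun t => sphere_pair base (sphere_cube t)) >>.

(* M is the matrix of the map induced by f on H_2, rows being the coordinates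
   of the images of x and y. *)
Definition H2_matrix (f : S2xS2 -> S2xS2) (M : 'M[int]_2) : Prop :=
  forall i, homologous (push_chain f (H2_basis i))
                       (\sum_j M i j *: H2_basis j).

Definition orthogonal_mx n (A : 'M[R]_n) : Prop := A *m A^T = 1%:M.

Definition tangent (p v : 'rV[R]_(3 + 3)) : Prop :=
  lsubmx v *m (lsubmx p)^T = 0 /\ rsubmx v *m (rsubmx p)^T = 0.

(* S^2 x S^2 is oriented by its outward normals: a tangent frame V at (x, y) is
   positive when (x, 0), (0, y), V is a positive basis of R^6. *)
Definition framed (p : 'rV[R]_(3 + 3)) (V : 'M[R]_(4, 3 + 3)) : 'M[R]_6 :=
  col_mx (col_mx (row_mx (lsubmx p) 0) (row_mx 0 (rsubmx p))) V.

(* The differential of p |-> p *m A at every point is v |-> v *m A. *)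
Definition orientation_preserving (A : 'M[R]_(3 + 3)) : Prop :=
  forall p V, S2xS2 p -> (forall i, tangent p (row i V)) ->
    0 < \det (framed p V) -> 0 < \det (framed (p *m A) (V *m A)).

Section Actions.
Variable gT : finGroupType.
(* MathComp actions are right actions; with the row convention of [H2_matrix]
   the action on homology is then a homomorphism gT -> GL(2, Z). *)
Implicit Type to : {action gT &-> S2xS2}.

Definition linear_orientation_preserving to : Prop :=
  forall g : gT, exists A : 'M[R]_(3 + 3),
    [/\ orthogonal_mx A, forall p, val (to p g) = val p *m A
      & orientation_preserving A].

Definition pseudofree to : Prop :=
  finite_set [set p | exists2 g : gT, g != 1%g & to p g = p].

Definition phi_image to : set 'M[int]_2 :=
  [set M | exists g, H2_matrix (to^~ g) M].

Definition phi_ker to : {set gT} :=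
  [set g | `[< H2_matrix (to^~ g) 1%:M >]]%SET.

End Actions.
End ProductOfSpheres.

Arguments S2xS2 R : clear implicits.

Definition generated_mx (S : set 'M[int]_2) : set 'M[int]_2 :=
  [set M | forall H : set 'M[int]_2, S `<=` H -> H 1%:M ->
     (forall A B, H A -> H B -> H (A *m B)) ->
     (forall A, H A -> H (invmx A)) -> H M].

Definition minus_id : 'M[int]_2 := - 1%:M.
Definition swap_mx : 'M[int]_2 := \matrix_(i, j) (i != j)%:R.

Section GroupLists.
Local Open Scope group_scope.
Variables (gT : finGroupType) (G : {group gT}).
Implicit Types (A C K : {group gT}) (u z k : gT).

Definition cyclic_of_order n (A : {set gT}) : Prop := cyclic A /\ #|A| = n.

Definition binary_dihedral m (A : {set gT}) : Prop :=
  A \isog Grp (k : q : (k ^+ m = q ^+ 2, k ^ q = k^-1)).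

Definition list1 : Prop :=
  [\/ G \isog 'Alt_('I_4), G \isog 'Sym_('I_4), G \isog 'Alt_('I_5)
    | (exists2 n, 0 < n & cyclic_of_order n G)
      \/ (exists2 n, 1 < n & G \isog 'D_(n.*2)) ]%N.

Definition list2 n : Prop :=
  G \isog finset.setX (Zp n) (Zp 2) \/ cyclic_of_order n.*2 G.

Definition admissible n2 mm mp : Prop :=
  [/\ 0 < n2, odd mm, odd mp & coprime mm mp]%N.

Definition twisted n2 mm mp A u C : Prop :=
  [/\ cyclic_of_order mm A, #[u] = (2 ^ n2.+1)%N,
      (forall a, a \in A -> a ^ u = a^-1) & cyclic_of_order mp C].

Definition list3a : Prop :=
  exists n2 mm mp A u C, [/\ admissible n2 mm mp, twisted n2 mm mp A u C
    & (A ><| <[u]>) \x C = G].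

Definition list3b : Prop :=
  exists n2 mm mp A C, [/\ admissible n2 mm mp,
    binary_dihedral (2 ^ n2.-1 * mm) A, cyclic_of_order mp C
    & A \x C = G].

Definition list3c K : Prop :=
  (exists2 n, (1 < n)%N & K \isog 'D_(n.*2)) /\
  (exists gamma gk2 k,
    [/\ gamma \in Aut K, gk2 \in K & gamma gk2 = gk2] /\
    [/\ {in K, forall g, gamma (gamma g) = gk2 * g * gk2^-1},
        k ^+ 2 = gk2, {in K, forall g, k * g * k^-1 = gamma g},
        K <*> <[k]> = G & #|G : K| = 2%N]) /\
  ~~ [splits G, over K].

Definition list3 : Prop := [\/ list3a, list3b | exists K, list3c K].

Definition list4a : Prop :=
  exists n2 mm mp A C, [/\ admissible n2 mm mp,
    binary_dihedral (2 ^ n2 * mm) A, cyclic_of_order mp C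
    & A \x C = G].

Definition list4b : Prop :=
  exists n2 mm mp A u C z, [/\ admissible n2 mm mp, (1 < n2)%N,
    twisted n2 mm mp A u C, #[z] = 2%N &
    [/\ {in A, forall a, a ^ z = a}, {in C, forall c, c ^ z = c},
        u ^ z = u ^+ (1 + 2 ^ n2)
      & ((A ><| <[u]>) \x C) ><| <[z]> = G]].

Definition list4 : Prop := list4a \/ list4b.

End GroupLists.

(* Main.v *)
(** H_2 is handled by hand.  Deforming rotations to the identity inside SO(3) and
    reversing one parameter of [sphere_cube] computes the matrix of an
    isometry; uniqueness of that matrix comes from a real cocycle on the
    singular squares of S^2: choose a tangent field along each square and add
    up the angles it makes with fixed fields along the edges.  The cocycle
    kills boundaries and degenerate squares and takes the value -4 pi on
    [sphere_cube].

    A linear isometry of S^2 x S^2 is a pair (A, B) of orthogonal matrices,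
    possibly followed by the exchange of the factors, and it preserves the
    orientation iff det A = det B.  Its fixed set is read off A, B and, when the
    factors are exchanged, off the product A B.  Hence pseudofreeness says that
    the two projections of ker phi to SO(3) are faithful, that an element acting
    by -1 on homology does not fix a point of both factors, and that no element
    exchanging the factors is an involution.

    Finite subgroups of SO(3) are classified by counting: the subgroups fixing a
    common axis partition the nontrivial elements.  A polyhedral group is
    recognised from its faithful action on its Sylow subgroups.  What remains is
    the theory of groups with a cyclic subgroup of index two and no involution
    outside of it.  Conversely, representations of ker phi in O(3) are induced
    to actions with exchange; the icosahedral group is realised as the
    rotation group of the twelve vertices, where noncommuting rotations of
    order 3 and 5 leave A_5 as the only possibility. *)
From HB Require Import structures.
Require Import Defs.
From mathcomp Require Import all_boot all_order all_algebra all_fingroup all_solvable.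
From mathcomp Require Import ring lra zify.
From mathcomp Require Import boolp classical_sets reals.
From mathcomp Require Import functions cardinality set_interval topology normedtype realfun trigo.
From mathcomp Require Import freeg complex.

Set Implicit Arguments.
Unset Strict Implicit.
Unset Printing Implicit Defensive.

Import Order.TTheory GRing.Theory Num.Theory.
Import numFieldTopology.Exports numFieldNormedType.Exports.

Local Open Scope classical_set_scope.
Local Open Scope ring_scope.

(** * The angle cocycle on singular squares *)

(** Multiplying an isometry of R^3 by its determinant gives a rotation, and an isometry of
    determinant -1 fixes a point of the sphere exactly when this rotation is a half turn. Elements
    preserving both factors thus become pairs of rotations, faithful in each coordinate on ker phi,
    and off ker phi pseudofreeness forbids two half turns at once. The obstacle is that a coordinate
    may fail to be faithful on the whole group of these elements: a nontrivial element of its kernel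
    acts as the antipodal map on one factor. If ker phi has index two in this group and there is no
    such element, the group is a rotation group without involutions off ker phi, hence cyclic; if
    there is one, it is a central involution and ker phi is cyclic. These alternatives produce the
    two groups of (2), and likewise (4)(a) and (4)(b). For an exchange g with blocks A and B, the
    square g^2 acts on the first factor by A B, so that finiteness of the fixed set of g is a
    condition on g^2. *)

Section MatrixContinuity.

Lemma continuous_matrix (T U : topologicalType) m n (f : T -> 'M[U]_(m, n)) :
  (forall i j, continuous (fun x => f x i j)) -> continuous f.
Proof.
move=> cf x A [P /= nP PA]; rewrite nbhs_simpl /=.
have H : \forall y \near x, forall ij : 'I_m * 'I_n, P ij.1 ij.2 (f y ij.1 ij.2).
  apply: filter_forall => -[i j]; exact: (cf i j x _ (nP i j)).
by apply: filterS H => y Py; apply: PA => i j; exact: (Py (i, j)).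
Qed.

Lemma continuous_coord (U : topologicalType) m n (i : 'I_m) (j : 'I_n) :
  continuous (fun M : 'M[U]_(m, n) => M i j).
Proof.
move=> M A nA.
exists (fun i' j' => if (i' == i) && (j' == j) then A else setT).
  move=> i' j'; case: ifP => [/andP[/eqP-> /eqP->]//|_]; exact: filterT.
by move=> N /(_ i j); rewrite !eqxx.
Qed.

Lemma continuous_set_type (T X : topologicalType) (A : set X) (f : T -> A) :
  continuous (val \o f) -> continuous f.
Proof.
move=> cf; exact: (@continuous_comp_initial A T X val f cf).
Qed.

Lemma continuous_val (X : topologicalType) (A : set X) : continuous (val : A -> X).
Proof. exact: (@initial_continuous A X val). Qed.

Lemma continuous_compT (T U W : topologicalType) (f : T -> U) (g : U -> W) :
  continuous f -> continuous g -> continuous (fun x => g (f x)).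
Proof. by move=> cf cg x; exact: (@continuous_comp _ _ _ f g x (cf x) (cg (f x))). Qed.

Lemma continuous_coordE (T U : topologicalType) m n (f : T -> 'M[U]_(m, n)) i j :
  continuous f -> continuous (fun x => f x i j).
Proof.
by move=> cf; exact: (continuous_compT cf (@continuous_coord U m n i j)).
Qed.

End MatrixContinuity.

(** * Contraction of the cube in small steps *)

Section UnitCube.
Variable R : realType.
Local Notation I := (unit_interval R).

Lemma clamp_subproof (x : R) : Num.max 0 (Num.min 1 x) \in unit_interval R.
Proof.
rewrite inE /unit_interval/= in_itv/= le_max lexx /= ge_max ler01 /=.
by rewrite ge_min lexx.
Qed.

Definition clamp (x : R) : I := SigSub (clamp_subproof x).

Lemma unit_interval_ge0 (t : I) : 0 <= val t.
Proof. by have := set_mem (valP t); rewrite /unit_interval/= in_itv/= => /andP[]. Qed.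

Lemma unit_interval_le1 (t : I) : val t <= 1.
Proof. by have := set_mem (valP t); rewrite /unit_interval/= in_itv/= => /andP[]. Qed.

Lemma clampK (x : R) : 0 <= x <= 1 -> val (clamp x) = x.
Proof. by case/andP=> x0 x1; rewrite /= (min_idPr x1) (max_idPr x0). Qed.

Lemma val_clamp (t : I) : clamp (val t) = t.
Proof.
by apply: val_inj; rewrite clampK // unit_interval_ge0 unit_interval_le1.
Qed.

Lemma continuous_clamp : continuous clamp.
Proof.
apply: continuous_set_type => x /=.
apply: (@continuous_max R R (fun=> 0) (Num.min 1)); first exact: cvg_cst.
by apply: (@continuous_min R R (fun=> 1) id); [exact: cvg_cst|exact: cvg_id].
Qed.

Definition clamp_row n (x : 'rV[R]_n) : 'rV[I]_n := map_mx clamp x.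
Definition val_row n (t : 'rV[I]_n) : 'rV[R]_n := map_mx val t.

Lemma val_rowK n (t : 'rV[I]_n) : clamp_row (val_row t) = t.
Proof. by apply/rowP => i; rewrite !mxE val_clamp. Qed.

Lemma continuous_clamp_row n : continuous (@clamp_row n).
Proof.
apply: continuous_matrix => i j.
under [X in continuous X]funext do rewrite mxE.
exact: (continuous_compT (@continuous_coord _ 1 n i j) continuous_clamp).
Qed.

Lemma continuous_val_row n : continuous (@val_row n).
Proof.
apply: continuous_matrix => i j.
under [X in continuous X]funext do rewrite mxE.
exact: (continuous_compT (@continuous_coord _ 1 n i j) (@continuous_val _ _)).
Qed.

(* The contraction of the cube to its corner 0, cut into [N] steps. *)
Definition shrink n N k (t : 'rV[I]_n) : 'rV[I]_n :=
  clamp_row ((k%:R / N%:R) *: val_row t).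

Lemma continuous_shrink n N k : continuous (@shrink n N k).
Proof.
have h := continuous_compT (@continuous_val_row n)
  (@scaler_continuous _ _ (k%:R / N%:R)).
exact: (continuous_compT h (@continuous_clamp_row n)).
Qed.

Lemma shrink0 n N (t t' : 'rV[I]_n) : shrink N 0 t = shrink N 0 t'.
Proof. by rewrite /shrink !mul0r !scale0r. Qed.

Lemma shrinkN n N (t : 'rV[I]_n) : shrink N.+1 N.+1 t = t.
Proof. by rewrite /shrink divff ?pnatr_eq0 // scale1r val_rowK. Qed.

(** Uniform continuity of S, drawn from the compactness of [0,1]^n after S is extended to R^n by
    [clamp_row]. A single mesh N then serves all points and all stages. *)
Lemma shrink_step n m (S : 'rV[I]_n -> 'rV[R]_m) (eps : R) :
  continuous S -> 0 < eps ->
  exists N, forall k t, (k <= N)%N ->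
    ball (S (shrink N.+1 k t)) eps (S (shrink N.+1 k.+1 t)).
Proof.
move=> cS e0; pose S' x := S (clamp_row x).
have cS' : continuous S'.
  exact: (continuous_compT (@continuous_clamp_row n) cS).
pose K := [set x : 'rV[R]_n | forall i, `[0, 1]%classic (x 0 i)].
have cK : compact K.
  exact: (@rV_compact R n (fun=> `[0, 1]%classic) (fun=> @segment_compact R 0 1)).
pose P (d : R) x := forall y, ball x d y -> ball (S' x) eps (S' y).
have HP : \forall d \near (0 : R)^'+, K `<=` P d.
  move/compact_near_coveringP: cK; apply => x Kx.
  have /nbhs_ballP[d /= d0 Hd] : nbhs x (S' @^-1` ball (S' x) (eps / 2)).
    by apply: cS'; apply: (@nbhsx_ballx R); rewrite divr_gt0.
  exists (ball x (d / 2), [set r | 0 < r < d / 2]) => /=.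
    split; first by apply: (@nbhsx_ballx R); rewrite divr_gt0.
    near=> r; apply/andP; split; near: r; first exact: nbhs_right_gt.
    by apply: nbhs_right_lt; rewrite divr_gt0.
  move=> [x' r] /= [bx' /andP[r0 rd]] y bxy.
  have h1 : ball (S' x) (eps / 2) (S' x').
    apply: Hd; apply: le_ball bx'; rewrite ler_pdivrMr // ler_peMr ?ltW //; lra.
  have h2 : ball (S' x) (eps / 2) (S' y).
    apply: Hd; rewrite (splitr d); apply: ball_triangle bx' _.
    by apply: le_ball bxy; exact: ltW.
  rewrite (splitr eps); apply: ball_triangle h2; exact: ball_sym.
have [d d0 Hd] : exists2 d : R, 0 < d & K `<=` P d.
  have : \forall d \near (0 : R)^'+, 0 < d /\ K `<=` P d.
    by apply: filterI => //; exact: nbhs_right_gt.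
  by case/filter_ex => d [d0 ?]; exists d.
(* Consecutive stages differ by at most 1/(N+1) in each coordinate, and this choice makes that
   smaller than d. *)
pose N := Num.truncn d^-1.
have Nd : N.+1%:R^-1 < d.
  have h := Num.Theory.truncnS_gt d^-1.
  by rewrite -[d]invrK ltf_pV2 // posrE ?invr_gt0 // ltr0n.
have N0 : (0 : R) < N.+1%:R by rewrite ltr0n.
exists N => k t kN.
have tv i : 0 <= val_row t 0 i <= 1.
  by rewrite mxE unit_interval_ge0 unit_interval_le1.
apply: Hd => /=.
  move=> i; rewrite /= in_itv /= !mxE; have /andP[] := tv i; rewrite !mxE => h0 h1.
  rewrite mulr_ge0 ?divr_ge0 ?ler0n //= mulr_ile1 ?divr_ge0 ?ler0n //.
  by rewrite ler_pdivrMr // mul1r ler_nat ltnW.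
split=> // i j; rewrite !mxE ord1 -ball_normE /= -mulrBl -mulrBl -natr1.
have /andP[] := tv j; rewrite !mxE => h0 h1.
rewrite opprD addrA subrr add0r mulN1r mulNr normrN normrM.
rewrite (ger0_norm h0) ger0_norm ?invr_ge0 ?ltW //.
by apply: le_lt_trans Nd; rewrite ler_piMr // invr_ge0 ltW.
Unshelve. all: by end_near. Qed.
End UnitCube.

Section ContinuityCombinators.
Variables (R : realType) (T : topologicalType).

Lemma continuous_add (W : normedModType R) (f g : T -> W) :
  continuous f -> continuous g -> continuous (fun x => f x + g x).
Proof. by move=> cf cg x; exact: (cvgD (cf x) (cg x)). Qed.

Lemma continuous_sub (W : normedModType R) (f g : T -> W) :
  continuous f -> continuous g -> continuous (fun x => f x - g x).
Proof. by move=> cf cg x; exact: (cvgB (cf x) (cg x)). Qed.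

Lemma continuous_scale (W : normedModType R) (a : T -> R) (f : T -> W) :
  continuous a -> continuous f -> continuous (fun x => a x *: f x).
Proof. by move=> cf cg x; exact: (cvgZ (cf x) (cg x)). Qed.

Lemma continuous_mul (f g : T -> R) :
  continuous f -> continuous g -> continuous (fun x => f x * g x).
Proof. by move=> cf cg x; exact: (cvgM (cf x) (cg x)). Qed.

Lemma continuous_inv (f : T -> R) : continuous f -> (forall x, f x != 0) ->
  continuous (fun x => (f x)^-1).
Proof. by move=> cf f0 x; exact: (cvgV (f0 x) (cf x)). Qed.

End ContinuityCombinators.

(** * Inner and vector products in R^3 *)

Section Vectors3.
Variable R : realType.
Local Notation V := 'rV[R]_3.

Definition dot (u v : V) : R := \sum_i u 0 i * v 0 i.

Definition vec3 (a b c : R) : V := \row_j nth 0 [:: a; b; c] j.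

Definition cross (u v : V) : V :=
  vec3 (u 0 1 * v 0 2%:R - u 0 2%:R * v 0 1)
       (u 0 2%:R * v 0 0 - u 0 0 * v 0 2%:R)
       (u 0 0 * v 0 1 - u 0 1 * v 0 0).

Lemma sum_I3 (A : nmodType) (f : 'I_3 -> A) :
  \sum_i f i = f 0 + f 1 + f 2%:R.
Proof.
rewrite !big_ord_recr big_ord0 /= add0r.
by congr (f _ + f _ + f _); apply: val_inj.
Qed.

Lemma dotE u v : dot u v = u 0 0 * v 0 0 + u 0 1 * v 0 1 + u 0 2%:R * v 0 2%:R.
Proof. exact: sum_I3. Qed.

Lemma forall_I3 (P : 'I_3 -> Prop) : P 0 -> P 1 -> P 2%:R -> forall i, P i.
Proof.
move=> P0 P1 P2 [[|[|[|//]]] lti].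
- by have -> : Ordinal lti = 0 by apply: val_inj.
- by have -> : Ordinal lti = 1 by apply: val_inj.
- by have -> : Ordinal lti = 2%:R by apply: val_inj.
Qed.

Lemma vec3_0 a b c : vec3 a b c 0 0 = a. Proof. by rewrite mxE. Qed.
Lemma vec3_1 a b c : vec3 a b c 0 1 = b. Proof. by rewrite mxE. Qed.
Lemma vec3_2 a b c : vec3 a b c 0 2%:R = c. Proof. by rewrite mxE. Qed.
Definition vec3E := (vec3_0, vec3_1, vec3_2).

Lemma row3P (u v : V) :
  u 0 0 = v 0 0 -> u 0 1 = v 0 1 -> u 0 2%:R = v 0 2%:R -> u = v.
Proof. by move=> h0 h1 h2; apply/rowP; apply: forall_I3. Qed.

Lemma dotC u v : dot u v = dot v u.
Proof. by rewrite !dotE; ring. Qed.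

Lemma dotDl u v w : dot (u + v) w = dot u w + dot v w.
Proof. by rewrite !dotE !mxE; ring. Qed.

Lemma dotDr u v w : dot u (v + w) = dot u v + dot u w.
Proof. by rewrite dotC dotDl !(dotC u). Qed.

Lemma dotZl a u v : dot (a *: u) v = a * dot u v.
Proof. by rewrite !dotE !mxE; ring. Qed.

Lemma dotZr a u v : dot u (a *: v) = a * dot u v.
Proof. by rewrite dotC dotZl dotC. Qed.

Lemma dotNl u v : dot (- u) v = - dot u v.
Proof. by rewrite -scaleN1r dotZl mulN1r. Qed.

Lemma dotNr u v : dot u (- v) = - dot u v.
Proof. by rewrite dotC dotNl dotC. Qed.

Lemma dot_ge0 u : 0 <= dot u u.
Proof. by apply: sumr_ge0 => i _; rewrite -expr2 sqr_ge0. Qed.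

Lemma dot_eq0 u : (dot u u == 0) = (u == 0).
Proof.
apply/eqP/eqP => [/eqP|->]; last by rewrite dotE !mxE; ring.
rewrite psumr_eq0 => [/allP h|i _]; last by rewrite -expr2 sqr_ge0.
apply/rowP => i; rewrite mxE; apply/eqP; rewrite -sqrf_eq0 expr2.
by apply: (h i); rewrite mem_index_enum.
Qed.

Lemma dot_gt0 u : (0 < dot u u) = (u != 0).
Proof. by rewrite lt_def dot_ge0 andbT dot_eq0. Qed.

Lemma dot_crossl u v : dot (cross u v) u = 0.
Proof. by rewrite dotE !vec3E; ring. Qed.

Lemma dot_crossr u v : dot (cross u v) v = 0.
Proof. by rewrite dotE !vec3E; ring. Qed.

Lemma dot_cross u v :
  dot (cross u v) (cross u v) = dot u u * dot v v - dot u v ^+ 2.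
Proof. by rewrite !dotE !vec3E; ring. Qed.

Lemma cross_decomposition u v w :
  dot (cross u v) (cross u v) *: w =
  (dot w u * dot v v - dot w v * dot u v) *: u +
  (dot w v * dot u u - dot w u * dot u v) *: v +
  dot (cross u v) w *: cross u v.
Proof. by apply: row3P; rewrite !dotE !mxE /=; ring. Qed.

Lemma crossZDr u a b v w : cross u (a *: v + b *: w) = a *: cross u v + b *: cross u w.
Proof. by apply: row3P; rewrite !mxE /=; ring. Qed.

Lemma cross_cross u v : cross u (cross u v) = dot u v *: u - dot u u *: v.
Proof. by apply: row3P; rewrite !mxE /= !dotE; ring. Qed.

Section Continuity.
Variables (T : topologicalType) (f g : T -> V).
Hypotheses (cf : continuous f) (cg : continuous g).

Lemma continuous_dot : continuous (fun x => dot (f x) (g x)).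
Proof.
under [X in continuous X]funext do rewrite dotE.
have h i : continuous (fun x => f x 0 i * g x 0 i).
  by apply: continuous_mul;
    [exact: (continuous_coordE cf)|exact: (continuous_coordE cg)].
by apply: continuous_add => //; apply: continuous_add.
Qed.

Lemma continuous_vec3 (a b c : T -> R) : continuous a -> continuous b ->
  continuous c -> continuous (fun x => vec3 (a x) (b x) (c x)).
Proof.
move=> ca cb cc; apply: continuous_matrix => i j; rewrite ord1.
by move: j; apply: forall_I3; under [X in continuous X]funext do rewrite vec3E.
Qed.

Lemma continuous_cross : continuous (fun x => cross (f x) (g x)).
Proof.
apply: continuous_vec3; (apply: continuous_sub; apply: continuous_mul);
  by [exact: (continuous_coordE cf)|exact: (continuous_coordE cg)].
Qed.

End Continuity.

End Vectors3.

(** * Tangent fields and angle functions over cubes *)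

Section Lifting.
Variables (R : realType) (n : nat).
Local Notation V := 'rV[R]_3.
Local Notation I := (unit_interval R).
Local Notation cube := 'rV[I]_n.

Definition spherical_cube (S : cube -> V) :=
  continuous S /\ forall t, dot (S t) (S t) = 1.

Definition tangent_field (S e : cube -> V) :=
  continuous e /\ forall t, dot (e t) (S t) = 0 /\ e t != 0.

(** Tangent fields only have to be nonzero, so e is rotated into e' up to a positive factor [l] that
    absorbs the lengths. *)
Definition angle (S e e' : cube -> V) (theta : cube -> R) :=
  continuous theta /\ forall t, exists2 l : R, 0 < l &
    e' t = l *: (cos (theta t) *: e t + sin (theta t) *: cross (S t) (e t)).

(** For unit vectors dot p q = 1 - |p - q|^2 / 2, and coordinates closer than 1/2 give |p - q|^2 <
    3/4. *)
Lemma ball_half_dot (p q : V) :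
  dot p p = 1 -> dot q q = 1 -> ball p (2^-1) q -> 0 < dot p q.
Proof.
move=> p1 q1 [_ b].
have h i : (p 0 i - q 0 i) ^+ 2 < 2^-1 ^+ 2.
  have := b 0 i; rewrite -ball_normE /= => h.
  by rewrite -(real_normK (num_real _)) ltr_pXn2r // nnegrE // invr_ge0.
move: (h 0) (h 1) (h 2%:R) p1 q1; rewrite !dotE => h0 h1 h2 p1 q1.
nra.
Qed.

(** The field is carried along the contraction. At stage 0 the map is constant and any tangent
    vector serves; at each further stage the field is projected orthogonally onto the new tangent
    planes. *)
Lemma tangent_field_exists S : spherical_cube S -> exists e, tangent_field S e.
Proof.
move=> [cS S1].
have [N HN] : exists N, forall k t, (k <= N)%N ->
    ball (S (shrink N.+1 k t)) 2^-1 (S (shrink N.+1 k.+1 t)).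
  by apply: shrink_step => //; rewrite invr_gt0.
suff H k : (k <= N.+1)%N -> exists e, tangent_field (S \o shrink N.+1 k) e.
  have [e [ce he]] := H N.+1 (leqnn _); exists e; split=> // t.
  by have := he t; rewrite /= shrinkN.
elim: k => [_|k IH kN].
  pose p := S (shrink N.+1 0 (\row__ clamp 0)).
  have [v [v0 v1]] : exists v : V, dot v p = 0 /\ v != 0.
    have [p0|p0] := eqVneq (p 0 0) 0.
      exists (vec3 1 0 0); split; first by rewrite dotE !vec3E p0; ring.
      by rewrite -dot_eq0 dotE !vec3E; apply/eqP; lra.
    exists (vec3 (- p 0 1) (p 0 0) 0); split; first by rewrite dotE !vec3E; ring.
    apply: contra p0 => /eqP/rowP/(_ 1); rewrite vec3E mxE => ->; exact: eqxx.
  exists (fun=> v); split; first exact: cst_continuous.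
  by move=> t /=; rewrite (shrink0 _ _ (\row__ clamp 0)).
have [e [ce he]] := IH (ltnW kN).
have cSk : continuous (S \o shrink N.+1 k.+1).
  exact: (continuous_compT (@continuous_shrink R n N.+1 k.+1) cS).
pose q := S \o shrink N.+1 k.+1.
exists (fun t => e t - dot (e t) (q t) *: q t); split.
  apply: continuous_sub => //; apply: continuous_scale => //.
  exact: (continuous_dot ce cSk).
move=> t; have qt : dot (q t) (q t) = 1 by exact: S1.
split; first by rewrite dotDl dotNl dotZl qt mulr1 subrr.
(* If the projection vanished, e t would be a multiple of q t and at the same time orthogonal to the
   previous point, which has positive inner product with q t. *)
have [ep e0] := he t; apply/negP; rewrite subr_eq0 => /eqP eq.
have h := ball_half_dot (S1 _) (S1 _) (HN k t kN).
have := ep; rewrite eq dotZl (dotC (q t)) => /eqP; rewrite mulf_eq0.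
rewrite (gt_eqF h) orbF => /eqP z; move: e0; rewrite eq z scale0r.
by rewrite eqxx.
Qed.

Lemma polar (u v : R) : u ^+ 2 + v ^+ 2 = 1 ->
  exists theta : R, cos theta = u /\ sin theta = v.
Proof.
move=> uv; have u1 : -1 <= u <= 1.
  have := sqr_ge0 v; have := sqr_ge0 (u - 1); have := sqr_ge0 (u + 1).
  by move=> *; apply/andP; split; nra.
have su : sin (acos u) = `|v|.
  by rewrite sin_acos // -sqrtr_sqr; congr Num.sqrt; rewrite -uv; ring.
have [v0|v0] := leP 0 v.
  by exists (acos u); rewrite acosK // su ger0_norm.
by exists (- acos u); rewrite cosN acosK // sinN su ltr0_norm // opprK.
Qed.

Lemma cos_sin_atan (c s : R) : 0 < c -> c ^+ 2 + s ^+ 2 = 1 ->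
  cos (atan (s / c)) = c /\ sin (atan (s / c)) = s.
Proof.
move=> c0 cs; have cn0 : c != 0 by rewrite gt_eqF.
have h : cos (atan (s / c)) = c.
  rewrite cos_atan (_ : 1 + _ = (c^-1) ^+ 2); last first.
    by rewrite exprVn -[1 in LHS](divff (expf_neq0 2 cn0)) expr_div_n -mulrDl cs div1r.
  by rewrite sqrtr_sqr ger0_norm ?invrK // invr_ge0 ltW.
split=> //; have := atanK (s / c); rewrite /tan h => /(congr1 (fun x => x * c)).
by rewrite -!mulrA mulVf // !mulr1.
Qed.

(** The same propagation lifts a map to the circle: one stage turns the point by less than a right
    angle, so the cosine [c] of the increment is positive and the correction atan (s / c) is
    continuous. *)
Lemma circle_lift (u v : cube -> R) : continuous u -> continuous v ->
  (forall t, u t ^+ 2 + v t ^+ 2 = 1) ->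
  exists theta : cube -> R, continuous theta /\
    forall t, cos (theta t) = u t /\ sin (theta t) = v t.
Proof.
(* The circle is viewed as the equator, so that [ball_half_dot] applies. *)
move=> cu cv uv1; pose S t : V := vec3 (u t) (v t) 0.
have S1 t : dot (S t) (S t) = 1 by rewrite dotE !vec3E -(uv1 t); ring.
have cS : continuous S by apply: continuous_vec3 => //; exact: cst_continuous.
have [N HN] : exists N, forall k t, (k <= N)%N ->
    ball (S (shrink N.+1 k t)) 2^-1 (S (shrink N.+1 k.+1 t)).
  by apply: shrink_step => //; rewrite invr_gt0.
suff H k : (k <= N.+1)%N -> exists theta : cube -> R, continuous theta /\
    forall t, cos (theta t) = u (shrink N.+1 k t) /\
              sin (theta t) = v (shrink N.+1 k t).
  have [th [cth hth]] := H N.+1 (leqnn _); exists th; split=> // t.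
  by have := hth t; rewrite /= shrinkN.
elim: k => [_|k IH kN].
  pose o : cube := shrink N.+1 0 (\row__ clamp 0).
  have [th [hc hs]] := polar (uv1 o).
  exists (fun=> th); split; first exact: cst_continuous.
  by move=> t /=; rewrite (shrink0 _ _ (\row__ clamp 0)).
have [th [cth hth]] := IH (ltnW kN).
have ck f : continuous f -> continuous (f \o @shrink R n N.+1 k : cube -> R).
  by move=> cf; exact: (continuous_compT (@continuous_shrink R n N.+1 k) cf).
have ck1 f : continuous f -> continuous (f \o @shrink R n N.+1 k.+1 : cube -> R).
  by move=> cf; exact: (continuous_compT (@continuous_shrink R n N.+1 k.+1) cf).
pose u0 := u \o shrink N.+1 k; pose u1 := u \o shrink N.+1 k.+1.
pose v0 := v \o shrink N.+1 k; pose v1 := v \o shrink N.+1 k.+1.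
pose c t := u0 t * u1 t + v0 t * v1 t; pose s t := u0 t * v1 t - v0 t * u1 t.
have c_gt0 t : 0 < c t.
  have := ball_half_dot (S1 _) (S1 _) (HN k t kN).
  by rewrite dotE !vec3E mulr0 addr0.
have uv0 t : u0 t ^+ 2 + v0 t ^+ 2 = 1 by exact: uv1.
have cs t : c t ^+ 2 + s t ^+ 2 = 1.
  rewrite /c /s; transitivity ((u0 t ^+ 2 + v0 t ^+ 2) * (u1 t ^+ 2 + v1 t ^+ 2)).
    by ring.
  by rewrite uv0 (_ : _ + _ = 1) ?mulr1 //; exact: uv1.
exists (fun t => th t + atan (s t / c t)); split.
  apply: continuous_add => //.
  have cc : continuous c by apply: continuous_add; apply: continuous_mul;
    by [exact: (ck _ cu)|exact: (ck1 _ cu)|exact: (ck _ cv)|exact: (ck1 _ cv)].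
  have cs' : continuous s by apply: continuous_sub; apply: continuous_mul;
    by [exact: (ck _ cu)|exact: (ck1 _ cu)|exact: (ck _ cv)|exact: (ck1 _ cv)].
  have cq : continuous (fun t => s t / c t).
    apply: continuous_mul => //; apply: continuous_inv => // t.
    by rewrite gt_eqF.
  exact: (continuous_compT cq (@continuous_atan R)).
move=> t; have [hc hs] := cos_sin_atan (c_gt0 t) (cs t).
have [thc ths] := hth t; rewrite cosD sinD hc hs thc ths.
rewrite -[u (shrink _ k.+1 t)]mul1r -[v (shrink _ k.+1 t)]mul1r -(uv0 t).
by rewrite /c /s /u0 /u1 /v0 /v1 /=; split; ring.
Qed.

Lemma tangent_decomposition (S e e' : V) : dot S S = 1 -> dot e S = 0 ->
  dot e' S = 0 ->
  dot e e *: e' = dot e e' *: e + dot (cross S e) e' *: cross S e /\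
  dot e e' ^+ 2 + dot (cross S e) e' ^+ 2 = dot e e * dot e' e'.
Proof.
move=> S1 e0 e'0; have := cross_decomposition S e e'.
rewrite dot_cross S1 (dotC S e) e0 e'0 expr0n /= subr0 mul1r mulr1 !mul0r mulr0.
rewrite subr0 scale0r add0r (dotC e' e) subr0 => h; split=> //.
by rewrite -dotZl h dotDl !dotZl; ring.
Qed.

Lemma angle_exists S e e' : spherical_cube S -> tangent_field S e ->
  tangent_field S e' -> exists theta, angle S e e' theta.
Proof.
move=> [cS S1] [ce he] [ce' he'].
pose r t := (Num.sqrt (dot (e t) (e t) * dot (e' t) (e' t)))^-1.
have ee_gt0 t : 0 < dot (e t) (e t) by rewrite dot_gt0; exact: (he t).2.
have ee'_gt0 t : 0 < dot (e' t) (e' t) by rewrite dot_gt0; exact: (he' t).2.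
have r_gt0 t : 0 < r t by rewrite invr_gt0 sqrtr_gt0 mulr_gt0.
have cr : continuous r.
  apply: continuous_inv; last by move=> t; rewrite gt_eqF // sqrtr_gt0 mulr_gt0.
  have h := continuous_mul (continuous_dot ce ce) (continuous_dot ce' ce').
  exact: (continuous_compT h (@sqrt_continuous R)).
pose u t := dot (e t) (e' t) * r t; pose v t := dot (cross (S t) (e t)) (e' t) * r t.
have cu : continuous u.
  exact: (continuous_mul (continuous_dot ce ce') cr).
have cv : continuous v.
  exact: (continuous_mul (continuous_dot (continuous_cross cS ce) ce') cr).
have [|th [cth hth]] := circle_lift cu cv.
  move=> t; rewrite /u /v !exprMn -mulrDl.
  have [_ ->] := tangent_decomposition (S1 t) (he t).1 (he' t).1.
  rewrite exprVn sqr_sqrtr ?divff // ?mulr_ge0 // ?ltW //.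
  by rewrite gt_eqF // mulr_gt0.
exists th; split=> // t; have [-> ->] := hth t.
exists (dot (e t) (e t) * r t)^-1; first by rewrite invr_gt0 mulr_gt0.
have [h _] := tangent_decomposition (S1 t) (he t).1 (he' t).1.
rewrite /u /v !(mulrC _ (r t)) -!scalerA -scalerDr -h !scalerA.
by rewrite -mulrA mulVf ?scale1r // gt_eqF // mulr_gt0.
Qed.

Lemma angle_cat S e e' e'' th th' : (forall t, dot (S t) (S t) = 1) ->
  (forall t, dot (e t) (S t) = 0) ->
  angle S e e' th -> angle S e' e'' th' -> angle S e e'' (fun t => th t + th' t).
Proof.
move=> S1 eS [cth hth] [cth' hth']; split.
  exact: continuous_add.
move=> t; have [l l0 el] := hth t; have [m m0 em] := hth' t.
exists (l * m); first exact: mulr_gt0.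
rewrite em el cosD sinD.
have -> : cross (S t) (l *: (cos (th t) *: e t + sin (th t) *: cross (S t) (e t)))
   = l *: (cos (th t) *: cross (S t) (e t) - sin (th t) *: e t).
  rewrite scalerDr !scalerA crossZDr cross_cross S1 (dotC (S t)) eS scale0r sub0r.
  by rewrite scale1r scalerBr !scalerA scalerN.
by apply: row3P; rewrite !mxE /=; ring.
Qed.

End Lifting.

Section Faces.
Variable R : realType.
Local Notation I := (unit_interval R).

Definition face_map n (i : 'I_n.+1) (a : I) (t : 'rV[I]_n) : 'rV[I]_n.+1 :=
  \row_j (if unlift i j is Some k then t 0 k else a).

Lemma faceE n X (i : 'I_n.+1) a (s : 'rV[I]_n.+1 -> X) t :
  face i a s t = s (face_map i a t).
Proof. by []. Qed.

Lemma continuous_face_map n (i : 'I_n.+1) a : continuous (@face_map n i a).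
Proof.
apply: continuous_matrix => i' j.
under [X in continuous X]funext do rewrite mxE.
by case: unliftP => [k _|_]; [exact: continuous_coord|exact: cst_continuous].
Qed.

Lemma continuous_face n (X : topologicalType) (i : 'I_n.+1) a (s : 'rV[I]_n.+1 -> X) :
  continuous s -> continuous (face i a s).
Proof. by move=> cs; exact: (continuous_compT (@continuous_face_map n i a) cs). Qed.

Definition row1 (a : I) : 'rV[I]_1 := \row__ a.
Definition row2 (a b : I) : 'rV[I]_2 := \row_j nth a [:: a; b] j.
Definition row3 (a b c : I) : 'rV[I]_3 := \row_j nth a [:: a; b; c] j.

Lemma row1K (t : 'rV[I]_1) : row1 (t 0 0) = t.
Proof. by apply/rowP => j; rewrite mxE ord1. Qed.

Lemma row2K (t : 'rV[I]_2) : row2 (t 0 0) (t 0 1) = t.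
Proof.
apply/rowP => -[[|[|//]] lt]; rewrite mxE /=; congr (t _ _); exact: val_inj.
Qed.

Lemma row2_0 a b : row2 a b 0 0 = a. Proof. by rewrite mxE. Qed.
Lemma row2_1 a b : row2 a b 0 1 = b. Proof. by rewrite mxE. Qed.

Lemma face_map_row n (i : 'I_n.+1) a (t : 'rV[I]_n) (u : 'rV[I]_n.+1) : u 0 i = a ->
  (forall k, u 0 (fintype.lift i k) = t 0 k) -> face_map i a t = u.
Proof.
by move=> ui uk; apply/rowP => j; rewrite mxE; case: unliftP => [k ->|->].
Qed.

Lemma face_map2_0 a b : face_map 0 a (row1 b) = row2 a b.
Proof. by apply: face_map_row => [|k]; rewrite !mxE // ord1. Qed.

Lemma face_map2_1 a b : face_map 1 a (row1 b) = row2 b a.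
Proof. by apply: face_map_row => [|k]; rewrite !mxE // ord1. Qed.

Lemma face_map3_0 a b c : face_map 0 a (row2 b c) = row3 a b c.
Proof. by apply: face_map_row => [|[[|[|//]] lt]]; rewrite !mxE. Qed.

Lemma face_map3_1 a b c : face_map 1 a (row2 b c) = row3 b a c.
Proof. by apply: face_map_row => [|[[|[|//]] lt]]; rewrite !mxE. Qed.

Lemma face_map3_2 a b c : face_map 2%:R a (row2 b c) = row3 b c a.
Proof. by apply: face_map_row => [|[[|[|//]] lt]]; rewrite !mxE. Qed.

Lemma path_ext X (f g : 'rV[I]_1 -> X) :
  (forall a, f (row1 a) = g (row1 a)) -> f = g.
Proof. by move=> h; apply/funext => t; rewrite -(row1K t). Qed.

Lemma sum_I2 (A : nmodType) (f : 'I_2 -> A) : \sum_i f i = f 0 + f 1.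
Proof.
by rewrite !big_ord_recr big_ord0 /= add0r; congr (f _ + f _); apply: val_inj.
Qed.

End Faces.

(** * Turning of a tangent field along a path *)

Section Turning.
Variable R : realType.
Local Notation V := 'rV[R]_3.
Local Notation I := (unit_interval R).
Local Notation path := ('rV[I]_1 -> V).

Definition increment (theta : 'rV[I]_1 -> R) : R :=
  theta (row1 (end1 R)) - theta (row1 (end0 R)).

(** A function with values in 2 pi Z that changed between the endpoints would take all intermediate
    values, including some whose cosine is not 1. *)
Lemma continuous_2pi_constant (f : 'rV[I]_1 -> R) : continuous f ->
  (forall t, cos (f t) = 1) -> increment f = 0.
Proof.
move=> cf cos1; pose g (x : R) := f (row1 (clamp x)).
have cg : continuous g.
  have h : continuous (fun x : R => row1 (clamp x)).
    apply: continuous_matrix => i j.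
    by under [X in continuous X]funext do rewrite mxE; exact: continuous_clamp.
  exact: (continuous_compT h cf).
have g0 : g 0 = f (row1 (end0 R)).
  by congr (f (row1 _)); apply: val_inj; rewrite clampK // lexx ler01.
have g1 : g 1 = f (row1 (end1 R)).
  by congr (f (row1 _)); apply: val_inj; rewrite clampK // lexx ler01.
rewrite /increment -g0 -g1.
apply/eqP; apply: contraT => neq.
pose m := Num.min (g 0) (g 1); pose M := Num.max (g 0) (g 1).
have mM : m < M.
  rewrite /m /M lt_max !gt_min !ltxx /= orbF -neq_lt.
  by rewrite -subr_eq0.
(* This intermediate value exceeds m by at most pi, and cosine is injective on [0, pi]; hence cos v
   differs from cos m = 1. *)
pose v := m + Num.min (M - m) pi.
have v1 : m < v by rewrite ltrDl lt_min subr_gt0 mM pi_gt0.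
have v2 : v <= M by rewrite -lerBrDl ge_min lexx.
have cw : {within `[(0 : R), 1], continuous g} by apply: continuous_subspaceT.
have [|x _ gx] := @IVT R g 0 1 v ler01 cw; first by rewrite ltW.
have cosm : cos m = 1 by rewrite /m; case: leP => _; exact: cos1.
have sinm : sin m = 0.
  by apply/eqP; rewrite -sqrf_eq0 sin2cos2 cosm expr1n subrr.
have : cos v = 1 by rewrite -gx; exact: cos1.
rewrite cosD cosm sinm mul1r mul0r subr0 -[X in _ = X -> _]cos0 => /cos_inj e.
have : Num.min (M - m) pi = 0.
  apply: e; rewrite in_itv /= ?lexx ?pi_ge0 //.
  by rewrite ge_min lexx orbT le_min pi_ge0 subr_ge0 ltW.
by move/eqP; rewrite gt_eqF // lt_min pi_gt0 subr_gt0 mM.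
Qed.

Lemma angle_unique n (S e e' : 'rV[I]_n -> V) th th' :
  spherical_cube S -> tangent_field S e -> angle S e e' th -> angle S e e' th' ->
  forall t, cos (th t - th' t) = 1.
Proof.
move=> [_ S1] [_ he] [_ h] [_ h'] t.
have [eS e0] := he t; have [l l0 el] := h t; have [l' l'0 el'] := h' t.
have ee : 0 < dot (e t) (e t) by rewrite dot_gt0.
have Se : dot (cross (S t) (e t)) (e t) = 0 by exact: dot_crossr.
have SeSe : dot (cross (S t) (e t)) (cross (S t) (e t)) = dot (e t) (e t).
  by rewrite dot_cross S1 (dotC (S t)) eS mul1r expr0n subr0.
have eqc : l * cos (th t) = l' * cos (th' t).
  have /= := congr1 (fun v : V => dot v (e t)) el; rewrite el' !dotZl !dotDl !dotZl Se !mulr0 !addr0.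
  by rewrite !mulrA => /(mulIf (lt0r_neq0 ee)).
have eqs : l * sin (th t) = l' * sin (th' t).
  have /= := congr1 (fun v : V => dot v (cross (S t) (e t))) el.
  rewrite el' !dotZl !dotDl !dotZl (dotC (e t)) Se SeSe !mulr0 !add0r.
  by rewrite !mulrA => /(mulIf (lt0r_neq0 ee)).
have ll : l = l'.
  apply/eqP; rewrite -(@eqrXn2 _ 2) ?ltW //; apply/eqP.
  rewrite -[l ^+ 2]mulr1 -(cos2Dsin2 (th t)) -[l' ^+ 2]mulr1 -(cos2Dsin2 (th' t)).
  by rewrite !mulrDr -!exprMn eqc eqs.
have ec : cos (th t) = cos (th' t) by apply: (mulfI (lt0r_neq0 l'0)); rewrite -eqc ll.
have es : sin (th t) = sin (th' t) by apply: (mulfI (lt0r_neq0 l'0)); rewrite -eqs ll.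
by rewrite cosB ec es -!expr2 cos2Dsin2.
Qed.

Lemma angle_increment (S e e' : path) th th' :
  spherical_cube S -> tangent_field S e -> angle S e e' th -> angle S e e' th' ->
  increment th = increment th'.
Proof.
move=> sS te h h'; apply/eqP; rewrite -subr_eq0; apply/eqP.
rewrite -(@continuous_2pi_constant (fun t => th t - th' t)); last 1 first.
- exact: angle_unique sS te h h'.
- by rewrite /increment; ring.
- by apply: continuous_sub; [exact: h.1|exact: h'.1].
Qed.

Definition constant_map (T U : Type) (f : T -> U) := forall t t', f t = f t'.

(** The reference field depends on the path alone, so two squares with a common edge measure turning
    there against the same field. It is constant on constant paths, which makes the edges of
    degenerate squares contribute nothing. *)
Definition path_field (S : path) : path := xget (fun=> 0)
  [set e | tangent_field S e /\ (constant_map S -> constant_map e)].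

Lemma path_fieldP (S : path) : spherical_cube S ->
  tangent_field S (path_field S) /\
  (constant_map S -> constant_map (path_field S)).
Proof.
move=> sS; rewrite /path_field; case: xgetP => [e _ //|none]; exfalso.
have [e [ce te]] := tangent_field_exists sS.
have [cst|ncst] := pselect (constant_map S); last by apply: (none e).
apply: (none (fun=> e (row1 (end0 R)))); split=> //; split; first exact: cst_continuous.
by move=> t; rewrite (cst t (row1 (end0 R))).
Qed.

Definition turning (S e : path) : R :=
  increment (xget (fun=> 0) [set th | angle S (path_field S) e th]).

Lemma turningE (S e : path) th : spherical_cube S ->
  angle S (path_field S) e th -> turning S e = increment th.
Proof.
move=> sS h; rewrite /turning; case: xgetP => [th' _ h'|/(_ th)//].
exact: angle_increment sS (path_fieldP sS).1 h' h.
Qed.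

Lemma turning_angle (S e e' : path) th : spherical_cube S -> tangent_field S e ->
  angle S e e' th -> turning S e' = turning S e + increment th.
Proof.
move=> sS te h; have [tp _] := path_fieldP sS.
have [th0 h0] := angle_exists sS tp te.
rewrite (turningE sS h0) (@turningE _ _ (fun t => th0 t + th t)) //.
  by rewrite /increment; ring.
by apply: angle_cat h0 h; [exact: sS.2|move=> t; exact: (tp.2 t).1].
Qed.

Lemma turning_constant (S e : path) : spherical_cube S -> tangent_field S e ->
  constant_map S -> constant_map e -> turning S e = 0.
Proof.
move=> sS te cS ce; have [tp cp] := path_fieldP sS.
have [th [_ h]] := angle_exists sS tp te.
rewrite (@turningE _ _ (fun=> th (row1 (end0 R)))) //.
  by rewrite /increment subrr.
split; first exact: cst_continuous.
move=> t; rewrite (ce t (row1 (end0 R))) (cS t (row1 (end0 R))).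
by rewrite (cp cS t (row1 (end0 R))); exact: h.
Qed.

End Turning.

(** * The cochain on squares and its cocycle property *)

Section Cocycle.
Variable R : realType.
Local Notation V := 'rV[R]_3.
Local Notation I := (unit_interval R).
Local Notation square := ('rV[I]_2 -> V).

Lemma spherical_face n (i : 'I_n.+1) a (S : 'rV[I]_n.+1 -> V) :
  spherical_cube S -> spherical_cube (face i a S).
Proof. by move=> [cS S1]; split=> [|t]; [exact: continuous_face|exact: S1]. Qed.

Lemma tangent_face n (i : 'I_n.+1) a (S e : 'rV[I]_n.+1 -> V) :
  tangent_field S e -> tangent_field (face i a S) (face i a e).
Proof. by move=> [cS S1]; split=> [|t]; [exact: continuous_face|exact: S1]. Qed.

Lemma angle_face n (i : 'I_n.+1) a (S e e' : 'rV[I]_n.+1 -> V) th :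
  angle S e e' th -> angle (face i a S) (face i a e) (face i a e') (face i a th).
Proof. by move=> [cS S1]; split=> [|t]; [exact: continuous_face|exact: S1]. Qed.

Definition boundary_turning (S e : square) : R :=
  \sum_(i < 2) (-1) ^+ i *
    (turning (face i (end1 R) S) (face i (end1 R) e) -
     turning (face i (end0 R) S) (face i (end0 R) e)).

(** Replacing the field changes the turning along each edge by the increment of the angle function,
    and these increments cancel around the square. *)
Lemma boundary_turning_indep (S e e' : square) : spherical_cube S ->
  tangent_field S e -> tangent_field S e' ->
  boundary_turning S e = boundary_turning S e'.
Proof.
move=> sS te te'; have [th h] := angle_exists sS te te'.
rewrite /boundary_turning !sum_I2.
have tf i a : turning (face i a S) (face i a e') =
    turning (face i a S) (face i a e) + increment (face i a th).
  apply: turning_angle; [exact: spherical_face|exact: tangent_face|exact: angle_face].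
rewrite !tf /increment !faceE !face_map2_0 !face_map2_1; ring.
Qed.

(** Up to a factor, a representative of the Euler class of the tangent bundle of S^2. It is real
    valued because turnings against arbitrary reference fields need not be multiples of 2 pi. *)
Definition euler_cochain (S : square) : R :=
  if `[< spherical_cube S >] then
    boundary_turning S (xget (fun=> 0) [set e | tangent_field S e])
  else 0.

Lemma euler_cochainE (S e : square) : spherical_cube S -> tangent_field S e ->
  euler_cochain S = boundary_turning S e.
Proof.
move=> sS te; rewrite /euler_cochain asboolT //; case: xgetP => [e' _ te'|/(_ e)//].
exact: boundary_turning_indep.
Qed.

Lemma face_face X (w : 'rV[I]_3 -> X) a b :
  [/\ face 0 b (face 0 a w) = face 0 a (face 1 b w),
      face 1 b (face 0 a w) = face 0 a (face 2%:R b w) &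
      face 1 b (face 1 a w) = face 1 a (face 2%:R b w)].
Proof.
by split; apply: path_ext => c;
  rewrite !faceE !(face_map2_0, face_map2_1) !(face_map3_0, face_map3_1, face_map3_2).
Qed.

(** One tangent field on the 3-cube restricts to all six faces, and each of the twelve edges then
    occurs in two faces with opposite signs. *)
Lemma euler_cocycle (w : 'rV[I]_3 -> V) : spherical_cube w ->
  \sum_(i < 3) (-1) ^+ i *
    (euler_cochain (face i (end1 R) w) - euler_cochain (face i (end0 R) w)) = 0.
Proof.
move=> sw; have [e te] := tangent_field_exists sw.
pose T (i : 'I_3) a (j : 'I_2) b := turning (face j b (face i a w)) (face j b (face i a e)).
have ef i a : euler_cochain (face i a w) = (T i a 0 (end1 R) - T i a 0 (end0 R))
    - (T i a 1 (end1 R) - T i a 1 (end0 R)).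
  rewrite (euler_cochainE (spherical_face i a sw) (tangent_face i a te)).
  by rewrite /boundary_turning sum_I2 expr0 expr1 mul1r mulN1r.
rewrite sum_I3 expr0 expr1 mul1r mulN1r (_ : (-1) ^+ 2%:R = 1); last by rewrite sqrrN expr1n.
rewrite mul1r !{}ef.
have E a b : [/\ T 0 a 0 b = T 1 b 0 a, T 0 a 1 b = T 2%:R b 0 a &
    T 1 a 1 b = T 2%:R b 1 a].
  rewrite /T; have [-> -> ->] := face_face w a b.
  by have [-> -> ->] := face_face e a b.
clearbody T.
have E1 a b : T 0 a 0 b = T 1 b 0 a by case: (E a b).
have E2 a b : T 0 a 1 b = T 2%:R b 0 a by case: (E a b).
have E3 a b : T 1 a 1 b = T 2%:R b 1 a by case: (E a b).
rewrite !(E1, E2, E3); ring.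
Qed.

(** S factors through a path g, and [path_field g] pulls back to a tangent field along S. The two
    edges running along g cancel; the other two are constant paths with constant fields. *)
Lemma euler_degenerate (S : square) : degenerate S -> euler_cochain S = 0.
Proof.
move=> [i di]; have [sS|nS] := pselect (spherical_cube S); last first.
  by rewrite /euler_cochain asboolF.
have cr (j : 'I_2) : continuous (fun t : 'rV[I]_2 => row1 (t 0 j)).
  apply: continuous_matrix => i' j'.
  by under [X in continuous X]funext do rewrite mxE; exact: continuous_coord.
have [i0|i1] := eqVneq i 0.
  have [g gE] : exists g, g = face 0 (end0 R) S by exists (face 0 (end0 R) S).
  have Sg t : S t = g (row1 (t 0 1)).
    rewrite gE faceE face_map2_0; apply: di => -[[|[|//]] lt].
      by rewrite i0.
    by rewrite mxE /= => _; congr (t _ _); exact: val_inj.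
  have sg : spherical_cube g by rewrite gE; exact: spherical_face.
  have [[cp tp] cst] := path_fieldP sg.
  have te : tangent_field S (fun t => path_field g (row1 (t 0 1))).
    split; first exact: (continuous_compT (cr 1) cp).
    by move=> t; rewrite Sg; exact: tp.
  rewrite (euler_cochainE sS te) /boundary_turning sum_I2.
  have h a : face 0 a S = g.
    by apply: path_ext => b; rewrite faceE face_map2_0 Sg row2_1.
  have h' a : face 0 a (fun t => path_field g (row1 (t 0 1))) = path_field g.
    by apply: path_ext => b; rewrite faceE face_map2_0 row2_1.
  rewrite (h (end1 R)) (h (end0 R)) (h' (end1 R)) (h' (end0 R)) subrr mulr0 add0r.
  rewrite turning_constant; first rewrite turning_constant.
  - by rewrite subrr mulr0.
  - exact: spherical_face.
  - exact: tangent_face.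
  - by move=> t t'; rewrite -(row1K t) -(row1K t') !faceE !face_map2_1 !Sg !row2_1.
  - by move=> t t'; rewrite -(row1K t) -(row1K t') !faceE !face_map2_1 !row2_1.
  - exact: spherical_face.
  - exact: tangent_face.
  - by move=> t t'; rewrite -(row1K t) -(row1K t') !faceE !face_map2_1 !Sg !row2_1.
  - by move=> t t'; rewrite -(row1K t) -(row1K t') !faceE !face_map2_1 !row2_1.
have {i1} i1 : i = 1 by case: i i1 {di} => -[|[|//]] lt // _; exact: val_inj.
have [g gE] : exists g, g = face 1 (end0 R) S by exists (face 1 (end0 R) S).
have Sg t : S t = g (row1 (t 0 0)).
  rewrite gE faceE face_map2_1; apply: di => -[[|[|//]] lt]; last by rewrite i1.
  by rewrite mxE /= => _; congr (t _ _); exact: val_inj.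
have sg : spherical_cube g by rewrite gE; exact: spherical_face.
have [[cp tp] cst] := path_fieldP sg.
have te : tangent_field S (fun t => path_field g (row1 (t 0 0))).
  split; first exact: (continuous_compT (cr 0) cp).
  by move=> t; rewrite Sg; exact: tp.
rewrite (euler_cochainE sS te) /boundary_turning sum_I2.
have h a : face 1 a S = g.
  by apply: path_ext => b; rewrite faceE face_map2_1 Sg row2_0.
have h' a : face 1 a (fun t => path_field g (row1 (t 0 0))) = path_field g.
  by apply: path_ext => b; rewrite faceE face_map2_1 row2_0.
rewrite (h (end1 R)) (h (end0 R)) (h' (end1 R)) (h' (end0 R)) subrr mulr0 addr0.
rewrite turning_constant; first rewrite turning_constant.
- by rewrite subrr mulr0.
- exact: spherical_face.
- exact: tangent_face.
- by move=> t t'; rewrite -(row1K t) -(row1K t') !faceE !face_map2_0 !Sg !row2_0.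
- by move=> t t'; rewrite -(row1K t) -(row1K t') !faceE !face_map2_0 !row2_0.
- exact: spherical_face.
- exact: tangent_face.
- by move=> t t'; rewrite -(row1K t) -(row1K t') !faceE !face_map2_0 !Sg !row2_0.
- by move=> t t'; rewrite -(row1K t) -(row1K t') !faceE !face_map2_0 !row2_0.
Qed.

End Cocycle.

Section FreegLift.
Variables (K : choiceType) (M : lmodType int) (f : K -> M).
Implicit Types D : {freeg K / int}.

Lemma fgliftB D D' : fglift f (D - D') = fglift f D - fglift f D'.
Proof. exact: lift_is_additive. Qed.

Lemma fglift0 : fglift f (0 : {freeg K / int}) = 0.
Proof. by rewrite -(subrr (0 : {freeg K / int})) fgliftB subrr. Qed.

Lemma fgliftD D D' : fglift f (D + D') = fglift f D + fglift f D'.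
Proof. by rewrite -[D' in LHS]opprK -[- D']sub0r !fgliftB fglift0 sub0r opprK. Qed.

Lemma fglift_sum I r (P : pred I) (F : I -> {freeg K / int}) :
  fglift f (\sum_(i <- r | P i) F i) = \sum_(i <- r | P i) fglift f (F i).
Proof. exact: (big_morph _ fgliftD fglift0). Qed.

Lemma fglift_dom D : fglift f D = \sum_(x <- dom D) coeff x D *: f x.
Proof.
rewrite -{1}[D]freeg_sumE fglift_sum.
by apply: eq_bigr => x _; rewrite liftU.
Qed.

Lemma fgliftZ a D : fglift f (a *: D) = a *: fglift f D.
Proof.
rewrite [fglift f D]fglift_dom scaler_sumr fglift_sum.
by apply: eq_bigr => x _; rewrite liftU scalerA.
Qed.

Lemma fglift1 k : fglift f << k >> = f k.
Proof. by rewrite liftU scale1r. Qed.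

End FreegLift.

(** * Extension of the cocycle to chains of the product *)

Section EulerCochain.
Variable R : realType.
Local Notation V := 'rV[R]_3.
Local Notation I := (unit_interval R).
Local Notation X := (S2xS2 R).

Definition proj (k : bool) (p : X) : V :=
  if k then rsubmx (val p) else lsubmx (val p).

Lemma continuous_proj k : continuous (proj k).
Proof.
apply: continuous_matrix => i j; rewrite /proj.
have h j' : continuous (fun x : X => val x i j').
  by apply: continuous_coordE; exact: continuous_val.
by case: k; under [X in continuous X]funext do rewrite mxE; exact: h.
Qed.

Lemma sphere2E (v : V) : sphere2 v <-> dot v v = 1.
Proof.
by rewrite /sphere2 /= (_ : \sum_i _ = dot v v).
Qed.

Lemma proj_sphere k (p : X) : dot (proj k p) (proj k p) = 1.
Proof.
by apply/sphere2E; have [? ?] := set_mem (valP p); rewrite /proj; case: k.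
Qed.

Definition euler_class k (c : chain R 2 X) : R :=
  fglift (fun s => euler_cochain (proj k \o s) : zmodule R) c.

Lemma euler_class_boundary k (w : chain R 3 X) : singular w ->
  euler_class k (boundary w) = 0.
Proof.
move=> sw; rewrite /boundary fglift_dom /euler_class fglift_sum big_seq big1 // => s sd.
rewrite fgliftZ [fglift _ _](_ : _ = 0) ?scaler0 // fglift_sum.
rewrite -[RHS](@euler_cocycle R (proj k \o s)).
  apply: eq_bigr => i _; rewrite fgliftZ fgliftB !fglift1.
  rewrite scalezrE.
  by case: (odd i) (signr_odd int i) (signr_odd R i) => /= <- <-;
    rewrite ?expr1 ?expr0 ?mul1r ?mulN1r ?mulrNz.
split; last by move=> t; exact: proj_sphere.
exact: (continuous_compT (sw s sd) (@continuous_proj k)).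
Qed.

Lemma euler_class_degenerate k (d : chain R 2 X) : degenerate_chain d ->
  euler_class k d = 0.
Proof.
move=> dd; rewrite /euler_class fglift_dom big_seq big1 // => s sd.
rewrite euler_degenerate ?scaler0 //; have [i di] := dd s sd.
by exists i => t t' tt'; rewrite /= (di t t').
Qed.

Lemma euler_class_homologous k (c c' : chain R 2 X) : homologous c c' ->
  euler_class k c = euler_class k c'.
Proof.
move=> [w [d [sw dd e]]]; apply/eqP; rewrite -subr_eq0 -[_ - _]fgliftB e fgliftD.
by rewrite [fglift _ _]euler_class_boundary // [fglift _ _]euler_class_degenerate // addr0.
Qed.

End EulerCochain.

(** * Value of the cocycle on the fundamental class *)

Section SphereClass.
Variable R : realType.
Local Notation V := 'rV[R]_3.
Local Notation I := (unit_interval R).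

Lemma val_sphere_cube (t : 'rV[I]_2) : val (sphere_cube t) =
  vec3 (sin (pi * val (t 0 0)) * cos (pi *+ 2 * val (t 0 1)))
       (sin (pi * val (t 0 0)) * sin (pi *+ 2 * val (t 0 1)))
       (cos (pi * val (t 0 0))).
Proof. by []. Qed.

Lemma continuous_angle (n : nat) (c : R) (j : 'I_n) :
  continuous (fun t : 'rV[I]_n => c * val (t 0 j)).
Proof.
apply: continuous_mul; first exact: cst_continuous.
exact: (continuous_compT (@continuous_coord _ 1 n 0 j) (@continuous_val _ _)).
Qed.

Lemma continuous_cos_angle (T : topologicalType) (f : T -> R) : continuous f ->
  continuous (fun t => cos (f t)).
Proof. by move=> cf; exact: (continuous_compT cf (@continuous_cos R)). Qed.

Lemma continuous_sin_angle (T : topologicalType) (f : T -> R) : continuous f ->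
  continuous (fun t => sin (f t)).
Proof. by move=> cf; exact: (continuous_compT cf (@continuous_sin R)). Qed.

Lemma continuous_spherical (T : topologicalType) (f g : T -> R) :
  continuous f -> continuous g -> continuous (fun t => spherical (f t) (g t)).
Proof.
move=> cf cg; apply: continuous_set_type.
apply: (@continuous_vec3 R T (fun t => sin (f t) * cos (g t))
  (fun t => sin (f t) * sin (g t)) (fun t => cos (f t))).
- by apply: continuous_mul; [exact: continuous_sin_angle|exact: continuous_cos_angle].
- by apply: continuous_mul; exact: continuous_sin_angle.
- exact: continuous_cos_angle.
Qed.

Lemma continuous_sphere_cube : continuous (@sphere_cube R).
Proof. by apply: continuous_spherical; exact: continuous_angle. Qed.

(** At a pole the meridian directions sweep out a full circle as the longitude varies, in opposite
    senses at the two poles when viewed from outside. *)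
Lemma turning_pole (eps : R) : eps = 1 \/ eps = -1 ->
  turning (fun=> vec3 0 0 eps)
    (fun t : 'rV[I]_1 => eps *: vec3 (cos (pi *+ 2 * val (t 0 0)))
                                     (sin (pi *+ 2 * val (t 0 0))) 0)
  = eps * (pi *+ 2).
Proof.
move=> he; have e2 : eps * eps = 1 by case: he => ->; ring.
pose S : 'rV[I]_1 -> V := fun=> vec3 0 0 eps.
pose e0 : 'rV[I]_1 -> V := fun=> eps *: vec3 1 0 0.
have sS : spherical_cube S.
  split; first exact: cst_continuous.
  by move=> t; rewrite dotE !vec3E e2; ring.
have te0 : tangent_field S e0.
  split; first exact: cst_continuous.
  move=> t; rewrite -dot_eq0 !dotE !mxE /=; split; first ring.
  by rewrite !mulr0 !addr0 !mulr1 e2 oner_eq0.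
rewrite (@turning_angle R S e0 _ (fun t => eps * (pi *+ 2 * val (t 0 0)))) //.
  rewrite turning_constant // add0r /increment !mxE /=; ring.
split.
  by apply: continuous_mul; [exact: cst_continuous|exact: continuous_angle].
move=> t; exists 1; first exact: ltr01.
rewrite scale1r; apply: row3P; rewrite !mxE /=;
  by case: he => ->; rewrite ?mul1r ?(mulN1r (pi *+ 2 * _)) ?cosN ?sinN; ring.
Qed.

Lemma boundary_turning_cylinder (S e : 'rV[I]_2 -> V) S0 S1 e0 e1 :
  face 1 (end1 R) S = face 1 (end0 R) S -> face 1 (end1 R) e = face 1 (end0 R) e ->
  face 0 (end0 R) S = S0 -> face 0 (end0 R) e = e0 ->
  face 0 (end1 R) S = S1 -> face 0 (end1 R) e = e1 ->
  boundary_turning S e = turning S1 e1 - turning S0 e0.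
Proof.
rewrite /boundary_turning sum_I2 expr0 expr1 mul1r mulN1r.
by move=> -> -> -> -> -> ->; rewrite subrr oppr0 addr0.
Qed.

(** The tangent field is the unit vector of increasing colatitude. The longitude edges cancel and
    each pole contributes -2 pi, so the total is -2 pi times the Euler characteristic of S^2. *)
Lemma euler_sphere_cube :
  euler_cochain (fun t => val (sphere_cube t) : V) = - (pi *+ 4) :> R.
Proof.
pose a (t : 'rV[I]_2) := pi * val (t 0 0); pose b (t : 'rV[I]_2) := pi *+ 2 * val (t 0 1).
pose e t : V := vec3 (cos (a t) * cos (b t)) (cos (a t) * sin (b t)) (- sin (a t)).
have cv : continuous (val : @sphere2 R -> V) by exact: continuous_val.
have sS : spherical_cube (fun t => val (sphere_cube t) : V).
  split; first exact: (continuous_compT continuous_sphere_cube cv).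
  by move=> t; apply/sphere2E; exact: (set_mem (valP (sphere_cube t))).
have te : tangent_field (fun t => val (sphere_cube t) : V) e.
  have ca : continuous a by exact: continuous_angle.
  have cb : continuous b by exact: continuous_angle.
  have cca := continuous_cos_angle ca; have ccb := continuous_cos_angle cb.
  have csa := continuous_sin_angle ca; have csb := continuous_sin_angle cb.
  split.
    apply: continuous_vec3; [exact: continuous_mul|exact: continuous_mul|].
    by move=> t; exact: (cvgN (csa t)).
  move=> t; rewrite val_sphere_cube -/(a t) -/(b t) -dot_eq0; split.
    rewrite dotE !vec3E; transitivity
      (cos (a t) * sin (a t) * (cos (b t) ^+ 2 + sin (b t) ^+ 2 - 1)); first ring.
    by rewrite cos2Dsin2 subrr mulr0.
  rewrite (_ : dot _ _ = 1) ?oner_eq0 // dotE !vec3E.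
  transitivity (cos (a t) ^+ 2 * (cos (b t) ^+ 2 + sin (b t) ^+ 2) + sin (a t) ^+ 2).
    by ring.
  by rewrite cos2Dsin2 mulr1 cos2Dsin2.
rewrite (euler_cochainE sS te).
have h1 : face 1 (end1 R) (fun t => val (sphere_cube t) : V) =
          face 1 (end0 R) (fun t => val (sphere_cube t) : V).
  apply: path_ext => x; rewrite !faceE !face_map2_1 !val_sphere_cube !row2_0 !row2_1 /=.
  by rewrite mulr1 mulr0 cos2pi sin2pi cos0 sin0.
have h2 : face 1 (end1 R) e = face 1 (end0 R) e.
  apply: path_ext => x; rewrite !faceE !face_map2_1 /e /a /b !row2_0 !row2_1 /=.
  by rewrite mulr1 mulr0 cos2pi sin2pi cos0 sin0.
have k1 : face 0 (end1 R) (fun t => val (sphere_cube t) : V) = fun=> vec3 0 0 (-1).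
  apply: path_ext => x; rewrite !faceE !face_map2_0 !val_sphere_cube !row2_0 !row2_1 /=.
  by rewrite mulr1 cospi sinpi !mul0r.
have k2 : face 0 (end1 R) e = fun t => (-1) *: vec3 (cos (pi *+ 2 * val (t 0 0)))
                                     (sin (pi *+ 2 * val (t 0 0))) 0.
  apply: path_ext => x; rewrite !faceE !face_map2_0 /e /a /b !row2_0 !row2_1 mxE /=.
  by rewrite mulr1 cospi sinpi; apply: row3P; rewrite !mxE /=; ring.
have k3 : face 0 (end0 R) (fun t => val (sphere_cube t) : V) = fun=> vec3 0 0 1.
  apply: path_ext => x; rewrite !faceE !face_map2_0 !val_sphere_cube !row2_0 !row2_1 /=.
  by rewrite mulr0 cos0 sin0 !mul0r.
have k4 : face 0 (end0 R) e = fun t => 1 *: vec3 (cos (pi *+ 2 * val (t 0 0)))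
                                     (sin (pi *+ 2 * val (t 0 0))) 0.
  apply: path_ext => x; rewrite !faceE !face_map2_0 /e /a /b !row2_0 !row2_1 mxE /=.
  by rewrite mulr0 cos0 sin0; apply: row3P; rewrite !mxE /=; ring.
rewrite (boundary_turning_cylinder h1 h2 k3 k4 k1 k2).
rewrite (turning_pole (or_intror erefl)) (turning_pole (or_introl erefl)).
by ring.
Qed.

End SphereClass.

(** * Uniqueness of the matrix on H_2 *)

Section H2Basis.
Variable R : realType.
Local Notation V := 'rV[R]_3.
Local Notation I := (unit_interval R).
Local Notation X := (S2xS2 R).

Definition slot (k : bool) (u v : @sphere2 R) : X :=
  if k then sphere_pair v u else sphere_pair u v.

Lemma proj_slot k u v : proj k (slot k u v) = val u.
Proof. by case: k; rewrite /proj /slot /= ?row_mxKl ?row_mxKr. Qed.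

Lemma proj_slotN k u v : proj (~~ k) (slot k u v) = val v.
Proof. by case: k; rewrite /proj /slot /= ?row_mxKl ?row_mxKr. Qed.

Lemma H2_basisE i :
  H2_basis R i = << fun t => slot (i != 0) (sphere_cube t) (spherical 0 0) >>.
Proof. by rewrite /H2_basis /slot; case: (i == 0). Qed.

Lemma euler_class_basis (k : bool) i :
  euler_class k (H2_basis R i) = if (i != 0) == k then - (pi *+ 4) else 0.
Proof.
rewrite H2_basisE /euler_class fglift1; have [<-|nk] := eqVneq (i != 0) k.
  rewrite -euler_sphere_cube; congr euler_cochain; apply/funext => t /=.
  by rewrite proj_slot.
have -> : k = ~~ (i != 0) by move: nk; case: (i != 0); case: k.
apply: euler_degenerate; exists 0 => t t' _ /=.
by rewrite !proj_slotN.
Qed.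

Lemma euler_class_comb (k : bool) (a : 'I_2 -> int) :
  euler_class k (\sum_j a j *: H2_basis R j) =
  (a (if k then 1 else 0))%:~R * - (pi *+ 4).
Proof.
have e j : euler_class k (a j *: H2_basis R j) =
    (a j)%:~R * euler_class k (H2_basis R j).
  by rewrite mulrzl -scalezrE /euler_class fgliftZ.
have eD c d : euler_class k (c + d) = euler_class k c + euler_class k d.
  by rewrite /euler_class fgliftD.
rewrite sum_I2 eD !e !euler_class_basis.
by case: k {e eD}; rewrite /= mulr0 ?addr0 ?add0r.
Qed.

(** Pulled back along the two projections, the cocycle is dual to the basis x, y up to the nonzero
    factor -4 pi, so it reads off the integer coefficients. *)
Lemma H2_matrix_unique (f : X -> X) (M N : 'M[int]_2) :
  H2_matrix f M -> H2_matrix f N -> M = N.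
Proof.
move=> hM hN; apply/matrixP => i j.
have h (k : bool) : M i (if k then 1 else 0) = N i (if k then 1 else 0).
  have := euler_class_homologous k (hM i).
  rewrite (euler_class_homologous k (hN i)) !euler_class_comb => /mulIf.
  rewrite oppr_eq0 mulrn_eq0 /= gt_eqF ?pi_gt0 // => /(_ isT) /eqP.
  by rewrite eqr_int => /eqP.
have := h (j != 0); case: j => -[|[|//]] lt.
  by rewrite (_ : Ordinal lt = 0) //; exact: val_inj.
by rewrite (_ : Ordinal lt = 1) //; exact: val_inj.
Qed.

End H2Basis.

(** * Orthogonal matrices in dimension three *)

Section Orthogonal3.
Variable R : realType.
Local Notation V := 'rV[R]_3.
Implicit Types (A B : 'M[R]_3) (u v w : V).

Lemma dot_mx u v : dot u v = (u *m v^T) 0 0.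
Proof. by rewrite mxE; apply: eq_bigr => i _; rewrite mxE. Qed.

Lemma orthogonal1 n : orthogonal_mx (1%:M : 'M[R]_n).
Proof. by rewrite /orthogonal_mx trmx1 mulmx1. Qed.

Lemma orthogonalM n (A B : 'M[R]_n) :
  orthogonal_mx A -> orthogonal_mx B -> orthogonal_mx (A *m B).
Proof.
by move=> oA oB; rewrite /orthogonal_mx trmx_mul mulmxA -(mulmxA A) oB mulmx1 oA.
Qed.

Lemma orthogonalT n (A : 'M[R]_n) : orthogonal_mx A -> A^T *m A = 1%:M.
Proof. exact: mulmx1C. Qed.

Lemma orthogonal_tr n (A : 'M[R]_n) : orthogonal_mx A -> orthogonal_mx A^T.
Proof. by move=> oA; rewrite /orthogonal_mx trmxK orthogonalT. Qed.

Lemma orthogonalN n (A : 'M[R]_n) : orthogonal_mx A -> orthogonal_mx (- A).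
Proof. by move=> oA; rewrite /orthogonal_mx linearN /= mulNmx mulmxN opprK. Qed.

Lemma orthogonal_det n (A : 'M[R]_n) : orthogonal_mx A -> \det A = 1 \/ \det A = -1.
Proof.
move=> /(congr1 determinant); rewrite det_mulmx det_tr det1 -expr2 => /eqP.
by rewrite sqrf_eq1 => /orP[] /eqP; [left|right].
Qed.

Lemma dot_orthogonal A u v : orthogonal_mx A -> dot (u *m A) (v *m A) = dot u v.
Proof. by move=> oA; rewrite !dot_mx trmx_mul mulmxA -(mulmxA u) oA mulmx1. Qed.

Lemma det3N A : \det (- A) = - \det A.
Proof. by rewrite -scaleN1r detZ; ring. Qed.

Definition rows3 u v w : 'M[R]_3 := \matrix_(i, j) nth u [:: u; v; w] i 0 j.

Lemma mul_rows3 u v w A : rows3 u v w *m A = rows3 (u *m A) (v *m A) (w *m A).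
Proof.
apply/matrixP; apply: forall_I3 => j; rewrite !mxE /=;
  by apply: eq_bigr => k _; rewrite mxE.
Qed.

Lemma det_rows3 u v w : \det (rows3 u v w) = dot (cross u v) w.
Proof.
rewrite (expand_det_row _ 0) sum_I3 /cofactor !(expand_det_row _ 0).
rewrite !big_ord_recr !big_ord0 /= /cofactor !det_mx11 !mxE /=.
rewrite dotE !vec3E /= !add0r.
have L (x y : 'I_3) : val x = val y -> x = y := @val_inj _ _ _ x y.
rewrite (L (fintype.lift 0 (widen_ord (leqnSn 1) ord_max)) 1 erefl).
rewrite (L (fintype.lift 0 (fintype.lift (widen_ord (leqnSn 1) ord_max) 0)) 2%:R erefl).
rewrite (L (fintype.lift 0 ord_max) 2%:R erefl).
rewrite (L (fintype.lift 0 (fintype.lift ord_max 0)) 1 erefl).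
rewrite (L (fintype.lift 1 (widen_ord (leqnSn 1) ord_max)) 0 erefl).
rewrite (L (fintype.lift 1 (fintype.lift (widen_ord (leqnSn 1) ord_max) 0)) 2%:R erefl).
rewrite (L (fintype.lift 1 ord_max) 2%:R erefl).
rewrite (L (fintype.lift 1 (fintype.lift ord_max 0)) 0 erefl).
rewrite (L (fintype.lift 2%:R (widen_ord (leqnSn 1) ord_max)) 0 erefl).
rewrite (L (fintype.lift 2%:R (fintype.lift (widen_ord (leqnSn 1) ord_max) 0)) 1 erefl).
rewrite (L (fintype.lift 2%:R ord_max) 1 erefl).
rewrite (L (fintype.lift 2%:R (fintype.lift ord_max 0)) 0 erefl).
rewrite (_ : (0 + (1 %% 3 + 1 %% 3) %% 3)%N = 2%N) // (_ : (0 + 1 %% 3)%N = 1%N) //.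
by rewrite addn0 expr0 expr1; ring.
Qed.

(** Both sides have the same inner product with every w A, since the triple product is a
    determinant. *)
Lemma cross_mul A u v : orthogonal_mx A ->
  cross (u *m A) (v *m A) = \det A *: (cross u v *m A).
Proof.
move=> oA; suff h : cross (u *m A) (v *m A) *m A^T = \det A *: cross u v.
  by rewrite scalemxAl -h -mulmxA orthogonalT // mulmx1.
have e w : dot (cross (u *m A) (v *m A)) (w *m A) = \det A * dot (cross u v) w.
  by rewrite -!det_rows3 -mul_rows3 det_mulmx mulrC.
have s w : dot (cross (u *m A) (v *m A) *m A^T) w = dot (\det A *: cross u v) w.
  rewrite dotZl -e -(dot_orthogonal _ _ oA) -mulmxA orthogonalT //.
  by rewrite mulmx1.
apply/eqP; rewrite -subr_eq0 -dot_eq0 dotDl dotNl s subrr.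
by rewrite eqxx.
Qed.

Lemma unit_scale u : u != 0 -> exists2 a : R, a != 0 & dot (a *: u) (a *: u) = 1.
Proof.
rewrite -dot_gt0 => u0; exists (Num.sqrt (dot u u))^-1.
  by rewrite invr_eq0 gt_eqF // sqrtr_gt0.
rewrite dotZl dotZr mulrA -invfM -expr2 sqr_sqrtr ?dot_ge0 //.
by rewrite mulVf // gt_eqF.
Qed.

Lemma unit_perp v : dot v v = 1 -> exists w, dot w w = 1 /\ dot v w = 0.
Proof.
have norm w : dot v w = 0 -> w != 0 -> exists w, dot w w = 1 /\ dot v w = 0.
  by move=> vw /unit_scale[a _ h]; exists (a *: w); rewrite h dotZr vw mulr0.
move=> v1; have [v0|v0] := eqVneq (v 0 0) 0.
  apply: (norm (vec3 1 0 0)); first by rewrite dotE !vec3E v0; ring.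
  by rewrite -dot_eq0 dotE !vec3E; apply/eqP; lra.
apply: (norm (vec3 (- v 0 1) (v 0 0) 0)); first by rewrite dotE !vec3E; ring.
apply: contra v0 => /eqP/rowP/(_ 1); rewrite vec3E mxE => ->; exact: eqxx.
Qed.

Lemma fixed_unit_vector A : \det (A - 1%:M) = 0 ->
  exists v, dot v v = 1 /\ v *m A = v.
Proof.
move=> /eqP/det0P[u u0 uA]; have [a _ h] := unit_scale u0.
exists (a *: u); split=> //; rewrite -scalemxAl; congr (_ *: _).
by apply/eqP; rewrite -subr_eq0 -{2}[u]mulmx1 -mulmxBr uA.
Qed.

(** From A - 1 = - A (A - 1)^T and the odd dimension, det (A - 1) equals its own opposite. *)
Lemma rotation_axis A : orthogonal_mx A -> \det A = 1 ->
  exists v, dot v v = 1 /\ v *m A = v.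
Proof.
move=> oA dA; apply: fixed_unit_vector.
have e : A - 1%:M = A *m (- (A - 1%:M))^T.
  by rewrite linearN linearB /= trmx1 opprB mulmxBr mulmx1 oA.
have : \det (A - 1%:M) = - \det (A - 1%:M).
  by rewrite {1}e det_mulmx dA mul1r det_tr det3N.
by lra.
Qed.

Lemma fixed_two_id A v w : orthogonal_mx A -> \det A = 1 ->
  cross v w != 0 -> v *m A = v -> w *m A = w -> A = 1%:M.
Proof.
move=> oA dA vw vA wA; have cA : cross v w *m A = cross v w.
  by rewrite -[LHS]scale1r -dA -cross_mul // vA wA.
have h : rows3 v w (cross v w) *m A = rows3 v w (cross v w).
  by rewrite mul_rows3 vA wA cA.
have u : rows3 v w (cross v w) \in unitmx.
  by rewrite unitmxE det_rows3 unitfE dot_eq0.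
by rewrite -[A](mulKmx u) h mulVmx.
Qed.

Lemma cross_unit_eq0 v w : dot v v = 1 -> dot w w = 1 -> cross v w = 0 ->
  w = v \/ w = - v.
Proof.
move=> v1 w1 /eqP; rewrite -dot_eq0 dot_cross v1 w1 mul1r subr_eq0 eq_sym.
rewrite sqrf_eq1 => /orP[] /eqP vw; [left|right]; apply/eqP.
  rewrite -subr_eq0 -dot_eq0 dotDl !dotDr !dotNl !dotNr w1 v1 (dotC w) vw.
  by apply/eqP; ring.
rewrite -subr_eq0 opprK -dot_eq0 dotDl !dotDr w1 v1 (dotC w) vw.
by apply/eqP; ring.
Qed.

Lemma rotation_axis_unique A v w : orthogonal_mx A -> \det A = 1 -> A != 1%:M ->
  dot v v = 1 -> dot w w = 1 -> v *m A = v -> w *m A = w -> w = v \/ w = - v.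
Proof.
move=> oA dA A1 v1 w1 vA wA; apply: cross_unit_eq0 => //.
apply/eqP; apply: contraNT A1 => vw; apply/eqP.
exact: fixed_two_id oA dA vw vA wA.
Qed.

Lemma dot_cross_unit v w : dot v v = 1 -> dot w w = 1 -> dot v w = 0 ->
  dot (cross v w) (cross v w) = 1.
Proof. by move=> v1 w1 vw; rewrite dot_cross v1 w1 vw mulr1 expr0n subr0. Qed.

Lemma perp_decomposition u v w : dot v v = 1 -> dot w w = 1 -> dot v w = 0 ->
  dot v u = 0 -> u = dot u w *: w + dot u (cross v w) *: cross v w /\
  dot u w ^+ 2 + dot u (cross v w) ^+ 2 = dot u u.
Proof.
move=> v1 w1 vw vu; have := tangent_decomposition v1 (etrans (dotC _ _) vw)
  (etrans (dotC _ _) vu).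
by rewrite w1 scale1r mul1r (dotC u w) (dotC u (cross _ _)).
Qed.

Lemma cross_perp_frame v w (c s : R) : dot v v = 1 -> dot v w = 0 ->
  cross v (c *: w + s *: cross v w) = - s *: w + c *: cross v w.
Proof.
move=> v1 vw; rewrite crossZDr cross_cross v1 vw scale0r sub0r scale1r scalerN.
by rewrite addrC scaleNr.
Qed.

(** On the plane orthogonal to v such a rotation has determinant -1, hence is a reflection there: it
    is a half turn. *)
Lemma rotation_flip A v : orthogonal_mx A -> \det A = 1 -> dot v v = 1 ->
  v *m A = - v -> A *m A = 1%:M.
Proof.
move=> oA dA v1 vA; have [w [w1 vw]] := unit_perp v1.
have vwA : dot v (w *m A) = 0.
  by apply/eqP; rewrite -oppr_eq0 -dotNl -vA dot_orthogonal // vw.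
have [e h] := perp_decomposition v1 w1 vw vwA.
rewrite dot_orthogonal // w1 in h.
move: e h; set c := dot _ w; set s := dot _ (cross v w) => e h.
have cA : cross v w *m A = s *: w - c *: cross v w.
  rewrite -[LHS]scale1r -dA -cross_mul // vA {1}e -scaleN1r.
  transitivity (- cross v (c *: w + s *: cross v w)).
    by apply: row3P; rewrite !mxE /=; ring.
  by rewrite cross_perp_frame // opprD scaleNr opprK.
apply: (@fixed_two_id _ v w).
- exact: orthogonalM.
- by rewrite det_mulmx dA mulr1.
- by rewrite -dot_eq0 dot_cross_unit // oner_eq0.
- by rewrite mulmxA vA mulNmx vA opprK.
- rewrite mulmxA {1}e mulmxDl -!scalemxAl cA {1}e scalerDr scalerBr !scalerA.
  rewrite (mulrC s c) addrACA subrr addr0 -scalerDl -!expr2 h scale1r.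
  by [].
Qed.

Definition plane_rotation v w (c s : R) : 'M[R]_3 :=
  (rows3 v w (cross v w))^T *m
  rows3 v (c *: w + s *: cross v w) (- s *: w + c *: cross v w).

Lemma frame_orthogonal v w : dot v v = 1 -> dot w w = 1 -> dot v w = 0 ->
  orthogonal_mx (rows3 v w (cross v w)).
Proof.
move=> v1 w1 vw; have vw1 := dot_cross_unit v1 w1 vw.
have e i j : (rows3 v w (cross v w) *m (rows3 v w (cross v w))^T) i j =
  dot (nth v [:: v; w; cross v w] i) (nth v [:: v; w; cross v w] j).
  by rewrite !mxE; apply: eq_bigr => k _; rewrite !mxE.
apply/matrixP; apply: forall_I3; apply: forall_I3; rewrite e mxE /=.
- exact: v1.
- exact: vw.
- by rewrite dotC dot_crossl.
- by rewrite dotC.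
- exact: w1.
- by rewrite dotC dot_crossr.
- exact: dot_crossl.
- exact: dot_crossr.
- exact: vw1.
Qed.

Section Frame.
Variables v w : V.
Hypotheses (v1 : dot v v = 1) (w1 : dot w w = 1) (vw : dot v w = 0).

Lemma plane_rotation_orthogonal c s : c ^+ 2 + s ^+ 2 = 1 ->
  orthogonal_mx (plane_rotation v w c s).
Proof.
move=> cs; apply: orthogonalM; first exact/orthogonal_tr/frame_orthogonal.
rewrite -cross_perp_frame //; apply: frame_orthogonal => //.
  rewrite dotDl !dotDr !dotZl !dotZr w1 dot_cross_unit // dot_crossr dotC.
  by rewrite dot_crossr -[RHS]cs; ring.
by rewrite dotDr !dotZr vw dotC dot_crossl; ring.
Qed.

Lemma plane_rotation_eq A : orthogonal_mx A -> \det A = 1 -> v *m A = v ->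
  let c := dot (w *m A) w in let s := dot (w *m A) (cross v w) in
  c ^+ 2 + s ^+ 2 = 1 /\ A = plane_rotation v w c s.
Proof.
move=> oA dA vA c s.
have vwA : dot v (w *m A) = 0 by rewrite -{1}vA dot_orthogonal.
have [e h] := perp_decomposition v1 w1 vw vwA.
rewrite dot_orthogonal // w1 -/c -/s in h; rewrite -/c -/s in e.
split=> //.
have cA : cross v w *m A = - s *: w + c *: cross v w.
  by rewrite -[LHS]scale1r -dA -cross_mul // vA e cross_perp_frame.
have -> : plane_rotation v w c s =
    (rows3 v w (cross v w))^T *m (rows3 v w (cross v w) *m A).
  by rewrite mul_rows3 vA cA e.
by rewrite mulmxA orthogonalT ?mul1mx //; exact: frame_orthogonal.
Qed.

Lemma plane_rotation10 : plane_rotation v w 1 0 = 1%:M.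
Proof.
rewrite /plane_rotation scale1r scale0r oppr0 scale0r scale1r addr0 add0r.
by rewrite orthogonalT //; exact: frame_orthogonal.
Qed.

End Frame.

Lemma rotation_path A : orthogonal_mx A -> \det A = 1 ->
  exists rho : unit_interval R -> 'M[R]_3,
    [/\ continuous rho, forall t, orthogonal_mx (rho t),
        rho (end0 R) = 1%:M & rho (end1 R) = A].
Proof.
move=> oA dA; have [v [v1 vA]] := rotation_axis oA dA.
have [w [w1 vw]] := unit_perp v1.
have [cs eA] := plane_rotation_eq v1 w1 vw oA dA vA.
have [th [hc hs]] := polar cs.
exists (fun t => plane_rotation v w (cos (th * val t)) (sin (th * val t))).
split.
- have ct : continuous (fun t : unit_interval R => th * val t).
    by apply: continuous_mul; [exact: cst_continuous|exact: continuous_val].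
  apply: continuous_matrix => i j.
  rewrite /plane_rotation; under [X in continuous X]funext do rewrite mxE sum_I3.
  have cc := continuous_cos_angle ct; have cS := continuous_sin_angle ct.
  have h k : continuous (fun t : unit_interval R => (rows3 v w (cross v w))^T i k *
    rows3 v (cos (th * val t) *: w + sin (th * val t) *: cross v w)
      (- sin (th * val t) *: w + cos (th * val t) *: cross v w) k j).
    apply: continuous_mul; first exact: cst_continuous.
    have cl (a b : unit_interval R -> R) (x y : V) : continuous a -> continuous b ->
        continuous (fun t => (a t *: x + b t *: y) 0 j).
      move=> ca cb; under [X in continuous X]funext do rewrite !mxE.
      by apply: continuous_add; apply: continuous_mul => //; exact: cst_continuous.
    under [X in continuous X]funext do rewrite mxE.
    move: k; apply: forall_I3 => /=.
    + exact: cst_continuous.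
    + exact: cl.
    + by apply: cl => // t; exact: (cvgN (cS t)).
  by apply: continuous_add; first apply: continuous_add.
- by move=> t; apply: plane_rotation_orthogonal => //; rewrite cos2Dsin2.
- by rewrite /= mulr0 cos0 sin0 plane_rotation10.
- by rewrite /= mulr1 hc hs -eA.
Qed.

(** Since A^2 = 1, every row of A + 1 is fixed by A, and one of these rows is nonzero. *)
Lemma reflection_fixed_unit A : orthogonal_mx A -> \det A = -1 ->
  A *m A = 1%:M -> A != - 1%:M -> exists v, dot v v = 1 /\ v *m A = v.
Proof.
move=> oA dA AA A1; have [i ri] : exists i, row i (A + 1%:M) != 0.
  apply/existsP; rewrite -negb_forall; apply: contra A1 => /forallP h.
  rewrite -addr_eq0; apply/eqP/row_matrixP => i; rewrite row0.
  exact/eqP/h.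
have [a _ h] := unit_scale ri; exists (a *: row i (A + 1%:M)); split=> //.
rewrite -scalemxAl -row_mul mulmxDl mul1mx AA addrC.
by [].
Qed.

(** The rotation - A reverses v, so it is a half turn about an axis u orthogonal to v, and A fixes
    the vector product of v and u. Thus A is a reflection in a plane. *)
Lemma reflection_structure A v : orthogonal_mx A -> \det A = -1 -> dot v v = 1 ->
  v *m A = v -> A *m A = 1%:M /\
  exists w, [/\ dot w w = 1, dot v w = 0 & w *m A = w].
Proof.
move=> oA dA v1 vA.
have oB := orthogonalN oA; have dB : \det (- A) = 1 by rewrite det3N dA opprK.
have BB : A *m A = 1%:M.
  rewrite -(rotation_flip oB dB v1 _); first by rewrite mulNmx mulmxN opprK.
  by rewrite mulmxN vA.
split=> //; have [u [u1 uB]] := rotation_axis oB dB.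
have uA : u *m A = - u by rewrite -{2}uB mulmxN opprK.
have vu : dot v u = 0.
  have := dot_orthogonal v u oA; rewrite vA uA dotNr; lra.
exists (cross v u); split; first exact: dot_cross_unit.
  by rewrite dotC dot_crossl.
apply: oppr_inj; rewrite -[LHS]scaleN1r -dA -cross_mul // vA uA.
by apply: row3P; rewrite !mxE /=; ring.
Qed.

End Orthogonal3.

(** * Action of isometries on H_2 *)

Section HomologousChains.
Variables (R : realType) (X : topologicalType).
Local Notation I := (unit_interval R).

Lemma degenerate_chain1 n (s : 'rV[I]_n -> X) : degenerate s ->
  degenerate_chain (<< s >> : chain R n X).
Proof. by move=> ds s'; rewrite domU1 inE => /eqP->. Qed.

Lemma degenerate_chainD n (c d : chain R n X) :
  degenerate_chain c -> degenerate_chain d -> degenerate_chain (c + d).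
Proof.
by move=> dc dd s /domD_subset; rewrite mem_cat => /orP[/dc|/dd].
Qed.

Lemma degenerate_chainN n (c : chain R n X) :
  degenerate_chain c -> degenerate_chain (- c).
Proof. by move=> dc s; rewrite domN => /dc. Qed.

Lemma homologous_trans n (c c' c'' : chain R n X) :
  homologous c c' -> homologous c' c'' -> homologous c c''.
Proof.
move=> [w [d [sw dd e]]] [w' [d' [sw' dd' e']]]; exists (w + w'), (d + d'); split.
- by move=> s /domD_subset; rewrite mem_cat => /orP[/sw|/sw'].
- exact: degenerate_chainD.
- by rewrite /boundary fgliftD addrACA -[LHS](subrKA c') e e'.
Qed.

Lemma boundary_cube3 (W : 'rV[I]_3 -> X) : boundary (<< W >> : chain R 3 X) =
  (<< face 0 (end1 R) W >> - << face 0 (end0 R) W >>) -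
  (<< face 1 (end1 R) W >> - << face 1 (end0 R) W >>) +
  (<< face 2%:R (end1 R) W >> - << face 2%:R (end0 R) W >>).
Proof.
rewrite /boundary fglift1 sum_I3 expr0 expr1 scale1r scaleN1r.
by rewrite (_ : (-1) ^+ 2%:R = 1 :> int) ?scale1r.
Qed.

Lemma degenerate_first (s : 'rV[I]_2 -> X) :
  (forall a a' b, s (row2 a b) = s (row2 a' b)) -> degenerate s.
Proof.
move=> h; exists 0 => t t' tt'; by rewrite -(row2K t) -(row2K t') (tt' 1).
Qed.

Lemma degenerate_second (s : 'rV[I]_2 -> X) :
  (forall a b b', s (row2 a b) = s (row2 a b')) -> degenerate s.
Proof.
move=> h; exists 1 => t t' tt'; by rewrite -(row2K t) -(row2K t') (tt' 0).
Qed.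

(** The third coordinate is the time of the homotopy. The two longitude faces cancel, and the two
    colatitude faces are degenerate because they do not depend on the longitude. *)
Lemma homotopy_homologous (W : 'rV[I]_3 -> X) : continuous W ->
  (forall a c, W (row3 a (end1 R) c) = W (row3 a (end0 R) c)) ->
  (forall b b' c, W (row3 (end0 R) b c) = W (row3 (end0 R) b' c)) ->
  (forall b b' c, W (row3 (end1 R) b c) = W (row3 (end1 R) b' c)) ->
  homologous (<< face 2%:R (end1 R) W >> : chain R 2 X) << face 2%:R (end0 R) W >>.
Proof.
move=> cW side cap0 cap1.
exists << W >>, (- (<< face 0 (end1 R) W >> - << face 0 (end0 R) W >>)); split.
- by move=> s; rewrite domU1 inE => /eqP->.
- apply/degenerate_chainN/degenerate_chainD; last apply: degenerate_chainN.
    apply/degenerate_chain1/degenerate_first => a a' b.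
    by rewrite !faceE !face_map3_0.
  apply/degenerate_chain1/degenerate_first => a a' b.
  by rewrite !faceE !face_map3_0.
- have e : face 1 (end1 R) W = face 1 (end0 R) W.
    by apply/funext => t; rewrite -(row2K t) !faceE !face_map3_1.
  by rewrite boundary_cube3 e subrr subr0 [RHS]addrAC addrN add0r.
Qed.

End HomologousChains.

Section OrthogonalOnH2.
Variable R : realType.
Local Notation V := 'rV[R]_3.
Local Notation I := (unit_interval R).
Local Notation X := (S2xS2 R).
Local Notation S2 := (@sphere2 R).

Definition sph (v : V) : S2 := insubd (spherical 0 0) v.

Lemma sphK v : dot v v = 1 -> val (sph v) = v.
Proof.
by move=> v1; rewrite /sph insubdK //; apply/mem_set/sphere2E.
Qed.

Lemma val_sph (u : S2) : sph (val u) = u.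
Proof. exact: valKd. Qed.

Lemma dot_val (u : S2) : dot (val u) (val u) = 1.
Proof. by apply/sphere2E; exact: (set_mem (valP u)). Qed.

Definition move_sph (A : 'M[R]_3) (u : S2) : S2 := sph (val u *m A).

Lemma val_move_sph A u : orthogonal_mx A -> val (move_sph A u) = val u *m A.
Proof. by move=> oA; rewrite sphK // dot_orthogonal // dot_val. Qed.

Lemma move_sph1 u : move_sph 1%:M u = u.
Proof. by rewrite /move_sph mulmx1 val_sph. Qed.

Lemma move_sphM A B u : orthogonal_mx A -> orthogonal_mx B ->
  move_sph B (move_sph A u) = move_sph (A *m B) u.
Proof.
move=> oA oB; apply: val_inj; rewrite !val_move_sph ?mulmxA //.
exact: orthogonalM.
Qed.

Lemma continuous_slot (T : topologicalType) k (u v : T -> S2) :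
  continuous u -> continuous v -> continuous (fun t => slot k (u t) (v t)).
Proof.
move=> cu cv; apply: continuous_set_type; apply: continuous_matrix => i j.
have h (a b : T -> S2) : continuous a -> continuous b ->
    continuous (fun t => row_mx (val (a t) : V) (val (b t)) i j).
  move=> ca cb; under [X in continuous X]funext do rewrite mxE.
  case: (fintype.split j) => j'; apply: continuous_coordE.
    exact: (continuous_compT ca (@continuous_val _ _)).
  exact: (continuous_compT cb (@continuous_val _ _)).
by case: k; exact: h.
Qed.

Lemma continuous_move_sph (T : topologicalType) (A : T -> 'M[R]_3) (u : T -> S2) :
  (forall t, orthogonal_mx (A t)) -> continuous A -> continuous u ->
  continuous (fun t => move_sph (A t) (u t)).
Proof.
move=> oA cA cu; apply: continuous_set_type.
rewrite (_ : val \o _ = fun t => val (u t) *m A t); last first.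
  by apply/funext => t; exact: val_move_sph.
apply: continuous_matrix => i j.
under [X in continuous X]funext do rewrite mxE sum_I3.
have h k : continuous (fun t => (val (u t) : V) i k * A t k j).
  apply: continuous_mul; apply: continuous_coordE => //.
  exact: (continuous_compT cu (@continuous_val _ _)).
by do 2?[apply: continuous_add].
Qed.

Lemma rotation_homologous k (A B : 'M[R]_3) (Y : 'rV[I]_2 -> S2) (b : S2) :
  orthogonal_mx A -> \det A = 1 -> orthogonal_mx B -> \det B = 1 ->
  continuous Y ->
  (forall x, Y (row2 x (end1 R)) = Y (row2 x (end0 R))) ->
  (forall y y', Y (row2 (end0 R) y) = Y (row2 (end0 R) y')) ->
  (forall y y', Y (row2 (end1 R) y) = Y (row2 (end1 R) y')) ->
  homologous (<< fun t => slot k (move_sph A (Y t)) (move_sph B b) >> : chain R 2 X)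
             << fun t => slot k (Y t) b >>.
Proof.
move=> oA dA oB dB cY side cap0 cap1.
have [r [cr or r0 r1]] := rotation_path oA dA.
have [s [cs os s0 s1]] := rotation_path oB dB.
pose W (t : 'rV[I]_3) : X :=
  slot k (move_sph (r (t 0 2%:R)) (Y (row2 (t 0 0) (t 0 1))))
         (move_sph (s (t 0 2%:R)) b).
have WE x y z : W (row3 x y z) =
    slot k (move_sph (r z) (Y (row2 x y))) (move_sph (s z) b).
  by rewrite /W !mxE.
have -> : (fun t => slot k (move_sph A (Y t)) (move_sph B b)) = face 2%:R (end1 R) W.
  by apply/funext => t; rewrite -(row2K t) faceE face_map3_2 WE r1 s1.
have -> : (fun t => slot k (Y t) b) = face 2%:R (end0 R) W.
  by apply/funext => t; rewrite -(row2K t) faceE face_map3_2 WE r0 s0 !move_sph1.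
have cc (i : 'I_3) : continuous (fun t : 'rV[I]_3 => t 0 i).
  exact: continuous_coord.
apply: homotopy_homologous.
- apply: continuous_slot; apply: continuous_move_sph => //.
  + exact: (continuous_compT (cc 2%:R) cr).
  + have cp : continuous (fun t : 'rV[I]_3 => row2 (t 0 0) (t 0 1)).
      apply: continuous_matrix => i j.
      under [X in continuous X]funext do rewrite mxE.
      by case: j => -[|[|//]] lt; exact: cc.
    exact: (continuous_compT cp cY).
  + exact: (continuous_compT (cc 2%:R) cs).
  + exact: cst_continuous.
- by move=> x z; rewrite !WE side.
- by move=> y y' z; rewrite !WE (cap0 y y').
- by move=> y y' z; rewrite !WE (cap1 y y').
Qed.

Definition reversed_cube (t : 'rV[I]_2) : S2 :=
  spherical (pi * val (t 0 0)) (pi *+ 2 * (1 - val (t 0 1))).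

Lemma spherical_sin0 a b b' : sin a = 0 -> spherical a b = spherical a b' :> S2.
Proof.
move=> a0; apply: val_inj; apply: (row3P (u := spherical_row a b));
  by rewrite !mxE /= ?a0 ?mul0r.
Qed.

Lemma spherical_2pi a b : spherical a (b + pi *+ 2) = spherical a b :> S2.
Proof.
apply: val_inj; apply: (row3P (u := spherical_row a (b + pi *+ 2)));
  by rewrite !mxE /= ?sinD2pi ?cosD2pi.
Qed.

Lemma continuous_reversed_cube : continuous reversed_cube.
Proof.
apply: continuous_spherical; first exact: continuous_angle.
apply: continuous_mul; first exact: cst_continuous.
apply: continuous_sub; first exact: cst_continuous.
exact: (continuous_compT (@continuous_coord _ 1 2 0 1) (@continuous_val _ _)).
Qed.

(** On the 3-cube with colatitude pi x and longitude 2 pi y (1 - z), the face y = 1 is the reversed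
    square, the face z = 0 the original one, and the other four are degenerate. Hence the sum of the
    two squares is a boundary modulo degenerate chains. *)
Lemma reversed_cube_homologous k (b : S2) :
  homologous (<< fun t => slot k (reversed_cube t) b >> : chain R 2 X)
    (- << fun t => slot k (sphere_cube t) b >>).
Proof.
pose W (t : 'rV[I]_3) : X := slot k (spherical (pi * val (t 0 0))
  (pi *+ 2 * (val (t 0 1) * (1 - val (t 0 2%:R))))) b.
have WE x y z : W (row3 x y z) = slot k (spherical (pi * val x)
    (pi *+ 2 * (val y * (1 - val z)))) b by rewrite /W !mxE.
have cc (i : 'I_3) : continuous (fun t : 'rV[I]_3 => val (t 0 i) : R).
  exact: (continuous_compT (@continuous_coord _ 1 3 0 i) (@continuous_val _ _)).
have cW : continuous W.
  apply: continuous_slot; last exact: cst_continuous.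
  apply: continuous_spherical; first exact: continuous_angle.
  apply: continuous_mul; first exact: cst_continuous.
  apply: continuous_mul => //; apply: continuous_sub => //; exact: cst_continuous.
have f1 : face 1 (end1 R) W = (fun t => slot k (reversed_cube t) b).
  apply/funext => t; rewrite -{1}(row2K t) faceE face_map3_1 WE.
  by rewrite /reversed_cube /= mul1r.
have f2 : face 2%:R (end0 R) W = (fun t => slot k (sphere_cube t) b).
  apply/funext => t; rewrite -{1}(row2K t) faceE face_map3_2 WE.
  by rewrite /sphere_cube /= subr0 mulr1.
exists (- << W >>), ((<< face 0 (end1 R) W >> - << face 0 (end0 R) W >>)
  + (<< face 1 (end0 R) W >> + << face 2%:R (end1 R) W >>)); split.
- by move=> s; rewrite domN domU1 inE => /eqP->.
- apply: degenerate_chainD; apply: degenerate_chainD; try apply: degenerate_chainN;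
    apply: degenerate_chain1.
  + apply: degenerate_first => x x' y; rewrite !faceE !face_map3_0 !WE.
    by congr slot; apply: spherical_sin0; rewrite /= mulr1 sinpi.
  + apply: degenerate_first => x x' y; rewrite !faceE !face_map3_0 !WE.
    by congr slot; apply: spherical_sin0; rewrite /= mulr0 sin0.
  + apply: degenerate_second => x y y'; rewrite !faceE !face_map3_1 !WE.
    by rewrite /= !mul0r.
  + apply: degenerate_second => x y y'; rewrite !faceE !face_map3_2 !WE.
    by rewrite /= subrr !mulr0.
- rewrite -f1 -f2 /boundary -[- << W >>]sub0r fgliftB fglift0 sub0r.
  rewrite -[fglift _ _]/(boundary (<< W >> : chain R 3 X)) boundary_cube3.
  set a0 := << face 0 _ W >>; set a1 := << face 0 _ W >>.
  set b0 := << face 1 _ W >>; set b1 := << face 1 _ W >>.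
  set c0 := << face 2%:R _ W >>; set c1 := << face 2%:R _ W >>.
  rewrite opprK opprD !opprB addrACA -[X in _ = X + _]addrA subrKA subrr addr0.
  by rewrite (addrC b1) [c0 - c1 + _]addrA subrK (addrC c0) addrA subrK.
Qed.

Definition reflection_mx : 'M[R]_3 :=
  \matrix_(i, j) if i == j then (if i == 1 then -1 else 1) else 0.

Lemma mul_reflection v : v *m reflection_mx = vec3 (v 0 0) (- v 0 1) (v 0 2%:R).
Proof. by apply: row3P; rewrite !mxE sum_I3 !mxE /=; ring. Qed.

Lemma reflection_orthogonal : orthogonal_mx reflection_mx.
Proof.
apply/matrixP; apply: forall_I3; apply: forall_I3; rewrite !mxE sum_I3 !mxE /=; ring.
Qed.

Lemma det_reflection : \det reflection_mx = -1.
Proof.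
have -> : reflection_mx = rows3 (vec3 1 0 0) (vec3 0 (-1) 0) (vec3 0 0 1).
  by apply/matrixP; apply: forall_I3; apply: forall_I3; rewrite !mxE.
by rewrite det_rows3 !dotE !vec3E; ring.
Qed.

(** Determinant 1 is a deformation to the identity. For determinant -1, A and B are each written as
    [reflection_mx] followed by a rotation; the reflection turns [sphere_cube] into [reversed_cube]
    and fixes the base point. *)
Lemma slot_homologous k (A B : 'M[R]_3) (d : int) :
  orthogonal_mx A -> \det A = d%:~R -> orthogonal_mx B -> \det B = d%:~R ->
  homologous (<< fun t => slot k (move_sph A (sphere_cube t)) (move_sph B (spherical 0 0)) >>
     : chain R 2 X)
    (d *: << fun t => slot k (sphere_cube t) (spherical 0 0) >>).
Proof.
move=> oA dA oB dB.
have [d1|dN1] : d = 1 \/ d = -1.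
  by case: (orthogonal_det oA) => /eqP; rewrite dA => h; [left|right]; apply/eqP;
    rewrite -(eqr_int R).
  rewrite d1 scale1r; rewrite d1 in dA dB; apply: rotation_homologous => //.
  - exact: continuous_sphere_cube.
  - move=> x; rewrite /sphere_cube !row2_0 !row2_1 /= mulr1 mulr0.
    by rewrite -[pi *+ 2]add0r spherical_2pi.
  - move=> y y'; rewrite /sphere_cube !row2_0 !row2_1.
    by apply: spherical_sin0; rewrite /= mulr0 sin0.
  - move=> y y'; rewrite /sphere_cube !row2_0 !row2_1.
    by apply: spherical_sin0; rewrite /= mulr1 sinpi.
rewrite dN1 scaleN1r; apply: homologous_trans (reversed_cube_homologous k _).
rewrite dN1 in dA dB; have oP := reflection_orthogonal.
have e C u : orthogonal_mx C -> move_sph C u =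
    move_sph (reflection_mx *m C) (move_sph reflection_mx u).
  move=> oC; rewrite move_sphM //; last exact: orthogonalM.
  rewrite mulmxA (_ : reflection_mx *m _ = 1%:M) ?mul1mx //.
  rewrite -{2}(_ : reflection_mx^T = reflection_mx) //.
  by apply/matrixP => i j; rewrite !mxE eq_sym; case: eqP => // ->.
have eb : move_sph reflection_mx (spherical 0 0) = spherical 0 0.
  apply: val_inj; rewrite val_move_sph // mul_reflection.
  by apply: row3P; rewrite !mxE /= ?sin0 ?mul0r ?oppr0.
have ec t : move_sph reflection_mx (sphere_cube t) = reversed_cube t.
  apply: val_inj; rewrite val_move_sph // mul_reflection.
  have h : pi *+ 2 * (1 - val (t 0 1)) = - (pi *+ 2 * val (t 0 1)) + pi *+ 2 :> R.
    by ring.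
  apply: (row3P (v := spherical_row _ _)); rewrite !mxE /= ?h ?cosD2pi ?sinD2pi //.
  - by rewrite cosN.
  - by rewrite sinN mulrN.
have -> : (fun t => slot k (move_sph A (sphere_cube t)) (move_sph B (spherical 0 0))) =
    fun t => slot k (move_sph (reflection_mx *m A) (reversed_cube t))
                    (move_sph (reflection_mx *m B) (spherical 0 0)).
  by apply/funext => t; rewrite (e A) // (e B) // eb ec.
apply: rotation_homologous.
- exact: orthogonalM.
- by rewrite det_mulmx det_reflection dA mulrNN mulr1.
- exact: orthogonalM.
- by rewrite det_mulmx det_reflection dB mulrNN mulr1.
- exact: continuous_reversed_cube.
- move=> x; rewrite /reversed_cube !row2_0 !row2_1 /= subrr subr0 mulr1 mulr0.
  by rewrite -[pi *+ 2]add0r spherical_2pi.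
- move=> y y'; rewrite /reversed_cube !row2_0 !row2_1.
  by apply: spherical_sin0; rewrite /= mulr0 sin0.
- move=> y y'; rewrite /reversed_cube !row2_0 !row2_1.
  by apply: spherical_sin0; rewrite /= mulr1 sinpi.
Qed.

Definition blk (w : bool) (A B : 'M[R]_3) : 'M[R]_(3 + 3) :=
  if w then block_mx 0 A B 0 else block_mx A 0 0 B.

Lemma slot_blk w k A B (f : X -> X) u v : orthogonal_mx A -> orthogonal_mx B ->
  (forall p, val (f p) = val p *m blk w A B) ->
  f (slot k u v) = slot (k (+) w) (move_sph (if k then B else A) u)
                        (move_sph (if k then A else B) v).
Proof.
move=> oA oB fE; apply: val_inj; rewrite fE.
case: k; case: w {fE}; rewrite /slot /blk /= mul_row_block !mulmx0 ?addr0 ?add0r;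
  by rewrite !val_move_sph.
Qed.

Definition H2_action (w : bool) (d : int) : 'M[int]_2 :=
  if w then d *: swap_mx else d%:M.

Lemma H2_matrix_blk w A B (d : int) (f : X -> X) :
  orthogonal_mx A -> \det A = d%:~R -> orthogonal_mx B -> \det B = d%:~R ->
  (forall p, val (f p) = val p *m blk w A B) ->
  H2_matrix f (H2_action w d).
Proof.
move=> oA dA oB dB fE i.
have -> : \sum_j H2_action w d i j *: H2_basis R j =
    d *: << fun t => slot ((i != 0) (+) w) (sphere_cube t) (spherical 0 0) >>.
  rewrite sum_I2 !H2_basisE /= /H2_action.
  by case: w {fE}; case: i => -[|[|//]] lt; rewrite !mxE /=
    ?mulr1 ?mulr0 ?mulr1n ?mulr0n ?scale0r ?addr0 ?add0r.
rewrite /push_chain H2_basisE fglift1.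
have -> : f \o (fun t => slot (i != 0) (sphere_cube t) (spherical 0 0)) =
   fun t => slot ((i != 0) (+) w) (move_sph (if i != 0 then B else A) (sphere_cube t))
                        (move_sph (if i != 0 then A else B) (spherical 0 0)).
  by apply/funext => t /=; rewrite (slot_blk _ _ _ oA oB fE).
by case: (i != 0); apply: slot_homologous.
Qed.

End OrthogonalOnH2.

(** * Linear actions on the product of spheres *)

Section BlockStructure.
Variable R : realType.
Local Notation V := 'rV[R]_3.
Local Notation X := (S2xS2 R).
Implicit Types (A B : 'M[R]_3) (M N : 'M[R]_(3 + 3)).

Lemma S2xS2_row (u v : V) : dot u u = 1 -> dot v v = 1 -> S2xS2 R (row_mx u v).
Proof. by move=> u1 v1; rewrite /S2xS2 /= row_mxKl row_mxKr; split; apply/sphere2E. Qed.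

Lemma S2xS2_proj (p : 'rV[R]_(3 + 3)) : S2xS2 R p ->
  dot (lsubmx p) (lsubmx p) = 1 /\ dot (rsubmx p) (rsubmx p) = 1.
Proof. by case=> /sphere2E ? /sphere2E ?. Qed.

Definition preserves M := forall p, S2xS2 R p -> S2xS2 R (p *m M).

Lemma unit_vector_exists : exists u : V, dot u u = 1.
Proof. by exists (vec3 1 0 0); rewrite dotE !vec3E; ring. Qed.

(** The images of (u, v) and of (u, -v) both have a first component of length 1; expanding the two
    squared lengths separates the mixed term. *)
Lemma preserves_orthogonal_halves M (P := ulsubmx M) (S := dlsubmx M) :
  preserves M -> (forall u v, dot u u = 1 -> dot v v = 1 ->
    dot (u *m P) (v *m S) = 0 /\ dot (u *m P) (u *m P) + dot (v *m S) (v *m S) = 1).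
Proof.
move=> pM u v u1 v1.
have h (w : V) : dot w w = 1 -> dot (u *m P + w *m S) (u *m P + w *m S) = 1.
  move=> w1; have := (S2xS2_proj (pM _ (S2xS2_row u1 w1))).1.
  by rewrite -{1 2}[M]submxK mul_row_block row_mxKl.
have := h v v1; have := h (- v); rewrite dotNl dotNr opprK => /(_ v1).
rewrite mulNmx !dotDl !dotDr !dotNl !dotNr opprK (dotC (v *m S)) => h1 h2.
by split; lra.
Qed.

Lemma unitmx_of_inj A : (forall u : V, u != 0 -> u *m A != 0) -> A \in unitmx.
Proof.
move=> h; rewrite unitmxE unitfE; apply/negP => /det0P[u u0 uA].
by have := h u u0; rewrite uA eqxx.
Qed.

Lemma mx_eq0_of_units m (A : 'M[R]_(3, m)) :
  (forall u : V, dot u u = 1 -> u *m A = 0) -> A = 0.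
Proof.
move=> h; apply/row_matrixP => i; rewrite row0 rowE; apply: h.
rewrite dot_mx trmx_delta mul_delta_mx mxE !eqxx //.
Qed.

(** The length of u P is the same for all unit u. If it is not zero, P is invertible, and the
    vectors v S, being orthogonal to the whole image of P, vanish. *)
Lemma preserves_half0 M : preserves M -> ulsubmx M = 0 \/ dlsubmx M = 0.
Proof.
move=> pM; have h := preserves_orthogonal_halves pM.
have [->|P0] := eqVneq (ulsubmx M) 0; [by left|right].
have [u0 u01] := unit_vector_exists.
have PE u : dot u u = 1 -> dot (u *m ulsubmx M) (u *m ulsubmx M) =
    dot (u0 *m ulsubmx M) (u0 *m ulsubmx M).
  by move=> u1; have [_] := h u u0 u1 u01; have [_] := h u0 u0 u01 u01; lra.
have P0' : dot (u0 *m ulsubmx M) (u0 *m ulsubmx M) != 0.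
  apply: contra P0 => /eqP e; apply/eqP/mx_eq0_of_units => u u1.
  by apply/eqP; rewrite -dot_eq0 PE // e.
have Pu : ulsubmx M \in unitmx.
  apply: unitmx_of_inj => u un0; have [a a0 au] := unit_scale un0.
  apply: contra P0' => /eqP e; rewrite -(PE _ au) -scalemxAl e scaler0.
  by rewrite dot_eq0.
apply: mx_eq0_of_units => v v1.
have : dot (v *m dlsubmx M) (v *m dlsubmx M) = 0.
  set x := v *m _; have [->|x0] := eqVneq x 0; first by rewrite dotE !mxE; ring.
  have y0 : x *m invmx (ulsubmx M) != 0.
    by apply: contra x0 => /eqP e; rewrite -[x](mulmxKV Pu) e mul0mx.
  have [a a0 au] := unit_scale y0.
  have [+ _] := h _ v au v1; rewrite -scalemxAl mulmxKV // dotZl => /eqP.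
  by rewrite mulf_eq0 (negbTE a0) => /eqP.
by move/eqP; rewrite dot_eq0 => /eqP.
Qed.

Lemma preserves_blk M : orthogonal_mx M -> preserves M ->
  exists w A B, [/\ orthogonal_mx A, orthogonal_mx B & M = blk w A B].
Proof.
move=> oM pM; have := oM; rewrite /orthogonal_mx -{1 2}[M]submxK tr_block_mx mulmx_block.
rewrite (@scalar_mx_block _ 3 3) => /eq_block_mx[].
have := preserves_half0 pM.
suff : forall P Q S T : 'M[R]_3, P = 0 \/ S = 0 ->
   P *m P^T + Q *m Q^T = 1%:M -> P *m S^T + Q *m T^T = 0 ->
   S *m P^T + T *m Q^T = 0 -> S *m S^T + T *m T^T = 1%:M ->
   exists w A B, [/\ orthogonal_mx A, orthogonal_mx B & block_mx P Q S T = blk w A B].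
  by move=> h ps e1 e2 e3 e4; have := h _ _ _ _ ps e1 e2 e3 e4; rewrite submxK.
move=> P Q S T [->|->]; rewrite !mul0mx ?trmx0 ?mulmx0 !add0r ?addr0.
  move=> QQ QT _ SST; have T0 : T = 0.
    have /mulmx1_unit[Qu _] := QQ.
    by apply: trmx_inj; rewrite trmx0 -[T^T](mulKmx Qu) QT mulmx0.
  exists true, Q, S; split=> //; last by rewrite T0.
  by move: SST; rewrite T0 mul0mx addr0.
move=> PQ QT _ TT; have Q0 : Q = 0.
  have /mulmx1_unit[_ Tu] := TT.
  by rewrite -[Q](mulmxK Tu) QT mul0mx.
exists false, P, T; split=> //; last by rewrite Q0.
by move: PQ; rewrite Q0 mul0mx addr0.
Qed.

Lemma det_swap_blocks n : \det (block_mx 0 1%:M 1%:M 0 : 'M[R]_(n + n)) = (-1) ^+ n.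
Proof.
have -> : (block_mx 0 1%:M 1%:M 0 : 'M[R]_(n + n)) =
   block_mx 1%:M 0 0 (-1)%:M *m block_mx 1%:M 1%:M 0 1%:M *m
   block_mx 1%:M 0 (-1)%:M 1%:M *m block_mx 1%:M 1%:M 0 1%:M.
  rewrite !mulmx_block !(mul1mx, mulmx1, mul0mx, mulmx0, addr0, add0r).
  rewrite -scalar_mxM ?mulN1r ?opprK -!raddfD /= ?subrr ?addNr ?addrN ?raddf0.
  by rewrite ?mul0mx ?add0r ?addr0 ?scalar_mx0.
by rewrite !det_mulmx !det_ublock !det_lblock !det1 !det_scalar !mulr1 mul1r.
Qed.

Lemma det_blk w A B : \det (blk w A B) = (-1) ^+ w * (\det A * \det B).
Proof.
case: w; rewrite /blk; last by rewrite det_ublock expr0 mul1r.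
have -> : block_mx 0 A B 0 = block_mx A 0 0 B *m block_mx 0 1%:M 1%:M 0 :> 'M[R]_(3 + 3).
  by rewrite mulmx_block !(mul0mx, mulmx0, mulmx1, addr0, add0r).
by rewrite det_mulmx det_ublock det_swap_blocks; ring.
Qed.

Lemma mul_row_blk w A B (u v : V) : row_mx u v *m blk w A B =
  if w then row_mx (v *m B) (u *m A) else row_mx (u *m A) (v *m B).
Proof.
by case: w; rewrite /blk mul_row_block !mulmx0 ?addr0 ?add0r.
Qed.

(** An exchange of the factors also exchanges the two normal rows of the frame. This sign [W]
    cancels the sign of the block exchange in dimension 3 + 3, so only det A and det B remain. *)
Lemma det_framed_blk w A B p (U : 'M[R]_(4, 3 + 3)) :
  \det (framed (p *m blk w A B) (U *m blk w A B)) =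
  \det (framed p U) * (\det A * \det B).
Proof.
pose W : 'M[R]_6 := if w then block_mx (block_mx 0 1%:M 1%:M 0 : 'M[R]_(1 + 1)) 0 0
  (1%:M : 'M[R]_4) else 1%:M.
have dW : \det W = (-1) ^+ w.
  rewrite /W; case: w {W}; last by rewrite det1.
  by rewrite (@det_ublock _ 2 4) (@det_swap_blocks 1) det1 mulr1.
have -> : framed (p *m blk w A B) (U *m blk w A B) = W *m (framed p U *m blk w A B).
  rewrite -{1}[p]hsubmxK mul_row_blk /framed.
  rewrite (@mul_col_mx _ 2 4) (@mul_col_mx _ 1 1) !mul_row_blk !mul0mx /W.
  case: w {W dW}; last by rewrite mul1mx row_mxKl row_mxKr.
  rewrite (@mul_block_col _ 2 4 2 4 _) !mul0mx mul1mx add0r addr0.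
  rewrite (@mul_block_col _ 1 1 1 1 _) !mul0mx !mul1mx add0r addr0.
  by rewrite row_mxKl row_mxKr.
rewrite !det_mulmx det_blk dW.
by rewrite mulrCA (mulrA ((-1) ^+ w)) -expr2 sqrr_sign mul1r.
Qed.

Lemma orientation_preserving_blk w A B : orthogonal_mx A -> orthogonal_mx B ->
  \det A = \det B -> orientation_preserving (blk w A B).
Proof.
move=> oA oB dAB p U _ _; rewrite det_framed_blk dAB.
by case: (orthogonal_det oB) => ->; rewrite ?mulrNN !mulr1.
Qed.

(** A frame is built at (x, x). Its tangent part is also tangent at (x, -x), and passing to that
    point changes the sign of a single normal row, so one of the two points works. *)
Lemma positive_frame_exists : exists p U,
  [/\ S2xS2 R p, forall i, tangent p (row i U) & 0 < \det (framed p U)].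
Proof.
have [x x1] := unit_vector_exists; have [w [w1 xw]] := unit_perp x1.
have c1 := dot_cross_unit x1 w1 xw.
pose W : 'M[R]_(2, 3) := \matrix_(i, j) nth w [:: w; cross x w] i 0 j.
have WW : W *m W^T = 1%:M.
  apply/matrixP => i j; have -> : (W *m W^T) i j =
      dot (nth w [:: w; cross x w] i) (nth w [:: w; cross x w] j).
    by rewrite !mxE; apply: eq_bigr => k _; rewrite !mxE.
  rewrite mxE; case: i => -[|[|//]] li; case: j => -[|[|//]] lj //=.
  - by rewrite dotC dot_crossr.
  - by rewrite dot_crossr.
have xx : x *m x^T = 1%:M by rewrite [LHS]mx11_scalar -dot_mx x1.
have Wx : W *m x^T = 0.
  apply/colP => i; have -> : (W *m x^T) i 0 = dot (nth w [:: w; cross x w] i) x.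
    by rewrite !mxE; apply: eq_bigr => k _; rewrite !mxE.
  by rewrite mxE; case: i => -[|[|//]] li /=; [rewrite dotC|rewrite dot_crossl].
have xW : x *m W^T = 0 by rewrite -[LHS]trmxK trmx_mul trmxK Wx trmx0.
pose U : 'M[R]_(4, 3 + 3) := block_mx W 0 0 W : 'M_(2 + 2, 3 + 3).
have tU (e : R) i : tangent (row_mx x (e *: x)) (row i U).
  rewrite /tangent row_mxKl row_mxKr.
  have -> : lsubmx (row i U) = row i (col_mx W 0 : 'M_(2 + 2, 3)).
    by rewrite -[col_mx W 0](row_mxKl _ (col_mx 0 W)) -block_mxEh;
      apply/rowP => j; rewrite !mxE.
  have -> : rsubmx (row i U) = row i (col_mx 0 W : 'M_(2 + 2, 3)).
    by rewrite -[col_mx 0 W](row_mxKr (col_mx W 0)) -block_mxEh;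
      apply/rowP => j; rewrite !mxE.
  rewrite linearZ /= -scalemxAr -!row_mul !(@mul_col_mx _ 2 2 3 1) Wx !mul0mx col_mx0.
  by rewrite row0 scaler0.
pose F := framed (row_mx x x) U.
have FF : F *m F^T = 1%:M.
  rewrite /F /framed row_mxKl row_mxKr /U block_mxEv.
  rewrite (@tr_col_mx _ 2 4 6) (@tr_col_mx _ 1 1 6) (@tr_col_mx _ 2 2 6).
  rewrite (@mul_col_row _ 2 4 _ 2 4) (@mul_col_row _ 1 1 _ 1 1).
  rewrite (@mul_col_row _ 2 2 _ 2 2) (@mul_col_row _ 1 1 _ 2 2) (@mul_col_row _ 2 2 _ 1 1).
  rewrite !(@tr_row_mx _ 1 3 3) !(@tr_row_mx _ 2 3 3) !trmx0.
  rewrite !(@mul_row_col _ 1 3 3 1) !(@mul_row_col _ 1 3 3 2).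
  rewrite !(@mul_row_col _ 2 3 3 1) !(@mul_row_col _ 2 3 3 2) !mulmx0 !mul0mx !addr0 !add0r xx xW Wx WW.
  rewrite -![block_mx _ 0 0 _](@scalar_mx_block R) !block_mx0.
  by rewrite -(@scalar_mx_block _ 2 2) -(@scalar_mx_block _ 2 4).
have : \det F != 0.
  apply/eqP => e; have := congr1 determinant FF.
  by rewrite det_mulmx e mul0r det1 => /eqP; rewrite eq_sym oner_eq0.
rewrite neq_lt => /orP[Fn|Fp]; last first.
  exists (row_mx x x), U; split=> //; first exact: S2xS2_row.
  by move=> i; have := tU 1 i; rewrite scale1r.
exists (row_mx x ((-1) *: x)), U; split=> //.
  by apply: S2xS2_row => //; rewrite dotZl dotZr x1 mulrA mulrNN !mulr1.
pose D : 'M[R]_6 := block_mx (block_mx 1%:M 0 0 (-1)%:M : 'M[R]_(1 + 1)) 0 0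
  (1%:M : 'M[R]_4).
have -> : framed (row_mx x ((-1) *: x)) U = D *m F.
  rewrite /F /framed !row_mxKl !row_mxKr /D.
  rewrite (@mul_block_col _ 2 4 2 4 _) !mul0mx mul1mx add0r addr0.
  rewrite (@mul_block_col _ 1 1 1 1 _) !mul0mx !mul1mx add0r addr0.
  by rewrite mul_scalar_mx (@scale_row_mx _ 1 3 3) scaler0.
rewrite det_mulmx (@det_ublock _ 2 4) (@det_ublock _ 1 1) !det1 det_scalar1.
by rewrite mul1r mulr1 mulN1r oppr_gt0.
Qed.

Lemma orientation_preserving_det w A B : orthogonal_mx A -> orthogonal_mx B ->
  orientation_preserving (blk w A B) -> \det A = \det B.
Proof.
move=> oA oB; have [p [U [pX tU dU]]] := positive_frame_exists.
move=> /(_ p U pX tU dU); rewrite det_framed_blk.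
case: (orthogonal_det oA) => ->; case: (orthogonal_det oB) => -> //;
  rewrite ?mulr1 ?mul1r; lra.
Qed.

End BlockStructure.

(** * Fixed sets of block isometries *)

Section FixedPoints.
Variable R : realType.
Local Notation V := 'rV[R]_3.
Local Notation X := (S2xS2 R).
Local Notation S2 := (@sphere2 R).
Implicit Types (A B : 'M[R]_3) (M N : 'M[R]_(3 + 3)).

Definition fixed_unit A := exists v : V, dot v v = 1 /\ v *m A = v.

Definition sphere_fix A : set S2 := [set u | val u *m A = val u].

Definition fixset M : set X := [set p | val p *m M = val p].

Lemma fixed_unitP A : fixed_unit A <-> sphere_fix A !=set0.
Proof.
split=> [[v [v1 vA]]|[u uA]]; first by exists (sph v); rewrite /sphere_fix /= sphK.
by exists (val u); split=> //; exact: dot_val.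
Qed.

Lemma sphere_fix_finite A : orthogonal_mx A -> \det A = 1 -> A != 1%:M ->
  finite_set (sphere_fix A).
Proof.
move=> oA dA A1; have [v [v1 vA]] := rotation_axis oA dA.
apply: (sub_finite_set _ (finite_set2 (sph v) (sph (- v)))) => u /= uA.
have [e|e] := rotation_axis_unique oA dA A1 v1 (dot_val u) vA uA; [left|right].
  by rewrite -e val_sph.
by rewrite -e val_sph.
Qed.

Lemma sphere_fix_infinite A (v w : V) : dot v v = 1 -> dot w w = 1 -> dot v w = 0 ->
  v *m A = v -> w *m A = w -> ~ finite_set (sphere_fix A).
Proof.
move=> v1 w1 vw vA wA fin.
(* The angles 1/(n+1) give distinct points of the fixed circle through v and w: they lie in [0, pi],
   where the cosine separates them. *)
pose t (n : nat) : R := n.+1%:R^-1.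
have tpi n : t n \in `[0, (pi : R)].
  have t1 : t n <= 1 by rewrite invf_le1 ?ltr0n // ler1n.
  have := @pi_ge2 R; rewrite in_itv /= invr_ge0 ler0n /= => pi2.
  by apply: le_trans t1 (le_trans _ pi2); rewrite ler1n.
pose f n := cos (t n).
have fI : {in setT &, injective f}.
  move=> m n _ _ /cos_inj => /(_ (tpi m) (tpi n)) /invr_inj /eqP.
  by rewrite eqr_nat => /eqP[].
apply: infinite_nat.
have := inj_card_eq fI => /eq_finite_set <-.
apply: sub_finite_set (finite_image (fun u : S2 => dot (val u) v) fin).
move=> _ [n _ <-] /=.
pose x := cos (t n) *: v + sin (t n) *: w.
have x1 : dot x x = 1.
  rewrite dotDl !dotDr !dotZl !dotZr v1 w1 (dotC w) vw -[RHS](cos2Dsin2 (t n)).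
  by ring.
exists (sph x); rewrite /sphere_fix /= sphK //.
  by rewrite /x mulmxDl -!scalemxAl vA wA.
by rewrite /x dotDl !dotZl v1 (dotC w) vw mulr0 addr0 mulr1.
Qed.

Lemma sphere_fix1_infinite : ~ finite_set (sphere_fix 1%:M).
Proof.
have [v v1] := @unit_vector_exists R; have [w [w1 vw]] := unit_perp v1.
by apply: sphere_fix_infinite v1 w1 vw _ _; rewrite mulmx1.
Qed.

Lemma reflection_fix_infinite A : orthogonal_mx A -> \det A = -1 -> fixed_unit A ->
  ~ finite_set (sphere_fix A).
Proof.
move=> oA dA [v [v1 vA]]; have [_ [w [w1 vw wA]]] := reflection_structure oA dA v1 vA.
exact: sphere_fix_infinite v1 w1 vw vA wA.
Qed.

Lemma slotK (p : X) : slot false (sph (proj false p)) (sph (proj true p)) = p.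
Proof.
have e k : val (sph (proj k p)) = proj k p by rewrite sphK // proj_sphere.
apply: val_inj; rewrite -[RHS](hsubmxK (val p)).
exact: (congr2 (@row_mx _ _ _ _) (e false) (e true)).
Qed.

Lemma fixset_blk0 A B u v :
  fixset (blk false A B) (slot false u v) <-> sphere_fix A u /\ sphere_fix B v.
Proof.
change (row_mx (val u) (val v) *m blk false A B = row_mx (val u) (val v) <->
  val u *m A = val u /\ val v *m B = val v); rewrite mul_row_blk.
by split=> [/eq_row_mx //|[-> ->]].
Qed.

Lemma fixset_blk1 A B u v : fixset (blk true A B) (slot false u v) <->
  val v *m B = val u /\ val u *m A = val v.
Proof.
change (row_mx (val u) (val v) *m blk true A B = row_mx (val u) (val v) <->
  val v *m B = val u /\ val u *m A = val v); rewrite mul_row_blk.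
by split=> [/eq_row_mx //|[-> ->]].
Qed.

Lemma finite_fixset_blk0 A B : finite_set (sphere_fix A) -> finite_set (sphere_fix B) ->
  finite_set (fixset (blk false A B)).
Proof.
move=> fA fB; apply: sub_finite_set (finite_image (fun uv => slot false uv.1 uv.2)
  (finite_setX fA fB)) => p.
rewrite -{1}(slotK p) => /fixset_blk0[uA vB].
by exists (sph (proj false p), sph (proj true p)) => //=; exact: slotK.
Qed.

Lemma fixset_blk0_finite A B : finite_set (fixset (blk false A B)) ->
  fixed_unit A -> fixed_unit B ->
  finite_set (sphere_fix A) /\ finite_set (sphere_fix B).
Proof.
move=> fin /fixed_unitP[u uA] /fixed_unitP[v vB]; split.
  apply: sub_finite_set (finite_image (fun p : X => sph (proj false p)) fin).
  move=> u' u'A; exists (slot false u' v); first exact/fixset_blk0.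
  by rewrite proj_slot val_sph.
apply: sub_finite_set (finite_image (fun p : X => sph (proj true p)) fin).
move=> v' v'A; exists (slot false u v'); first exact/fixset_blk0.
by rewrite (proj_slotN false) val_sph.
Qed.

Lemma fixset_empty A B : ~ (fixed_unit A /\ fixed_unit B) ->
  finite_set (fixset (blk false A B)).
Proof.
move=> nf; apply: (sub_finite_set (B := set0)) => // p.
rewrite -{1}(slotK p) => /fixset_blk0[uA vB]; apply: nf.
by split; apply/fixed_unitP; [exists (sph (proj false p))|exists (sph (proj true p))].
Qed.

(** The fixed set is a product. A rotation other than the identity has a finite nonempty fixed set
    on the sphere, while an isometry of determinant -1 fixes either no point or infinitely many. *)
Lemma fixset_blk0P A B : orthogonal_mx A -> orthogonal_mx B -> \det A = \det B ->
  finite_set (fixset (blk false A B)) <->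
  (\det A = 1 /\ A != 1%:M /\ B != 1%:M) \/
  (\det A = -1 /\ ~ (fixed_unit A /\ fixed_unit B)).
Proof.
move=> oA oB dAB; split.
  move=> fin; case: (orthogonal_det oA) => dA; [left|right]; split=> //.
    have fA : fixed_unit A by have [v ?] := rotation_axis oA dA; exists v.
    have fB : fixed_unit B.
      by have [|v ?] := rotation_axis oB; [rewrite -dAB|exists v].
    have [hA hB] := fixset_blk0_finite fin fA fB.
    by split; apply/eqP => e; apply: sphere_fix1_infinite; [rewrite e in hA|rewrite e in hB].
  move=> [fA fB]; have [hA hB] := fixset_blk0_finite fin fA fB.
  exact: reflection_fix_infinite fA hA.
case=> [[dA [A1 B1]]|[dA nf]]; last exact: fixset_empty.
by apply: finite_fixset_blk0; apply: sphere_fix_finite => //; rewrite -dAB.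
Qed.

(** The fixed points are the pairs (u, u A) with u fixed by A B, which is a rotation because the
    determinants agree. *)
Lemma fixset_blk1P A B : orthogonal_mx A -> orthogonal_mx B -> \det A = \det B ->
  finite_set (fixset (blk true A B)) <-> A *m B != 1%:M.
Proof.
move=> oA oB dAB; split.
  move=> fin; apply/eqP => AB; apply: sphere_fix1_infinite.
  apply: sub_finite_set (finite_image (fun p : X => sph (proj false p)) fin).
  move=> u _; exists (slot false u (move_sph A u)); last by rewrite proj_slot val_sph.
  by apply/fixset_blk1; rewrite val_move_sph // -mulmxA AB mulmx1.
move=> AB; have oAB := orthogonalM oA oB.
have dAB1 : \det (A *m B) = 1.
  by rewrite det_mulmx dAB; case: (orthogonal_det oB) => ->; ring.
apply: sub_finite_set (finite_image (fun u => slot false u (move_sph A u))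
  (sphere_fix_finite oAB dAB1 AB)) => p.
rewrite -{1}(slotK p) => /fixset_blk1[vB uA].
exists (sph (proj false p)); first by rewrite /sphere_fix /= mulmxA uA vB.
rewrite -[RHS]slotK; congr slot; apply: val_inj.
by rewrite val_move_sph.
Qed.

Lemma rotoreflection_fixed A : orthogonal_mx A -> \det A = -1 ->
  fixed_unit A <-> (A *m A = 1%:M /\ A != - 1%:M).
Proof.
move=> oA dA; split=> [[v [v1 vA]]|[AA A1]]; last exact: reflection_fixed_unit.
split; first by have [] := reflection_structure oA dA v1 vA.
apply/eqP => e; have := dot_eq0 v; rewrite v1 oner_eq0 => /esym/eqP; apply.
have : v = - v by rewrite -{1}vA e mulmxN mulmx1.
by move=> /eqP; rewrite -subr_eq0 opprK -mulr2n -scaler_nat scaler_eq0 pnatr_eq0 /= => /eqP.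
Qed.

End FixedPoints.

(** * Actions as matrix-valued functions on the group *)

Section Representation.
Variables (R : realType) (gT : finGroupType).
Local Notation X := (S2xS2 R).
Implicit Types to : {action gT &-> S2xS2 R}.

Lemma blkM w (A B : 'M[R]_3) w' A' B' : blk w A B *m blk w' A' B' =
  blk (w (+) w') (A *m (if w then B' else A')) (B *m (if w then A' else B')).
Proof.
by case: w; case: w'; rewrite /blk mulmx_block !(mulmx0, mul0mx) !(addr0, add0r).
Qed.

Lemma orthogonal_neq0 (A : 'M[R]_3) : orthogonal_mx A -> A <> 0.
Proof.
move=> oA e; have := congr1 determinant oA.
by rewrite e mul0mx det0 det1 => /eqP; rewrite eq_sym oner_eq0.
Qed.

Lemma blk_inj w (A B : 'M[R]_3) w' A' B' : orthogonal_mx A -> orthogonal_mx B ->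
  blk w A B = blk w' A' B' -> [/\ w = w', A = A' & B = B'].
Proof.
move=> /orthogonal_neq0 A0 /orthogonal_neq0 B0.
by case: w; case: w'; rewrite /blk => /eq_block_mx[].
Qed.

(** The product of spheres spans R^6: the vector (u, 0) is the midpoint of (u, x) and (u, -x). *)
Lemma eq_on_S2xS2 (M N : 'M[R]_(3 + 3)) :
  (forall p, S2xS2 R p -> p *m M = p *m N) -> M = N.
Proof.
move=> h; have hh (u v : 'rV[R]_3) : dot u u = 1 -> dot v v = 1 ->
    row_mx u v *m (M - N) = 0.
  by move=> u1 v1; rewrite mulmxBr h ?subrr //; exact: S2xS2_row.
have [x x1] := @unit_vector_exists R.
have h1 (u : 'rV[R]_3) : dot u u = 1 -> row_mx u 0 *m (M - N) = 0.
  move=> u1; have -> : row_mx u 0 = 2%:R^-1 *: (row_mx u x + row_mx u (- x)).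
    rewrite add_row_mx subrr scale_row_mx scaler0 -mulr2n -(scaler_nat 2 u) scalerA.
    by rewrite mulVf ?scale1r // pnatr_eq0.
  rewrite -scalemxAl mulmxDl !hh ?addr0 ?scaler0 //.
  by rewrite dotNl dotNr opprK.
have h2 (u : 'rV[R]_3) : dot u u = 1 -> row_mx 0 u *m (M - N) = 0.
  move=> u1; have := hh x u x1 u1.
  by rewrite -[row_mx x u](_ : row_mx x 0 + row_mx 0 u = _) ?mulmxDl ?h1 ?add0r //
    add_row_mx addr0 add0r.
apply/eqP; rewrite -subr_eq0; apply/eqP.
have e : M - N = col_mx (usubmx (M - N)) (dsubmx (M - N)) by rewrite vsubmxK.
have z1 : usubmx (M - N) = 0.
  apply: mx_eq0_of_units => u u1; have := h1 u u1.
  by rewrite {1}e mul_row_col mul0mx addr0.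
have z2 : dsubmx (M - N) = 0.
  apply: mx_eq0_of_units => u u1; have := h2 u u1.
  by rewrite {1}e mul_row_col mul0mx add0r.
by rewrite e z1 z2 col_mx0.
Qed.

Lemma total_actionM (T : Type) (to : {action gT &-> T}) x g h :
  to x (g * h)%g = to (to x g) h.
Proof. by case: to => f fP; apply: (proj2 fP x g h); rewrite inE. Qed.

Definition represented to (w : gT -> bool) (A B : gT -> 'M[R]_3) :=
  forall g, [/\ orthogonal_mx (A g), orthogonal_mx (B g), \det (A g) = \det (B g)
    & forall p, val (to p g) = val p *m blk (w g) (A g) (B g)].

Lemma represented_exists to : linear_orientation_preserving to ->
  exists w A B, represented to w A B.
Proof.
move=> lin; have h g : exists wAB : bool * ('M[R]_3 * 'M[R]_3),
    [/\ orthogonal_mx wAB.2.1, orthogonal_mx wAB.2.2,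
      \det wAB.2.1 = \det wAB.2.2
    & forall p, val (to p g) = val p *m blk wAB.1 wAB.2.1 wAB.2.2].
  have [M [oM tM opM]] := lin g.
  have pM : preserves M.
    move=> p pX; have := tM (SigSub (mem_set pX)) => /= <-.
    exact: (set_mem (valP (to _ g))).
  have [w [A [B [oA oB e]]]] := preserves_blk oM pM.
  exists (w, (A, B)); split=> //=; last by rewrite -e.
  by apply: (orientation_preserving_det oA oB (w := w)); rewrite -e.
have [f hf] := choice h.
by exists (fun g => (f g).1), (fun g => (f g).2.1), (fun g => (f g).2.2).
Qed.

(** The product rule of the wreath product of O(3) with Z_2, for right actions. *)
Definition swap_multiplicative (w : gT -> bool) (A B : gT -> 'M[R]_3) :=
  forall g h, [/\ w (g * h)%g = w g (+) w h,
    A (g * h)%g = A g *m (if w g then B h else A h)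
  & B (g * h)%g = B g *m (if w g then A h else B h)].

Lemma represented_mul to w A B : represented to w A B -> swap_multiplicative w A B.
Proof.
move=> rep g h; have [oA oB _ gE] := rep g; have [oA' oB' _ hE] := rep h.
have [oA'' oB'' _ ghE] := rep (g * h)%g.
apply: blk_inj => //; rewrite -blkM; apply: eq_on_S2xS2 => p pX.
have := ghE (SigSub (mem_set pX)); rewrite total_actionM hE gE /= => <-.
by rewrite mulmxA.
Qed.

Lemma multiplicative1 w A B : (forall g, orthogonal_mx (A g)) ->
  (forall g, orthogonal_mx (B g)) -> swap_multiplicative w A B ->
  [/\ w 1%g = false, A 1%g = 1%:M & B 1%g = 1%:M].
Proof.
move=> oA oB mul; have [] := mul 1%g 1%g; rewrite mulg1 addbb => w1.
rewrite w1 => eA eB; split=> //.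
  by rewrite -(oA 1%g) {2}eA -mulmxA oA mulmx1.
by rewrite -(oB 1%g) {2}eB -mulmxA oB mulmx1.
Qed.

Lemma represented_build w A B : (forall g, orthogonal_mx (A g)) ->
  (forall g, orthogonal_mx (B g)) -> (forall g, \det (A g) = \det (B g)) ->
  swap_multiplicative w A B -> exists to, represented to w A B.
Proof.
move=> oA oB dAB mul; have [w1 A1 B1] := multiplicative1 oA oB mul.
pose M g := blk (w g) (A g) (B g).
pose act (p : X) (g : gT) : X := insubd p (val p *m M g).
have actE p g : val (act p g) = val p *m M g.
  rewrite /act insubdK //; apply/mem_set; rewrite -[val p]hsubmxK /M mul_row_blk.
  have [/sphere2E u1 /sphere2E v1] := set_mem (valP p).
  by case: (w g); apply: S2xS2_row; rewrite dot_orthogonal.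
have act1 : act^~ 1%g =1 id.
  move=> p; apply: val_inj; rewrite actE /M w1 A1 B1 -[RHS]mulmx1.
  by rewrite (@scalar_mx_block _ 3 3).
have actM p : act_morph act p.
  move=> g h; apply: val_inj; rewrite !actE -mulmxA; congr (_ *m _).
  by rewrite /M blkM; have [-> -> ->] := mul g h.
by exists (TotalAction act1 actM).
Qed.

Lemma represented_linear to w A B : represented to w A B ->
  linear_orientation_preserving to.
Proof.
move=> rep g; have [oA oB dAB gE] := rep g.
exists (blk (w g) (A g) (B g)); split=> //; last exact: orientation_preserving_blk.
rewrite /orthogonal_mx; have -> : (blk (w g) (A g) (B g))^T =
    blk (w g) (if w g then (B g)^T else (A g)^T) (if w g then (A g)^T else (B g)^T).
  by rewrite /blk; case: (w g); rewrite tr_block_mx !trmx0.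
rewrite blkM addbb (@scalar_mx_block _ 3 3).
by case: (w g); congr block_mx.
Qed.

Lemma pseudofreeP to w A B : represented to w A B -> pseudofree to <->
  forall g, g != 1%g -> finite_set (fixset (blk (w g) (A g) (B g))).
Proof.
move=> rep; have fE g p : to p g = p <-> fixset (blk (w g) (A g) (B g)) p.
  have [_ _ _ gE] := rep g; rewrite /fixset /= -gE.
  by split=> [->//|]; exact: val_inj.
split=> [pf g g1|fin].
  by apply: sub_finite_set pf => p /fE fp; exists g.
rewrite /pseudofree (_ : [set p | _] = \bigcup_(g in [set g : gT | g != 1%g])
    fixset (blk (w g) (A g) (B g))).
  apply: bigcup_finite; first exact: finite_finset.
  by move=> g /= g1; exact: fin.
by apply/seteqP; split=> p /= [g g1 /fE ?]; exists g.
Qed.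

Definition dsign (A : 'M[R]_3) : int := if \det A == 1 then 1 else -1.

Lemma dsignE (A : 'M[R]_3) : orthogonal_mx A -> \det A = (dsign A)%:~R.
Proof.
rewrite /dsign => /orthogonal_det[->|->]; first by rewrite eqxx.
have -> : (-1 == 1 :> R) = false by apply/eqP => h; lra.
by rewrite mulrNz.
Qed.

Lemma represented_H2 to w A B g N : represented to w A B ->
  H2_matrix (to^~ g) N <-> N = H2_action (w g) (dsign (A g)).
Proof.
move=> rep; have [oA oB dAB gE] := rep g.
have h : H2_matrix (to^~ g) (H2_action (w g) (dsign (A g))).
  have dB : \det (B g) = (dsign (A g))%:~R by rewrite -dAB; exact: dsignE.
  exact: (H2_matrix_blk oA (dsignE oA) oB dB gE).
split=> [hN|->//]; exact: H2_matrix_unique hN h.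
Qed.

End Representation.

(** * Finite groups of rotations *)

Section AxisStructure.
Local Close Scope classical_set_scope.
Local Open Scope nat_scope.
Local Open Scope group_scope.
Variable gT : finGroupType.
Implicit Types (K : {group gT}) (ax : gT -> {group gT}).

(* The combinatorics of a finite group of rotations: [ax x] is the subgroup of
   the rotations about the axis of [x]. *)
Record axis_structure K ax : Prop := AxisStructure {
  axis_mem : {in K^#, forall x, x \in ax x};
  axis_sub : {in K^#, forall x, ax x \subset K};
  axis_cyclic : {in K^#, forall x, cyclic (ax x)};
  axis_eq : {in K^#, forall x y, y \in (ax x)^# -> ax y = ax x};
  axisJ : {in K^# & K, forall x g, ax (x ^ g) = (ax x :^ g)%G};
  axis_flip : {in K^#, forall x g, g \in 'N_K(ax x) :\: ax x -> g ^+ 2 = 1};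
  axis_flipM : {in K^#, forall x g h, g \in 'N_K(ax x) :\: ax x ->
    h \in 'N_K(ax x) :\: ax x -> g * h \in ax x} }.

Section Theory.
Variables (K : {group gT}) (ax : gT -> {group gT}).
Hypothesis axK : axis_structure K ax.
Implicit Types x y z : gT.

(** For rotations this is the stabiliser of the axis as a line: the rotations about it together with
    the half turns that reverse it. *)
Definition sat x := 'N_K(ax x)%G.

Lemma axis_subD1 x : x \in K^# -> (ax x)^# \subset K^#.
Proof. by move=> Kx; apply: finset.setSD; exact: axis_sub. Qed.

Lemma axis_sat x : x \in K^# -> ax x \subset sat x.
Proof. by move=> Kx; rewrite finset.subsetI (axis_sub axK) // normG. Qed.

Lemma axis_gt1 x : x \in K^# -> 1 < #|ax x|.
Proof.
move=> Kx; rewrite cardG_gt1; apply/trivgPn; exists x; first exact: (axis_mem axK).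
by case/setD1P: Kx.
Qed.

Lemma axis_normedTI x : x \in K^# -> normedTI (ax x)^# K (sat x).
Proof.
move=> Kx; apply/normedTI_P; split.
- rewrite -cards_eq0 -lt0n.
  by have := axis_gt1 Kx; rewrite (cardsD1 1 (ax x)) group1.
- by rewrite normD1.
- move=> g Kg /pred0Pn[y /andP[/= ay ayg]].
  have Ky : y \in K^# by exact: (fintype.subsetP (axis_subD1 Kx)).
  rewrite inE Kg /=; apply/normP.
  have e1 := axis_eq axK Kx ay.
  have : y ^ g^-1 \in (ax x)^# by rewrite -mem_conjg.
  move/(axis_eq axK Kx) => e2.
  have e3 : ax y = (ax x :^ g)%G.
    rewrite -e2 -(axisJ axK) // ?conjgKV //.
    by rewrite conjgE; case/setD1P: Ky => y1 Ky; rewrite !inE -conjgE conjg_eq1 y1 groupJ // groupV.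
  by rewrite -[LHS]/(gval (ax x :^ g)%G) -e3 e1.
Qed.

Definition axis_class x := class_support (ax x)^# K.

Lemma axis_classP x y : x \in K^# -> y \in axis_class x ->
  y \in K^# /\ exists2 g, g \in K & ax y = (ax x :^ g)%G.
Proof.
move=> Kx /imset2P[z g az Kg ->].
have Kz := fintype.subsetP (axis_subD1 Kx) z az; split.
  by case/setD1P: Kz => z1 Kz; rewrite !inE conjg_eq1 z1 groupJ.
by exists g => //; rewrite (axisJ axK) // (axis_eq axK Kx az).
Qed.

Lemma axis_class_refl x : x \in K^# -> x \in axis_class x.
Proof.
move=> Kx; apply/imset2P; exists x 1; rewrite ?group1 ?conjg1 //.
by case/setD1P: (Kx) => x1 _; rewrite !inE x1 (axis_mem axK).
Qed.

Lemma axis_class_sub x : x \in K^# -> axis_class x \subset K^#.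
Proof. by move=> Kx; apply/fintype.subsetP => y /(axis_classP Kx)[]. Qed.

Lemma axis_class_conj x y g : x \in K^# -> y \in K^# -> g \in K ->
  ax y = (ax x :^ g)%G -> y \in axis_class x.
Proof.
move=> Kx Ky Kg e; apply/imset2P; exists (y ^ g^-1) g => //; last by rewrite conjgKV.
rewrite !inE conjg_eq1; case/setD1P: (Ky) => -> _ /=.
by rewrite -mem_conjg; have := axis_mem axK Ky; rewrite e.
Qed.

Lemma axis_class_disjoint x y : x \in K^# -> y \in K^# ->
  y \notin axis_class x -> [disjoint axis_class x & axis_class y].
Proof.
move=> Kx Ky; apply: contraR => /pred0Pn[z /andP[/= zx zy]].
have [_ [g Kg eg]] := axis_classP Kx zx; have [_ [h Kh eh]] := axis_classP Ky zy.
apply: (axis_class_conj (g := g * h^-1) Kx Ky); first by rewrite groupM ?groupV.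
by apply: val_inj; rewrite /= conjsgM -[ax x :^ g]/(gval (ax x :^ g)%G) -eg eh /= conjsgK.
Qed.

Lemma card_axis_class x : x \in K^# ->
  #|axis_class x| = (#|ax x|.-1 * #|K : sat x|)%N.
Proof.
move=> Kx; rewrite /axis_class (card_support_normedTI (axis_normedTI Kx)).
by rewrite [in RHS](cardsD1 1 (ax x)) group1.
Qed.

(** The product of two elements reversing the axis lies in [ax x], so they fill at most one
    coset. *)
Lemma card_sat x : x \in K^# -> sat x = ax x :> {set gT} \/ #|sat x| = (2 * #|ax x|)%N.
Proof.
move=> Kx; have [e|ne] := eqVneq (sat x : {set gT}) (ax x); [by left|right].
have [g gN] : exists g, g \in sat x :\: ax x.
  apply/set0Pn; apply: contra ne => /eqP e.
  by rewrite finset.eqEsubset axis_sat // andbT -finset.setD_eq0 e.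
rewrite mulnC -(Lagrange (axis_sat Kx)); congr (_ * _)%N.
have le2 : #|sat x :\: ax x| <= #|ax x|.
  rewrite -(card_lcoset (ax x) g); apply: subset_leq_card; apply/fintype.subsetP => h hN.
  rewrite mem_lcoset; have g2 := axis_flip axK Kx gN.
  have -> : g^-1 = g by apply/eqP; rewrite eq_invg_mul -[g * g]/(g ^+ 2) g2.
  exact: (axis_flipM axK Kx).
have := cardsD (sat x) (ax x); rewrite (finset.setIidPr (axis_sat Kx)) => eD.
have e := Lagrange (axis_sat Kx).
have c0 := cardG_gt0 (ax x); have i1 : 1 < #|sat x : ax x|.
  rewrite indexg_gt1; apply: contra ne => s.
  by rewrite finset.eqEsubset s axis_sat.
move: le2; rewrite eD -e; case: #|sat x : ax x| i1 => [|[|[|k]]] // _.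
by rewrite leq_subLR !mulnS; lia.
Qed.

(* With [N := |K|] and [n := |ax x|]: the conjugates of [ax x] are [s] in number,
   where [N = n s] or [N = 2 n s]. *)
Lemma axis_numerics x : x \in K^# -> exists s,
  #|axis_class x| = (#|ax x|.-1 * s)%N /\ 0 < s /\
  ((sat x = ax x :> {set gT} /\ #|K| = (#|ax x| * s)%N) \/
   (#|sat x| = (2 * #|ax x|)%N /\ #|K| = (2 * #|ax x| * s)%N)).
Proof.
move=> Kx; exists #|K : sat x|; rewrite card_axis_class //; split=> //; split=> //.
have L : #|K| = (#|sat x| * #|K : sat x|)%N by rewrite Lagrange // finset.subsetIl.
case: (card_sat Kx) => e; [left|right]; split=> //; rewrite L e //.
Qed.

Lemma card_KD1 : #|K| = #|K^#|.+1.
Proof. by rewrite (cardsD1 1 K) group1. Qed.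

Lemma axis_class_full x : x \in K^# -> sat x = ax x :> {set gT} ->
  #|axis_class x| = #|K^#| -> ax x = K :> {set gT}.
Proof.
move=> Kx sx c; apply/eqP; rewrite eqEcard (axis_sub axK) //=.
have [s [cx [s0 [[_ N]|[e _]]]]] := axis_numerics Kx; last first.
  by have := axis_gt1 Kx; rewrite sx in e; lia.
have := axis_gt1 Kx; have := card_KD1; rewrite -c cx N.
case: #|ax x| => [|[|n]] //= h _; nia.
Qed.

Lemma two_axis_classes x y : x \in K^# -> y \in K^# -> y \notin axis_class x ->
  #|axis_class x| + #|axis_class y| <= #|K^#|.
Proof.
move=> Kx Ky nyx; have := axis_class_disjoint Kx Ky nyx.
rewrite -leq_card_setU => /eqP <-; apply: subset_leq_card.
by rewrite finset.subUset !axis_class_sub.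
Qed.

Lemma three_axis_classes x y z : x \in K^# -> y \in K^# -> z \in K^# ->
  y \notin axis_class x -> z \notin axis_class x -> z \notin axis_class y ->
  #|axis_class x| + #|axis_class y| + #|axis_class z| <= #|K^#|.
Proof.
move=> Kx Ky Kz nyx nzx nzy; have := axis_class_disjoint Kx Ky nyx.
rewrite -leq_card_setU => /eqP <-.
have : [disjoint axis_class x :|: axis_class y & axis_class z].
  rewrite -finset.setI_eq0 finset.setIUl finset.setU_eq0 !finset.setI_eq0.
  by rewrite !axis_class_disjoint.
rewrite -leq_card_setU => /eqP <-; apply: subset_leq_card.
by rewrite !finset.subUset !axis_class_sub.
Qed.

(** With N = |K| and n = |ax x|, the class of an axis that is never reversed has N - N/n elements,
    at least 3N/4. Any other class has at least N/4, too many for N - 1. *)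
Lemma self_sat_axis x : x \in K^# -> sat x = ax x :> {set gT} -> 3 < #|ax x| ->
  ax x = K :> {set gT}.
Proof.
move=> Kx sx n4; have [c|[y Ky]] : #|axis_class x| = #|K^#| \/
    exists2 y, y \in K^# & y \notin axis_class x.
- have [s|] := boolP (K^# \subset axis_class x).
    by left; apply/eqP; rewrite eqn_leq !subset_leq_card ?axis_class_sub.
  by case/fintype.subsetPn => y; right; exists y.
- exact: axis_class_full.
move=> nyx; have := two_axis_classes Kx Ky nyx.
have := axis_gt1 Ky; have := card_KD1.
have [s [-> [s0 [[_ N]|[e _]]]]] := axis_numerics Kx; last by rewrite sx in e; lia.
have [t [-> [t0 [[_ M]|[_ M]]]]] := axis_numerics Ky; move: N M n4; case: #|ax x| => // n;
  case: #|ax y| => [|[|m]] //= ; nia.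
Qed.

(** If no axis is reversed, each class has at least half of |K| elements, so there is only one
    class. *)
Lemma all_self_sat_cyclic : {in K^#, forall x, sat x = ax x :> {set gT}} -> cyclic K.
Proof.
move=> all1; have [K1|[x Kx]] := set_0Vmem K^#.
  have -> : K = 1%G by apply/trivGP; rewrite -finset.setD_eq0 K1.
  exact: cyclic1.
have [s|] := boolP (K^# \subset axis_class x).
  rewrite -(axis_class_full Kx (all1 x Kx)); first exact: (axis_cyclic axK).
  by apply/eqP; rewrite eqn_leq !subset_leq_card ?axis_class_sub.
case/fintype.subsetPn => y Ky nyx; have := two_axis_classes Kx Ky nyx.
have := axis_gt1 Ky; have := axis_gt1 Kx; have := card_KD1.
have [s [-> [s0 [[_ N]|[e _]]]]] := axis_numerics Kx; last first.
  by rewrite all1 // in e; have := axis_gt1 Kx; lia.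
have [t [-> [t0 [[_ M]|[e _]]]]] := axis_numerics Ky; last first.
  by rewrite all1 // in e; have := axis_gt1 Ky; lia.
by move: N M; case: #|ax x| => [|[|n]] //=; case: #|ax y| => [|[|m]] //=; nia.
Qed.

End Theory.
End AxisStructure.

(** * Arithmetic of the class equation *)

Section ClassArithmetic.
Local Open Scope nat_scope.

Lemma class_ge_quarter n s N : 1 < n -> N = n * s \/ N = 2 * n * s ->
  N <= 4 * (n.-1 * s).
Proof.
case: n => [|[|n]] //= _ h; have := leq0n (n * s).
by case: h => ->; lia.
Qed.

Lemma class_ge_half n s : 1 < n -> n * s <= 2 * (n.-1 * s).
Proof. by case: n => [|[|n]] //= _; have := leq0n (n * s); lia. Qed.

(** Equality would mean s + t = 1. *)
Lemma two_class_arith n m s t N : 1 < n -> 1 < m -> 0 < s -> 0 < t ->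
  N = 2 * n * s -> N = 2 * m * t -> N <> (n.-1 * s + m.-1 * t).+1.
Proof.
case: n => [|[|n]] //; case: m => [|[|m]] //= _ _; case: s => // s; case: t => // t _ _.
by move=> h1 h2; have := leq0n (n * s); have := leq0n (m * t); lia.
Qed.

(** This is the equation 1/n1 + 1/n2 + 1/n3 = 1 + 2/N of the dihedral and polyhedral groups, cleared
    of denominators by s_i = N/(2 n_i). *)
Lemma three_class_arith n1 n2 n3 s1 s2 s3 N :
  1 < n1 -> n1 <= n2 -> n2 <= n3 -> N = 2 * n1 * s1 -> N = 2 * n2 * s2 ->
  N = 2 * n3 * s3 -> N = (n1.-1 * s1 + n2.-1 * s2 + n3.-1 * s3).+1 ->
  n1 = 2 /\ ((n2 = 2 /\ N = 2 * n3) \/ (n2 = 3 /\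
    ((n3 = 3 /\ N = 12) \/ (n3 = 4 /\ N = 24) \/ (n3 = 5 /\ N = 60)))).
Proof.
move=> n1_gt1 le12 le23 N1 N2 N3 e.
have S : s1 + s2 + s3 = (n1 * s1).+1.
  move: N1 N2 N3 e n1_gt1 le12 le23; case: n1 => // n1; case: n2 => // n2; case: n3 => //=.
  by move=> n3; lia.
have M2 : n2 * s2 = n1 * s1 by lia.
have M3 : n3 * s3 = n1 * s1 by lia.
have le_mul n s k : k <= n -> k * s <= n * s by move=> h; rewrite leq_mul2r h orbT.
have n12 : n1 = 2.
  apply/eqP; rewrite eqn_leq n1_gt1 andbT leqNgt; apply/negP => n13.
  have := le_mul n1 s1 3 n13; have := le_mul n2 s2 3 (leq_trans n13 le12).
  by have := le_mul n3 s3 3 (leq_trans n13 (leq_trans le12 le23)); lia.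
move: S M2 M3 N1 le12 => {e}; rewrite {}n12 => S M2 M3 N1 le12; split=> //.
have n2_lt4 : n2 < 4.
  rewrite ltnNge; apply/negP => n24.
  by have := le_mul n2 s2 4 n24; have := le_mul n3 s3 4 (leq_trans n24 le23); lia.
have [n2E|n2E] : n2 = 2 \/ n2 = 3 by lia.
  left; split=> //; rewrite n2E in M2; have s3E : s3 = 1 by lia.
  by move: N3; rewrite s3E muln1.
right; split=> //; rewrite n2E in M2 le23.
have n3_lt6 : n3 < 6.
  by rewrite ltnNge; apply/negP => n36; have := le_mul n3 s3 6 n36; lia.
have [n3E|[n3E|n3E]] : n3 = 3 \/ n3 = 4 \/ n3 = 5 by lia.
- by left; split=> //; rewrite n3E in M3; lia.
- by right; left; split=> //; rewrite n3E in M3; lia.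
- by right; right; split=> //; rewrite n3E in M3; lia.
Qed.

End ClassArithmetic.

Section AxisClassification.
Local Close Scope classical_set_scope.
Local Open Scope nat_scope.
Local Open Scope group_scope.
Variable gT : finGroupType.
Variables (K : {group gT}) (ax : gT -> {group gT}).
Hypothesis axK : axis_structure K ax.
Implicit Types x y z : gT.
Local Notation sat := (sat K ax).
Local Notation axis_class := (axis_class K ax).

Lemma four_axis_classes x y z t : x \in K^# -> y \in K^# -> z \in K^# -> t \in K^# ->
  y \notin axis_class x -> z \notin axis_class x -> z \notin axis_class y ->
  t \notin axis_class x -> t \notin axis_class y -> t \notin axis_class z ->
  #|axis_class x| + #|axis_class y| + #|axis_class z| + #|axis_class t| <= #|K^#|.
Proof.
move=> Kx Ky Kz Kt nyx nzx nzy ntx nty ntz.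
have dxy := axis_class_disjoint axK Kx Ky nyx; move: (dxy).
rewrite -leq_card_setU => /eqP <-.
have dz : [disjoint axis_class x :|: axis_class y & axis_class z].
  by rewrite -finset.setI_eq0 finset.setIUl finset.setU_eq0 !finset.setI_eq0 !(axis_class_disjoint axK).
move: (dz); rewrite -leq_card_setU => /eqP <-.
have dt : [disjoint axis_class x :|: axis_class y :|: axis_class z & axis_class t].
  by rewrite -finset.setI_eq0 !finset.setIUl !finset.setU_eq0 !finset.setI_eq0 !(axis_class_disjoint axK).
move: (dt); rewrite -leq_card_setU => /eqP <-; apply: subset_leq_card.
by rewrite !finset.subUset !(axis_class_sub axK).
Qed.

Lemma full_or_outside (A : {set gT}) : A \subset K^# ->
  #|A| = #|K^#| \/ exists2 y, y \in K^# & y \notin A.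
Proof.
move=> sA; have [s|] := boolP (K^# \subset A).
  by left; apply/eqP; rewrite eqn_leq !subset_leq_card.
by case/fintype.subsetPn => y; right; exists y.
Qed.

Definition three_classes x y z :=
  [/\ [/\ x \in K^#, y \in K^# & z \in K^#],
      [/\ y \notin axis_class x, z \notin axis_class x & z \notin axis_class y] &
      #|axis_class x| + #|axis_class y| + #|axis_class z| = #|K^#|].

Lemma axis_class_sym x y : x \in K^# -> y \in K^# ->
  (y \in axis_class x) = (x \in axis_class y).
Proof.
move=> Kx Ky; apply/idP/idP => h.
  have [_ [g Kg e]] := axis_classP axK Kx h.
  apply: (axis_class_conj axK (g := g^-1)) => //; rewrite ?groupV //.
  by apply: val_inj; rewrite /= e /= conjsgK.
have [_ [g Kg e]] := axis_classP axK Ky h.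
apply: (axis_class_conj axK (g := g^-1)) => //; rewrite ?groupV //.
by apply: val_inj; rewrite /= e /= conjsgK.
Qed.

Lemma three_classes_swap12 x y z : three_classes x y z -> three_classes y x z.
Proof.
case=> -[Kx Ky Kz] [a b c] e; split=> //; last by rewrite (addnC #|axis_class y|).
by split=> //; rewrite axis_class_sym.
Qed.

Lemma three_classes_swap23 x y z : three_classes x y z -> three_classes x z y.
Proof.
case=> -[Kx Ky Kz] [a b c] e; split=> //; last by rewrite addnAC.
by split=> //; rewrite axis_class_sym.
Qed.

Lemma three_classes_sorted x y z : three_classes x y z -> exists x' y' z',
  three_classes x' y' z' /\ #|ax x'| <= #|ax y'| /\ #|ax y'| <= #|ax z'|.
Proof.
move=> h; have h' := three_classes_swap12 h; have k := three_classes_swap23 h.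
have k' := three_classes_swap12 k; have l := three_classes_swap23 h'.
have l' := three_classes_swap12 l.
case: (leqP #|ax x| #|ax y|) => xy; case: (leqP #|ax y| #|ax z|) => yz;
  case: (leqP #|ax x| #|ax z|) => xz.
- by exists x, y, z; split.
- by exists x, y, z; split.
- by exists x, z, y; split=> //; split=> //; apply: ltnW.
- by exists z, x, y; split=> //; split=> //; apply: ltnW.
- by exists y, x, z; split=> //; split=> //; apply: ltnW.
- by exists y, z, x; split=> //; split=> //; apply: ltnW.
- by exists z, y, x; split=> //; split; apply: ltnW.
- by exists z, y, x; split=> //; split; apply: ltnW.
Qed.

Definition dihedral_axis := exists2 x, x \in K^# & sat x = K /\ #|K| = (2 * #|ax x|)%N.
(** Orders 12 and 24 are kept together: the tetrahedral and the octahedral group are both recognised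
    from their action on four axes of order 3. *)
Definition tetrahedral_axis := exists2 x, x \in K^# & #|ax x| = 3 /\ #|K : sat x| = 4
  /\ (#|K| = 12 \/ #|K| = 24).
(** The data say that the fifteen axes of order 2 are conjugate, that each has a stabiliser of order
    4, and that no other axis has even order. *)
Definition icosahedral_axis := exists2 x, x \in K^# & #|ax x| = 2 /\ #|sat x| = 4
  /\ #|axis_class x| = 15 /\ #|K| = 60 /\ {in K^#, forall y, ~~ odd #|ax y| -> y \in axis_class x}.

Lemma index_sat x s : #|K| = (#|sat x| * s)%N -> #|K : sat x| = s.
Proof.
move=> e; apply/eqP; rewrite -(eqn_pmul2l (cardG_gt0 (sat x))) -e Lagrange //.
exact: finset.subsetIl.
Qed.

Lemma card_axis_class_eq x y : y \in K^# -> x \in K^# -> y \in axis_class x -> #|ax y| = #|ax x|.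
Proof.
by move=> Ky Kx /(axis_classP axK Kx)[_ [g _ ->]]; rewrite /= cardJg.
Qed.

Lemma axis_class_cover x y z w : three_classes x y z -> w \in K^# ->
  [\/ w \in axis_class x, w \in axis_class y | w \in axis_class z].
Proof.
move=> [[Kx Ky Kz] [nyx nzx nzy] e] Kw.
case: (boolP (w \in axis_class x)) => [|wx]; first by constructor 1.
case: (boolP (w \in axis_class y)) => [|wy]; first by constructor 2.
case: (boolP (w \in axis_class z)) => [|wz]; first by constructor 3.
have := four_axis_classes Kx Ky Kz Kw nyx nzx nzy wx wy wz; rewrite e.
have : 0 < #|axis_class w| by apply/card_gt0P; exists w; exact: axis_class_refl.
lia.
Qed.

Lemma axis_classification :
  [\/ cyclic K, dihedral_axis, tetrahedral_axis | icosahedral_axis].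
Proof.
have [K1|[x0 Kx0]] := set_0Vmem K^#.
  constructor 1; have -> : K = 1%G by apply/trivGP; rewrite -finset.setD_eq0 K1.
  exact: cyclic1.
have cardK := card_KD1 K.
case: (boolP [exists x in K^#, sat x == ax x :> {set gT}]) => [|noself].
  case/existsP => x /andP[Kx /eqP sx].
  have [c|[y Ky nyx]] := full_or_outside (axis_class_sub axK Kx).
    by constructor 1; rewrite -(axis_class_full axK Kx sx c); exact: (axis_cyclic axK).
  have [n4|n4] := ltnP 3 #|ax x|.
    by constructor 1; rewrite -(self_sat_axis axK Kx sx n4); exact: (axis_cyclic axK).
  have U2 : axis_class x :|: axis_class y \subset K^#.
    by rewrite finset.subUset !(axis_class_sub axK).
  have n1 := axis_gt1 axK Kx; have m1 := axis_gt1 axK Ky.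
  have [s [cx [s0 [[_ N]|[e _]]]]] := axis_numerics axK Kx; last by rewrite sx in e; lia.
  have [t [cy [t0 my]]] := axis_numerics axK Ky.
  (* The unreversed class of x takes at least half of |K| and every other class at least a quarter,
     so there is no third class. *)
  have [c|[z Kz]] := full_or_outside U2; last first.
    rewrite inE negb_or => /andP[nzx nzy].
    have := three_axis_classes axK Kx Ky Kz nyx nzx nzy.
    have o1 := axis_gt1 axK Kz.
    have [r [-> [r0 mz]]] := axis_numerics axK Kz; rewrite cx cy => le.
    have qz : #|K| <= 4 * (#|ax z|.-1 * r).
      by apply: class_ge_quarter o1 _; case: mz => -[]; [left|right].
    have qy : #|K| <= 4 * (#|ax y|.-1 * t).
      by apply: class_ge_quarter m1 _; case: my => -[]; [left|right].
    have qx : #|K| <= 2 * (#|ax x|.-1 * s) by rewrite N; exact: class_ge_half.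
    by move: qx qy qz le cardK; clear; lia.
  have := axis_class_disjoint axK Kx Ky nyx; rewrite -leq_card_setU c => /eqP e.
  have {e} : #|K| = (#|ax x|.-1 * s + #|ax y|.-1 * t).+1 by rewrite cardK e cx cy.
  (* Order 2 forces the axis of y to be reversed with a single conjugate, the dihedral case. Order 3
     forces four conjugates and |K| = 12. *)
  have [n2|n3] : #|ax x| = 2 \/ #|ax x| = 3 by lia.
    rewrite n2 in N *; move=> e; constructor 2; exists y => //.
    have {my} [cy2 N2] : #|sat y| = (2 * #|ax y|)%N /\ #|K| = (2 * #|ax y|)%N.
      case: my => -[sy M]; last first.
        suff t1 : t = 1%N by rewrite sy M t1 muln1.
        by move: m1 M e; rewrite N; case: #|ax y| => [|[|m]] //= _; lia.
      exfalso; move: m1 M e; rewrite N; case: #|ax y| => [|[|m]] //= _ h1 h2.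
      by have := leq0n (m * t)%N; lia.
    split=> //; apply/val_inj/eqP.
    by rewrite /= eqEcard finset.subsetIl N2 -cy2 leqnn.
  rewrite n3 in N *; move=> e; constructor 3; exists x => //.
  have s4 : s = 4.
    case: my => -[sy M]; move: m1 M e; rewrite N; case: #|ax y| => [|[|m]] //= _.
      by move=> h1 h2; have := leq0n (m * t)%N; lia.
    case: m => [|m] h1 h2; first by lia.
    by have := leq0n (m * t)%N; lia.
  rewrite n3 (index_sat (s := 4)); first by rewrite N s4; split=> //; split=> //; left.
  by rewrite sx N n3 s4.
(* From here on every axis is reversed, so each class has at least a quarter and less than half of
   |K| elements. One or two classes do not exhaust the nontrivial elements and four are too many,
   which leaves three. *)
have all2 x : x \in K^# -> exists s, [/\ #|axis_class x| = (#|ax x|.-1 * s)%N, 0 < s,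
    #|sat x| = (2 * #|ax x|)%N & #|K| = (2 * #|ax x| * s)%N].
  move=> Kx; have [s [cx [s0 [[e _]|[e N]]]]] := axis_numerics axK Kx; last by exists s.
  by case/negP: noself; apply/existsP; exists x; rewrite Kx e eqxx.
have [y Ky nyx] : exists2 y, y \in K^# & y \notin axis_class x0.
  have [e|//] := full_or_outside (axis_class_sub axK Kx0).
  have [s [cx s0 _ N]] := all2 x0 Kx0; have n1 := axis_gt1 axK Kx0; exfalso.
  have := class_ge_half s n1; move: cardK n1 s0; rewrite -e cx N; clear.
  by case: #|ax x0| => [|[|n]] //= h1 _ s0 _; have := leq0n (n * s)%N; lia.
have [z Kz] : exists2 z, z \in K^# & z \notin axis_class x0 :|: axis_class y.
  have U2 : axis_class x0 :|: axis_class y \subset K^#.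
    by rewrite finset.subUset !(axis_class_sub axK).
  have [e|//] := full_or_outside U2; exfalso.
  have := axis_class_disjoint axK Kx0 Ky nyx; rewrite -leq_card_setU e => /eqP {}e.
  have [s [cx s0 _ N]] := all2 x0 Kx0; have [t [cy t0 _ M]] := all2 y Ky.
  have n1 := axis_gt1 axK Kx0; have m1 := axis_gt1 axK Ky.
  by apply: (two_class_arith n1 m1 s0 t0 N M); rewrite cardK e cx cy.
rewrite inE negb_or => /andP[nzx nzy].
have {nzx nzy nyx Ky Kz y Kx0 x0 z} [x [y [z [[Kxyz nxyz e] [xy yz]]]]] :
    exists x y z, three_classes x y z /\ #|ax x| <= #|ax y| /\ #|ax y| <= #|ax z|.
  apply: (@three_classes_sorted x0 y z); split=> //.
  have dz : [disjoint axis_class x0 :|: axis_class y & axis_class z].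
    by rewrite -finset.setI_eq0 finset.setIUl finset.setU_eq0 !finset.setI_eq0 !(axis_class_disjoint axK).
  have := axis_class_disjoint axK Kx0 Ky nyx; rewrite -leq_card_setU => /eqP <-.
  move: dz; rewrite -leq_card_setU => /eqP <-.
  have U3 : axis_class x0 :|: axis_class y :|: axis_class z \subset K^#.
    by rewrite !finset.subUset !(axis_class_sub axK).
  have [//|[t Kt]] := full_or_outside U3.
  rewrite !inE !negb_or => /andP[/andP[ntx nty] ntz]; exfalso.
  have := four_axis_classes Kx0 Ky Kz Kt nyx nzx nzy ntx nty ntz.
  have big w : w \in K^# -> 4 * #|axis_class w| >= #|K|.
    move=> Kw; have [s [-> s0 _ N]] := all2 w Kw.
    by apply: class_ge_quarter (axis_gt1 axK Kw) _; right.
  have bx := big _ Kx0; have bY := big _ Ky; have bz := big _ Kz; have bt := big _ Kt.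
  by move: bx bY bz bt cardK; clear; lia.
have [[Kx Ky Kz] [nyx nzx nzy]] := (Kxyz, nxyz).
have tc : three_classes x y z by [].
have [s1 [c1 s10 e1 N1]] := all2 x Kx; have [s2 [c2 s20 e2 N2]] := all2 y Ky.
have [s3 [c3 s30 e3 N3]] := all2 z Kz.
have n11 := axis_gt1 axK Kx.
have {e} e : #|K| = (#|ax x|.-1 * s1 + #|ax y|.-1 * s2 + #|ax z|.-1 * s3).+1.
  by rewrite cardK -e c1 c2 c3.
have [nx2 [[ny N]|[ny nz]]] := three_class_arith n11 xy yz N1 N2 N3 e.
  constructor 2; exists z => //; split=> //.
  by apply/val_inj/eqP; rewrite /= eqEcard finset.subsetIl N -e3 leqnn.
case: nz => [[nz N]|[[nz N]|[nz N]]].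
(* Orders (2, 3, 3) cannot occur with all axes reversed: both axis groups of order 3 would be Sylow
   subgroups, hence conjugate. The tetrahedral group appears in the branch with an unreversed
   axis. *)
- exfalso; have K12 := N.
  have sylow w : w \in K^# -> #|ax w| = 3 -> 3.-Sylow(K) (ax w).
    move=> Kw nw; rewrite pHallE (axis_sub axK) //= nw K12.
    by rewrite p_part.
  have [g Kg eg] := Sylow_trans (sylow y Ky ny) (sylow z Kz nz).
  case/negP: nzy; apply: (axis_class_conj axK Ky Kz Kg).
  exact: val_inj.
- constructor 3; exists y => //; rewrite ny; split=> //.
  by rewrite (index_sat (s := 4)) ?e2 ?ny ?N //; split=> //; right.
- constructor 4; exists x => //; rewrite nx2; split=> //; rewrite e1 nx2; split=> //.
  rewrite c1 nx2; split; last split=> //.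
    by move: N1; rewrite N nx2; clear; lia.
  move=> w Kw ev; case: (axis_class_cover tc Kw) => // h.
    by move: ev; rewrite (card_axis_class_eq Kw Ky h) ny.
  by move: ev; rewrite (card_axis_class_eq Kw Kz h) nz.
Qed.

End AxisClassification.

(** * Alternating groups and conjugation actions *)

Section PermGroups.
Local Close Scope classical_set_scope.
Local Open Scope nat_scope.
Local Open Scope group_scope.

Lemma index2_mul (gT : finGroupType) (G H : {group gT}) x y : H \subset G ->
  #|G : H| = 2 -> x \in G -> y \in G -> x \notin H -> y \notin H -> x * y \in H.
Proof.
move=> sHG i2 Gx Gy Hx Hy.
have : x \in G :\: H by rewrite inE Hx.
rewrite -(rcoset_index2 sHG i2 (x := y^-1)); last by rewrite inE groupV Hy groupV.
by rewrite mem_rcoset invgK.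
Qed.

(** A transposition in the normal subgroup H would bring all its conjugates, hence the whole
    symmetric group. So every transposition lies off H, and membership of a product of them is
    decided by parity. *)
Lemma index2_Alt n (H : {group {perm 'I_n}}) :
  (2 * #|H|)%N = n`! -> H = 'Alt_('I_n) :> {set {perm 'I_n}}.
Proof.
move=> oH; have sH : H \subset [set: {perm 'I_n}] by exact: finset.subsetT.
have cT : #|[set: {perm 'I_n}]| = n`!.
  by have := card_Sym 'I_n; rewrite card_ord /Sym.
have i2 : #|[set: {perm 'I_n}] : H| = 2.
  apply/eqP; rewrite -(eqn_pmul2l (cardG_gt0 H)) (Lagrange sH) cT -oH mulnC.
  by [].
have nt a b : a != b -> tperm a b \notin H.
  move=> ab; apply/negP => Hab; have := cT; rewrite -oH.
  suff -> : [set: {perm 'I_n}] = H.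
    by move/eqP; rewrite -{1}[#|H|]mul1n eqn_pmul2r.
  apply/eqP; rewrite finset.eqEsubset finset.subsetT andbT -(gen_tperm a) gen_subG.
  apply/fintype.subsetP => _ /finset.imsetP[y _ ->].
  have [->|ya] := eqVneq y a; first by rewrite tperm1.
  have [->//|yb] := eqVneq y b.
  have -> : tperm a y = tperm a b ^ tperm b y.
    by rewrite tpermJ tpermL tpermD // eq_sym.
  have nH : [set: {perm 'I_n}] \subset 'N(H) := normal_norm (index2_normal sH i2).
  by rewrite memJ_norm // (fintype.subsetP nH) ?inE.
apply/setP => s; rewrite Alt_even; have [ts -> dts] := prod_tpermP s.
elim: ts dts => [_|t ts IH /= /andP[dt dts]].
  by rewrite big_nil group1 odd_perm1.
rewrite big_cons odd_mul_tperm dt addTb negbK -[RHS]negbK -IH //.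
have := nt _ _ dt; set u := \prod_(_ <- _) _; set v := tperm _ _ => Hv.
have [Hu|Hu] := boolP (u \in H); first by rewrite groupMr // (negbTE Hv).
by apply: (index2_mul sH i2); rewrite ?inE.
Qed.

Lemma conj_perm_morphism (gT : finGroupType) (G : {group gT})
    (S : {set {group gT}}) n : 0 < n -> #|S| = n ->
  {in G & S, forall g (Q : {group gT}), (Q :^ g)%G \in S} ->
  exists f : {morphism G >-> {perm 'I_n}},
    forall g, g \in G -> f g = 1 -> {in S, forall Q : {group gT}, (Q :^ g)%G = Q}.
Proof.
move=> n0 cS SJ; have [Q0 S0] : exists Q0, Q0 \in S by apply/card_gt0P; rewrite cS.
have cS' : n = #|S| by [].
pose e (i : 'I_n) : {group gT} := enum_val (cast_ord cS' i).
pose r (Q : {group gT}) : 'I_n := cast_ord (esym cS') (enum_rank_in S0 Q).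
have eS i : e i \in S by exact: enum_valP.
have er Q : Q \in S -> e (r Q) = Q by move=> SQ; rewrite /e /r cast_ordKV enum_rankK_in.
have re i : r (e i) = i by rewrite /e /r enum_valK_in cast_ordK.
pose a i g := r (e i :^ g)%G.
have eJ i g : g \in G -> e (a i g) = (e i :^ g)%G.
  by move=> Gg; rewrite er // SJ.
(* Outside G the map [a^~ g] need not be a permutation; the default 1 covers those g. *)
pose f g := odflt 1 [pick p : {perm 'I_n} | [forall i, p i == a i g]].
have fE g : g \in G -> forall i, f g i = a i g.
  move=> Gg; rewrite /f; case: pickP => [p /forallP h i|none]; first exact/eqP/h.
  have inj : injective (a^~ g).
    move=> i j /(congr1 e); rewrite !eJ // => /(congr1 val)/= /conjsg_inj h.
    by rewrite -(re i) -(re j); congr r; exact: val_inj.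
  by have := none (perm inj) => /forallP[] i; rewrite permE.
have fM : {in G &, {morph f : x y / x * y}}.
  move=> x y Gx Gy; apply/permP => i; rewrite permM !fE ?groupM //.
  rewrite /a -[e (r _)]/(e (a i x)) eJ //; congr r; apply: val_inj => /=.
  by rewrite conjsgM.
exists (Morphism fM) => g Gg /= fg1 Q SQ.
by rewrite -{1}(er Q SQ) -eJ // -fE // fg1 perm1 er.
Qed.

End PermGroups.

(** * Recognition of the polyhedral and dihedral groups *)

Section Polyhedral.
Local Close Scope classical_set_scope.
Local Open Scope nat_scope.
Local Open Scope group_scope.
Variable gT : finGroupType.
Implicit Types (G K P : {group gT}).

(** The Sylow subgroups will be those of the four axes of order 3 (p = 3, n = 4), or the five Klein
    four-groups of the icosahedral group (p = 2, n = 5). *)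
Definition polyhedral K := exists p n, [/\ #|'Syl_p(K)| = n,
  forall g, g \in K -> {in 'Syl_p(K), forall Q : {group gT}, (Q :^ g)%G = Q} -> g = 1
  & (n = 4 /\ (#|K| = 12 \/ #|K| = 24)) \/ (n = 5 /\ #|K| = 60)].

Lemma SylJ p K G : G \subset 'N(K) ->
  {in G & 'Syl_p(K), forall g (Q : {group gT}), (Q :^ g)%G \in 'Syl_p(K)}.
Proof.
move=> nKG g Q Gg; rewrite !inE /= => sQ.
by rewrite -(normP (fintype.subsetP nKG g Gg)) pHallJ2.
Qed.

Lemma polyhedral_isog K : polyhedral K ->
  [\/ K \isog 'Alt_('I_4), K \isog 'Sym_('I_4) | K \isog 'Alt_('I_5)].
Proof.
case=> p [n [cS faithful num]].
have iso m : 0 < m -> #|'Syl_p(K)| = m ->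
    exists2 H : {group {perm 'I_m}}, K \isog H & #|H| = #|K|.
  move=> m0 cm; have [f kf] := conj_perm_morphism m0 cm (SylJ (p := p) (normG K)).
  have injf : 'injm f.
    apply/fintype.subsetP => g kg; have Kg := dom_ker kg.
    by rewrite inE; apply/eqP/faithful => //; apply: kf => //; exact: mker.
  by exists (f @* K)%G; [exact: sub_isog (subxx K) injf|rewrite card_injm].
case: num => -[nE oK]; rewrite nE in cS.
  have [H iH oH] := iso 4 isT cS.
  case: oK => oK; [constructor 1|constructor 2].
    suff <- : gval H = 'Alt_('I_4) by exact: iH.
    by apply: index2_Alt; rewrite oH oK.
  suff <- : gval H = 'Sym_('I_4) by exact: iH.
  by apply/eqP; rewrite eqEcard finset.subsetT oH oK card_Sym card_ord.
have [H iH oH] := iso 5 isT cS; constructor 3.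
suff <- : gval H = 'Alt_('I_5) by exact: iH.
by apply: index2_Alt; rewrite oH oK.
Qed.

(** G acts on the Sylow subgroups of K. A nontrivial element of the kernel lies off K, and its
    square is in K and acts trivially, so it would be an involution. If the action is faithful, the
    orders leave only G = S_n with K = A_n, and transpositions are involutions off K. *)
Lemma polyhedral_no_extension G K : polyhedral K -> K \subset G -> #|G : K| = 2 ->
  {in G :\: K, forall g, g ^+ 2 != 1} -> False.
Proof.
case=> p [n [cS faithful num]] sKG i2 noinv.
have n0 : 0 < n by case: num => -[->].
have nK : G \subset 'N(K) := normal_norm (index2_normal sKG i2).
have [f kf] := conj_perm_morphism n0 cS (SylJ (p := p) nK).
have oG : #|G| = (2 * #|K|)%N by rewrite -(Lagrange sKG) i2 mulnC.
have injK g : g \in K -> f g = 1 -> g = 1.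
  by move=> Kg fg; apply: faithful => //; apply: kf => //; exact: (fintype.subsetP sKG).
have [injf|] := boolP ('injm f); last first.
  case/fintype.subsetPn => z kz; rewrite inE => z1.
  have Gz := dom_ker kz; have fz := mker kz.
  have Kz : z \notin K by apply: contra z1 => Kz; apply/eqP/injK.
  have : z ^+ 2 != 1 by apply: noinv; rewrite inE Kz.
  case/eqP; apply: injK; first by rewrite expgS expg1 (index2_mul sKG i2).
  by rewrite morphX // fz expg1n.
have oT : #|[set: {perm 'I_n}]| = n`!.
  by have := card_Sym 'I_n; rewrite card_ord /Sym.
have le : #|f @* G| <= n`! by rewrite -oT subset_leq_card ?finset.subsetT.
have cG : #|f @* G| = (2 * #|K|)%N by rewrite card_injm.
have o2 : (2 * #|K|)%N = n`!.
  by move: le; rewrite cG; case: num => -[->]; [case=> ->|move=> ->].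
have fG : f @* G = [set: {perm 'I_n}].
  by apply/eqP; rewrite eqEcard finset.subsetT oT cG o2 leqnn.
have cfK : #|f @* K| = #|K| by rewrite card_injm.
have fK : f @* K = 'Alt_('I_n) by apply: (index2_Alt (H := (f @* K)%G)); rewrite /= cfK.
have [a [b ab]] : exists a b : 'I_n, a != b.
  have n2 : 1 < n by case: num => -[->].
  by exists (Ordinal n0), (Ordinal n2).
have : tperm a b \in f @* G by rewrite fG inE.
case/morphimP => g _ Gg tg.
have Kg : g \notin K.
  apply: contraL (isT) => Kg; have : tperm a b \in f @* K.
    by rewrite tg mem_morphim.
  by rewrite fK Alt_even odd_tperm ab.
have := noinv g; rewrite inE Kg Gg => /(_ isT)/eqP[].
apply: (injmP injf); rewrite ?groupX // morphX // morph1 -tg.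
by rewrite expgS expg1 tperm2.
Qed.

(** Let Z be the kernel of the action. If Z met P it would contain all conjugates of P; these
    normalise P, hence equal P, which is not normal. So Z and P meet trivially and normalise each
    other, Z centralises P, and therefore Z lies in P. *)
Lemma syl_faithful p K P : p.-Sylow(K) P -> ~~ (K \subset 'N(P)) -> 'C_K(P) \subset P ->
  (forall Z : {group gT}, Z <| K -> Z :&: P != 1 -> P \subset Z) ->
  forall g, g \in K -> {in 'Syl_p(K), forall Q : {group gT}, (Q :^ g)%G = Q} -> g = 1.
Proof.
move=> sylP nP cP ZP.
pose Z := [set g in K | [forall Q in 'Syl_p(K), (Q :^ g)%G == Q]].
have gZ : group_set Z.
  apply/group_setP; split=> [|x y].
    rewrite inE group1; apply/forall_inP => Q _; apply/eqP/val_inj; exact: conjsg1.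
  rewrite !inE => /andP[Kx /forall_inP hx] /andP[Ky /forall_inP hy].
  rewrite groupM //; apply/forall_inP => Q sQ; apply/eqP/val_inj => /=.
  have /eqP/(congr1 val)/= ex := hx Q sQ; have /eqP/(congr1 val)/= ey := hy Q sQ.
  by rewrite conjsgM ex ey.
have nZ : Group gZ <| K.
  apply/normalP; split; first by apply/fintype.subsetP => g; rewrite inE => /andP[].
  move=> h Kh; apply/normP; rewrite inE; apply/fintype.subsetP => _ /finset.imsetP[g + ->].
  rewrite !inE => /andP[Kg /forall_inP hg]; rewrite groupJ //=.
  apply/forall_inP => Q sQ; apply/eqP/val_inj => /=.
  have sQ' : (Q :^ h^-1)%G \in 'Syl_p(K) by rewrite (SylJ (normG K)) ?groupV.
  have /eqP/(congr1 val)/= e := hg _ sQ'.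
  by rewrite conjgE !conjsgM e -conjsgM mulVg conjsg1.
have sZN Q : Q \in 'Syl_p(K) -> Z \subset 'N(Q).
  move=> sQ; apply/fintype.subsetP => g; rewrite inE => /andP[_ /forall_inP/(_ _ sQ)/eqP/(congr1 val) e].
  exact/normP.
have sP : P \in 'Syl_p(K) by rewrite inE.
have Z1 : Z :&: P = 1.
  apply/eqP; apply: contraT => /(ZP (Group gZ) nZ) /= sPZ.
  have [h Kh hP] := fintype.subsetPn nP.
  have sQ : (P :^ h)%G \in 'Syl_p(K) by rewrite (SylJ (normG K)).
  have PN : P <| 'N_K(P) by rewrite normalSG // (pHall_sub sylP).
  have sQZ : P :^ h \subset Z.
    have eZ : Z :^ h = Z := normP (fintype.subsetP (normal_norm nZ) h Kh).
    by rewrite -eZ conjSg.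
  have sQN : P :^ h \subset 'N_K(P).
    rewrite finset.subsetI (fintype.subset_trans sQZ (sZN P sP)).
    by move: sQ; rewrite inE => /pHall_sub ->.
  have sylN : p.-Sylow('N_K(P)) P.
    by apply: (pHall_subl _ _ sylP); rewrite ?finset.subsetIl // finset.subsetI (pHall_sub sylP) normG.
  have : P :^ h \subset P.
    by rewrite (sub_normal_Hall sylN PN sQN) pgroupJ (pHall_pgroup sylP).
  by move=> sPh; case/negP: hP; rewrite inE.
have cZP : Z \subset 'C(P).
  apply/commG1P/trivgP; rewrite -Z1; apply: (@commg_subI _ Z P (Group gZ) P).
    by rewrite finset.subsetI subxx (sZN P sP).
  rewrite finset.subsetI subxx /=; exact: fintype.subset_trans (pHall_sub sylP) (normal_norm nZ).
move=> g Kg hg; have Zg : g \in Z by rewrite inE Kg; apply/forall_inP => Q sQ; apply/eqP/hg.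
have : g \in Z :&: P.
  rewrite inE Zg (fintype.subsetP cP) // inE Kg; exact: (fintype.subsetP cZP).
by rewrite Z1 => /set1gP.
Qed.

Section Axis.
Variables (K : {group gT}) (ax : gT -> {group gT}).
Hypothesis axK : axis_structure K ax.
Local Notation sat := (sat K ax).

Lemma satJ x g : x \in K^# -> g \in K -> sat (x ^ g) = sat x :^ g :> {set gT}.
Proof. by move=> Kx Kg; rewrite /= (axisJ axK) //= normJ conjIg conjGid. Qed.

Lemma cent1_sat x : x \in K^# -> 'C_K[x] \subset sat x.
Proof.
move=> Kx; apply/fintype.subsetP => g /finset.setIP[Kg /cent1P cg]; rewrite inE Kg.
apply/normP; have := axisJ axK Kx Kg.
have -> : x ^ g = x by rewrite conjgE -cg mulKg.
by move/(congr1 val).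
Qed.

(** If g commutes with x but lies off its axis group, then g and g x both reverse the axis and are
    involutions, whence x^2 = (g x)^2 = 1. *)
Lemma cent1_axis x : x \in K^# -> x ^+ 2 != 1 -> 'C_K[x] \subset ax x.
Proof.
move=> Kx x2; apply/fintype.subsetP => g cg; apply: contraR x2 => ng.
have sg := fintype.subsetP (cent1_sat Kx) g cg.
have gN : g \in 'N_K(ax x) :\: ax x by rewrite inE ng.
have gxN : g * x \in 'N_K(ax x) :\: ax x.
  have xa := axis_mem axK Kx.
  rewrite inE groupMr // ng groupMl //.
  exact: (fintype.subsetP (axis_sat axK Kx)).
have g2 := axis_flip axK Kx gN; have gx2 := axis_flip axK Kx gxN.
have [_ /cent1P c] := finset.setIP cg.
by rewrite -gx2 expgMn // g2 mul1g.
Qed.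

Lemma tetrahedral_polyhedral : tetrahedral_axis K ax -> polyhedral K.
Proof.
case=> x Kx [ox [ix oK]].
have sylP : 3.-Sylow(K) (ax x).
  by rewrite pHallE (axis_sub axK) //= ox; case: oK => ->; rewrite p_part.
exists 3, 4; split; last by left.
- by rewrite (card_Syl sylP).
apply: (syl_faithful sylP).
- apply/negP => nP; have e : sat x = K :> {set gT} by rewrite /= (finset.setIidPl nP).
  by move: ix; rewrite e indexgg.
- apply: fintype.subset_trans (cent1_axis Kx _).
    by rewrite finset.setIS // -cent_set1 centS // finset.sub1set (axis_mem axK).
  apply/eqP => x2; have x1 : x != 1 by case/setD1P: Kx.
  have := order_dvdG (axis_mem axK Kx); rewrite ox => d3.
  have d2 : #[x] %| 2 by rewrite order_dvdn x2.
  have : #[x] %| gcdn 3 2 by rewrite dvdn_gcd d3 d2.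
  by rewrite dvdn1 order_eq1 (negbTE x1).
- move=> Z nZ nt; have pr : prime #|ax x| by rewrite ox.
  by apply: prime_meetG pr _; rewrite finset.setIC.
Qed.

(** The stabiliser of an axis of order 2 is a Klein four-group, and all its involutions have that
    same stabiliser. The fifteen involutions thus fall into five disjoint triples, one for each
    Sylow 2-subgroup. *)
Lemma icosahedral_polyhedral : icosahedral_axis K ax -> polyhedral K.
Proof.
case=> x Kx [ox [osat [ocl [oK ev]]]].
have x1 : x != 1 by case/setD1P: Kx.
have sylP : 2.-Sylow(K) (sat x).
  by rewrite pHallE finset.subsetIl /= osat oK p_part.
have axE : ax x = [set 1; x] :> {set gT}.
  apply/esym/eqP; rewrite eqEcard ox cards2 eq_sym x1 andbT.
  by rewrite finset.subUset !finset.sub1set group1 (axis_mem axK).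
have inv y : y \in K^# -> y ^+ 2 = 1 -> y \in axis_class K ax x.
  move=> Ky y2; apply: ev => //.
  have y1 : y != 1 by case/setD1P: Ky.
  have oy : #[y] = 2 by apply/eqP; rewrite eqn_leq dvdn_leq ?order_dvdn ?y2 //= order_gt1.
  have := order_dvdG (axis_mem axK Ky); rewrite oy => d.
  by rewrite -dvdn2.
have clP y : y \in axis_class K ax x -> exists2 g, g \in K & y = x ^ g.
  case/imset2P => z g; rewrite axE !inE => /andP[z1 /orP[e|/eqP->]] Kg ->.
    by rewrite e in z1.
  by exists g.
have satinv u : u \in (sat x)^# -> u ^+ 2 = 1.
  case/setD1P => u1 su; have [|nu] := boolP (u \in ax x).
    rewrite axE !inE (negbTE u1) /= => /eqP->.
    have := expg_cardG (axis_mem axK Kx); by rewrite ox.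
  by apply: (axis_flip axK Kx); rewrite inE nu.
have sK : (sat x)^# \subset K^# by rewrite finset.setSD // finset.subsetIl.
have abV : abelian (sat x) by apply: (@p2group_abelian _ 2); [rewrite /pgroup osat|rewrite osat].
have satu u : u \in (sat x)^# -> sat x = sat u :> {set gT}.
  move=> su; have Ku := fintype.subsetP sK u su.
  have [g Kg ug] := clP u (inv u Ku (satinv u su)).
  have ou : #|sat u| = 4.
    by rewrite ug satJ // cardJg.
  apply/eqP; rewrite eqEcard ou osat leqnn andbT.
  apply: fintype.subset_trans (cent1_sat Ku); rewrite finset.subsetI finset.subsetIl.
  by rewrite sub_cent1 (fintype.subsetP abV) //; case/setD1P: su.
have c3 : #|(sat x)^#| = 3.
  by have := cardsD1 1 (sat x); rewrite group1 osat => -[].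
have TI : normedTI (sat x)^# K 'N_K(sat x).
  apply/normedTI_P; split.
  - by rewrite -cards_eq0 c3.
  - by rewrite normD1.
  - move=> g Kg /pred0Pn[u /andP[/= su]]; rewrite mem_conjg => su'.
    rewrite inE Kg; apply/normP.
    have Ku := fintype.subsetP sK u su.
    have Kug : u ^ g^-1 \in K^# by exact: (fintype.subsetP sK).
    by rewrite {1}(satu _ su') -satJ // conjgKV -(satu u su).
have iN : #|K : 'N_K(sat x)| = 5.
  have e : class_support (sat x)^# K = axis_class K ax x.
    apply/eqP; rewrite finset.eqEsubset; apply/andP; split; apply/fintype.subsetP => u.
      case/imset2P => z g sz Kg ->; apply: inv.
        have Kz := fintype.subsetP sK z sz; case/setD1P: Kz => z1 Kz.
        by rewrite !inE conjg_eq1 z1 groupJ.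
      by rewrite -conjXg satinv // conj1g.
    case/clP => g Kg ->; apply/imset2P; exists x g => //.
    apply/setD1P; split=> //.
    exact: (fintype.subsetP (axis_sat axK Kx) x (axis_mem axK Kx)).
  have := card_support_normedTI TI; rewrite e ocl.
  rewrite c3 => h; apply/eqP; rewrite -(eqn_pmul2l (isT : 0 < 3)) -h.
  by [].
exists 2, 5; split; last by right.
- by rewrite (card_Syl sylP).
apply: (syl_faithful sylP).
- apply/negP => nP; move: iN; rewrite (finset.setIidPl nP) indexgg.
  by [].
- apply: fintype.subset_trans (cent1_sat Kx).
  rewrite finset.setIS // -cent_set1 centS // finset.sub1set (fintype.subsetP (axis_sat axK Kx)) //.
  exact: (axis_mem axK).
- move=> Z nZ /trivgPn[u /finset.setIP[Zu su] u1]; apply/fintype.subsetP => v sv.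
  have [->|v1] := eqVneq v 1; first exact: group1.
  have su' : u \in (sat x)^# by apply/setD1P.
  have sv' : v \in (sat x)^# by apply/setD1P.
  have [g Kg ug] := clP u (inv u (fintype.subsetP sK u su') (satinv u su')).
  have [h Kh vh] := clP v (inv v (fintype.subsetP sK v sv') (satinv v sv')).
  have -> : v = u ^ (g^-1 * h) by rewrite conjgM ug conjgK.
  by rewrite memJ_norm // (fintype.subsetP (normal_norm nZ)) // groupM ?groupV.
Qed.

Lemma dihedral_axis_isog : dihedral_axis K ax ->
  exists2 n, 1 < n & K \isog 'D_(n.*2).
Proof.
case=> x Kx [sx oK]; exists #|ax x|; first exact: (axis_gt1 axK Kx).
have i2 : #|K : ax x| = 2.
  by have := Lagrange (axis_sub axK Kx); rewrite oK [RHS]mulnC => /eqP; rewrite eqn_pmul2l // => /eqP.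
have [g Kg ng] : exists2 g, g \in K & g \notin ax x.
  by apply/fintype.subsetPn; rewrite -indexg_gt1 i2.
have [r er] := cyclicP (axis_cyclic axK Kx).
have ra : r \in ax x by rewrite er cycle_id.
have rK : r \in K by exact: (fintype.subsetP (axis_sub axK Kx)).
have r1 : r != 1.
  apply/eqP => r1; have := axis_gt1 axK Kx; rewrite er r1 cycle1 cards1.
  by [].
have inv h : h \in K -> h \notin ax x -> #[h] = 2.
  move=> Kh nh; apply/eqP; rewrite eqn_leq order_gt1.
  have -> : h != 1 by apply: contra nh => /eqP->; exact: group1.
  rewrite dvdn_leq // order_dvdn; apply/eqP.
  apply: (axis_flip axK Kx); rewrite inE nh.
  by rewrite -[X in h \in gval X]/(sat x) sx.
have nh : g * r \notin ax x by rewrite groupMr.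
have ne : g != g * r by rewrite -{1}(mulg1 g) (inj_eq (mulgI g)) eq_sym.
have := involutions_gen_dihedral (inv g Kg ng) (inv _ (groupM Kg rK) nh) ne.
set G := <<_>>; have -> : G = K.
  have sG : G \subset K by rewrite gen_subG finset.subUset !finset.sub1set Kg groupM.
  have gG : g \in G by rewrite mem_gen // !inE eqxx.
  have rG : r \in G.
    rewrite -(mulKg g r) groupM ?groupV // mem_gen // !inE eqxx orbT.
    by [].
  have saG : ax x \subset G by rewrite er cycle_subG.
  apply/eqP; rewrite finset.eqEsubset sG /=; apply/fintype.subsetP => k Kk.
  have [ak|nk] := boolP (k \in ax x); first exact: (fintype.subsetP saG).
  rewrite -(mulKg g k) groupM ?groupV // (fintype.subsetP saG) //.
  exact: (index2_mul (axis_sub axK Kx) i2).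
by rewrite oK mul2n.
Qed.

End Axis.

End Polyhedral.

(** * Rotation representations and their axes *)

Section RotationGroups.
Variables (R : realType) (gT : finGroupType).
Local Notation V := 'rV[R]_3.
Implicit Types (K : {group gT}) (rho : gT -> 'M[R]_3).

Record rotation_rep K rho : Prop := RotationRep {
  rotM : {in K &, forall x y, rho (x * y)%g = rho x *m rho y};
  rot_orthogonal : {in K, forall x, orthogonal_mx (rho x)};
  rot_det : {in K, forall x, \det (rho x) = 1};
  rot_inj : {in K, forall x, rho x = 1%:M -> x = 1%g} }.

Lemma rot1 K rho : rotation_rep K rho -> rho 1%g = 1%:M.
Proof.
move=> r; have := rotM r (group1 K) (group1 K); rewrite mulg1 => e.
have o := rot_orthogonal r (group1 K).
by rewrite -(orthogonalT o) {3}e mulmxA orthogonalT // mul1mx.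
Qed.

Lemma rotation_in_frame (A : 'M[R]_3) (v w : V) : dot v v = 1 -> dot w w = 1 ->
  dot v w = 0 -> orthogonal_mx A -> \det A = 1 -> v *m A = v ->
  let c := dot (w *m A) w in let s := dot (w *m A) (cross v w) in
  w *m A = c *: w + s *: cross v w /\ cross v w *m A = - s *: w + c *: cross v w.
Proof.
move=> v1 w1 vw oA dA vA c s.
have vwA : dot v (w *m A) = 0 by rewrite -{1}vA dot_orthogonal.
have [e _] := perp_decomposition v1 w1 vw vwA; split=> //.
by rewrite -[LHS]scale1r -dA -cross_mul // vA e cross_perp_frame.
Qed.

(** Rotations about v embed into the multiplicative group of the complex numbers, whose finite
    subgroups are cyclic. *)
Lemma axis_stabilizer_cyclic K rho (v : V) (C : {group gT}) : rotation_rep K rho ->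
  C \subset K -> dot v v = 1 -> {in C, forall h, v *m rho h = v} -> cyclic C.
Proof.
move=> r /fintype.subsetP sCK v1 fixC; have [w [w1 vw]] := unit_perp v1.
pose f (h : gT) : R[i] :=
  Complex (dot (w *m rho h) w) (dot (w *m rho h) (cross v w)).
have vw1 := dot_cross_unit v1 w1 vw.
apply: (@field_mul_group_cyclic _ C _ f).
  move=> h k Ch Ck; rewrite /f (rotM r) ?sCK // mulmxA.
  have [eh1 eh2] := rotation_in_frame v1 w1 vw (rot_orthogonal r (sCK _ Ch))
    (rot_det r (sCK _ Ch)) (fixC _ Ch).
  have [ek1 ek2] := rotation_in_frame v1 w1 vw (rot_orthogonal r (sCK _ Ck))
    (rot_det r (sCK _ Ck)) (fixC _ Ck).
  move: eh1 eh2 ek1 ek2; set c := dot (w *m rho h) w; set s := dot (w *m rho h) _.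
  set c' := dot (w *m rho k) w; set s' := dot (w *m rho k) _ => eh1 eh2 ek1 ek2.
  rewrite eh1 mulmxDl -!scalemxAl ek1 ek2 !dotDl !dotZl !dotDl !dotZl w1 vw1.
  rewrite dot_crossr (dotC w) dot_crossr.
  by apply/eqP; rewrite eq_complex /=; apply/andP; split; apply/eqP; ring.
move=> h Ch; split=> [e|->]; last first.
  rewrite /f (rot1 r) mulmx1 w1 (dotC w) dot_crossr.
  by [].
apply: (rot_inj r (sCK _ Ch)).
have [_ ->] := plane_rotation_eq v1 w1 vw (rot_orthogonal r (sCK _ Ch))
    (rot_det r (sCK _ Ch)) (fixC _ Ch).
by move: e; rewrite /f => -[-> ->]; rewrite plane_rotation10.
Qed.

Lemma rotation_axis_structure K rho : rotation_rep K rho ->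
  exists ax, axis_structure K ax.
Proof.
move=> r; have /choice[v hv] : forall x, exists v : V,
    x \in K -> dot v v = 1 /\ v *m rho x = v.
  move=> x; have [Kx|nKx] := boolP (x \in K); last by exists 0.
  by have [v ?] := rotation_axis (rot_orthogonal r Kx) (rot_det r Kx); exists v.
pose A x : {set gT} := finset (fun h : gT => (h \in K) && (v x *m rho h == v x)).
have gA x : group_set (A x).
  apply/group_setP; split=> [|g h]; first by rewrite inE group1 (rot1 r) mulmx1 eqxx.
  rewrite !inE => /andP[Kg /eqP vg] /andP[Kh /eqP vh].
  by rewrite groupM //= (rotM r) // mulmxA vg vh eqxx.
pose ax x := Group (gA x).
have axP x g : (g \in ax x) = (g \in K) && (v x *m rho g == v x) by rewrite inE.
have rJ g h : g \in K -> h \in K -> rho g *m rho (h ^ g)%g = rho h *m rho g.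
  by move=> Kg Kh; rewrite -(rotM r Kg (groupJ Kh Kg)) -(rotM r Kh Kg) -conjgC.
have rV g : g \in K -> rho g *m rho g^-1%g = 1%:M.
  by move=> Kg; rewrite -(rotM r) ?groupV // mulgV (rot1 r).
have uniq x y (u : V) : x \in K -> x != 1%g -> y \in K -> dot u u = 1 ->
    v y *m rho x = v y -> u *m rho x = u -> u = v y \/ u = - v y.
  move=> Kx x1 Ky u1 vyx ux; have [vy1 _] := hv y Ky.
  apply: (rotation_axis_unique (rot_orthogonal r Kx) (rot_det r Kx)) => //.
  by apply: contra x1 => /eqP/(rot_inj r Kx)->.
have eq_pm x y : v x = v y \/ v x = - v y -> ax x = ax y.
  move=> e; apply/val_inj/setP => g; rewrite /= !inE.
  by case: e => -> //; rewrite mulNmx eqr_opp.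
have KD x : x \in K^#%g -> x != 1%g /\ x \in K by case/setD1P.
(* The conjugate x ^ g lies in [ax x], so it fixes both v x and its image under g; these agree up to
   sign, and equality would put g into [ax x]. *)
have flip x g : x \in K^#%g -> g \in ('N_K(ax x) :\: ax x)%g ->
    g \in K /\ v x *m rho g = - v x.
  move=> /KD[x1 Kx]; rewrite inE axP => /andP[ng /finset.setIP[Kg Ng]].
  split=> //; rewrite Kg /= in ng; have [vx1 vxx] := hv x Kx.
  have xa : (x ^ g)%g \in ax x by rewrite memJ_norm // axP Kx vxx eqxx.
  have : v x *m rho g = v x \/ v x *m rho g = - v x.
    apply: (uniq (x ^ g)%g) => //.
    - by rewrite groupJ.
    - by rewrite conjg_eq1.
    - by rewrite dot_orthogonal //; exact: (rot_orthogonal r).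
    - by move: xa; rewrite axP => /andP[_ /eqP].
    - by rewrite -mulmxA rJ // mulmxA vxx.
  by case=> // e; rewrite e eqxx in ng.
exists ax; split.
- by move=> x /KD[x1 Kx]; rewrite axP Kx (hv x Kx).2 eqxx.
- by move=> x _; apply/fintype.subsetP => g; rewrite axP => /andP[].
- move=> x /KD[x1 Kx]; apply: (@axis_stabilizer_cyclic K rho (v x)) => //.
  + by apply/fintype.subsetP => g; rewrite axP => /andP[].
  + exact: (hv x Kx).1.
  + by move=> h; rewrite axP => /andP[_ /eqP].
- move=> x /KD[x1 Kx] y /setD1P[y1]; rewrite axP => /andP[Ky /eqP vxy].
  apply: eq_pm; have [vy1 vyy] := hv y Ky; exact: (uniq y).
- move=> x g /KD[x1 Kx] Kg; have [vx1 vxx] := hv x Kx.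
  have Kxg : (x ^ g)%g \in K by rewrite groupJ.
  have [vxg1 vxgx] := hv _ Kxg.
  have e : v (x ^ g)%g = v x *m rho g \/ v (x ^ g)%g = - (v x *m rho g).
    apply: (rotation_axis_unique (rot_orthogonal r Kxg) (rot_det r Kxg)) => //.
    + apply/eqP => /(rot_inj r Kxg)/eqP; rewrite conjg_eq1; exact/negP.
    + by rewrite dot_orthogonal //; exact: (rot_orthogonal r).
    + by rewrite -mulmxA rJ // mulmxA vxx.
  apply/val_inj/setP => h; rewrite mem_conjg !inE groupJr ?groupV //.
  have [Kh|//] := boolP (h \in K); rewrite /=.
  have -> : (v (x ^ g)%g *m rho h == v (x ^ g)%g) = (v x *m rho g *m rho h == v x *m rho g).
    by case: e => -> //; rewrite mulNmx eqr_opp.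
  have Kh' : (h ^ g^-1)%g \in K by rewrite groupJ ?groupV.
  have eh := rJ g _ Kg Kh'; rewrite conjgKV in eh.
  rewrite -mulmxA eh mulmxA; apply/eqP/eqP => [h1|->//].
  by rewrite -[v x *m rho _]mulmx1 -(rV g Kg) mulmxA h1 -mulmxA rV // mulmx1.
- move=> x Kx g /(flip x g Kx)[Kg e]; have [x1 Kx'] := KD x Kx.
  apply: (rot_inj r); first by rewrite groupX.
  rewrite expgS expg1 (rotM r) //.
  exact: (rotation_flip (rot_orthogonal r Kg) (rot_det r Kg) (hv x Kx').1 e).
- move=> x Kx g h /(flip x g Kx)[Kg eg] /(flip x h Kx)[Kh eh].
  by rewrite axP groupM //= (rotM r) // mulmxA eg mulNmx eh opprK eqxx.
Qed.

Lemma rotation_group_trichotomy K rho : rotation_rep K rho ->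
  [\/ cyclic K, exists2 n, (1 < n)%N & K \isog 'D_(n.*2) | polyhedral K].
Proof.
case/rotation_axis_structure => ax axK.
case: (axis_classification axK) => [c|d|t|i].
- by constructor 1.
- by constructor 2; exact: dihedral_axis_isog d.
- by constructor 3; exact: tetrahedral_polyhedral t.
- by constructor 3; exact: icosahedral_polyhedral i.
Qed.

End RotationGroups.

(** * Binary dihedral groups and cyclic subgroups of index two *)

Section BinaryDihedral.
Local Close Scope classical_set_scope.
Local Open Scope nat_scope.
Local Open Scope group_scope.

Definition dicyclic_relations (gT : finGroupType) m (A : {set gT}) k q :=
  [/\ <[k]> <*> <[q]> = A, k ^+ m = q ^+ 2 & k ^ q = k^-1].

Lemma dicyclic_homP (gT : finGroupType) m (A : {set gT}) :
  reflect (exists k q, dicyclic_relations m A k q)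
    (A \homg Grp (k : q : (k ^+ m = q ^+ 2, k ^ q = k^-1))).
Proof.
apply: (iffP existsP) => [[[k q] /= /eqP[] e1 e2 e3]|[k [q [e1 e2 e3]]]].
  by exists k, q.
by exists (k, q); rewrite /= e1 e2 e3 !eqxx.
Qed.

Section Model.
Variable m' : nat.
Local Notation Z := 'Z_(m'.*2.+2).

(* [(a, e)] stands for [k ^ a * q ^ e]. *)
Definition dicyclic_model : Type := (Z * bool)%type.
HB.instance Definition _ := Finite.on dicyclic_model.

Definition dcm_mul (x y : dicyclic_model) : dicyclic_model :=
  ((x.1 + (if x.2 then - y.1 else y.1) +
    (if x.2 && y.2 then m'.+1%:R else 0))%R, x.2 (+) y.2).
Definition dcm_inv (x : dicyclic_model) : dicyclic_model :=
  (if x.2 then x.1 + m'.+1%:R else - x.1, x.2)%R.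
Definition dcm_one : dicyclic_model := (0%R, false).

Lemma dcm_m2 : (m'.+1%:R + m'.+1%:R = 0 :> Z)%R.
Proof. by rewrite -natrD addnn doubleS pchar_Zp. Qed.

Lemma dcm_mulA : associative dcm_mul.
Proof.
move=> [a [|]] [b [|]] [c [|]]; rewrite /dcm_mul /=; congr (_, _); try ring.
by apply/esym/subr0_eq; rewrite -[RHS]dcm_m2; ring.
Qed.

Lemma dcm_mul1 : left_id dcm_one dcm_mul.
Proof. by case=> a e; rewrite /dcm_mul /=; congr (_, _); ring. Qed.

Lemma dcm_mulV : left_inverse dcm_one dcm_inv dcm_mul.
Proof.
case=> a [|]; rewrite /dcm_mul /dcm_inv /=; congr (_, _); last by ring.
by rewrite -[RHS]dcm_m2; ring.
Qed.

HB.instance Definition _ :=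
  Finite_isGroup.Build dicyclic_model dcm_mulA dcm_mul1 dcm_mulV.

Lemma card_dicyclic_model : #|[set: dicyclic_model]| = (4 * m'.+1)%N.
Proof.
rewrite cardsT card_prod card_bool card_ord.
by rewrite -doubleS -muln2 -mulnA mulnC.
Qed.

Let k : dicyclic_model := (1%R, false).
Let q : dicyclic_model := (0%R, true).

Lemma dcm_expk n : k ^+ n = (n%:R%R, false).
Proof.
elim: n => [|n IH] //; rewrite expgS IH.
by rewrite -[LHS]/(dcm_mul k _) /dcm_mul /= addr0 -natr1 addrC.
Qed.

Lemma dicyclic_model_relations : dicyclic_relations m'.+1 [set: dicyclic_model] k q.
Proof.
split.
- apply/eqP; rewrite finset.eqEsubset finset.subsetT; apply/fintype.subsetP => -[a e] _.
  have -> : (a, e) = k ^+ a * q ^+ e :> dicyclic_model.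
    rewrite dcm_expk -[RHS]/(dcm_mul _ _) /dcm_mul /= natr_Zp.
    by case: e; rewrite ?expg1 ?expg0 /=; congr (_, _); ring.
  by rewrite groupM // groupX // mem_gen // inE cycle_id ?orbT.
- rewrite dcm_expk expgS expg1 -[RHS]/(dcm_mul q q) /dcm_mul /=; congr (_, _); ring.
- rewrite conjgE -[LHS]/(dcm_mul (dcm_inv q) (dcm_mul k q)).
  rewrite -[RHS]/(dcm_inv k) /dcm_mul /dcm_inv /=; congr (_, _).
  rewrite -[RHS]addr0 -[X in (_ = _ + X)%R]dcm_m2; ring.
Qed.

Lemma dicyclic_model_presentation : [set: dicyclic_model] \isog
  Grp (k : q : (k ^+ m'.+1 = q ^+ 2, k ^ q = k^-1)).
Proof.
apply: intro_isoGrp; first by apply/dicyclic_homP; exists k, q; exact: dicyclic_model_relations.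
move=> rT H /dicyclic_homP[x [y [defH xy yx]]].
(* This power equals y^2, which commutes with y, while y inverts x. Hence the power is its own
   inverse and x^(2(m'+1)) = 1 follows from the relations. *)
have y2C : x ^+ m'.+1 = x^-1 ^+ m'.+1.
  by rewrite -yx -conjXg xy conjXg conjgE mulKg.
have x2m : x ^+ m'.*2.+2 = 1.
  by rewrite -doubleS -addnn expgD {1}y2C expVgn mulVg.
have yx' n : y * x ^+ n = x^-1 ^+ n * y.
  by rewrite [RHS]conjgC conjXg conjVg yx invgK.
pose f (z : dicyclic_model) := x ^+ z.1 * y ^+ z.2.
have fM : {in [set: dicyclic_model] &, {morph f : u v / u * v}}.
  have xD (a b : Z) : x ^+ (a + b)%R = x ^+ a * x ^+ b.
    by rewrite /= expg_mod // expgD.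
  have xN (a : Z) : x ^+ (- a)%R = x^-1 ^+ a.
    by apply: (mulIg (x ^+ a)); rewrite -xD addNr expVgn mulVg.
  have xm : x ^+ (m'.+1%:R : Z)%R = y ^+ 2.
    by rewrite val_Zp_nat // expg_mod.
  have y2x n : y ^+ 2 * x ^+ n = x ^+ n * y ^+ 2 by rewrite -xy -!expgD addnC.
  move=> [a e] [b g] _ _; rewrite -[_ * _ in LHS]/(dcm_mul _ _) /f /dcm_mul.
  case: e g => [] []; rewrite /fst /snd ?andTb ?andbF ?andFb ?xD ?xN ?xm ?expg0 ?expg1 ?mulg1.
  - by rewrite -!mulgA; congr (_ * _); rewrite (mulgA y) yx' -mulgA.
  - by rewrite -!mulgA yx'.
  - by rewrite mulgA.
  - by [].
apply/homgP; exists (Morphism fM); apply/eqP; rewrite finset.eqEsubset; apply/andP; split.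
  apply/fintype.subsetP => _ /morphimP[[a e] _ _ ->]; rewrite -defH.
  by rewrite groupM // groupX // mem_gen // inE cycle_id ?orbT.
rewrite -defH join_subG !cycle_subG; apply/andP; split.
  apply/morphimP; exists k; rewrite ?inE // /= /f /=.
  by rewrite mulg1 modn_small ?expg1.
by apply/morphimP; exists q; rewrite ?inE //= /f /= mul1g.
Qed.

End Model.

(** A group satisfying the relations is a quotient of the model, so having order 4m makes it
    isomorphic to it. The presentation is thereby replaced by an order and two generators. *)
Lemma binary_dihedralP (gT : finGroupType) m (A : {group gT}) : 0 < m ->
  binary_dihedral m A <->
  #|A| = (4 * m)%N /\ exists k q, dicyclic_relations m A k q.
Proof.
case: m => // m' _; have P := dicyclic_model_presentation m'.
split=> [iA|[oA /dicyclic_homP hA]].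
  have iAM : A \isog [set: dicyclic_model m'].
    by rewrite isogEhom P iA (isoGrp_hom P) (isoGrp_hom iA).
  split; first by rewrite (card_isog iAM) card_dicyclic_model.
  exact/dicyclic_homP/isoGrp_hom.
suff iAM : A \isog [set: dicyclic_model m'] by exact: isoGrp_trans iAM P.
by apply/(isoGrpP A P); rewrite card_dicyclic_model.
Qed.

End BinaryDihedral.

(** * Groups with a cyclic subgroup of index two and no outer involution *)

Section CyclicIndexTwo.
Local Close Scope classical_set_scope.
Local Open Scope nat_scope.
Local Open Scope group_scope.
Variable gT : finGroupType.
Implicit Types (G K H A C : {group gT}) (u x y : gT).

Lemma card_join_square K u : u \in 'N(K) -> u \notin K -> u ^+ 2 \in K ->
  #|K <*> <[u]>| = (2 * #|K|)%N.
Proof.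
move=> nKu nu u2; have nK : <[u]> \subset 'N(K) by rewrite cycle_subG.
have sK : K \subset K <*> <[u]> := joing_subl _ _.
rewrite -(Lagrange sK) mulnC; congr (_ * _)%N.
have nKB : K <*> <[u]> \subset 'N(K) by rewrite join_subG normG.
rewrite -card_quotient // quotientYidl // quotient_cycle //.
apply: nt_prime_order => //; last by apply: contra nu => /eqP/(coset_idr nKu).
by rewrite -morphX //; apply/coset_id.
Qed.

Lemma double_half_succ n : odd n -> (2 * n./2.+1)%N = n.+1.
Proof. by move=> on; rewrite mulnS mul2n -[in RHS](odd_double_half n) on. Qed.

Lemma index2_square G K x : K \subset G -> #|G : K| = 2 -> x \in G -> x ^+ 2 \in K.
Proof.
move=> sKG i2 Gx; have [Kx|nx] := boolP (x \in K); first by rewrite groupX.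
by rewrite expgS expg1 (index2_mul sKG i2).
Qed.

Lemma index2_odd G K x : K \subset G -> #|G : K| = 2 -> x \in G -> odd #[x] -> x \in K.
Proof.
move=> sKG i2 Gx ox; have -> : x = (x ^+ 2) ^+ (#[x]./2).+1.
  by rewrite -expgM double_half_succ // expgS expg_order mulg1.
by rewrite groupX // (index2_square sKG i2).
Qed.

Lemma involution_cycle y z : z \in <[y]> -> #[z] = 2 -> forall z', z' \in <[y]> ->
  #[z'] = 2 -> z = z'.
Proof.
move=> yz oz z' yz' oz'; have : <[z]> = <[z']>.
  apply/eqP; rewrite (eq_subG_cyclic (cycle_cyclic y)) ?cycle_subG //.
  by rewrite -!orderE oz oz'.
rewrite !cycle2g // => e; have : z \in [set 1; z'] by rewrite -e !inE eqxx orbT.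
rewrite !inE => /orP[/eqP z1|/eqP//]; by rewrite z1 order1 in oz.
Qed.

(** The subgroups of a cyclic 2-group form a chain, so <a> is properly contained in <b> and lies in
    its maximal subgroup <b^2>. *)
Lemma two_cycle_chain y a b n : #[y] = (2 ^ n)%N -> a \in <[y]> -> b \in <[y]> ->
  b \notin <[a]> -> a \in <[b ^+ 2]>.
Proof.
move=> oy ya yb nb.
have pow x : x \in <[y]> -> exists2 i, i <= n & #[x] = (2 ^ i)%N.
  by move=> /order_dvdG; rewrite -orderE oy => /(dvdn_pfactor _ _ (isT : prime 2)).
have [i _ oa] := pow _ ya; have [j _ ob] := pow _ yb.
have cyc := cycle_cyclic y.
have lij : i < j.
  rewrite ltnNge; apply: contra nb => lji; rewrite -cycle_subG.
  by rewrite -(cardSg_cyclic cyc) ?cycle_subG // -!orderE oa ob dvdn_exp2l.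
rewrite -cycle_subG -(cardSg_cyclic cyc) ?cycle_subG ?groupX // -!orderE oa.
rewrite orderXdiv ob; last by rewrite dvdn_exp // (leq_ltn_trans _ lij).
by case: j lij {ob} => // j lij; rewrite expnS mulKn // dvdn_exp2l.
Qed.

Variables G K : {group gT}.
Hypotheses (sKG : K \subset G) (i2 : #|G : K| = 2) (cK : cyclic K).
Hypothesis noinv : {in G :\: K, forall g, g ^+ 2 != 1}.

Lemma outer_two_element : exists2 u, u \in G :\: K & 2.-elt u.
Proof.
have [g Gg ng] : exists2 g, g \in G & g \notin K.
  by apply/fintype.subsetPn; rewrite -indexg_gt1 i2.
exists g.`_2; last exact: p_elt_constt.
rewrite inE (groupX _ Gg) andbT; apply: contra ng => Ku.
rewrite -(consttC 2 g) groupM //; apply: (index2_odd sKG i2); first exact: groupX.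
rewrite odd_2'nat -[nat_pred_of_nat 2]/(2 : nat_pred); exact: p_elt_constt.
Qed.

(** Conjugation by u is an automorphism of order at most 2 of the odd part of K. Since x^2 = (x
    (x^u)^-1) (x x^u) and square roots exist in odd order, that part is the product of the elements
    inverted by u and those fixed by u. *)
Lemma odd_part_decomposition u : u \in G :\: K -> 2.-elt u -> exists A C,
  [/\ [/\ cyclic A, odd #|A|, cyclic C & odd #|C|], coprime #|A| #|C|,
    {in A, forall a, a ^ u = a^-1}, {in C, forall c, c ^ u = c}
   & 'O_2(K) \x (A \x C) = K].
Proof.
case/finset.setDP=> Gu nu u2; pose M := 'O_2^'(K)%G.
have abK := cyclic_abelian cK; have nKG : G \subset 'N(K) := normal_norm (index2_normal sKG i2).
have sMK : M \subset K by exact: pcore_sub.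
have nMu : u \in 'N(M) by rewrite (fintype.subsetP (char_norm_trans (pcore_char _ K) nKG)).
have oM : odd #|M| by rewrite odd_2'nat; exact: pcore_pgroup.
have cM : cyclic M := cyclicS sMK cK.
have comm x y : x \in M -> y \in M -> x * y = y * x.
  by move=> Mx My; apply: (centsP abK); exact: (fintype.subsetP sMK).
have Ju x : x \in M -> x ^ u \in M by move=> Mx; rewrite memJ_norm.
have Juu x : x \in M -> (x ^ u) ^ u = x.
  move=> Mx; rewrite -conjgM; apply/conjg_fixP/commgP.
  by apply: (centsP abK); [exact: (fintype.subsetP sMK)|exact: (index2_square sKG i2 Gu)].
pose A := [set x in M | x ^ u == x^-1]; pose C := [set x in M | x ^ u == x].
have gA : group_set A.
  apply/group_setP; split=> [|x y]; first by rewrite inE group1 conj1g invg1 eqxx.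
  rewrite !inE => /andP[Mx /eqP ex] /andP[My /eqP ey].
  by rewrite groupM //= conjMg ex ey invMg comm ?groupV.
have gC : group_set C.
  apply/group_setP; split=> [|x y]; first by rewrite inE group1 conj1g eqxx.
  rewrite !inE => /andP[Mx /eqP ex] /andP[My /eqP ey].
  by rewrite groupM //= conjMg ex ey.
have sAM : A \subset M by apply/fintype.subsetP => x; rewrite inE => /andP[].
have sCM : C \subset M by apply/fintype.subsetP => x; rewrite inE => /andP[].
have half x : x \in M -> x = (x ^+ 2) ^+ (#|M|./2).+1.
  move=> Mx; rewrite -expgM double_half_succ //.
  by rewrite expgS expg_cardG // mulg1.
have dM : Group gA \x Group gC = M.
  rewrite dprodE.
  - apply/eqP; rewrite finset.eqEsubset mul_subG //=; apply/fintype.subsetP => x Mx.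
    have Mxu := Ju x Mx; have MxV : (x ^ u)^-1 \in M by rewrite groupV.
    have M1 : x * (x ^ u)^-1 \in M := groupM Mx MxV.
    have M2 : x * x ^ u \in M := groupM Mx Mxu.
    have -> : x = (x * (x ^ u)^-1) ^+ (#|M|./2).+1 * (x * x ^ u) ^+ (#|M|./2).+1.
      rewrite -expgMn; last exact: comm.
      rewrite [LHS](half x Mx); congr (expgn _ _).
      by rewrite expgS expg1 [x * x ^ u]comm // mulgA mulgKV.
    apply: mem_mulg; [apply: (@groupX _ (Group gA))|apply: (@groupX _ (Group gC))]; rewrite inE.
      by rewrite M1 /= conjMg conjVg Juu // invMg invgK.
    by rewrite M2 /= conjMg Juu // comm.
  - apply/centsP => x Cx y Ay; apply: comm; first exact: (fintype.subsetP sCM).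
    exact: (fintype.subsetP sAM).
  - apply/trivgP/fintype.subsetP => x; rewrite !inE => /andP[/andP[Mx /eqP ->] /andP[_ xx]].
    have x2 : x ^+ 2 = 1 by rewrite expgS expg1 -{1}(eqP xx) mulVg.
    by rewrite (half x Mx) x2 expg1n.
have cA : cyclic (Group gA) := cyclicS (H := Group gA) sAM cM.
have cC : cyclic (Group gC) := cyclicS (H := Group gC) sCM cM.
exists (Group gA), (Group gC); split=> //.
- split=> //; [exact: (dvdn_odd (cardSg (H := Group gA) sAM))|exact: (dvdn_odd (cardSg (H := Group gC) sCM))].
- by rewrite -(cyclic_dprod dM).
- by move=> a; rewrite inE => /andP[_ /eqP].
- by move=> a; rewrite inE => /andP[_ /eqP].
- by rewrite dM; exact: nilpotent_pcoreC (abelian_nil abK).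
Qed.

Lemma coprime_product_eq H A C : A \subset H -> C \subset H -> C \subset 'C(A) ->
  coprime #|A| #|C| -> #|H| = (#|A| * #|C|)%N -> A \x C = H.
Proof.
move=> sA sC cAC co oH; rewrite dprodE ?coprime_TIg //.
by apply/eqP; rewrite eqEcard mul_subG //= oH coprime_cardMg.
Qed.

(** Write K as <y> x A x C with y of 2-power order, A inverted and C centralised by u. If u^2
    generates <y>, the twisted product appears. Otherwise the absence of outer involutions forces u
    to invert y, and u together with <y> and A generates a dicyclic group. *)
Lemma cyclic_index2 :
  (exists n2 mm mp A u C, [/\ admissible n2 mm mp, twisted n2 mm mp A u C,
     u \in G :\: K & (A ><| <[u]>) \x C = G]) \/ list4a G.
Proof.
have [u Du u2] := outer_two_element.
have [A [C [[cA oA cC oC] coAC uA uC dK]]] := odd_part_decomposition Du u2.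
case/finset.setDP: (Du) => Gu nu; have abK := cyclic_abelian cK.
have nKG : G \subset 'N(K) := normal_norm (index2_normal sKG i2).
have oG : #|G| = (2 * #|K|)%N by rewrite -(Lagrange sKG) i2 mulnC.
have [AC eAC] : exists AC : {group gT}, A \x C = AC.
  by have [[_ B _ eB] _ _ _] := dprodP dK; exists B.
have oAC := dprod_card eAC; rewrite eAC in dK; have oK := dprod_card dK.
have [_ /esym mAC _ _] := dprodP eAC; have [_ /esym mK _ _] := dprodP dK.
have sACK : AC \subset K by rewrite mK mulG_subr.
have sAK : A \subset K by apply: fintype.subset_trans sACK; rewrite mAC mulG_subl.
have sCK : C \subset K by apply: fintype.subset_trans sACK; rewrite mAC mulG_subr.
have p2Y : 2.-group 'O_2(K) by exact: pcore_pgroup.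
have sYK : 'O_2(K) \subset K by exact: pcore_sub.
have cY := cyclicS sYK cK; have [y defY] := cyclicP cY.
have yK : y \in K by rewrite (fintype.subsetP sYK) // defY cycle_id.
set n2 := logn 2 #|'O_2(K)|; have oY : #|'O_2(K)| = (2 ^ n2)%N := card_pgroup p2Y.
have oy : #[y] = (2 ^ n2)%N by rewrite orderE -defY.
have Ku2 : u ^+ 2 \in K := index2_square sKG i2 Gu.
have Yu2 : u ^+ 2 \in <[y]>.
  rewrite -defY (mem_normal_Hall (nilpotent_pcore_Hall 2 (abelian_nil abK)) (pcore_normal _ _) Ku2).
  exact: p_eltX.
have u21 : u ^+ 2 != 1 := noinv Du.
have n20 : 0 < n2.
  rewrite lt0n; apply: contra u21 => /eqP n20.
  by move: Yu2; rewrite (_ : y = 1) ?cycle1 ?inE //; apply/eqP; rewrite -order_eq1 oy n20.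
have adm : admissible n2 #|A| #|C| by [].
have cGC : C \subset 'C(G).
  apply/centsP => c Cc g Gg; have Kc := fintype.subsetP sCK _ Cc.
  have cu : commute c u by apply/commgP/conjg_fixP; exact: uC.
  have [Kg|ng] := boolP (g \in K); first exact: (centsP abK).
  have Kgu : g * u^-1 \in K by rewrite (index2_mul sKG i2) // ?groupV.
  by rewrite -(mulgKV u g); apply: commuteM => //; exact: (centsP abK).
have [eY|neY] := eqVneq <[u ^+ 2]> <[y]>.
  left; have ou2 : #[u ^+ 2] = (2 ^ n2)%N by rewrite orderE eY -orderE.
  have ou : #[u] = (2 ^ n2.+1)%N.
    have [e oe] := p_natP u2; case: e oe => [|e] oe.
      by move: u21; rewrite (_ : u = 1) ?expg1n ?eqxx //; apply/eqP; rewrite -order_eq1 oe.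
    move: ou2; rewrite orderXdiv oe ?expnS ?dvdn_mulr // mulKn //.
    by move=> ->.
  exists n2, #|A|, #|C|, A, u, C; split=> //.
  have nAu : <[u]> \subset 'N(A).
    rewrite cycle_subG; apply/normP/eqP; rewrite eqEcard cardJg leqnn andbT.
    by apply/fintype.subsetP => _ /finset.imsetP[a Aa ->]; rewrite uA ?groupV.
  have coAu : coprime #|A| #|<[u]>| by rewrite -orderE ou coprime_sym coprimeXl // coprime2n.
  rewrite sdprodE ?coprime_TIg // -norm_joinEr //.
  have cAu : #|A <*> <[u]>| = (#|A| * 2 ^ n2.+1)%N.
    by rewrite norm_joinEr // coprime_cardMg // -orderE ou.
  apply: (coprime_product_eq (A := (A <*> <[u]>)%G)).
  - by rewrite join_subG cycle_subG Gu (fintype.subset_trans sAK).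
  - exact: fintype.subset_trans sCK sKG.
  - apply: fintype.subset_trans cGC (centS _).
    by rewrite join_subG cycle_subG Gu (fintype.subset_trans sAK).
  - by rewrite cAu coprimeMl coAC coprimeXl // coprime2n.
  - by rewrite cAu oG -oK -oAC oY expnS -!mulnA (mulnCA (2 ^ n2)%N) mulnCA.
right.
have Ju x : x \in K -> x ^ u \in K by move=> Kx; rewrite memJ_norm // (fintype.subsetP nKG).
have Juu x : x \in K -> (x ^ u) ^ u = x.
  by move=> Kx; rewrite -conjgM; apply/conjg_fixP/commgP; exact: (centsP abK).
have Jy x : x \in <[y]> -> x ^ u \in <[y]>.
  rewrite -defY => Yx; rewrite memJ_norm //.
  exact: (fintype.subsetP (char_norm_trans (pcore_char 2 K) nKG)).
pose c := y ^ u * y.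
have yy : y \in <[y]> := cycle_id y.
have yc : c \in <[y]> := groupM (Jy y yy) yy.
have comm x z : x \in <[y]> -> z \in <[y]> -> x * z = z * x.
  by move=> yx yz; apply: (centsP (cycle_abelian y)).
(* Since (u y^i)^2 = u^2 c^i, the inverse of u^2 cannot be a power of c. Two applications of
   [two_cycle_chain] then place c in <u^4> and in <y^4>. *)
have u2c : u ^+ 2 \notin <[c]>.
  apply/negP; rewrite -groupV => /cycleP[i ei].
  have : (u * y ^+ i) ^+ 2 != 1.
    by apply: noinv; rewrite inE groupMr ?groupX // nu groupM // (fintype.subsetP sKG) ?groupX.
  have -> : (u * y ^+ i) ^+ 2 = u ^+ 2 * ((y ^+ i) ^ u * y ^+ i).
    by rewrite [LHS]expgS expg1 -mulgA (mulgA _ u) (conjgC _ u) !mulgA.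
  rewrite conjXg -expgMn; last by apply: comm; rewrite ?Jy.
  by rewrite -/c -ei mulgV eqxx.
have cu4 := two_cycle_chain oy yc Yu2 u2c.
have u2y2 : u ^+ 2 \in <[y ^+ 2]>.
  apply: (two_cycle_chain oy Yu2 yy); apply: contra neY => u2y.
  by rewrite finset.eqEsubset !cycle_subG Yu2.
have cy4 : c \in <[(y ^+ 2) ^+ 2]>.
  rewrite -cycle_subG; rewrite -cycle_subG in cu4; apply: (fintype.subset_trans cu4).
  by rewrite cycle_subG; case/cycleP: u2y2 => i ->; rewrite -expgM mulnC expgM mem_cycle.
(* The element d is inverted by u, and d = c y^-2 with c in <y^4>; it therefore still generates y^2,
   and with it u^2. *)
pose d := y^-1 * y ^ u.
have du : d ^ u = d^-1 by rewrite /d conjMg conjVg Juu // [RHS]invMg invgK.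
have yV : y^-1 \in <[y]> := groupVr yy.
have yd : d \in <[y]> := groupM yV (Jy y yy).
have dc : d = c * y ^- 2.
  by rewrite /d /c expgS expg1 invMg -mulgA mulKVg comm // Jy.
have y2d : y ^+ 2 \in <[d]>.
  apply: contraR u21 => ny2; have d4 := two_cycle_chain oy yd (groupX 2 yy) ny2.
  have y24 : y ^+ 2 \in <[(y ^+ 2) ^+ 2]>.
    by rewrite -groupV -(mulKg c (y ^- 2)) -dc groupM // groupV.
  have e : <[y ^+ 2]> = <[(y ^+ 2) ^+ 2]>.
    by apply/eqP; rewrite finset.eqEsubset !cycle_subG y24 mem_cycle.
  have y21 : y ^+ 2 == 1.
    have n2' : n2.-1 <= n2 by rewrite leq_pred.
    have o2 : #[y ^+ 2] = (2 ^ n2.-1)%N.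
      by rewrite orderXdiv oy -(prednK n20) expnS ?mulKn ?dvdn_mulr.
    have := congr1 (fun X : {set gT} => #|X|) e; rewrite -!orderE o2.
    move: o2; case: (n2.-1) => [|j] o2; first by rewrite -order_eq1 o2.
    rewrite orderXdiv o2 expnS ?dvdn_mulr // mulKn // => /eqP.
    by rewrite -{2}(mul1n (2 ^ j)%N) eqn_pmul2r ?expn_gt0.
  by move: u2y2; rewrite (eqP y21) cycle1 inE.
(* As a power of d, u^2 is inverted by u, but it also commutes with u. Then c, lying in <u^4>, is
   trivial. *)
have u4 : (u ^+ 2) ^+ 2 = 1.
  have : u ^+ 2 \in <[d]>.
    by rewrite -cycle_subG in y2d; exact: (fintype.subsetP y2d).
  case/cycleP=> i ei; have : (u ^+ 2) ^ u = u ^- 2 by rewrite ei conjXg du expgVn.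
  rewrite conjXg conjgE mulKg => /eqP; rewrite eq_sym eq_invg_mul => /eqP.
  by rewrite [(u ^+ 2) ^+ 2]expgS expg1.
have c1 : c = 1 by move: cu4; rewrite u4 cycle1 inE => /eqP.
have yu : y ^ u = y^-1 by apply/eqP; rewrite eq_sym eq_invg_mul comm ?Jy // -/c c1.
have ou2 : #[u ^+ 2] = 2 by apply: nt_prime_order.
have n21 : 1 < n2.
  rewrite ltn_neqAle n20 andbT; apply: contra neY => /eqP n21.
  by rewrite (eq_subG_cyclic (cycle_cyclic y)) ?cycle_subG // -!orderE ou2 oy -n21.
have [a defA] := cyclicP cA.
have aA : a \in A by rewrite defA cycle_id.
have aK : a \in K := fintype.subsetP sAK a aA.
have oa : #[a] = #|A| by rewrite orderE -defA.
have ya : commute y a by exact: (centsP abK).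
pose k := y * a; pose m := (2 ^ n2.-1 * #|A|)%N.
have Kk : k \in K by rewrite groupM.
have ok : #[k] = (2 * m)%N.
  rewrite orderM //; last by rewrite oy oa coprimeXl // coprime2n.
  by rewrite oy oa /m mulnA -expnS prednK.
have ku : k ^ u = k^-1 by rewrite /k conjMg yu uA // -invMg ya.
have sub_k x : x \in K -> #[x] %| #[k] -> x \in <[k]>.
  by move=> Kx; rewrite -cycle_subG -(cardSg_cyclic cK) ?cycle_subG.
have ku2 : u ^+ 2 \in <[k]> by apply: sub_k; rewrite ?ou2 ?ok ?dvdn_mulr.
have nku : u \in 'N(<[k]>).
  by apply/normP; rewrite -cycleJ ku cycleV.
have nk : u \notin <[k]> by apply: contra nu; apply: fintype.subsetP; rewrite cycle_subG.
have oB := card_join_square nku nk ku2; rewrite -orderE ok in oB.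
have m0 : 0 < m by rewrite muln_gt0 expn_gt0 cardG_gt0.
(* The element k has order 2m with m = 2^(n2-1) |A|; the exponent n2 - 1 is positive because u^2, of
   order 2, does not generate <y>. *)
exists n2.-1, #|A|, #|C|, (<[k]> <*> <[u]>)%G, C; split=> //.
- by split=> //; rewrite -ltnS prednK.
- apply/binary_dihedralP => //; split; first by rewrite /= oB mulnA.
  exists k, u; split=> //; apply: (involution_cycle (y := k)); rewrite ?mem_cycle //.
  rewrite -/m orderXdiv ok; last exact: dvdn_mull.
  exact: mulnK.
have sBG : <[k]> <*> <[u]> \subset G.
  by rewrite join_subG !cycle_subG Gu (fintype.subsetP sKG).
apply: coprime_product_eq => //.
- exact: fintype.subset_trans sCK sKG.
- exact: fintype.subset_trans cGC (centS sBG).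
- rewrite [#|_|]oB /m !coprimeMl coAC coprimeXl ?coprime2n ?oC //.
- rewrite [#|_ <*> _|]oB oG -oK -oAC oY /m; move: (prednK n20); case: (n2) => // j _.
  by rewrite expnS !mulnA.
Qed.
End CyclicIndexTwo.

(** * Groups acting pseudofreely *)

Section PairsOfRotations.
Local Close Scope classical_set_scope.
Local Open Scope nat_scope.
Local Open Scope group_scope.
Variables (R : realType) (gT : finGroupType).
Implicit Types (G H K L : {group gT}) (a b : gT -> 'M[R]_3).

Definition involutive_mx (M : 'M[R]_3) := M *m M = 1%:M /\ M != 1%:M.

Definition rotation_hom H a :=
  {in H &, forall x y, a (x * y) = a x *m a y} /\
  {in H, forall x, orthogonal_mx (a x) /\ \det (a x) = 1%R}.

(** In the application H preserves the factors, K is ker phi, and a, b are the two block matrices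
    multiplied by their determinants. Off K a block has determinant -1, and it fixes a point exactly
    when its multiple is a half turn; [pair_free] excludes this for both at once. *)
Record pair_rep H K a b : Prop := PairRep {
  pair_sub : K \subset H;
  pair_index : #|H : K| = 2;
  pair_hom1 : rotation_hom H a;
  pair_hom2 : rotation_hom H b;
  pair_inj1 : {in K, forall x, a x = 1%:M -> x = 1};
  pair_inj2 : {in K, forall x, b x = 1%:M -> x = 1};
  pair_free : {in H :\: K, forall g, ~ (involutive_mx (a g) /\ involutive_mx (b g))} }.

Lemma rotation_hom1 H a : rotation_hom H a -> a 1 = 1%:M.
Proof.
case=> aM ao; have := aM 1 1 (group1 H) (group1 H); rewrite mulg1 => e.
have [o _] := ao 1 (group1 H); by rewrite -(orthogonalT o) {3}e mulmxA orthogonalT // mul1mx.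
Qed.

Lemma rotation_hom_rep H a : rotation_hom H a ->
  {in H, forall x, a x = 1%:M -> x = 1} -> rotation_rep H a.
Proof. by case=> aM ao inj; split=> // x Hx; have [] := ao x Hx. Qed.

Lemma rotation_homS H K a : K \subset H -> rotation_hom H a -> rotation_hom K a.
Proof.
move=> /fintype.subsetP sKH [aM ao]; split=> [x y Kx Ky|x Kx]; first by apply: aM; exact: sKH.
by apply: ao; exact: sKH.
Qed.

Lemma pair_rep_sym H K a b : pair_rep H K a b -> pair_rep H K b a.
Proof.
by move=> [s i h1 h2 i1 i2 f]; constructor=> // g Hg [h h']; apply: (f g Hg).
Qed.

Definition central_partner H K a b h := [/\ h \in H :\: K, #[h] = 2,
  {in H, forall g, commute h g}, a h = 1%:M
  & {in K, forall k, #[k] = 2 -> b h = b k}].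

(** For an involution k of K, h k is an involution off K with a (h k) = a k a half turn, so b (h k)
    is trivial and b h = b k. As b is faithful on K, there is at most one such k. An element g
    reversing the axis of x would give two, g and g x; so no axis is reversed and K is cyclic. *)
Lemma kernel_partner H K a b h : pair_rep H K a b -> h \in H -> h != 1 -> a h = 1%:M ->
  cyclic K /\ central_partner H K a b h.
Proof.
move=> rep Hh h1 ah; have [sKH i2 ha hb ia ib free] := rep.
have [[aM _] [bM _]] := (ha, hb); have sub := fintype.subsetP sKH.
have nh : h \notin K by apply: contra h1 => Kh; rewrite (ia _ Kh ah).
have h2 : h ^+ 2 = 1.
  apply: ia; first exact: (index2_square sKH i2).
  by rewrite expgS expg1 aM // ah mulmx1.
have oh : #[h] = 2 by exact: nt_prime_order.
have comm : {in H, forall g, commute h g}.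
  move=> g Hg; apply/commgP/eqP; have Hhg : h ^ g \in H by rewrite groupJ.
  have nhg : h ^ g \notin K by rewrite -(memJ_norm h (fintype.subsetP (normal_norm (index2_normal sKH i2)) g Hg)) in nh.
  apply: ia; first by rewrite commgEl (index2_mul sKH i2) ?groupV.
  have rV x : x \in H -> a x = 1%:M -> a x^-1 = 1%:M.
    by move=> Hx ax; have := aM x x^-1 Hx (groupVr Hx); rewrite mulgV ax mul1mx (rotation_hom1 ha).
  rewrite commgEl aM ?groupV // rV // mul1mx conjgE !aM ?groupM ?groupV // ah mul1mx.
  by rewrite -aM ?groupV // mulVg (rotation_hom1 ha).
have bk : {in K, forall k, #[k] = 2 -> b h = b k}.
  move=> k Kk ok; have Hk := sub k Kk.
  have k2 : k ^+ 2 = 1 by rewrite -ok expg_order.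
  have k1 : k != 1 by rewrite -order_gt1 ok.
  have sq c g : rotation_hom H c -> g \in H -> g ^+ 2 = 1 -> c g *m c g = 1%:M.
    by move=> hc Hg g2; rewrite -hc.1 // -expg2 g2 (rotation_hom1 hc).
  have hk2 : (h * k) ^+ 2 = 1 by rewrite expgMn ?h2 ?k2 ?mulg1 //; exact: comm.
  have D : h * k \in H :\: K by rewrite inE groupMr // nh groupM.
  have e : b (h * k) = 1%:M.
    apply/eqP; apply: contra_notT (free _ D) => bhk; split; split=> //.
    - by apply: sq; rewrite ?groupM.
    - by rewrite aM // ah mul1mx; apply: contra k1 => /eqP/(ia _ Kk)->.
    - by apply: sq; rewrite ?groupM.
  by rewrite -[b k]mul1mx -(sq b h) // -mulmxA -bM // e mulmx1.
split; last by split; rewrite // inE nh.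
have [ax axK] := rotation_axis_structure (rotation_hom_rep (rotation_homS sKH ha) ia).
apply: (all_self_sat_cyclic axK) => x Kx; apply/eqP; rewrite finset.eqEsubset (axis_sat axK Kx) andbT.
apply/fintype.subsetP => g sg; apply: contraT => ng; have [x1 Kx'] := finset.setD1P Kx.
have inv y : y \in sat K ax x -> y \notin ax x -> y \in K /\ #[y] = 2.
  move=> sy ny; split; first by case/finset.setIP: sy.
  apply: nt_prime_order => //; last by apply: contra ny => /eqP->; exact: group1.
  by apply: (axis_flip axK Kx); rewrite inE ny.
have xx := axis_mem axK Kx.
have [Kg og] := inv g sg ng.
have [Kgx ogx] : g * x \in K /\ #[g * x] = 2.
  by apply: inv; rewrite groupMr // (fintype.subsetP (axis_sat axK Kx)).
case/eqP: x1; apply: ib => //.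
have [ob _] := hb.2 g (sub g Kg).
have : b g *m b x = b g by rewrite -bM ?sub // -(bk _ Kg og) (bk _ Kgx ogx).
by move/(congr1 (mulmx (b g)^T)); rewrite mulmxA orthogonalT // mul1mx.
Qed.

(** If a and b are both faithful on H, no involution lies off K. For g off K, an element reversing
    its axis is an involution, hence in K, and so is its product with g, which is absurd. Thus the
    axis of g is not reversed, and its order makes it all of H. *)
Lemma pair_rep_classification H K a b : pair_rep H K a b ->
  (cyclic H /\ {in H :\: K, forall g, g ^+ 2 != 1}) \/
  cyclic K /\ exists h, central_partner H K a b h \/ central_partner H K b a h.
Proof.
move=> rep; have [sKH i2 ha hb ia ib free] := rep.
have [/existsP[h /and3P[Hh h1 /orP[/eqP ah|/eqP bh]]]|] :=
    boolP [exists h, [&& h \in H, h != 1 & (a h == 1%:M) || (b h == 1%:M)]].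
- by right; have [cK p] := kernel_partner rep Hh h1 ah; split=> //; exists h; left.
- by right; have [cK p] := kernel_partner (pair_rep_sym rep) Hh h1 bh; split=> //; exists h; right.
rewrite negb_exists => /forallP inj; left.
have injab g : g \in H -> g != 1 -> a g != 1%:M /\ b g != 1%:M.
  by move=> Hg g1; have := inj g; rewrite Hg g1 negb_or => /andP.
have noinv : {in H :\: K, forall g, g ^+ 2 != 1}.
  move=> g Dg; apply/negP => /eqP g2; apply: (free g Dg); case/finset.setDP: Dg => Hg ng.
  have g1 : g != 1 by apply: contra ng => /eqP->; exact: group1.
  have [ag bg] := injab g Hg g1.
  by split; split=> //; rewrite -?ha.1 -?hb.1 // -expg2 g2 ?(rotation_hom1 ha) ?(rotation_hom1 hb).
split=> //.
have [ax axH] : exists ax, axis_structure H ax.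
  apply: rotation_axis_structure; apply: (rotation_hom_rep ha) => x Hx ax1.
  by apply/eqP; apply: contraT => x1; have [] := injab x Hx x1; rewrite ax1 eqxx.
have [g Hg ng] : exists2 g, g \in H & g \notin K.
  by apply/fintype.subsetPn; rewrite -indexg_gt1 i2.
have Dg : g \in H :\: K by rewrite inE ng.
have g1 : g != 1 by apply: contra ng => /eqP->; exact: group1.
have Kg : g \in H^# by rewrite !inE g1.
have gg := axis_mem axH Kg.
suff e : ax g = H :> {set gT} by rewrite -e; exact: (axis_cyclic axH).
apply: (self_sat_axis axH Kg).
  apply/eqP; rewrite finset.eqEsubset (axis_sat axH Kg) andbT.
  apply/fintype.subsetP => k sk; apply: contraT => nk.
  have flip y : y \in sat H ax g -> y \notin ax g -> y \in K.
    move=> sy ny; apply: contraT => nKy; have Hy : y \in H by case/finset.setIP: sy.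
    have : y ^+ 2 != 1 by apply: noinv; rewrite inE nKy.
    by rewrite (axis_flip axH Kg) ?eqxx // inE ny.
  have Kk := flip k sk nk.
  have : k * g \in K by apply: flip; rewrite groupMr // (fintype.subsetP (axis_sat axH Kg)).
  by rewrite groupMl // (negPf ng).
(* The order of g is even because g lies off K, and it is not 2; hence it is at least 4. *)
have : #[g] <= #|ax g| by rewrite orderE subset_leq_card ?cycle_subG.
apply: leq_trans; have := noinv g Dg; rewrite -order_dvdn.
have : ~~ odd #[g] by apply: contra ng; exact: (index2_odd sKH i2).
by have := order_gt0 g; case: #[g] => // -[|[|[|]]].
Qed.

End PairsOfRotations.

(** * From rotation representations to the lists *)

Section ForwardLists.
Local Close Scope classical_set_scope.
Local Open Scope nat_scope.
Local Open Scope group_scope.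
Variables (R : realType) (gT : finGroupType).
Implicit Types (G H K L : {group gT}) (a b : gT -> 'M[R]_3).

Lemma list1_of_rotation_rep G a : rotation_rep G a -> list1 G.
Proof.
case/rotation_group_trichotomy => [c|d|/polyhedral_isog[]].
- by constructor 4; left; exists #|G|.
- by constructor 4; right.
- by constructor 1.
- by constructor 2.
- by constructor 3.
Qed.

Lemma involution_sdprod G K h : K \subset G -> #|G : K| = 2 -> h \in G :\: K ->
  #[h] = 2 -> K ><| <[h]> = G.
Proof.
move=> sKG i2 /finset.setDP[Gh nh] oh.
have Nh := fintype.subsetP (normal_norm (index2_normal sKG i2)) h Gh.
have pr : prime #|<[h]>| by rewrite -orderE oh.
have nh' : ~~ (<[h]> \subset K) by rewrite cycle_subG.
rewrite sdprodEY ?cycle_subG //; last by rewrite finset.setIC; exact: prime_TIg pr nh'.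
apply/eqP; rewrite eqEcard join_subG sKG cycle_subG Gh /=.
by rewrite card_join_square ?(index2_square sKG i2) // -(Lagrange sKG) i2 mulnC.
Qed.

Lemma list2_of_pair_rep G K a b : pair_rep G K a b ->
  exists n, [/\ 0 < n, cyclic_of_order n K & list2 G n].
Proof.
move=> rep; have sKG := pair_sub rep; have i2 := pair_index rep.
have isoZ (B : {group gT}) : cyclic B -> B \isog Zp #|B|.
  by case/cyclicP => x ->; rewrite isog_sym; exact: Zp_isog.
have oG : #|G| = #|K|.*2 by rewrite -(Lagrange sKG) i2 muln2.
exists #|K|; rewrite cardG_gt0.
case: (pair_rep_classification rep) => [[cG _]|[cK [h ph]]].
  by split=> //; [split=> //; exact: cyclicS sKG cG|right].
have [Dh oh comm] : [/\ h \in G :\: K, #[h] = 2 & {in G, forall g, commute h g}].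
  by case: ph => [[? ? ? _ _]|[? ? ? _ _]].
case/finset.setDP: (Dh) => Gh nh; split=> //; left.
apply: isog_dprod (setX_dprod _ _) _ _.
- rewrite dprodEsd; first exact: (@involution_sdprod G K h sKG i2 Dh oh).
  by rewrite cycle_subG; apply/centP => k Kk; apply: comm; exact: (fintype.subsetP sKG).
- exact: isog_trans (isoZ _ cK) (isog_setX1 _ _).
- by rewrite -oh; exact: isog_trans (isoZ _ (cycle_cyclic h)) (isog_set1X _ _).
Qed.

(** The exponent shifts by one. The groups of (3)(b) with n2 = 1 are also of type (3)(a), since D*_m
    for odd m is the product of Z_m and Z_4 twisted by inversion. *)
Lemma list3b_of_list4a G : list4a G -> list3b G.
Proof. by case=> n2 [mm [mp [A [C [[n20 o1 o2 co] B c e]]]]]; exists n2.+1, mm, mp, A, C. Qed.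

Lemma list3c_of_dihedral G K : K \subset G -> #|G : K| = 2 ->
  {in G :\: K, forall g, g ^+ 2 != 1} -> (exists2 n, 1 < n & K \isog 'D_(n.*2)) -> list3c G K.
Proof.
move=> sKG i2 noinv dK; split=> //.
have [k Gk nk] : exists2 k, k \in G & k \notin K.
  by apply/fintype.subsetPn; rewrite -indexg_gt1 i2.
(* Conjugation here is g ^ x = x^-1 g x, so the automorphism g -> k g k^-1 is conjugation by
   k^-1. *)
have Nk : k^-1 \in 'N(K).
  by rewrite groupV (fintype.subsetP (normal_norm (index2_normal sKG i2))).
have k2 := index2_square sKG i2 Gk.
have cE g : g \in K -> conj_aut K k^-1 g = k * g * k^-1.
  by move=> Kg; rewrite norm_conj_autE // conjgE invgK mulgA.
split.
  exists (conj_aut K k^-1), (k ^+ 2), k; split; [split|split].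
  - exact: Aut_aut.
  - exact: k2.
  - by rewrite cE // expgS expg1 mulgA mulgK.
  - move=> g Kg; rewrite !cE //; last by rewrite -[k * g * _]mulgA -{1}[k]invgK -conjgE memJ_norm.
    by rewrite expgS expg1 invMg !mulgA.
  - by [].
  - by move=> g Kg; rewrite cE.
  - apply/eqP; rewrite eqEcard join_subG sKG cycle_subG Gk /=.
    rewrite card_join_square //; last by rewrite -groupV.
    by rewrite -(Lagrange sKG) i2 mulnC.
  - exact: i2.
apply/negP => /splitsP[P /complP[tiKP eP]].
have [p Pp p1] : exists2 p, p \in P & p != 1.
  apply/trivgPn; apply: contra nk => /eqP P1; move: eP.
  by rewrite P1 mulg1 => ->.
have Gp : p \in G by rewrite -eP (fintype.subsetP (mulG_subr K P)).
have np : p \notin K.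
  apply: contra p1 => Kp; have : p \in K :&: P by rewrite inE Kp.
  by rewrite tiKP inE.
have : p ^+ 2 != 1 by apply: noinv; rewrite inE np.
have : p ^+ 2 \in K :&: P by apply/finset.setIP; split; [exact: (index2_square sKG i2)|exact: groupX].
by rewrite tiKP inE => ->.
Qed.

Lemma list3_of_rotation_rep G K a : K \subset G -> #|G : K| = 2 ->
  {in G :\: K, forall g, g ^+ 2 != 1} -> rotation_rep K a ->
  [\/ list3a G, list3b G | list3c G K].
Proof.
move=> sKG i2 noinv /rotation_group_trichotomy[cK|dK|pK].
- case: (cyclic_index2 sKG i2 cK noinv) => [[n2 [mm [mp [A [u [C [adm tw _ e]]]]]]]|l4].
    by constructor 1; exists n2, mm, mp, A, u, C.
  by constructor 2; exact: list3b_of_list4a.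
- by constructor 3; exact: list3c_of_dihedral.
- by case: (polyhedral_no_extension pK sKG i2 noinv).
Qed.

Lemma card_twisted n2 mm mp (A C L : {group gT}) u : twisted n2 mm mp A u C ->
  (A ><| <[u]>) \x C = L -> #|L| = (mm * 2 ^ n2.+1 * mp)%N.
Proof.
move=> [[_ oA] ou _ [_ oC]] e; have [[B _ eB _] _ _ _] := dprodP e.
by rewrite -(dprod_card e) eB -(sdprod_card eB) oA oC -orderE ou.
Qed.

Lemma twisted_sub (A C L : {group gT}) u : (A ><| <[u]>) \x C = L ->
  [/\ A \subset L, u \in L & C \subset L].
Proof.
move=> e; have [[B _ eB _] _ _ _] := dprodP e; have eB' := sdprodW eB.
have eL := dprodW e; rewrite eB in eL.
have sBL : B \subset L by rewrite -eL mulG_subl.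
have sAB : A \subset B by rewrite -eB' mulG_subl.
split; first exact: fintype.subset_trans sAB sBL.
  by apply: (fintype.subsetP sBL); rewrite -cycle_subG -eB' mulG_subr.
by rewrite -eL mulG_subr.
Qed.

Section Four.
Variables (G H K L : {group gT}).
Variables a b : gT -> 'M[R]_3.
Hypotheses (sHG : H \subset G) (iH : #|G : H| = 2) (sLG : L \subset G) (iL : #|G : L| = 2).
Hypotheses (eK : L :&: H = K) (rep : pair_rep H K a b).
Hypothesis noinv : {in G :\: H, forall g, g ^+ 2 != 1}.
Hypothesis swap1 : {in G :\: H & H, forall t g, a g = 1%:M <-> b (g ^ t) = 1%:M}.
Hypothesis swap2 : {in G :\: H & H, forall t g, b g = 1%:M <-> a (g ^ t) = 1%:M}.

Let sKH : K \subset H := pair_sub rep.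
Let iK : #|H : K| = 2 := pair_index rep.
Let sKL : K \subset L. Proof. by rewrite -eK finset.subsetIl. Qed.

Lemma four_square g : g \in G -> g ^+ 2 \in K.
Proof. by move=> Gg; rewrite -eK inE (index2_square sHG iH) // (index2_square sLG iL). Qed.

Lemma four_normal : G \subset 'N(K).
Proof.
rewrite -eK; apply: normsI; apply: normal_norm; exact: index2_normal.
Qed.

Lemma four_card : #|G| = (4 * #|K|)%N /\ #|L : K| = 2.
Proof.
have oG : #|G| = (4 * #|K|)%N.
  by rewrite -(Lagrange sHG) iH -(Lagrange sKH) iK -mulnA mulnC.
split=> //; have := oG; rewrite -(Lagrange sLG) iL -(Lagrange sKL) -mulnA mulnC.
by move/eqP; rewrite eqn_pmul2r // => /eqP; case: #|L : K| => [|[|[|]]] //; lia.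
Qed.

(** An exchanging element t of 2-power order has t^2 in K and different from 1, and a power of t^2
    is an involution. *)
Lemma four_involution : exists2 k0, k0 \in K & #[k0] = 2.
Proof.
have [t Dt t2] := outer_two_element sHG iH.
have Kt : t ^+ 2 \in K by apply: four_square; case/finset.setDP: Dt.
have [[|j] oj] := p_natP (p_eltX 2 t2).
  by have := noinv Dt; rewrite -order_eq1 oj.
exists ((t ^+ 2) ^+ (2 ^ j)); first by rewrite groupX.
rewrite orderXdiv oj expnS ?dvdn_mull // mulnK ?expn_gt0 //.
Qed.

Lemma list4_of_pair_rep : list4 G.
Proof.
have [k0 Kk0 ok0] := four_involution.
have [oG iLK] := four_card.
case: (pair_rep_classification rep) => [[cH _]|[cK [h ph]]].
  (* When H is cyclic the twisted form is excluded by orders: u^2 lies in K and has order 2^n2,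
     while |K| = |G|/4 is exactly divisible by 2^(n2-1). *)
  left; case: (cyclic_index2 sHG iH cH noinv) => [[n2 [mm [mp [A [u [C [adm tw Du e]]]]]]]|//].
  have Ku : u ^+ 2 \in K by apply: four_square; case/finset.setDP: Du.
  have ou : #[u ^+ 2] = (2 ^ n2)%N.
    by have [_ ou _ _] := tw; rewrite orderXdiv ou expnS ?dvdn_mulr // mulKn.
  have := order_dvdG Ku; rewrite ou; have := card_twisted tw e; rewrite oG => e4.
  have [n20 o1 o2 _] := adm; case: n2 n20 {adm tw ou} e4 => // n _ e4.
  have {}e4 : #|K| = (mm * mp * 2 ^ n)%N.
    by apply/eqP; rewrite -(eqn_pmul2l (isT : 0 < 4)) e4 !expnS; apply/eqP; ring.
  rewrite e4 expnS dvdn_pmul2r ?expn_gt0 // dvdn2 oddM o1 o2.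
  by [].
right; have [Dh oh comm] : [/\ h \in H :\: K, #[h] = 2 & {in H, forall g, commute h g}].
  by case: ph => [[? ? ? _ _]|[? ? ? _ _]].
case/finset.setDP: (Dh) => Hh nh.
have Gh : h \in G := fintype.subsetP sHG h Hh.
have nLh : h \notin L by apply: contra nh => Lh; rewrite -eK inE Lh.
have h2 : h ^+ 2 = 1 by rewrite -oh expg_order.
have subH := fintype.subsetP sHG; have subK := fintype.subsetP sKH.
have uniq k : k \in K -> #[k] = 2 -> k = k0.
  have [y ey] := cyclicP cK; rewrite ey => yk ok.
  by apply: (involution_cycle yk ok) => //; rewrite -ey.
have k02 : k0 ^+ 2 = 1 by rewrite -ok0 expg_order.
have k0J t : t \in G -> k0 ^ t = k0.
  move=> Gt; apply: uniq; last by rewrite orderJ.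
  by rewrite memJ_norm // (fintype.subsetP four_normal).
(* Say a h = 1. Conjugation by the exchanging t carries this to the other factor: b (h ^ t) = 1,
   while b h = b k0. Hence b kills k0 h (h ^ t), an element of K, which is therefore trivial. *)
have hJ t : t \in G :\: H -> h ^ t = h * k0.
  move=> Dt; case/finset.setDP: (Dt) => Gt nt; have Nt := fintype.subsetP (normal_norm (index2_normal sHG iH)) t Gt.
  have Hht : h ^ t \in H by rewrite memJ_norm.
  have Khth : h * h ^ t \in K.
    by rewrite (index2_mul sKH iK) // memJ_norm // (fintype.subsetP four_normal).
  have Hk0 := subK _ Kk0; have Hhk : h * k0 \in H by rewrite groupM.
  have finish (c : gT -> 'M[R]_3) : rotation_hom H c -> {in K, forall x, c x = 1%:M -> x = 1} ->
      c (h ^ t) = 1%:M -> c h = c k0 -> h ^ t = h * k0.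
    move=> hc ic ct ck; suff e : k0 * (h * h ^ t) = 1.
      have V x : #[x] = 2 -> x^-1 = x.
        by move=> ox; apply/eqP; rewrite eq_invg_mul -expg2 -ox expg_order.
      by move/eqP: e; rewrite mulgA -eq_invg_mul invMg !V // => /eqP.
    apply: ic; first by rewrite groupM.
    rewrite (hc.1 _ _ Hk0 (groupM Hh Hht)) (hc.1 _ _ Hh Hht) ct mulmx1 ck -hc.1 // -expg2 k02.
    exact: rotation_hom1 hc.
  case: ph => -[_ _ _ h1 hk].
    have bt := (swap1 Dt Hh).1 h1; exact: finish (pair_hom2 rep) (pair_inj2 rep) bt (hk _ Kk0 ok0).
  have at' := (swap2 Dt Hh).1 h1; exact: finish (pair_hom1 rep) (pair_inj1 rep) at' (hk _ Kk0 ok0).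
have DL u : u \in L :\: K -> u \in G :\: H.
  case/finset.setDP=> Lu nu; rewrite inE (fintype.subsetP sLG) // andbT.
  by apply: contra nu => Hu; rewrite -eK inE Lu.
have noinvL : {in L :\: K, forall g, g ^+ 2 != 1} by move=> g Dg; apply/noinv/DL.
(* By the previous relation (u h)^2 = u^2 k0, so u^2 = k0 would make u h an exchanging
   involution. *)
have nok0 u : u \in L :\: K -> u ^+ 2 != k0.
  move=> Du; apply/negP => /eqP u2; have Dg := DL u Du; case/finset.setDP: (Dg) => Gu nu.
  have : (u * h) ^+ 2 != 1 by apply: noinv; rewrite inE groupMr // nu groupM.
  rewrite expgS expg1 -mulgA (mulgA h) (conjgC h) (hJ u) // !mulgA -expg2 u2.
  rewrite -(mulgA (k0 * h)) -expg2 expgMn ?k02 ?h2 ?mulg1 ?eqxx //.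
  exact/commute_sym/comm/subK.
case: (cyclic_index2 sKL iLK cK noinvL) => [[n2 [mm [mp [A [u [C [adm tw Du e]]]]]]]|]; last first.
  (* In a dicyclic factor q and k q have the same square, whose own square is 1. One of them lies
     off K, for otherwise A, and with the odd group C all of L, would lie in K; its square is then
     k0. *)
  case=> n2 [mm [mp [A [C [[n20 o1 o2 _] B [_ oC] e]]]]].
  have m0 : (0 < 2 ^ n2 * mm)%N by rewrite muln_gt0 expn_gt0 (odd_gt0 o1).
  have [oA [k [q [eA km kq]]]] := (binary_dihedralP A m0).1 B.
  have sAL : A \subset L by have [_ eL _ _] := dprodP e; rewrite -eL mulG_subl.
  have Aq : q \in A by rewrite -eA mem_gen // inE cycle_id orbT.
  have Ak : k \in A by rewrite -eA mem_gen // inE cycle_id.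
  have q4 : (q ^+ 2) ^+ 2 = 1.
    have e2 : q ^+ 2 = k ^- (2 ^ n2 * mm).
      by rewrite -expgVn -kq -conjXg km conjXg conjgE mulKg.
    by rewrite [LHS]expgS expg1 -{1}km e2 mulgV.
  have kq2 : (k * q) ^+ 2 = q ^+ 2.
    by rewrite expgS expg1 {1}(conjgC k) kq -mulgA mulKg.
  have [x [Ax nx x2]] : exists x, [/\ x \in A, x \notin K & x ^+ 2 = q ^+ 2].
    have [Kq|nq] := boolP (q \in K); last by exists q.
    have [Kkq|nkq] := boolP (k * q \in K); last by exists (k * q); rewrite groupM.
    have Kk : k \in K by rewrite -(mulgK q k) groupM ?groupV.
    have sAK : A \subset K by rewrite -eA join_subG !cycle_subG Kk.
    have sCL : C \subset L by have [_ eL _ _] := dprodP e; rewrite -eL mulG_subr.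
    have sCK : C \subset K.
      apply/fintype.subsetP => x Cx; apply: (index2_odd sKL iLK).
        exact: (fintype.subsetP sCL).
      by apply: dvdn_odd (order_dvdG Cx) _; rewrite oC.
    have : L \subset K by have [_ <- _ _] := dprodP e; rewrite mul_subG.
    by rewrite -indexg_eq1 iLK.
  have Dx : x \in L :\: K by rewrite inE nx (fintype.subsetP sAL).
  case/eqP: (nok0 x Dx); apply: uniq; first by rewrite (index2_square sKL iLK) // (fintype.subsetP sAL).
  by apply: nt_prime_order; rewrite ?noinvL // x2 q4.
have [n20 o1 o2 co] := adm; have [[cA oA] ou uA [cC oC]] := tw.
have [sAL Lu sCL] := twisted_sub e.
have oddK (B : {group gT}) : B \subset L -> odd #|B| -> B \subset K.
  move=> sBL oB; apply/fintype.subsetP => x Bx; apply: (index2_odd sKL iLK).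
    exact: (fintype.subsetP sBL).
  by apply: dvdn_odd oB; exact: order_dvdG.
have sAK : A \subset K by apply: oddK; rewrite ?oA.
have sCK : C \subset K by apply: oddK; rewrite ?oC.
have u2n : u ^+ (2 ^ n2) = k0.
  apply: uniq; last by rewrite orderXdiv ou expnS ?dvdn_mull // mulnK ?expn_gt0.
  by rewrite -(prednK n20) expnS expgM groupX // (index2_square sKL iLK).
have n21 : 1 < n2.
  rewrite ltn_neqAle n20 andbT; apply/negP => /eqP n1; case/eqP: (nok0 u Du).
  by rewrite -u2n -n1.
(* The antipodal element h serves as z: the relation h ^ u = h k0 with k0 = u^(2^n2) is the same as
   u ^ h = u^(1 + 2^n2). *)
exists n2, mm, mp, A, u, C, h; split=> //; split.
- by move=> x Ax; apply/conjg_fixP/commgP/commute_sym/comm/subK/(fintype.subsetP sAK).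
- by move=> x Cx; apply/conjg_fixP/commgP/commute_sym/comm/subK/(fintype.subsetP sCK).
- have k00 : k0 * k0 = 1 by rewrite -expg2.
  rewrite expgD expg1 u2n; apply: (mulgI h); rewrite -conjgC mulgA (conjgC h) (hJ u) ?DL //.
  by rewrite !mulgA -[_ * k0 * k0]mulgA k00 mulg1.
- by rewrite e; apply: (@involution_sdprod G L h) => //; rewrite inE nLh.
Qed.
End Four.

End ForwardLists.

(** * Representations of the rotation groups *)

Section AxialRotations.
Variable R : realType.
Local Notation V := 'rV[R]_3.

Definition rot (x : R) : 'M[R]_3 :=
  rows3 (vec3 1 0 0) (vec3 0 (cos x) (sin x)) (vec3 0 (- sin x) (cos x)).

Definition half_turn : 'M[R]_3 := rows3 (vec3 (-1) 0 0) (vec3 0 1 0) (vec3 0 0 (-1)).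

Lemma rows3_mul (u v w u' v' w' : V) : rows3 u v w *m rows3 u' v' w' =
  rows3 (u 0 0 *: u' + u 0 1 *: v' + u 0 2%:R *: w')
        (v 0 0 *: u' + v 0 1 *: v' + v 0 2%:R *: w')
        (w 0 0 *: u' + w 0 1 *: v' + w 0 2%:R *: w').
Proof.
have e (p : V) : p *m rows3 u' v' w' = p 0 0 *: u' + p 0 1 *: v' + p 0 2%:R *: w'.
  apply/rowP => j; rewrite !mxE sum_I3 !mxE /=.
  by [].
by rewrite mul_rows3 !e.
Qed.

Lemma vec3_comb (a b c : R) (p q r s t u x y z : R) :
  a *: vec3 p q r + b *: vec3 s t u + c *: vec3 x y z =
  vec3 (a * p + b * s + c * x) (a * q + b * t + c * y) (a * r + b * u + c * z).
Proof. by apply: row3P; rewrite !mxE. Qed.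

Lemma rot_mul x y : rot x *m rot y = rot (x + y).
Proof.
rewrite /rot rows3_mul !vec3E !vec3_comb cosD sinD.
by congr rows3; congr vec3; ring.
Qed.

Lemma rot0 : rot 0 = 1%:M.
Proof.
apply/matrixP; apply: forall_I3; apply: forall_I3;
  by rewrite !mxE /= ?cos0 ?sin0 ?oppr0 //.
Qed.

Lemma trmx_rot x : (rot x)^T = rot (- x).
Proof.
apply/matrixP; apply: forall_I3; apply: forall_I3;
  by rewrite !mxE /= ?cosN ?sinN ?opprK //.
Qed.

Lemma rot_orthogonal_mx x : orthogonal_mx (rot x).
Proof. by rewrite /orthogonal_mx trmx_rot rot_mul subrr rot0. Qed.

Lemma det_rot x : \det (rot x) = 1.
Proof.
rewrite /rot det_rows3 /cross dotE !vec3E -[RHS](cos2Dsin2 x); ring.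
Qed.

Lemma half_turn_orthogonal : orthogonal_mx half_turn.
Proof.
rewrite /orthogonal_mx; apply/matrixP; apply: forall_I3; apply: forall_I3;
  by rewrite !mxE sum_I3 !mxE /=; ring.
Qed.

Lemma det_half_turn : \det half_turn = 1.
Proof. rewrite /half_turn det_rows3 /cross dotE !vec3E; ring. Qed.

Lemma half_turn2 : half_turn *m half_turn = 1%:M.
Proof.
apply/matrixP; apply: forall_I3; apply: forall_I3;
  by rewrite !mxE sum_I3 !mxE /=; ring.
Qed.

Lemma half_turn_rot x : half_turn *m rot x = rot (- x) *m half_turn.
Proof.
rewrite /rot /half_turn !rows3_mul !vec3E !vec3_comb cosN sinN.
by congr rows3; congr vec3; ring.
Qed.

Lemma half_turn_neq_rot x : half_turn <> rot x.
Proof. by move/matrixP/(_ 0 0); rewrite !mxE /=; lra. Qed.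

Lemma rot1_sin x : rot x = 1%:M -> sin (x / 2) = 0.
Proof.
move/matrixP/(_ 1 1); rewrite !mxE /= => cx.
have : cos x = 1 - (sin (x / 2) ^+ 2) *+ 2.
  by rewrite {1}(_ : x = (x / 2) *+ 2) ?cos_mulr2n ?cos2sin2; field.
rewrite cx => e; have /eqP : sin (x / 2) ^+ 2 = 0 by lra.
by rewrite sqrf_eq0 => /eqP.
Qed.

Definition root_rot (N : nat) : 'M[R]_3 := rot (pi *+ 2 / N%:R).

Lemma root_rotX N j : root_rot N ^+ j = rot (pi *+ 2 * j%:R / N%:R).
Proof.
elim: j => [|j IH]; first by rewrite expr0 mulr0 mul0r rot0.
rewrite exprS IH -[_ * _]/(_ *m _) rot_mul; congr rot; rewrite -natr1; ring.
Qed.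

Lemma root_rotX_orthogonal N j : orthogonal_mx (root_rot N ^+ j).
Proof. by rewrite root_rotX; exact: rot_orthogonal_mx. Qed.

Lemma det_root_rotX N j : \det (root_rot N ^+ j) = 1.
Proof. by rewrite root_rotX det_rot. Qed.

Lemma root_rot_eq1 N j : (0 < N)%N -> (root_rot N ^+ j == 1) = (N %| j)%N.
Proof.
move=> N0; have N1 : N%:R != 0 :> R by rewrite pnatr_eq0 -lt0n.
have full : root_rot N ^+ N = 1.
  rewrite root_rotX mulfK // -[RHS]rot0 /rot -[pi *+ 2]add0r cosD2pi sinD2pi.
  by [].
apply/eqP/idP => [|/dvdnP[k ->]]; last by rewrite mulnC exprM full expr1n.
rewrite {1}(divn_eq j N) exprD mulnC exprM full expr1n mul1r root_rotX.
move=> /rot1_sin h; rewrite /dvdn; apply: contraT; rewrite -lt0n => r0.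
have := ltn_pmod j N0; move: (j %% N)%N r0 h => r r0 h rN.
have : 0 < sin (pi *+ 2 * r%:R / N%:R / 2 : R).
  have -> : pi *+ 2 * r%:R / N%:R / 2 = pi * (r%:R / N%:R) :> R.
    by rewrite -mulr_natr; field.
  have p0 := pi_gt0 R.
  have q0 : 0 < r%:R / N%:R :> R by rewrite divr_gt0 // ltr0n.
  have q1 : r%:R / N%:R < 1 :> R by rewrite ltr_pdivrMr ?ltr0n // mul1r ltr_nat.
  by apply: sin_gt0_pi; rewrite mulr_gt0 //= gtr_pMr.
by rewrite h ltxx.
Qed.

Lemma root_rot_eqmod N i j : (0 < N)%N -> (i = j %[mod N])%N ->
  root_rot N ^+ i = root_rot N ^+ j.
Proof.
move=> N0 e; have p k : root_rot N ^+ k = root_rot N ^+ (k %% N).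
  rewrite {1}(divn_eq k N) exprD mulnC exprM.
  have /eqP -> : root_rot N ^+ N == 1 by rewrite root_rot_eq1.
  by rewrite expr1n mul1r.
by rewrite p e -p.
Qed.

End AxialRotations.

(** * Cyclic, dihedral and octahedral groups inside SO(3) *)

Section Embeddings.
Local Close Scope classical_set_scope.
Local Open Scope nat_scope.
Local Open Scope group_scope.
Variable R : realType.
Implicit Types gT aT : finGroupType.

Lemma discrete_log gT (x : gT) : exists e : gT -> nat,
  {in <[x]>, forall g, g = x ^+ e g} /\
  {in <[x]> &, forall g h, e (g * h) = e g + e h %[mod #[x]]}.
Proof.
have /choice[e he] : forall g, exists i, g \in <[x]> -> g = x ^+ i.
  move=> g; have [/cycleP[i ->]|] := boolP (g \in <[x]>); first by exists i.
  by exists 0.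
exists e; split=> // g h xg xh; apply/eqP; rewrite -eq_expg_mod_order expgD.
by rewrite -!he // groupM.
Qed.

Lemma rotation_rep_isog gT aT (K : {group gT}) (L : {group aT}) (a : aT -> 'M[R]_3) :
  K \isog L -> rotation_rep L a -> exists b : gT -> 'M[R]_3, rotation_rep K b.
Proof.
case/isogP => f injf fK r; exists (a \o f).
have fL x : x \in K -> f x \in L by move=> Kx; rewrite -fK mem_morphim.
split=> [x y Kx Ky|x Kx|x Kx|x Kx] /=.
- by rewrite morphM // (rotM r) ?fL.
- exact: (rot_orthogonal r (fL x Kx)).
- exact: (rot_det r (fL x Kx)).
- move/(rot_inj r (fL x Kx)) => fx.
  by apply/eqP; rewrite -(morph_injm_eq1 injf) //; apply/eqP.
Qed.

Lemma cyclic_embedding gT (K : {group gT}) : cyclic K ->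
  exists a : gT -> 'M[R]_3, rotation_rep K a.
Proof.
move=> cK; have [x ex] := cyclicP cK; have [e] := discrete_log x.
rewrite -ex => -[eX eM].
exists (fun g => root_rot R #[x] ^+ e g)%R; split=> [g h Kg Kh|g Kg|g Kg|g Kg].
- by rewrite -[RHS]exprD; apply: root_rot_eqmod; rewrite ?order_gt0 ?eM.
- exact: root_rotX_orthogonal.
- exact: det_root_rotX.
- move/eqP; rewrite root_rot_eq1 ?order_gt0 // => d.
  by rewrite (eX g Kg); apply/eqP; rewrite -order_dvdn.
Qed.

(** x is sent to a rotation about the first coordinate axis and y to the half turn about the second;
    an element g off <x> is split as (g y) y. *)
Lemma dihedral_embedding gT (K : {group gT}) x y : <[x]> \subset K -> #|K : <[x]>| = 2 ->
  y \in K -> y \notin <[x]> -> y ^+ 2 = 1 -> x ^ y = x^-1 ->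
  exists a : gT -> 'M[R]_3, rotation_rep K a.
Proof.
move=> sXK i2 Ky ny y2 xy; have [e [eX eM]] := discrete_log x.
pose r g := (root_rot R #[x] ^+ e g)%R.
have rM g h : g \in <[x]> -> h \in <[x]> -> r (g * h) = r g *m r h.
  by move=> xg xh; rewrite -[RHS]exprD; apply: root_rot_eqmod; rewrite ?order_gt0 ?eM.
have ro g : orthogonal_mx (r g) by exact: root_rotX_orthogonal.
have rinj g : g \in <[x]> -> r g = 1%:M -> g = 1.
  move=> xg /eqP; rewrite root_rot_eq1 ?order_gt0 // => d.
  by rewrite (eX g xg); apply/eqP; rewrite -order_dvdn.
have r1 : r 1 = 1%:M.
  have := rM 1 1 (group1 _) (group1 _); rewrite mulg1 => e1.
  by rewrite -(orthogonalT (ro 1)) {3}e1 mulmxA orthogonalT // mul1mx.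
have rV g : g \in <[x]> -> r g^-1 = (r g)^T.
  move=> xg; rewrite -[LHS]mul1mx -(orthogonalT (ro g)) -mulmxA -rM ?groupV //.
  by rewrite mulgV r1 mulmx1.
have tr g : half_turn R *m r g = (r g)^T *m half_turn R.
  by rewrite /r root_rotX trmx_rot half_turn_rot.
have yV : y^-1 = y by apply/eqP; rewrite eq_invg_mul -expg2 y2.
have gJ g : g \in <[x]> -> y * g * y = g^-1.
  by case/cycleP=> i ->; rewrite -{1}yV -mulgA -conjgE conjXg xy expgVn.
have sub := fintype.subsetP sXK.
have yy g : g * y * y = g by rewrite -mulgA -expg2 y2 mulg1.
have Xy g : g \in K -> g \notin <[x]> -> g * y \in <[x]>.
  by move=> Kg ng; exact: (index2_mul sXK i2).
exists (fun g => if g \in <[x]> then r g else r (g * y) *m half_turn R).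
split=> [g h Kg Kh|g Kg|g Kg|g Kg].
- case: (boolP (g \in <[x]>)) => xg; case: (boolP (h \in <[x]>)) => xh /=.
  + by rewrite groupM // rM.
  + by rewrite groupMl // (negPf xh) -mulgA (rM g) ?Xy // -mulmxA.
  + rewrite groupMr // (negPf xg) -(mulmxA (r _)) tr -rV // mulmxA -rM ?groupV ?Xy //.
    by rewrite -(gJ h xh) !mulgA yy.
  + rewrite (index2_mul sXK i2) // -(mulmxA (r _)) (mulmxA (half_turn R)) tr.
    rewrite -(mulmxA _ (half_turn R)) half_turn2 mulmx1 -rV ?Xy // -rM ?groupV ?Xy //.
    by rewrite -(gJ (h * y)) ?Xy // !mulgA yy -(mulgA _ y y) -expg2 y2 mulg1.
- by case: ifP => _; [exact: ro|apply: orthogonalM => //; exact: half_turn_orthogonal].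
- by case: ifP => _; rewrite ?det_mulmx ?det_half_turn det_root_rotX ?mulr1.
- case: ifP => [xg|nxg]; first exact: rinj.
  move=> e1; case: (@half_turn_neq_rot R (- (pi *+ 2 * (e (g * y)%g)%:R / #[x]%:R))%R).
  rewrite -trmx_rot -root_rotX -[LHS]mul1mx -(orthogonalT (ro (g * y))) -mulmxA e1.
  by rewrite mulmx1.
Qed.

Lemma dihedral_structure gT (K : {group gT}) n : 1 < n -> K \isog 'D_(n.*2) ->
  exists x y, [/\ <[x]> \subset K, #|K : <[x]>| = 2, y \in K :\: <[x]>,
                  y ^+ 2 = 1 & x ^ y = x^-1].
Proof.
move=> n1 iso.
have oK : #|K| = n.*2 by rewrite (card_isog iso) card_dihedral // half_double.
have : K \homg Grp (x : y : (x ^+ n, y ^+ 2, x ^ y = x^-1)).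
  have := isoGrp_hom (isoGrp_trans iso (Grp_dihedral n1)).
  by [].
case/existsP=> -[x y] /= /eqP[defK xn y2 xy].
have Nxy : <[y]> \subset 'N(<[x]>) by rewrite cycle_subG; apply/normP; rewrite -cycleJ xy cycleV.
have sXK : <[x]> \subset K by rewrite -defK joing_subl.
have Ky : y \in K by rewrite -cycle_subG -defK joing_subr.
have le : #[x] <= n by rewrite dvdn_leq ?order_dvdn ?xn // ltnW.
have ny : y \notin <[x]>.
  apply/negP => xy'; have e : <[x]> = K :> {set gT}.
    by rewrite -defK; apply/esym/joing_idPl; rewrite cycle_subG.
  by move: le; rewrite orderE e oK -addnn leqNgt -{1}(addn0 n) ltn_add2l (ltnW n1).
have oK' := card_join_square (fintype.subsetP Nxy y (cycle_id y)) ny.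
have {}oK' : #|K| = (2 * #|<[x]>|)%N by rewrite -oK' ?y2 ?group1 // [gval <[x]>%G]/= defK.
exists x, y; split=> //; last by rewrite inE ny.
by apply/eqP; rewrite -(eqn_pmul2l (cardG_gt0 <[x]>)) Lagrange // oK' mulnC.
Qed.

Lemma dihedral_isog_embedding gT (K : {group gT}) n : 1 < n -> K \isog 'D_(n.*2) ->
  exists a : gT -> 'M[R]_3, rotation_rep K a.
Proof.
move=> n1 /(dihedral_structure n1)[x [y [sX i2 /finset.setDP[Ky ny] y2 xy]]].
exact: dihedral_embedding sX i2 Ky ny y2 xy.
Qed.

Local Open Scope ring_scope.

(** The columns are the vertices of a regular tetrahedron, and the rows span the complement of (1,
    1, 1, 1) in R^4. Compressing permutation matrices by it gives the three-dimensional summand of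
    the permutation representation. *)
Definition hadamard : 'M[R]_(3, 4) := \matrix_(i, j)
  nth 0 (nth [::] [:: [:: 1; 1; -1; -1]; [:: 1; -1; 1; -1]; [:: 1; -1; -1; 1]] i) j.

Lemma forall_I4 (P : 'I_4 -> Prop) : P 0 -> P 1 -> P 2%:R -> P 3%:R -> forall i, P i.
Proof.
move=> P0 P1 P2 P3 [[|[|[|[|//]]]] lti].
- by rewrite (_ : Ordinal lti = 0) //; apply: val_inj.
- by rewrite (_ : Ordinal lti = 1) //; apply: val_inj.
- by rewrite (_ : Ordinal lti = 2%:R) //; apply: val_inj.
- by rewrite (_ : Ordinal lti = 3%:R) //; apply: val_inj.
Qed.

Lemma hadamard_rows : hadamard *m hadamard^T = 4%:R%:M.
Proof.
apply/matrixP; apply: forall_I3; apply: forall_I3;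
  rewrite !mxE !big_ord_recr big_ord0 /= !mxE /=; ring.
Qed.

Lemma hadamard_columns : hadamard^T *m hadamard = 4%:R%:M - const_mx 1.
Proof.
apply/matrixP; apply: forall_I4; apply: forall_I4;
  rewrite !mxE sum_I3 !mxE /=; ring.
Qed.

Lemma hadamard_sum : hadamard *m (const_mx 1 : 'M_4) = 0.
Proof.
apply/matrixP; apply: forall_I3 => j;
  rewrite !mxE !big_ord_recr big_ord0 /= !mxE /=; ring.
Qed.

Lemma perm_const (s : 'S_4) : perm_mx s *m const_mx 1 = const_mx 1 :> 'M[R]_4.
Proof. by rewrite -row_permE; apply/matrixP => i j; rewrite !mxE. Qed.

Definition hadamard_conj (s : 'S_4) : 'M[R]_3 := 4^-1 *: (hadamard *m perm_mx s *m hadamard^T).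

Lemma hadamard_conjM s t : hadamard_conj (s * t)%g = hadamard_conj s *m hadamard_conj t.
Proof.
rewrite /hadamard_conj -scalemxAl -scalemxAr scalerA !mulmxA.
rewrite -(mulmxA _ hadamard^T hadamard) hadamard_columns mulmxBr.
have -> : hadamard *m perm_mx s *m (const_mx 1 : 'M[R]_4) = 0 by rewrite -mulmxA perm_const hadamard_sum.
rewrite subr0 scalar_mxC mul_scalar_mx -!scalemxAl scalerA perm_mxM !mulmxA.
by congr (_ *: _); field.
Qed.

Lemma hadamard_conj1 : hadamard_conj 1%g = 1%:M.
Proof.
rewrite /hadamard_conj perm_mx1 mulmx1 hadamard_rows scale_scalar_mx.
by congr (_%:M); field.
Qed.

Lemma hadamard_conj_orthogonal s : orthogonal_mx (hadamard_conj s).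
Proof.
rewrite /orthogonal_mx (_ : (hadamard_conj s)^T = hadamard_conj s^-1%g).
  by rewrite -hadamard_conjM mulgV hadamard_conj1.
by rewrite /hadamard_conj linearZ /= !trmx_mul trmxK tr_perm_mx mulmxA.
Qed.

(** Carried back to R^4, the diagonal entries of the equation read 16 [s i = i] - 4 = 12 c, which is
    impossible if i is moved. *)
Lemma hadamard_conj_scalar s (c : R) : c = 1 \/ c = -1 -> hadamard_conj s = c%:M -> s = 1%g.
Proof.
move=> hc e.
have e1 : (4%:R%:M - const_mx 1) *m perm_mx s *m (4%:R%:M - const_mx 1) =
    (4 * c) *: (4%:R%:M - const_mx 1) :> 'M[R]_4.
  rewrite -hadamard_columns; transitivity (hadamard^T *m (4 *: hadamard_conj s) *m hadamard).
    by rewrite /hadamard_conj scalerA mulfV ?scale1r ?mulmxA // pnatr_eq0.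
  by rewrite e scale_scalar_mx scalar_mxC -mulmxA mul_scalar_mx.
have e2 i : 16 * (s i == i)%:R - 4 = 12 * c :> R.
  pose J : 'M[R]_4 := const_mx 1; pose P : 'M[R]_4 := perm_mx s.
  have PJ : P *m J = J by exact: perm_const.
  have JP : J *m P = J.
    by rewrite -[LHS]trmxK trmx_mul tr_perm_mx trmx_const perm_const trmx_const.
  have JJ : J *m J = 4 *: J.
    by apply/matrixP => k l; rewrite !mxE !big_ord_recr big_ord0 /= !mxE; ring.
  move: e1; rewrite -/J -/P !mulmxBl !mulmxBr !mul_scalar_mx JP.
  rewrite !mul_mx_scalar -!scalemxAl PJ JJ => /matrixP/(_ i i).
  by rewrite !mxE eqxx /=; lra.
apply/permP => i; rewrite perm1; apply/eqP; have := e2 i.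
by case: eqP => // _; rewrite mulr0; case: hc => ->; lra.
Qed.

(** Twisting by the determinant turns the symmetries of the tetrahedron into the rotations of the
    cube. *)
Lemma Sym4_embedding : exists a : {perm 'I_4} -> 'M[R]_3, rotation_rep 'Sym_('I_4) a.
Proof.
pose d s := \det (hadamard_conj s).
have d2 s : d s = 1 \/ d s = -1 := orthogonal_det (hadamard_conj_orthogonal s).
have dd s : d s * d s = 1 by case: (d2 s) => ->; ring.
have Z (A B : 'M[R]_3) (c e : R) : (c *: A) *m (e *: B) = (c * e) *: (A *m B).
  by rewrite -scalemxAl -scalemxAr scalerA.
exists (fun s => d s *: hadamard_conj s); split=> [s t _ _|s _|s _|s _].
- by rewrite Z -hadamard_conjM /d hadamard_conjM det_mulmx.
- have o := hadamard_conj_orthogonal s.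
  have e : (d s *: hadamard_conj s)^T = d s *: (hadamard_conj s)^T by exact: linearZ.
  by rewrite /orthogonal_mx e Z o dd scale1r.
- by rewrite detZ -/(d s) exprS expr2 dd mulr1 dd.
- move=> e; apply: (hadamard_conj_scalar (d2 s)).
  by rewrite -[LHS]scale1r -(dd s) -scalerA e scalemx1.
Qed.

Lemma rotation_repS gT (K L : {group gT}) (a : gT -> 'M[R]_3) : K \subset L ->
  rotation_rep L a -> rotation_rep K a.
Proof.
move=> /fintype.subsetP sKL r; split=> [x y Kx Ky|x Kx|x Kx|x Kx].
- by rewrite (rotM r) ?sKL.
- exact: (rot_orthogonal r (sKL x Kx)).
- exact: (rot_det r (sKL x Kx)).
- exact: (rot_inj r (sKL x Kx)).
Qed.

End Embeddings.

(** * The rotation group of the icosahedron *)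

Section Icosahedron.
Variable R : realType.
Local Notation V := 'rV[R]_3.

Lemma rotation_symmetries n (v : 'I_n -> V) : injective v ->
  (forall A B : 'M[R]_3, (forall i, v i *m A = v i *m B) -> A = B) ->
  exists (T : {group {perm 'I_n}}) (a : {perm 'I_n} -> 'M[R]_3), rotation_rep T a /\
    forall (s : {perm 'I_n}) M, orthogonal_mx M -> \det M = 1 -> (forall i, v i *m M = v (s i)) -> s \in T.
Proof.
move=> vinj span.
pose realizes (s : {perm 'I_n}) (M : 'M[R]_3) := [/\ orthogonal_mx M, \det M = 1 & forall i, v i *m M = v (s i)].
pose T : {set {perm 'I_n}} := finset (fun s => `[< exists M, realizes s M >]).
have inT s M : realizes s M -> s \in T by move=> h; rewrite inE; apply/asboolP; exists M.
have rM s t M N : realizes s M -> realizes t N -> realizes (s * t)%g (M *m N).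
  move=> [oM dM sM] [oN dN tN]; split; first exact: orthogonalM.
    by rewrite det_mulmx dM dN mulr1.
  by move=> i; rewrite mulmxA sM tN permM.
have memT s : (s \in T) = `[< exists M, realizes s M >] by rewrite inE.
have gT : group_set T.
  apply/group_setP; split=> [|s t].
    by apply: (inT _ 1%:M); split; [exact: orthogonal1|rewrite det1|move=> i; rewrite mulmx1 perm1].
  rewrite !memT => /asboolP[M sM] /asboolP[N tN]; apply/asboolP; exists (M *m N).
  exact: rM.
have /choice[a ha] : forall s, exists M, s \in T -> realizes s M.
  move=> s; have [|] := boolP (s \in T); last by exists 0.
  by rewrite inE => /asboolP[M]; exists M.
exists (Group gT), a; split; last by move=> s M oM dM sM; apply: (inT s M).
split=> [s t sT tT|s /ha[]|s /ha[]|s /ha[_ _ sE] e] //.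
- have [_ _ e1] := rM _ _ _ _ (ha s sT) (ha t tT).
  have [_ _ e2] := ha _ (@groupM _ (Group gT) _ _ sT tT).
  by apply: span => i; rewrite e1 e2.
- by apply/permP => i; apply: vinj; rewrite perm1 -sE e mulmx1.
Qed.

(** The golden ratio. *)
Let phi : R := (1 + Num.sqrt 5) / 2.

Let phi2 : phi * phi = phi + 1.
Proof.
have s5 : Num.sqrt 5 * Num.sqrt 5 = 5 :> R by rewrite -expr2 sqr_sqrtr.
by rewrite /phi; lra.
Qed.

Let phi_gt0 : 0 < phi.
Proof. by rewrite /phi divr_gt0 // addr_gt0 // sqrtr_gt0. Qed.

Definition icosahedron (i : 'I_12) : V := nth 0
  [:: vec3 0 1 phi; vec3 0 1 (- phi); vec3 0 (-1) phi; vec3 0 (-1) (- phi);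
      vec3 phi 0 1; vec3 (- phi) 0 1; vec3 phi 0 (-1); vec3 (- phi) 0 (-1);
      vec3 1 phi 0; vec3 1 (- phi) 0; vec3 (-1) phi 0; vec3 (-1) (- phi) 0] i.

(** The rotation of order 5 about the vertex (0, 1, phi). *)
Definition rotation5 : 'M[R]_3 :=
  rows3 (vec3 ((phi - 1) / 2) (phi / 2) (- 1 / 2)) (vec3 (- phi / 2) (1 / 2) ((phi - 1) / 2))
        (vec3 (1 / 2) ((phi - 1) / 2) (phi / 2)).

Definition rotation3 : 'M[R]_3 := rows3 (vec3 0 1 0) (vec3 0 0 1) (vec3 1 0 0).

Lemma perm_of_list (l : seq nat) (k : nat) : all (fun i => i < 12)%N l ->
  size l = 12 -> (forall i, (i < 12)%N -> iter k.+1 (nth 0%N l) i = i) ->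
  exists s : {perm 'I_12}, (forall i, s i = nth 0%N l i :> nat) /\ (s ^+ k.+1 = 1)%g.
Proof.
move=> al sl it; have lt (i : 'I_12) : (nth 0 l i < 12)%N by apply: (all_nthP 0%N al); rewrite sl.
pose f i := Ordinal (lt i).
have fk j (i : 'I_12) : iter j f i = iter j (nth 0%N l) i :> nat by elim: j => //= j ->.
have fid i : iter k.+1 f i = i by apply: val_inj; rewrite /= -[RHS](it i (ltn_ord i)) -(fk k.+1).
have finj : injective f.
  by apply: (can_inj (g := iter k f)) => i; rewrite -iterSr fid.
exists (perm finj); split=> [i|]; first by rewrite permE.
apply/permP => i; rewrite perm1 permX -[RHS]fid; apply: eq_iter => j; exact: permE.
Qed.

Lemma icosahedron_span (A B : 'M[R]_3) :
  (forall i, icosahedron i *m A = icosahedron i *m B) -> A = B.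
Proof.
move=> h; have pair (i j : 'I_12) k : icosahedron i + icosahedron j = 2 *: delta_mx 0 k ->
    row k A = row k B.
  move=> e; have e2 (C : 'M[R]_3) : row k C = 2^-1 *: (icosahedron i *m C + icosahedron j *m C).
    by rewrite -mulmxDl e -scalemxAl scalerA mulVf ?scale1r -?rowE // pnatr_eq0.
  by rewrite !e2 !h.
apply/row_matrixP; apply: forall_I3.
- apply: (pair (@Ordinal 12 8 isT) (@Ordinal 12 9 isT)).
  by apply: row3P; rewrite /icosahedron /= !mxE /=; ring.
- apply: (pair (@Ordinal 12 0 isT) (@Ordinal 12 1 isT)).
  by apply: row3P; rewrite /icosahedron /= !mxE /=; ring.
- apply: (pair (@Ordinal 12 4 isT) (@Ordinal 12 5 isT)).
  by apply: row3P; rewrite /icosahedron /= !mxE /=; ring.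
Qed.

Lemma vec3_inj (a b c a' b' c' : R) : vec3 a b c = vec3 a' b' c' -> [/\ a = a', b = b' & c = c'].
Proof.
move=> e; split.
- by have /rowP/(_ 0) := e; rewrite !vec3E.
- by have /rowP/(_ 1) := e; rewrite !vec3E.
- by have /rowP/(_ 2%:R) := e; rewrite !vec3E.
Qed.

Lemma icosahedron_inj : injective icosahedron.
Proof.
have p0 := phi_gt0; move=> [i hi] [j hj] e; apply: val_inj => /=; move: e; rewrite /icosahedron /=.
case: i hi => [|[|[|[|[|[|[|[|[|[|[|[|i]]]]]]]]]]]] //= _; case: j hj => [|[|[|[|[|[|[|[|[|[|[|[|j]]]]]]]]]]]] //= _; by move=> /vec3_inj[] *; exfalso; lra.
Qed.

Lemma vec3_mul_rows3 (a b c p q r s t u x y z : R) :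
  vec3 a b c *m rows3 (vec3 p q r) (vec3 s t u) (vec3 x y z) =
  vec3 (a * p + b * s + c * x) (a * q + b * t + c * y) (a * r + b * u + c * z).
Proof. by apply: row3P; rewrite !mxE sum_I3 !mxE. Qed.

(** The permutations of the vertices induced by the rotations of order 5 and 3. Given as lists of
    indices, their orders and the failure to commute are settled by computation. *)
Let list5 := [:: 0; 7; 4; 3; 8; 2; 1; 11; 10; 6; 5; 9]%N.
Let list3' := [:: 4; 5; 6; 7; 8; 9; 10; 11; 0; 1; 2; 3]%N.

Lemma rotation5_icosahedron (i j : 'I_12) : j = nth 0%N list5 i :> nat ->
  icosahedron i *m rotation5 = icosahedron j.
Proof.
have h := phi2; move=> e; rewrite {2}/icosahedron e /icosahedron; case: i {e} => i hi /=.
by case: i hi => [|[|[|[|[|[|[|[|[|[|[|[|i]]]]]]]]]]]] //= _; rewrite /rotation5 vec3_mul_rows3;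
  congr vec3; lra.
Qed.

Lemma rotation3_icosahedron (i j : 'I_12) : j = nth 0%N list3' i :> nat ->
  icosahedron i *m rotation3 = icosahedron j.
Proof.
move=> e; rewrite {2}/icosahedron e /icosahedron; case: i {e} => i hi /=.
by case: i hi => [|[|[|[|[|[|[|[|[|[|[|[|i]]]]]]]]]]]] //= _; rewrite /rotation3 vec3_mul_rows3;
  congr vec3; ring.
Qed.

Lemma rotation5_SO : orthogonal_mx rotation5 /\ \det rotation5 = 1.
Proof.
have h := phi2; have h3 : phi * phi * phi = 2 * phi + 1 by rewrite h mulrDl h; ring.
split; last by rewrite /rotation5 det_rows3 /cross dotE !vec3E; lra.
by apply/matrixP; apply: forall_I3; apply: forall_I3; rewrite !mxE sum_I3 !mxE /=; lra.
Qed.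

Lemma rotation3_SO : orthogonal_mx rotation3 /\ \det rotation3 = 1.
Proof.
split; last by rewrite /rotation3 det_rows3 /cross dotE !vec3E; lra.
by apply/matrixP; apply: forall_I3; apply: forall_I3; rewrite !mxE sum_I3 !mxE /=; ring.
Qed.

(** The order of the symmetry group is never computed. Elements of odd order in a dihedral group lie
    in its cyclic half and commute, and 5 divides neither 12 nor 24. *)
Lemma Alt5_embedding : exists a : {perm 'I_5} -> 'M[R]_3, rotation_rep 'Alt_('I_5) a.
Proof.
have [T [a [ra inT]]] := rotation_symmetries icosahedron_inj icosahedron_span.
have [s [sE s5]] : exists s : {perm 'I_12}, (forall i, s i = nth 0%N list5 i :> nat) /\ (s ^+ 5 = 1)%g.
  by apply: perm_of_list => // i; do 12 (case: i => [|i] //).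
have [t [tE t3]] : exists t : {perm 'I_12}, (forall i, t i = nth 0%N list3' i :> nat) /\ (t ^+ 3 = 1)%g.
  by apply: perm_of_list => // i; do 12 (case: i => [|i] //).
have Ts : s \in T by apply: (inT s rotation5); [apply rotation5_SO..|move=> i; apply: rotation5_icosahedron].
have Tt : t \in T by apply: (inT t rotation3); [apply rotation3_SO..|move=> i; apply: rotation3_icosahedron].
have nst : (s * t != t * s)%g.
  apply/eqP => /permP/(_ (@Ordinal 12 0 isT))/(congr1 val).
  by rewrite !permM /= !sE !tE sE.
have os : #[s]%g = 5%N.
  apply: nt_prime_order => //; apply: contraNneq nst => ->; by rewrite mulg1 mul1g.
have ot : #[t]%g = 3%N.
  apply: nt_prime_order => //; apply: contraNneq nst => ->; by rewrite mulg1 mul1g.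
suff iT : T \isog 'Alt_('I_5) by apply: rotation_rep_isog ra; rewrite isog_sym.
have d5 : (5 %| #|T|)%N by have := order_dvdG Ts; rewrite os.
case: (rotation_group_trichotomy ra) => [cT|[n n1 dT]|/polyhedral_isog[iT|iT|//]].
- by case/eqP: nst; apply: (centsP (cyclic_abelian cT)).
- have [x [y [sX i2 _ _ _]]] := dihedral_structure n1 dT.
  have xs : s \in <[x]>%g by apply: (index2_odd sX i2); rewrite ?os.
  have xt : t \in <[x]>%g by apply: (index2_odd sX i2); rewrite ?ot.
  by case/eqP: nst; apply: (centsP (cycle_abelian x)).
- have c : #|('Alt_('I_4))%g| = 12%N by apply: double_inj; rewrite -mul2n card_Alt card_ord.
  by move: d5; rewrite (card_isog iT) c.
- by move: d5; rewrite (card_isog iT) card_Sym card_ord.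
Qed.

End Icosahedron.

(** * Image of the action on homology *)

Section HomologyImage.
Local Notation H2b w e := (H2_action w ((-1) ^+ nat_of_bool e)).

Lemma H2b1 : H2b false false = 1%:M.
Proof. by []. Qed.

Lemma H2b_minus : H2b false true = minus_id.
Proof. by rewrite /H2_action expr1 /minus_id raddfN. Qed.

Lemma H2b_swap : H2b true false = swap_mx.
Proof. by rewrite /H2_action expr0 scale1r. Qed.

Lemma swap_mx2 : swap_mx *m swap_mx = 1%:M.
Proof.
apply/matrixP => i j; rewrite !mxE !big_ord_recr big_ord0 /= !mxE.
by case: i => -[|[|//]] hi; case: j => -[|[|//]] hj.
Qed.

Lemma H2b_mul w e w' e' : H2b w e *m H2b w' e' = H2b (w (+) w') (e (+) e').
Proof.
rewrite /H2_action signr_addb; case: w; case: w' => /=.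
- by rewrite -scalemxAl -scalemxAr scalerA swap_mx2 scalemx1.
- by rewrite -scalemxAl mul_mx_scalar scalerA.
- by rewrite mul_scalar_mx scalerA.
- by rewrite -scalar_mxM.
Qed.

Lemma H2b_inv w e : invmx (H2b w e) = H2b w e.
Proof.
have h : H2b w e *m H2b w e = 1%:M by rewrite H2b_mul !addbb.
have [u _] := mulmx1_unit h.
by rewrite -[LHS]mulmx1 -h mulmxA mulVmx // mul1mx.
Qed.

Lemma H2b_inj w e w' e' : H2b w e = H2b w' e' -> w = w' /\ e = e'.
Proof.
move/matrixP => h; have := h 0 0; have := h 0 1; rewrite /H2_action.
by case: w {h}; case: w'; case: e; case: e'; rewrite !mxE /=.
Qed.

(** All images lie in the Klein four-group of the matrices (-1)^e times the w-th power of the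
    exchange. Its subgroups are coded by predicates on the two bits, and each of their elements is a
    product of at most two generators. *)
Lemma generated_mxE (S : set 'M[int]_2) (P : bool -> bool -> bool) :
  P false false -> (forall w e w' e', P w e -> P w' e' -> P (w (+) w') (e (+) e')) ->
  S `<=` [set N | exists w e, P w e /\ N = H2b w e] ->
  (forall w e, P w e -> H2b w e = 1%:M \/ S (H2b w e) \/
     exists w1 e1 w2 e2, [/\ S (H2b w1 e1), S (H2b w2 e2) & H2b w e = H2b w1 e1 *m H2b w2 e2]) ->
  generated_mx S = [set N | exists w e, P w e /\ N = H2b w e].
Proof.
move=> P1 PM SP gen; apply/seteqP; split=> N.
  apply; first exact: SP.
  - by exists false, false.
  - move=> _ _ [w [e [Pwe ->]]] [w' [e' [Pwe' ->]]]; exists (w (+) w'), (e (+) e').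
    by rewrite H2b_mul; split=> //; exact: PM.
  - by move=> _ [w [e [Pwe ->]]]; exists w, e; rewrite H2b_inv.
move=> [w [e [Pwe ->]]] Q SQ Q1 QM QV.
case: (gen w e Pwe) => [->//|[/SQ//|[w1 [e1 [w2 [e2 [/SQ q1 /SQ q2 ->]]]]]]].
exact: QM.
Qed.

Lemma generated_minus : generated_mx [set minus_id] =
  [set N | exists w e, ~~ w /\ N = H2b w e].
Proof.
apply: (generated_mxE (P := fun w _ => ~~ w)) => //.
- by move=> [] e [] e'.
- by move=> _ ->; exists false, true; rewrite H2b_minus.
- by move=> [] [] // _; [right; left; rewrite H2b_minus|left].
Qed.

Lemma generated_swap : generated_mx [set swap_mx] =
  [set N | exists w e, ~~ e /\ N = H2b w e].
Proof.
apply: (generated_mxE (P := fun _ e => ~~ e)) => //.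
- by move=> w [] w' [].
- by move=> _ ->; exists true, false; rewrite H2b_swap.
- by move=> [] [] // _; [right; left; rewrite H2b_swap|left].
Qed.

Lemma generated_minus_swap : generated_mx [set minus_id; swap_mx] =
  [set N | exists w e, true /\ N = H2b w e].
Proof.
apply: (generated_mxE (P := fun _ _ => true)) => //.
- by move=> _ [] ->; [exists false, true; rewrite H2b_minus|exists true, false; rewrite H2b_swap].
- move=> [] [] // _; last by left.
  + right; right; exists false, true, true, false; rewrite H2b_minus H2b_swap; split; [by left|by right|].
    by rewrite -H2b_minus -H2b_swap H2b_mul.
  + by right; left; right; rewrite H2b_swap.
  + by right; left; left; rewrite H2b_minus.
Qed.

Lemma trivial_image : [set 1%:M] = [set N | exists w e, (~~ w && ~~ e) /\ N = H2b w e].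
Proof.
apply/seteqP; split=> [_ ->|N [w [e [/andP[/negPf-> /negPf->] ->]]]] //.
by exists false, false.
Qed.

Variables (R : realType) (gT : finGroupType) (to : {action gT &-> S2xS2 R}).
Variables (w : gT -> bool) (A B : gT -> 'M[R]_3).
Hypothesis rep : represented to w A B.

Definition reverses g := \det (A g) != 1.

Lemma phi_image_eqP (P : bool -> bool -> bool) :
  phi_image to = [set N | exists w' e, P w' e /\ N = H2b w' e] <->
  (forall g, P (w g) (reverses g)) /\
  (forall w' e, P w' e -> exists g, w g = w' /\ reverses g = e).
Proof.
have dE g : dsign (A g) = (-1) ^+ nat_of_bool (reverses g).
  by rewrite /dsign /reverses; case: eqP.
have imE N : phi_image to N <-> exists g, N = H2b (w g) (reverses g).
  by split=> -[g]; [move/(represented_H2 g N rep)|move=> h]; exists g;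
    [rewrite -dE|apply/(represented_H2 g N rep); rewrite dE].
split=> [e|[h1 h2]].
  split=> [g|w' e' Pwe].
    have : phi_image to (H2b (w g) (reverses g)) by apply/imE; exists g.
    by rewrite e => -[w' [e' [Pwe /H2b_inj[-> ->]]]].
  have : phi_image to (H2b w' e') by rewrite e; exists w', e'.
  by case/imE => g /H2b_inj[-> ->]; exists g.
apply/seteqP; split=> N.
  by case/imE => g ->; exists (w g), (reverses g).
by case=> w' [e' [/h2[g [<- <-]] ->]]; apply/imE; exists g.
Qed.

Lemma phi_kerE : phi_ker to = [set g | ~~ w g && ~~ reverses g]%SET.
Proof.
have dE g : dsign (A g) = (-1) ^+ nat_of_bool (reverses g).
  by rewrite /dsign /reverses; case: eqP.
apply/setP => g; rewrite !inE; apply/idP/idP => [/asboolP/(represented_H2 g _ rep)|h].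
  by rewrite dE -H2b1 => /H2b_inj[<- <-].
apply/asboolP/(represented_H2 g _ rep); rewrite dE.
by case/andP: h => /negPf-> /negPf->.
Qed.

End HomologyImage.

Lemma one_neq_N1 (R : realType) : (1 : R) <> -1.
Proof. by move=> h; lra. Qed.

(** * Algebraic consequences of pseudofreeness *)

Section ActionData.
Variables (R : realType) (gT : finGroupType) (to : {action gT &-> S2xS2 R}).
Variables (w : gT -> bool) (A B : gT -> 'M[R]_3).
Hypotheses (rep : represented to w A B) (pf : pseudofree to).
Let mul := represented_mul rep.
Let oA g : orthogonal_mx (A g). Proof. by case: (rep g). Qed.
Let oB g : orthogonal_mx (B g). Proof. by case: (rep g). Qed.
Let dAB g : \det (A g) = \det (B g). Proof. by case: (rep g). Qed.
Let fin := (pseudofreeP rep).1 pf.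
Local Notation e := (reverses A).

Lemma detE g : \det (A g) = (-1) ^+ nat_of_bool (e g).
Proof.
rewrite /reverses; case: (orthogonal_det (oA g)) => ->; first by rewrite eqxx.
by rewrite (_ : (-1 == 1 :> R) = false) //; apply/eqP; lra.
Qed.

Lemma swapsM g h : w (g * h)%g = w g (+) w h. Proof. by case: (mul g h). Qed.

Lemma reversesM g h : e (g * h)%g = e g (+) e h.
Proof.
have h1 : (-1) ^+ nat_of_bool (e (g * h)%g) = (-1) ^+ nat_of_bool (e g (+) e h) :> R.
  rewrite signr_addb -!detE; have [_ -> _] := mul g h; rewrite det_mulmx.
  by case: (w g); rewrite -?dAB.
by move: h1; case: (e _); case: (_ (+) _) => //=; rewrite ?expr1 ?expr0 => h2; case: (@one_neq_N1 R).
Qed.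

(** If g exchanges the factors and g^2 = 1, then A B = 1 and g fixes all the points (u, u A). *)
Lemma swap_square g : w g -> (g ^+ 2 != 1)%g.
Proof.
move=> wg; have [w1 A1 _] := multiplicative1 oA oB mul.
have g1 : g != 1%g by apply: contraTneq wg => ->; rewrite w1.
have := fin g1; rewrite wg => /fixset_blk1P-/(_ (oA g) (oB g) (dAB g)).
by apply: contraNneq => g2; have [_] := mul g g; rewrite wg -expg2 g2 A1 => <-.
Qed.

Let a g := \det (A g) *: A g.
Let b g := \det (B g) *: B g.

Lemma signed_SO (M : 'M[R]_3) : orthogonal_mx M ->
  orthogonal_mx (\det M *: M) /\ \det (\det M *: M) = 1.
Proof.
move=> oM; have [d|d] := orthogonal_det oM; rewrite d ?scale1r //.
by rewrite scaleN1r det3N d opprK; split=> //; exact: orthogonalN.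
Qed.

Lemma mulmxZ (M N : 'M[R]_3) (x y : R) : (x *: M) *m (y *: N) = (x * y) *: (M *m N).
Proof. by rewrite -scalemxAl -scalemxAr scalerA. Qed.

Variable H : {group gT}.
Hypothesis HE : forall g, (g \in H) = ~~ w g.

Lemma signed_hom1 : rotation_hom H a.
Proof.
split=> [g h|g _]; last exact: signed_SO.
rewrite !HE /a => /negPf wg _; rewrite mulmxZ; have [_ -> _] := mul g h.
by rewrite wg det_mulmx.
Qed.

Lemma signed_hom2 : rotation_hom H b.
Proof.
split=> [g h|g _]; last exact: signed_SO.
rewrite !HE /b => /negPf wg _; rewrite mulmxZ; have [_ _ ->] := mul g h.
by rewrite wg det_mulmx.
Qed.

Lemma preserving_inj g : ~~ w g -> ~~ e g -> a g = 1%:M \/ b g = 1%:M -> g = 1%g.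
Proof.
move=> /negPf wg eg h; apply/eqP; apply: contraT => /fin; rewrite wg.
have d : \det (A g) = 1 by rewrite detE (negPf eg).
move/(fixset_blk0P (oA g) (oB g) (dAB g)) => [[_ [A1 B1]]|[d' _]]; last first.
  by case: (@one_neq_N1 R (etrans (esym d) d')).
case: h; rewrite /a /b -?dAB d scale1r => h; [by rewrite h eqxx in A1|by rewrite h eqxx in B1].
Qed.

Lemma action_pair_rep (K : {group gT}) : K \subset H -> #|H : K|%g = 2%N ->
  (forall g, (g \in K) = ~~ w g && ~~ e g) -> pair_rep H K a b.
Proof.
move=> sKH i2 KE; split=> //; [exact: signed_hom1|exact: signed_hom2|..].
- by move=> g; rewrite KE => /andP[wg eg] h; apply: preserving_inj => //; left.
- by move=> g; rewrite KE => /andP[wg eg] h; apply: preserving_inj => //; right.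
move=> g; rewrite inE KE HE => /andP[h wg] [ia ib].
rewrite wg /= negbK in h; have d : \det (A g) = -1 by rewrite detE h.
have g1 : g != 1%g.
  apply: contraTneq h => ->; have [_ A1 _] := multiplicative1 oA oB mul.
  by rewrite /reverses A1 det1 eqxx.
have inv (M : 'M[R]_3) : orthogonal_mx M -> \det M = -1 -> involutive_mx (\det M *: M) -> fixed_unit M.
  move=> oM dM [MM M1]; apply/(rotoreflection_fixed oM dM); split.
    by move: MM; rewrite mulmxZ dM mulrNN mulr1 scale1r.
  by apply: contra M1 => /eqP e1; rewrite dM e1 scaleN1r opprK.
have := fin g1; rewrite (negPf wg) => /(fixset_blk0P (oA g) (oB g) (dAB g))[[d' _]|[_ nf]].
  by case: (@one_neq_N1 R (etrans (esym d') d)).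
apply: nf; split; first exact: inv (oA g) d ia.
by apply: inv (oB g) _ ib; rewrite -dAB.
Qed.

Lemma swap_conj1 t g : w t -> ~~ w g -> a g = 1%:M <-> b (g ^ t)%g = 1%:M.
Proof.
move=> wt /negPf wg.
have e1 : A g *m A t = A t *m B (g ^ t)%g.
  by have [_ h1 _] := mul g t; have [_ h2 _] := mul t (g ^ t)%g; rewrite wg in h1; rewrite wt in h2; rewrite -h1 -h2 -conjgC.
have dg : \det (A g) = \det (B (g ^ t)%g).
  have := congr1 determinant e1; rewrite !det_mulmx mulrC => /mulfI; apply.
  by rewrite detE signr_eq0.
have e2 : a g *m A t = A t *m b (g ^ t)%g by rewrite /a /b -dg -scalemxAl -scalemxAr e1.
split=> h; move: e2; rewrite h ?mul1mx ?mulmx1 => e2.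
  by move/(congr1 (mulmx (A t)^T)): e2; rewrite mulmxA !orthogonalT // mul1mx.
by move/(congr1 (mulmx^~ (A t)^T)): e2; rewrite -mulmxA oA mulmx1.
Qed.

Lemma swap_conj2 t g : w t -> ~~ w g -> b g = 1%:M <-> a (g ^ t)%g = 1%:M.
Proof.
move=> wt /negPf wg.
have e1 : B g *m B t = B t *m A (g ^ t)%g.
  by have [_ _ h1] := mul g t; have [_ _ h2] := mul t (g ^ t)%g; rewrite wg in h1; rewrite wt in h2; rewrite -h1 -h2 -conjgC.
have dg : \det (B g) = \det (A (g ^ t)%g).
  have := congr1 determinant e1; rewrite !det_mulmx mulrC => /mulfI; apply.
  by rewrite -dAB detE signr_eq0.
have e2 : b g *m B t = B t *m a (g ^ t)%g by rewrite /a /b -dg -scalemxAl -scalemxAr e1.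
split=> h; move: e2; rewrite h ?mul1mx ?mulmx1 => e2.
  by move/(congr1 (mulmx (B t)^T)): e2; rewrite mulmxA !orthogonalT // mul1mx.
by move/(congr1 (mulmx^~ (B t)^T)): e2; rewrite -mulmxA oB mulmx1.
Qed.

End ActionData.

Section BooleanKernel.
Local Close Scope classical_set_scope.
Local Open Scope nat_scope.
Local Open Scope group_scope.
Variables (gT : finGroupType) (chi : gT -> bool).
Hypothesis chiM : forall g h, chi (g * h) = chi g (+) chi h.

Lemma boolean_kernel (G : {group gT}) : exists K : {group gT},
  [/\ forall g, (g \in K) = (g \in G) && ~~ chi g, K \subset G
    & (exists2 g, g \in G & chi g) -> #|G : K| = 2].
Proof.
have chi1 : chi 1 = false by have := chiM 1 1; rewrite mulg1 addbb.
pose K := [set g in G | ~~ chi g].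
have gK : group_set K.
  apply/group_setP; split=> [|g h]; first by rewrite inE group1 chi1.
  rewrite !inE => /andP[Gg /negPf cg] /andP[Gh /negPf ch].
  by rewrite groupM //= chiM cg ch.
have sKG : K \subset G by apply/fintype.subsetP => g; rewrite inE => /andP[].
have KE g : (g \in Group gK) = (g \in G) && ~~ chi g by rewrite inE.
exists (Group gK); split=> // -[g Gg cg].
have chiV h : chi h^-1 = chi h by have := chiM h h^-1; rewrite mulgV chi1; case: (chi h); case: (chi _).
have nK : g \in 'N(Group gK).
  apply/normP/eqP; rewrite eqEcard cardJg leqnn andbT.
  apply/fintype.subsetP => _ /finset.imsetP[h hK ->]; move: hK; rewrite !KE => /andP[Gh ch].
  by rewrite groupJ //= conjgE !chiM chiV; case: (chi g) => //=; case: (chi h) ch.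
have ng : g \notin Group gK by rewrite KE cg andbF.
have g2 : g ^+ 2 \in Group gK by rewrite KE groupX // expg2 chiM addbb.
have eG : Group gK <*> <[g]> = G.
  apply/eqP; rewrite finset.eqEsubset join_subG sKG cycle_subG Gg /=.
  apply/fintype.subsetP => h Gh; have [ch|ch] := boolP (chi h); last first.
    by rewrite (fintype.subsetP (joing_subl _ _)) // KE Gh.
  have Jg : g \in Group gK <*> <[g]>.
    by rewrite (fintype.subsetP (joing_subr (Group gK) <[g]>)) // cycle_id.
  have Jh : h * g^-1 \in Group gK <*> <[g]>.
    apply: (fintype.subsetP (joing_subl (Group gK) <[g]>)).
    by rewrite KE groupM ?groupV //= chiM chiV ch cg.
  by rewrite -(mulgKV g h) groupM.
have := card_join_square nK ng g2; rewrite eG => oG.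
by apply/eqP; rewrite -(eqn_pmul2l (cardG_gt0 (Group gK))) Lagrange // oG mulnC.
Qed.

End BooleanKernel.

(** * From a pseudofree action to the lists *)

Section Forward.
Local Close Scope classical_set_scope.
Local Open Scope nat_scope.
Local Open Scope group_scope.
Variables (R : realType) (gT : finGroupType) (to : {action gT &-> S2xS2 R}).
Variables (w : gT -> bool) (A B : gT -> 'M[R]_3).
Hypotheses (rep : represented to w A B) (pf : pseudofree to).
Local Notation e := (reverses A).
Local Notation G := [set: gT]%G.
Let wM := swapsM rep.
Let eM := reversesM rep.

Lemma forward1 : (forall g, ~~ w g && ~~ e g) -> list1 G.
Proof.
move=> triv; have GE g : (g \in G) = ~~ w g by rewrite inE; case/andP: (triv g) => ->.
apply: (list1_of_rotation_rep (rotation_hom_rep (signed_hom1 rep GE) _)).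
by move=> g _ h; have /andP[wg eg] := triv g; apply: (preserving_inj rep pf wg eg); left.
Qed.

Lemma forward2 : (forall g, ~~ w g) -> (exists g, e g) ->
  exists n, [/\ 0 < n, cyclic_of_order n (phi_ker to) & list2 G n].
Proof.
move=> nw [t et]; have GE g : (g \in G) = ~~ w g by rewrite inE nw.
have [K [KE sKG /(_ (ex_intro2 _ _ t (finset.in_setT t) et)) i2]] := boolean_kernel eM G.
have KE' g : (g \in K) = ~~ w g && ~~ e g by rewrite KE inE nw.
have -> : phi_ker to = K by apply/setP => g; rewrite (phi_kerE rep) inE KE'.
exact: (list2_of_pair_rep (action_pair_rep rep pf GE sKG i2 KE')).
Qed.

Lemma outer_no_involution (H : {group gT}) : (forall g, (g \in H) = ~~ w g) ->
  {in G :\: H, forall g, g ^+ 2 != 1}.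
Proof. by move=> HE g; rewrite inE HE negbK => /andP[wg _]; exact: (swap_square rep pf wg). Qed.

Lemma forward3 : (exists g, w g) -> (forall g, ~~ w g -> ~~ e g) ->
  [\/ list3a G, list3b G | exists2 K : {group gT}, K = [set g | ~~ w g && ~~ e g] :> {set gT} & list3c G K].
Proof.
move=> [t wt] we.
have [H [HE sHG /(_ (ex_intro2 _ _ t (finset.in_setT t) wt)) i2]] := boolean_kernel wM G.
have HE' g : (g \in H) = ~~ w g by rewrite HE inE.
have r : rotation_rep H (fun g => \det (A g) *: A g)%R.
  apply: (rotation_hom_rep (signed_hom1 rep HE')) => g; rewrite HE' => wg h.
  by apply: (preserving_inj rep pf wg (we g wg)); left.
case: (list3_of_rotation_rep sHG i2 (outer_no_involution HE') r) => h.
- by constructor 1.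
- by constructor 2.
- constructor 3; exists H => //; apply/setP => g; rewrite inE HE'.
  by case: (boolP (w g)) => //= wg; rewrite we.
Qed.

Lemma forward4 : (exists g, w g) -> (exists2 g, ~~ w g & e g) -> list4 G.
Proof.
move=> [t wt] [s ws es].
have [H [HE sHG /(_ (ex_intro2 _ _ t (finset.in_setT t) wt)) iH]] := boolean_kernel wM G.
have [L [LE sLG /(_ (ex_intro2 _ _ s (finset.in_setT s) es)) iL]] := boolean_kernel eM G.
have HE' g : (g \in H) = ~~ w g by rewrite HE inE.
have Hs : s \in H by rewrite HE'.
have [K [KE sKH /(_ (ex_intro2 _ _ s Hs es)) iK]] := boolean_kernel eM H.
have KE' g : (g \in K) = ~~ w g && ~~ e g by rewrite KE HE'.
have eK : L :&: H = K by apply/setP => g; rewrite inE KE' LE HE' inE andbC.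
have pr := action_pair_rep rep pf HE' sKH iK KE'.
apply: (list4_of_pair_rep sHG iH sLG iL eK pr (outer_no_involution HE')).
- move=> u g /finset.setDP[_]; rewrite !HE' negbK => wu wg; exact: (swap_conj1 rep wu wg).
- move=> u g /finset.setDP[_]; rewrite !HE' negbK => wu wg; exact: (swap_conj2 rep wu wg).
Qed.

End Forward.

(** * Construction of actions *)

Section ActionBuilders.
Variables (R : realType) (gT : finGroupType).
Implicit Types (to : {action gT &-> S2xS2 R}) (A B f : gT -> 'M[R]_3).
Local Notation acts to := (linear_orientation_preserving to /\ pseudofree to).

Lemma build_action (w : gT -> bool) A B : (forall g, orthogonal_mx (A g)) ->
  (forall g, orthogonal_mx (B g)) -> (forall g, \det (A g) = \det (B g)) ->
  swap_multiplicative w A B ->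
  (forall g, g != 1%g -> finite_set (fixset (blk (w g) (A g) (B g)))) ->
  exists2 to, acts to & represented to w A B.
Proof.
move=> oA oB dAB mul fin; have [to rep] := represented_build oA oB dAB mul.
by exists to => //; split; [exact: represented_linear rep|exact/(pseudofreeP rep)].
Qed.

Lemma diagonal_action f : rotation_rep [set: gT]%G f ->
  exists2 to, acts to & represented to (fun=> false) f f.
Proof.
move=> r; have T g : g \in [set: gT]%G by rewrite inE.
have of' g := rot_orthogonal r (T g).
apply: build_action => //.
- by move=> g h; rewrite (rotM r).
- move=> g g1; apply/(fixset_blk0P (of' g) (of' g) erefl); left.
  have f1 : f g != 1%:M by apply: contra g1 => /eqP/(rot_inj r (T g))->.
  by rewrite (rot_det r (T g)).
Qed.

Lemma det_signed_rot N j (s : bool) :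
  orthogonal_mx ((-1) ^+ s *: (root_rot R N ^+ j : 'M_3)) /\
  \det ((-1) ^+ s *: (root_rot R N ^+ j : 'M_3)) = (-1) ^+ s.
Proof.
have o := root_rotX_orthogonal R N j; have d := det_root_rotX R N j.
case: s; rewrite ?expr0 ?expr1 ?scale1r ?scaleN1r ?det3N d //.
by split=> //; exact: orthogonalN.
Qed.

Lemma reverses_sign (A : gT -> 'M[R]_3) g (s : bool) : \det (A g) = (-1) ^+ s -> reverses A g = s.
Proof.
rewrite /reverses => ->; case: s; rewrite ?expr0 ?expr1 ?eqxx //.
by apply/eqP => h; case: (@one_neq_N1 R).
Qed.

Lemma fixed_negated_rot N j : (0 < N)%N -> fixed_unit (- (root_rot R N ^+ j : 'M_3)) ->
  (N %| j + j)%N /\ ~~ (N %| j)%N.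
Proof.
move=> N0; have o := orthogonalN (root_rotX_orthogonal R N j).
have d : \det (- (root_rot R N ^+ j : 'M_3)) = -1 by rewrite det3N det_root_rotX.
move/(rotoreflection_fixed o d) => [sq n1]; split.
  by rewrite -(root_rot_eq1 R _ N0) exprD -[_ * _]/(_ *m _) -[_ *m _]opprK -mulmxN -mulNmx sq eqxx.
by rewrite -(root_rot_eq1 R _ N0) -(inj_eq oppr_inj).
Qed.

(** Both factors carry rotations of order dividing 2n about one axis, negated on the elements with s
    g. *)
Lemma sign_action (s : gT -> bool) (ex : gT -> nat) n : (0 < n)%N ->
  (forall g h, s (g * h)%g = s g (+) s h) ->
  (forall g h, ex (g * h)%g = ex g + ex h %[mod n.*2])%N ->
  (forall g, ~~ s g -> (n.*2 %| ex g)%N -> g = 1%g) ->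
  exists2 to, acts to & exists A B, represented to (fun=> false) A B /\ reverses A =1 s.
Proof.
move=> n0 sM exM inj; have N0 : (0 < n.*2)%N by rewrite double_gt0.
pose A g : 'M[R]_3 := (-1) ^+ s g *: (root_rot R n.*2 ^+ ex g : 'M_3).
(* A negated rotation fixes a point only if its exponent is n modulo 2n. The extra n on the second
   factor prevents this from happening on both factors, and it is additive modulo 2n. *)
pose B g : 'M[R]_3 := (-1) ^+ s g *: (root_rot R n.*2 ^+ (ex g + s g * n)%N : 'M_3).
have [to act rep] : exists2 to, acts to & represented to (fun=> false) A B.
  apply: build_action.
  - by move=> g; exact: (det_signed_rot _ _ _).1.
  - by move=> g; exact: (det_signed_rot _ _ _).1.
  - by move=> g; rewrite !(det_signed_rot _ _ _).2.
  - move=> g h; split=> //; rewrite /A /B sM signr_addb mulmxZ; congr (_ *: _);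
      rewrite -[RHS]exprD; apply: root_rot_eqmod => //.
    rewrite addnACA -modnDml exM modnDml; apply/eqP; rewrite eqn_modDl.
    case: (s g); case: (s h); rewrite //= ?mul0n ?mul1n ?addn0 ?add0n //.
    by rewrite addnn modnn mod0n.
  - move=> g g1; have [oA dA] := det_signed_rot n.*2 (ex g) (s g).
    have [oB dB] := det_signed_rot n.*2 (ex g + s g * n) (s g).
    apply/(fixset_blk0P oA oB); first by rewrite dA dB.
    case sg : (s g) dA dB; rewrite ?expr0 ?expr1 => dA dB; [right|left].
      split=> //; rewrite !scaleN1r mul1n => -[/(fixed_negated_rot N0)[d2 nd] /(fixed_negated_rot N0)[_]].
      case/negP; move: d2; rewrite addnn -!muln2 => d2; move: nd; rewrite -!muln2.
      have dn : (n %| ex g)%N by rewrite -(dvdn_pmul2r (isT : (0 < 2)%N)).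
      case/dvdnP: dn => k ->; rewrite -mulSnr !(mulnC _ n) !dvdn_pmul2l // !dvdn2 /=.
      by rewrite negbK.
    rewrite !scale1r mul0n addn0; split; first by rewrite det_root_rotX.
    suff h : (root_rot R n.*2 ^+ ex g : 'M_3) != 1%:M by split.
    apply: contra g1 => h; apply/eqP; apply: inj; first by rewrite sg.
    by rewrite -(root_rot_eq1 R _ N0).
exists to => //; exists A, B; split=> // g.
by apply: reverses_sign; exact: (det_signed_rot _ _ _).2.
Qed.

(** The representation of G induced from f, written with the transversal {1, t}. For g off H the
    product A B is f (g^2), so the fixed set is finite once g^2 is not 1. *)
Lemma swap_action (H : {group gT}) f t : #|[set: gT]%G : H|%g = 2%N -> t \notin H ->
  {in H &, forall g h, f (g * h)%g = f g *m f h} ->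
  {in H, forall h, orthogonal_mx (f h)} ->
  {in H, forall h, \det (f (h ^ t^-1)%g) = \det (f h)} -> \det (f (t ^+ 2)%g) = 1 ->
  {in H, forall h, f h = 1%:M -> h = 1%g} ->
  {in H, forall h, \det (f h) = -1 -> ~ (fixed_unit (f h) /\ fixed_unit (f (h ^ t^-1)%g))} ->
  {in [set: gT]%G :\: H, forall g, g ^+ 2 != 1}%g ->
  exists2 to, acts to & exists A B, [/\ represented to (fun g => g \notin H) A B,
    {in H, forall h, A h = f h} & forall g, g \notin H -> A g = f (g * t^-1)%g].
Proof.
move=> i2 nt fM fo fJ ft2 finj fnf noinv.
have nH x : (x \in 'N(H))%g.
  have := normal_norm (index2_normal (finset.subsetT H) i2).
  by move/fintype.subsetP; apply; rewrite inE.
have mH x y : x \notin H -> y \notin H -> (x * y)%g \in H.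
  by move=> nx ny; apply: (index2_mul (finset.subsetT H) i2); rewrite ?inE.
have ntV : (t^-1)%g \notin H by rewrite groupV.
have JH x : x \in H -> (x ^ t^-1)%g \in H by move=> Hx; rewrite memJ_norm.
have JE x : (x ^ t^-1 = t * x * t^-1)%g by rewrite conjgE invgK mulgA.
have f1 : f 1%g = 1%:M.
  have := fM 1%g 1%g (group1 H) (group1 H); rewrite mulg1 => e1.
  by rewrite -(orthogonalT (fo 1%g (group1 H))) {3}e1 mulmxA orthogonalT ?mul1mx //; exact: fo.
pose A g := if g \in H then f g else f (g * t^-1)%g.
pose B g := if g \in H then f (g ^ t^-1)%g else f (t * g)%g.
have oA g : orthogonal_mx (A g).
  by rewrite /A; case: ifP => [/fo//|/negbT ng]; apply: fo; exact: mH.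
have oB g : orthogonal_mx (B g).
  by rewrite /B; case: ifP => [/JH/fo//|/negbT ng]; apply: fo; exact: mH.
have dAB g : \det (A g) = \det (B g).
  rewrite /A /B; case: ifP => [Hg|/negbT ng]; first by rewrite fJ.
  have -> : (t * g = (g * t^-1) ^ t^-1 * t ^+ 2)%g.
    by rewrite JE expg2 !mulgA !mulgKV.
  have Hgt := mH _ _ ng ntV; have Ht2 := mH _ _ nt nt; rewrite -expg2 in Ht2.
  by rewrite (fM _ _ (JH _ Hgt) Ht2) det_mulmx ft2 mulr1 fJ.
have mul : swap_multiplicative (fun g => g \notin H) A B.
  move=> g h; rewrite /A /B; have [Hg|ng] := boolP (g \in H); have [Hh|nh] := boolP (h \in H).
  - by rewrite groupM //= (fM _ _ Hg Hh) conjMg (fM _ _ (JH _ Hg) (JH _ Hh)).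
  - rewrite groupMl // (negPf nh) -mulgA (fM _ _ Hg (mH _ _ nh ntV)); split=> //.
    by rewrite -(fM _ _ (JH _ Hg) (mH _ _ nt nh)) JE !mulgA mulgKV.
  - rewrite groupMr // (negPf ng) mulgA (fM _ _ (mH _ _ nt ng) Hh); split=> //.
    by rewrite -(fM _ _ (mH _ _ ng ntV) (JH _ Hh)) JE !mulgA mulgKV.
  - rewrite (mH _ _ ng nh) /=; split=> //.
      by rewrite -(fM _ _ (mH _ _ ng ntV) (mH _ _ nt nh)) !mulgA mulgKV.
    by rewrite -(fM _ _ (mH _ _ nt ng) (mH _ _ nh ntV)) JE !mulgA.
have finj' g : g \in H -> g != 1%g -> f g != 1%:M.
  by move=> Hg g1; apply: contra g1 => /eqP/(finj g Hg)->.
have [to act rep] : exists2 to, acts to & represented to (fun g => g \notin H) A B.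
  apply: build_action => // g g1; have [Hg|ng] := boolP (g \in H) => /=.
    apply/(fixset_blk0P (oA g) (oB g) (dAB g)); have := dAB g; rewrite /A /B Hg => dg.
    case: (orthogonal_det (fo g Hg)) => d; [left|right]; split=> //.
      by split; apply: finj'; rewrite ?JH // conjg_eq1.
    exact: fnf.
  apply/(fixset_blk1P (oA g) (oB g) (dAB g)); have [_] := mul g g.
  rewrite ng => <- _; have Hgg : (g * g)%g \in H by exact: mH.
  by rewrite /A Hgg; apply: finj' => //; rewrite -expg2; apply: noinv; rewrite inE ng inE.
by exists to => //; exists A, B; split=> // g Hg; rewrite /A ?Hg // (negPf Hg).
Qed.

End ActionBuilders.

(** * Subgroups of index two in the listed groups *)

Section ConverseGroups.
Local Close Scope classical_set_scope.
Local Open Scope nat_scope.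
Local Open Scope group_scope.
Variable gT : finGroupType.
Implicit Types (G A C K L P : {group gT}) (u x z : gT).

Lemma index2_of_card G K : K \subset G -> #|G| = (2 * #|K|)%N -> #|G : K| = 2.
Proof.
by move=> sKG oG; apply/eqP; rewrite -(eqn_pmul2l (cardG_gt0 K)) Lagrange // oG mulnC.
Qed.

Lemma two_part n r : odd r -> ((2 ^ n * r)`_2 = 2 ^ n)%N.
Proof.
move=> r1; rewrite partnM ?expn_gt0 ?(odd_gt0 r1) // part_pnat_id ?pnatX //.
by rewrite part_p'nat ?muln1 // -odd_2'nat.
Qed.

(** The cyclic subgroup is generated by a u^2 c, a product of commuting elements of coprime orders.
    The last clause is meant for (4)(b), where z centralises A, C and u^2. *)
Lemma twisted_cyclic n2 mm mp A C L u : admissible n2 mm mp -> twisted n2 mm mp A u C ->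
  (A ><| <[u]>) \x C = L -> exists x, [/\ <[x]> \subset L, #|L : <[x]>| = 2,
    u ^+ 2 \in <[x]>, u \notin <[x]> &
    {in 'C(A) :&: 'C(C) :&: 'C[u ^+ 2], forall z, commute z x}].
Proof.
move=> [n20 o1 o2 co] tw e; have oL := card_twisted tw e.
have [[cA oA] ou uA [cC oC]] := tw; have [sAL Lu sCL] := twisted_sub e.
have [a eA] := cyclicP cA; have [c eC] := cyclicP cC.
have Aa : a \in A by rewrite eA cycle_id.
have Cc : c \in C by rewrite eC cycle_id.
have oa : #[a] = mm by rewrite orderE -eA.
have oc : #[c] = mp by rewrite orderE -eC.
have ou2 : #[u ^+ 2] = (2 ^ n2)%N by rewrite orderXdiv ou expnS ?dvdn_mulr // mulKn.
have [[B _ eB _] _ cBC _] := dprodP e; rewrite eB in cBC.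
have eB' := sdprodW eB.
have sAB : A \subset B by rewrite -eB' mulG_subl.
have Bu : u \in B by rewrite -cycle_subG -eB' mulG_subr.
have au2 : commute a (u ^+ 2).
  by apply/commgP/conjg_fixP; rewrite expg2 conjgM uA // uA ?groupV // invgK.
have auc : commute (a * u ^+ 2) c.
  by apply/commute_sym; apply: (centsP cBC) => //; rewrite groupM ?groupX // (fintype.subsetP sAB).
have co1 : coprime #[a] #[u ^+ 2] by rewrite oa ou2 coprime_sym coprimeXl // coprime2n.
have co2 : coprime #[a * u ^+ 2] #[c].
  by rewrite (orderM au2 co1) oa ou2 oc coprimeMl co coprimeXl // coprime2n.
exists (a * u ^+ 2 * c).
have ox : #[a * u ^+ 2 * c] = (mm * 2 ^ n2 * mp)%N by rewrite (orderM auc co2) (orderM au2 co1) oa ou2 oc.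
have sxL : <[a * u ^+ 2 * c]> \subset L.
  have La := fintype.subsetP sAL a Aa; have Lc := fintype.subsetP sCL c Cc.
  by rewrite cycle_subG; exact: groupM (groupM La (groupX 2 Lu)) Lc.
have i2 : #|L : <[a * u ^+ 2 * c]>| = 2.
  by apply: index2_of_card => //; rewrite oL -[#|_|]/(#[_]) ox expnS; ring.
split=> //.
- exact: (index2_square sxL i2).
- apply/negP => /order_dvdG; rewrite -[#|_|]/(#[_]) ou ox expnS mulnAC.
  by rewrite dvdn_pmul2r ?expn_gt0 // dvdn2 oddM o1 o2.
- move=> z /finset.setIP[/finset.setIP[/centP cA' /centP cC'] /cent1P cu].
  by apply: commuteM; [apply: commuteM; [exact: cA'|]|exact: cC'].
Qed.

Lemma sylow_involution G P g : 2.-Sylow(G) P -> g \in G -> g ^+ 2 = 1 ->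
  exists2 y, y \in G & g ^ y \in P.
Proof.
move=> sP Gg g2; have [] := Sylow_subJ (Q := <[g]>) sP.
- by rewrite cycle_subG.
- rewrite /pgroup -orderE; apply: pnat_dvd (_ : #[g] %| 2) _ => //.
  by rewrite order_dvdn g2.
move=> y Gy; rewrite cycle_subG mem_conjg => h; exists y^-1 => //; exact: groupVr.
Qed.

(** An involution is conjugate into the Sylow subgroup <u>. Since 4 divides the order of u, it is
    then a power of u^2 and lies in the cyclic subgroup. *)
Lemma list3a_cyclic G : list3a G -> exists K : {group gT},
  [/\ K \subset G, #|G : K| = 2, cyclic K & {in G :\: K, forall g, g ^+ 2 != 1}].
Proof.
case=> n2 [mm [mp [A [u [C [adm tw e]]]]]].
have [x [sxG i2 u2x ux _]] := twisted_cyclic adm tw e.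
exists <[x]>%G; split=> //; first exact: cycle_cyclic.
move=> g /finset.setDP[Gg ng]; apply/negP => /eqP g2.
have [n20 o1 o2 co] := adm; have [_ ou _ _] := tw; have [_ Gu _] := twisted_sub e.
have sP : 2.-Sylow(G) <[u]>.
  rewrite pHallE cycle_subG Gu /= -orderE ou (card_twisted tw e).
  by rewrite mulnAC [(_ * 2 ^ _)%N]mulnC two_part ?oddM ?o1.
have [y Gy] := sylow_involution sP Gg g2.
have nx : g ^ y \notin <[x]> by rewrite memJ_norm // (fintype.subsetP (normal_norm (index2_normal sxG i2))).
case/cycleP=> j ej; case/negP: nx; rewrite ej.
have : (g ^ y) ^+ 2 = 1 by rewrite -conjXg g2 conj1g.
rewrite ej -expgM => /eqP; rewrite -order_dvdn ou => d.
have : (4 %| j * 2)%N by apply: dvdn_trans d; case: (n2) n20 => // k _; rewrite !expnS mulnA dvdn_mulr.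
rewrite -[4%N]/(2 * 2)%N dvdn_pmul2r // => /dvdnP[i ->].
by rewrite mulnC expgM groupX.
Qed.

(** If b d with b in A and d in C has square 1, then b^2 = 1, whereas elements of A off <k> have the
    nontrivial square q^2. Hence b d lies in <k c>. *)
Lemma dicyclic_cyclic m mp A C G : 0 < m -> binary_dihedral m A -> cyclic_of_order mp C ->
  odd mp -> coprime m mp -> A \x C = G -> exists x k q, [/\ [/\ <[x]> \subset G,
    #|G : <[x]>| = 2, #[x] = (2 * m * mp)%N & {in G :\: <[x]>, forall g, g ^+ 2 != 1}],
    k \in <[x]>, q \in G :\: <[x]>, k ^+ (2 * m) = 1 & q ^+ 2 = k ^+ m].
Proof.
move=> m0 /(binary_dihedralP A m0)[oA [k [q [eA km kq]]]] [cC oC] omp co e.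
have oG := dprod_card e; rewrite oA oC in oG.
have [c eC] := cyclicP cC.
have [_ eG cAC tiAC] := dprodP e.
have sAG : A \subset G by rewrite -eG mulG_subl.
have sCG : C \subset G by rewrite -eG mulG_subr.
have Ak : k \in A by rewrite -eA mem_gen // inE cycle_id.
have Aq : q \in A by rewrite -eA mem_gen // inE cycle_id orbT.
have Cc : c \in C by rewrite eC cycle_id.
have k2m : k ^+ (2 * m) = 1.
  have e2 : q ^+ 2 = k ^- m by rewrite -expgVn -kq -conjXg km conjXg conjgE mulKg.
  by rewrite mul2n -addnn expgD {2}km e2 mulgV.
have Nq : q \in 'N(<[k]>) by apply/normP; rewrite -cycleJ kq cycleV.
have le : #[k] <= 2 * m by rewrite dvdn_leq ?muln_gt0 ?m0 // order_dvdn k2m.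
have nq : q \notin <[k]>.
  apply/negP => kq'; have eA' : <[k]> = A :> {set gT}.
    by rewrite -eA; apply/esym/joing_idPl; rewrite cycle_subG.
  by move: le; rewrite orderE eA' oA leq_pmul2r.
have q2 : q ^+ 2 \in <[k]> by rewrite -km mem_cycle.
have ok : #[k] = (2 * m)%N.
  have := card_join_square (K := <[k]>%G) Nq nq q2; rewrite [gval <[k]>%G]/= eA oA -orderE.
  by rewrite -[4]/(2 * 2)%N -mulnA => /eqP; rewrite eqn_pmul2l // eq_sym => /eqP.
have oc : #[c] = mp by rewrite orderE -eC.
have kc : commute k c by apply/commute_sym; apply: (centsP cAC).
have cokc : coprime #[k] #[c] by rewrite ok oc coprimeMl co coprime2n omp.
have ekc := cycleM kc cokc.
have ox : #[k * c] = (2 * m * mp)%N by rewrite orderM // ok oc.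
have kx : k \in <[k * c]> by rewrite ekc; apply: (fintype.subsetP (mulG_subl _ _)); exact: cycle_id.
have sxG : <[k * c]> \subset G.
  rewrite cycle_subG; exact: (groupM (fintype.subsetP sAG k Ak) (fintype.subsetP sCG c Cc)).
have i2 : #|G : <[k * c]>| = 2.
  by apply: index2_of_card => //; rewrite -oG -[#|_|]/(#[_]) ox; ring.
have skA : <[k]> \subset A by rewrite cycle_subG.
have i2A : #|A : <[k]>| = 2 by apply: index2_of_card => //; rewrite oA -[#|_|]/(#[_]) ok mulnA.
have qsq b : b \in A -> b \notin <[k]> -> b ^+ 2 = q ^+ 2.
  move=> Ab nb; have bq : b * q^-1 \in <[k]> by rewrite (index2_mul skA i2A) ?groupV.
  have [i ei] := cycleP _ _ bq; have -> : b = k ^+ i * q by rewrite -ei mulgKV.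
  by rewrite [LHS]expg2 {1}(conjgC (k ^+ i)) conjXg kq expgVn -mulgA mulKg.
have q21 : q ^+ 2 != 1.
  by rewrite -km -order_dvdn ok; apply/negP => /(dvdn_leq m0); rewrite leqNgt -{1}(mul1n m) ltn_pmul2r.
have noinv : {in G :\: <[k * c]>, forall g, g ^+ 2 != 1}.
  move=> g /finset.setDP[Gg ng]; apply/negP => /eqP g2.
  have /mulsgP[b d Ab Cd eg] : g \in A * C by rewrite eG.
  have bd : commute b d by apply/commute_sym; apply: (centsP cAC).
  have b2 : b ^+ 2 = 1.
    apply/set1P; rewrite -[[set 1]]/(1 : {set gT}) -tiAC inE groupX //=.
    have : b ^+ 2 * d ^+ 2 = 1 by rewrite -expgMn // -eg.
    by move/eqP; rewrite -eq_invg_mul => /eqP e1; rewrite -groupV e1 groupX.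
  have xb : b \in <[k * c]>.
    have [kb|nkb] := boolP (b \in <[k]>); last by case/eqP: q21; rewrite -(qsq b).
    by apply: (fintype.subsetP _ b kb); rewrite cycle_subG.
  have xd : d \in <[k * c]>.
    by rewrite ekc; apply: (fintype.subsetP (mulG_subr _ _)); rewrite -eC.
  by case/negP: ng; rewrite eg; exact: groupM xb xd.
exists (k * c), k, q; split=> //.
rewrite inE (fintype.subsetP sAG) // andbT; apply: contra nq => qx.
have : q \in <[k * c]> :&: A by rewrite inE qx.
rewrite ekc -group_modl // => /mulsgP[y d ky]; rewrite -eC finset.setIC tiAC => /set1P-> ->.
by rewrite mulg1.
Qed.

Lemma list3b_cyclic G : list3b G -> exists K : {group gT},
  [/\ K \subset G, #|G : K| = 2, cyclic K & {in G :\: K, forall g, g ^+ 2 != 1}].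
Proof.
case=> n2 [mm [mp [A [C [[n20 o1 o2 co] B c e]]]]].
have m0 : (0 < 2 ^ n2.-1 * mm)%N by rewrite muln_gt0 expn_gt0 (odd_gt0 o1).
have co' : coprime (2 ^ n2.-1 * mm) mp by rewrite coprimeMl co coprimeXl // coprime2n.
have [x [k [q [[sx i2 _ noinv] _ _ _ _]]]] := dicyclic_cyclic m0 B c o2 co' e.
by exists <[x]>%G; split=> //; exact: cycle_cyclic.
Qed.

Lemma list3c_dihedral G K : list3c G K ->
  [/\ K \subset G, #|G : K| = 2, exists2 n, 1 < n & K \isog 'D_(n.*2)
    & {in G :\: K, forall g, g ^+ 2 != 1}].
Proof.
case=> dK [[gam [gk [k [_ [_ _ _ eG i2]]]]] ns].
have sKG : K \subset G by rewrite -eG joing_subl.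
split=> // g /finset.setDP[Gg ng]; apply: contra ns => g2.
have og : #[g] = 2.
  by apply: nt_prime_order; [|exact/eqP|apply: contra ng => /eqP->; exact: group1].
apply/splitsP; exists <[g]>%G; apply/complP.
have D : g \in G :\: K by rewrite inE ng.
have [_ <- _ ->] := sdprodP (involution_sdprod sKG i2 D og); by [].
Qed.

End ConverseGroups.

(** * Actions realising the lists *)

Section ConverseActions.
Variables (R : realType) (gT : finGroupType).
Implicit Types (to : {action gT &-> S2xS2 R}) (f : gT -> 'M[R]_3) (H K : {group gT}).
Local Notation acts to := (linear_orientation_preserving to /\ pseudofree to).
Local Notation G := [set: gT]%G.

Lemma reverses_det1 (A : gT -> 'M[R]_3) g : \det (A g) = 1 -> reverses A g = false.
Proof. by rewrite /reverses => ->; rewrite eqxx. Qed.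

Lemma reverses_detN1 (A : gT -> 'M[R]_3) g : \det (A g) = -1 -> reverses A g = true.
Proof. by move=> d; apply: (@reverses_sign R gT A g true); rewrite d expr1. Qed.

Lemma converse1 : list1 G -> exists2 to : {action gT &-> S2xS2 R}, acts to & phi_image to = [set 1%:M].
Proof.
move=> l1; have [f r] : exists f, rotation_rep G f.
  have [a4 r4] := Sym4_embedding R; have [a5 r5] := Alt5_embedding R.
  case: l1 => [i|i|i|[[n _ [c _]]|[n n1 i]]].
  - by apply: (rotation_rep_isog i); apply: rotation_repS r4; exact: finset.subsetT.
  - exact: (rotation_rep_isog i r4).
  - exact: (rotation_rep_isog i r5).
  - exact: cyclic_embedding.
  - exact: dihedral_isog_embedding i.
have [to act rep] := diagonal_action r; exists to => //.
have e g : reverses f g = false by apply: reverses_det1; apply: (rot_det r); rewrite inE.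
rewrite trivial_image; apply/(phi_image_eqP rep (fun w e => ~~ w && ~~ e)); split=> [g|[] [] // _].
  by rewrite e.
by exists 1%g.
Qed.

Lemma sign_action_image (s : gT -> bool) (ex : gT -> nat) n : (0 < n)%N ->
  (forall g h, s (g * h)%g = s g (+) s h) ->
  (forall g h, ex (g * h)%g = ex g + ex h %[mod n.*2])%N ->
  (forall g, ~~ s g -> (n.*2 %| ex g)%N -> g = 1%g) -> (exists g, s g) ->
  exists2 to : {action gT &-> S2xS2 R}, acts to & phi_image to = generated_mx [set minus_id].
Proof.
move=> n0 sM exM inj [g sg]; have [to act [A [B [rep rE]]]] := sign_action R n0 sM exM inj.
exists to => //; rewrite generated_minus; apply/(phi_image_eqP rep (fun w _ => ~~ w)).
split=> // -[] // e _; case: e; first by exists g; rewrite rE sg.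
by exists 1%g; rewrite rE; have := sM 1%g 1%g; rewrite mulg1 addbb.
Qed.

Lemma converse2 n : (0 < n)%N -> list2 G n ->
  exists2 to : {action gT &-> S2xS2 R}, acts to & phi_image to = generated_mx [set minus_id].
Proof.
move=> n0 []; last first.
  case=> /cyclicP[x ex] oG; have ox : #[x]%g = n.*2 by rewrite orderE -ex.
  have Tx g : g \in <[x]>%g by rewrite -ex inE.
  have [e [eX eM]] := discrete_log x.
  have eM' g h : (e (g * h)%g = e g + e h %[mod n.*2])%N by rewrite -ox eM.
  apply: (sign_action_image (s := fun g => odd (e g)) n0 _ eM').
  - by move=> g h; rewrite -(odd_mod _ (odd_double n)) eM' (odd_mod _ (odd_double n)) oddD.
  - by move=> g _; rewrite -ox => /dvdnP[k ek]; rewrite (eX g) // ek mulnC expgM expg_order expg1n.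
  - exists x; rewrite -(odd_mod _ (odd_double n)) (_ : e x = 1 %[mod n.*2])%N ?odd_mod ?odd_double //.
    by apply/eqP; rewrite -ox -eq_expg_mod_order expg1 -eX.
case/isogP => f injf fG.
have T g : g \in G by rewrite inE.
have fM g h : f (g * h)%g = (f g * f h)%g by rewrite morphM.
have f_in g : f g \in finset.setX (Zp n) (Zp 2) by rewrite -fG mem_morphim.
(* The rotation used has order 2n, so the Z_n coordinate is doubled; the Z_2 coordinate is the
   sign. *)
pose ex g := (2 * (f g).1)%N; pose s g := odd (f g).2.
apply: (sign_action_image (s := s) (ex := ex) n0).
- move=> g h; rewrite /s fM [X in nat_of_ord X]/= /=.
  by rewrite odd_mod // oddD.
- move=> g h; rewrite /ex fM /=; move: (nat_of_ord (f g).1) (nat_of_ord (f h).1) => a b.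
  (* For n = 1 the type 'Z_1 has two elements and adds modulo 2, so the congruence is checked apart;
     there both sides are even. *)
  have [n1|n1] := ltnP 1 n; first by rewrite Zp_cast // muln_modr -!mul2n modn_mod mulnDr.
  have -> : n = 1%N by apply/eqP; rewrite eqn_leq n1.
  by rewrite -mulnDr !(mulnC 2) !modnMl.
- move=> g; rewrite /s /ex => og dg; apply/eqP; rewrite -(morph_injm_eq1 injf) //.
  apply/eqP; have := f_in g; case: (f g) og dg => i j /=; rewrite inE => oj di /andP[Zi _].
  have -> : j = 0 by apply: val_inj; case: j oj {Zi} => -[|[|[|]]].
  congr (_, _); have [n1|n1] := ltnP 1 n; last first.
    by move: Zi; rewrite /Zp ltnNge n1 /= inE => /eqP.
  apply: val_inj => /=; move: di; rewrite -!mul2n dvdn_pmul2l // => /dvdnP[k ek].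
  have : (i < n)%N by rewrite -[X in (_ < X)%N](Zp_cast n1).
  by rewrite ek; case: k {ek} => //= k; rewrite mulSn ltnNge leq_addr.
have : ((1%g, Zp1) : 'Z_n * 'Z_2) \in (f @* G)%g.
  by rewrite fG inE /= group1 inE.
by case/morphimP => g _ _ eg; exists g; rewrite /s -eg.
Qed.

Lemma rotation_subgroup_action K f : #|G : K|%g = 2%N -> rotation_rep K f ->
  {in G :\: K, forall g, g ^+ 2 != 1}%g ->
  exists2 to : {action gT &-> S2xS2 R}, acts to & phi_image to = generated_mx [set swap_mx] /\ phi_ker to = K.
Proof.
move=> i2 r noinv; have [t _ nt] : exists2 t, t \in G & t \notin K.
  by apply/fintype.subsetPn; rewrite -indexg_gt1 i2.
have T g : g \in G by rewrite inE.
have sKG := finset.subsetT K.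
have JK h : h \in K -> (h ^ t^-1)%g \in K.
  by move=> Kh; rewrite memJ_norm // (fintype.subsetP (normal_norm (index2_normal sKG i2))).
have ntV : (t^-1)%g \notin K by rewrite groupV.
have [] := @swap_action R gT K f t i2 nt (rotM r) (rot_orthogonal r) _ _ (rot_inj r) _ noinv.
- by move=> h Kh; rewrite !(rot_det r) ?JK.
- by apply: (rot_det r); apply: (index2_square sKG i2).
- by move=> h Kh; rewrite (rot_det r Kh) => /one_neq_N1.
move=> to act [A [B [rep AK An]]]; exists to => //.
have e g : reverses A g = false.
  apply: reverses_det1; have [Kg|ng] := boolP (g \in K); first by rewrite AK // (rot_det r).
  by rewrite An // (rot_det r) // (index2_mul sKG i2).
split; last by apply/setP => g; rewrite (phi_kerE rep) inE e andbT negbK.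
rewrite generated_swap; apply/(phi_image_eqP rep (fun _ e => ~~ e)).
split=> [g|w [] // _]; first by rewrite e.
by case: w; [exists t|exists 1%g]; rewrite e ?nt ?group1.
Qed.

Lemma swap_action_image H f t h0 : #|G : H|%g = 2%N -> t \notin H ->
  {in H &, forall g h, f (g * h)%g = f g *m f h} ->
  {in H, forall h, orthogonal_mx (f h)} ->
  {in H, forall h, \det (f (h ^ t^-1)%g) = \det (f h)} -> \det (f (t ^+ 2)%g) = 1 ->
  {in H, forall h, f h = 1%:M -> h = 1%g} ->
  {in H, forall h, \det (f h) = -1 -> ~ (fixed_unit (f h) /\ fixed_unit (f (h ^ t^-1)%g))} ->
  {in G :\: H, forall g, g ^+ 2 != 1}%g -> h0 \in H -> \det (f h0) = -1 ->
  exists2 to : {action gT &-> S2xS2 R}, acts to & phi_image to = generated_mx [set minus_id; swap_mx].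
Proof.
move=> i2 nt fM fo fJ ft2 finj fnf noinv Hh0 dh0.
have [to act [A [B [rep AK An]]]] := swap_action i2 nt fM fo fJ ft2 finj fnf noinv.
exists to => //; rewrite generated_minus_swap; apply/(phi_image_eqP rep (fun _ _ => true)).
split=> // w e _.
have f1 : \det (f 1%g) = 1.
  have := congr1 determinant (fM 1%g 1%g (group1 H) (group1 H)); rewrite mulg1 det_mulmx.
  case: (orthogonal_det (fo 1%g (group1 H))) => -> // h; case: (@one_neq_N1 R).
  by rewrite [RHS]h mulrNN mulr1.
case: w; case: e.
- exists (h0 * t)%g; rewrite groupMl // nt; split=> //.
  by apply: reverses_detN1; rewrite An ?mulgK // groupMl.
- exists t; rewrite nt; split=> //; apply: reverses_det1; by rewrite An // mulgV.
- exists h0; rewrite Hh0; split=> //; apply: reverses_detN1; by rewrite AK.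
- exists 1%g; rewrite group1; split=> //; apply: reverses_det1; by rewrite AK.
Qed.

Lemma converse3c K : list3c G K ->
  exists2 to : {action gT &-> S2xS2 R}, acts to & phi_image to = generated_mx [set swap_mx] /\ phi_ker to = K.
Proof.
case/list3c_dihedral => sKG i2 [n n1 dK] noinv.
have [f r] := dihedral_isog_embedding R n1 dK.
exact: rotation_subgroup_action r noinv.
Qed.

Lemma converse3 : list3 G -> exists2 to : {action gT &-> S2xS2 R}, acts to & phi_image to = generated_mx [set swap_mx].
Proof.
have cyc K : K \subset G -> #|G : K|%g = 2%N -> cyclic K -> {in G :\: K, forall g, g ^+ 2 != 1}%g ->
    exists2 to : {action gT &-> S2xS2 R}, acts to & phi_image to = generated_mx [set swap_mx].
  move=> sKG i2 cK noinv; have [f r] := cyclic_embedding R cK.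
  by have [to act [im _]] := rotation_subgroup_action i2 r noinv; exists to.
case=> [/list3a_cyclic[K [sK iK cK nK]]|/list3b_cyclic[K [sK iK cK nK]]|[K /converse3c[to act [im _]]]].
- exact: (cyc K sK iK cK nK).
- exact: (cyc K sK iK cK nK).
- by exists to.
Qed.

(** The cyclic subgroup <x> of order 2 N2 acts by x^i -> (-1)^i times a rotation of order 2 N2 to
    the power i. The only half turn has exponent N2, which is even because n2 > 0, so no element
    with odd i fixes a point. *)
Lemma converse4a : list4a G ->
  exists2 to : {action gT &-> S2xS2 R}, acts to & phi_image to = generated_mx [set minus_id; swap_mx].
Proof.
case=> n2 [mm [mp [D [C [[n20 o1 o2 co] BD cC e]]]]].
have m0 : (0 < 2 ^ n2 * mm)%N by rewrite muln_gt0 expn_gt0 (odd_gt0 o1).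
have co' : coprime (2 ^ n2 * mm) mp by rewrite coprimeMl co coprimeXl // coprime2n.
have [x [k [q [[sx i2 ox noinv] xk Dq k2m q2]]]] := dicyclic_cyclic m0 BD cC o2 co' e.
pose N2 := (2 ^ n2 * mm * mp)%N.
have {}ox : #[x]%g = (2 * N2)%N by rewrite ox !mulnA.
have d2 : (2 %| N2)%N by rewrite /N2 -(prednK n20) expnS -!mulnA; exact: dvdn_mulr.
have N0 : (0 < #[x]%g)%N := order_gt0 x.
have N20 : (0 < N2)%N by rewrite muln_gt0 m0 odd_gt0.
have [ex [eX eM]] := discrete_log x.
have evN : odd #[x]%g = false by rewrite ox oddM.
pose s g := odd (ex g).
(* The parity of the exponent is expressed without reference to x, which makes it visibly invariant
   under conjugation. *)
have sE g : g \in <[x]>%g -> s g = (g ^+ N2 != 1)%g.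
  move=> xg; rewrite [in RHS](eX g xg) -expgM -order_dvdn ox dvdn_pmul2r // dvdn2 negbK.
  by [].
have /finset.setDP[_ nq] := Dq.
pose f g : 'M[R]_3 := (-1) ^+ s g *: (root_rot R #[x]%g ^+ ex g : 'M_3).
have fP g := det_signed_rot R #[x]%g (ex g) (s g).
have Jx h : h \in <[x]>%g -> (h ^ q^-1)%g \in <[x]>%g.
  by move=> xh; rewrite memJ_norm // (fintype.subsetP (normal_norm (index2_normal sx i2))) // inE.
have sV b : (-1) ^+ nat_of_bool b = 1 :> R -> b = false.
  by case: b; rewrite // expr1 => h; case: (@one_neq_N1 R).
apply: (@swap_action_image <[x]>%G f q x i2 nq).
- move=> g h xg xh; rewrite /f mulmxZ -signr_addb; congr (_ *: _); last first.
    by rewrite -[RHS]exprD; apply: root_rot_eqmod; rewrite // eM.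
  by rewrite /s -(odd_mod _ evN) eM // odd_mod // oddD.
- by move=> h _; exact: (fP h).1.
- move=> h xh; rewrite !(fP _).2 !sE ?Jx //.
  by rewrite -conjXg conjg_eq1.
- rewrite (fP _).2 sE; last by rewrite q2 groupX.
  have [j ej] := dvdnP d2; rewrite q2 ej (mulnC j) expgM.
  have -> : ((k ^+ (2 ^ n2 * mm)) ^+ 2 = 1)%g by rewrite -expgM mulnC.
  by rewrite expg1n eqxx expr0.
- move=> h xh e1; have sh : s h = false by apply: sV; rewrite -(fP h).2 -/(f h) e1 det1.
  move: e1; rewrite /f sh expr0 scale1r => /eqP; rewrite root_rot_eq1 //.
  by case/dvdnP => j ej; rewrite (eX h xh) ej mulnC expgM expg_order expg1n.
- move=> h xh; rewrite (fP h).2 => dh [+ _].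
  have sh : s h = true by apply: contra_eqT dh => /negPf->; apply/eqP; exact: one_neq_N1.
  rewrite /f sh expr1 scaleN1r => /(fixed_negated_rot N0)[].
  rewrite addnn -mul2n ox dvdn_pmul2l // => /(dvdn_trans d2); rewrite dvdn2 -/(s h) sh.
  by [].
- exact: noinv.
- exact: cycle_id.
- rewrite (fP x).2 sE ?cycle_id //.
  have -> : (x ^+ N2 != 1)%g.
    by rewrite -order_dvdn ox; apply/negP => /(dvdn_leq N20); rewrite mul2n -addnn -{3}(addn0 N2) leq_add2l leqNgt N20.
  by rewrite expr1.
Qed.

(** The action is induced from H = <x> x <z>, with z acting as the antipodal map on the first factor
    and <x> by rotations. The exchanging element u conjugates z to z times the involution of <x>, so
    z is antipodal on one factor only. *)
Lemma converse4b : list4b G ->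
  exists2 to : {action gT &-> S2xS2 R}, acts to & phi_image to = generated_mx [set minus_id; swap_mx].
Proof.
case=> n2 [mm [mp [D [u [C [z [adm n21 tw oz [zD zC uz e]]]]]]]].
have [[L _ eL _] _ _ tiLz] := sdprodP e; rewrite eL in e tiLz.
have [x [sxL i2x u2x ux comm]] := twisted_cyclic adm tw eL.
have oL := card_twisted tw eL; have oG := sdprod_card e; rewrite -orderE oz in oG.
have [n20 o1 o2 _] := adm; have [_ ou _ _] := tw; have [_ Lu _] := twisted_sub eL.
have z2 : (z ^+ 2 = 1)%g by rewrite -oz expg_order.
have zz : (z * z = 1)%g by rewrite -expg2.
have zV : (z^-1 = z)%g by apply/eqP; rewrite eq_invg_mul zz.
have nLz : z \notin L.
  apply/negP => Lz; have : z \in (L :&: <[z]>)%g by rewrite inE Lz cycle_id.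
  by rewrite tiLz inE => /eqP z1; rewrite z1 order1 in oz.
have uX j : ((u ^+ j) ^ z = u ^+ (j + j * 2 ^ n2))%g.
  by rewrite conjXg uz -expgM mulnC mulnDr muln1.
have zx : commute z x.
  apply: comm; apply/finset.setIP; split; [apply/finset.setIP; split|].
  - by apply/centP => d Dd; apply/commute_sym/commgP/conjg_fixP/zD.
  - by apply/centP => d Cd; apply/commute_sym/commgP/conjg_fixP/zC.
  - apply/cent1P; apply/commute_sym/commgP/conjg_fixP.
    by rewrite uX expgD -expnS -ou expg_order mulg1.
pose K := <[x]>%G; have zK h : h \in K -> commute z h by case/cycleP => i ->; exact: commuteX.
have nKz : z \notin K by apply: contra nLz => /(fintype.subsetP sxL).
have NKz : z \in ('N(K))%g.
  by apply/normP; rewrite -cycleJ (_ : x ^ z = x)%g //; apply/conjg_fixP/commgP/commute_sym.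
have K1 : (z ^+ 2)%g \in K by rewrite z2 group1.
have oKL : #|L| = (2 * #|K|)%N by rewrite -(Lagrange sxL) i2x mulnC.
pose H := (K <*> <[z]>)%G; have oH : #|H| = (2 * #|K|)%N := card_join_square NKz nKz K1.
have sKH : K \subset H by exact: joing_subl.
have Hz : z \in H by rewrite -cycle_subG; exact: joing_subr.
have iK : #|H : K|%g = 2%N by apply: index2_of_card.
have sHG : H \subset G by exact: finset.subsetT.
have iH : #|G : H|%g = 2%N by apply: index2_of_card => //; rewrite oH -oKL -oG mulnC.
have HK h : h \in H -> h \notin K -> (h * z)%g \in K by move=> Hh nh; exact: (index2_mul sKH iK).
have nHu : u \notin H.
  apply: contra nLz => Hu; have := HK u Hu ux; move/(fintype.subsetP sxL).
  by rewrite groupMl.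
have NKu : (u^-1)%g \in ('N(K))%g.
  by rewrite groupV (fintype.subsetP (normal_norm (index2_normal sxL i2x))).
have NH g : g \in ('N(H))%g by rewrite (fintype.subsetP (normal_norm (index2_normal sHG iH))) // inE.
have JK h : ((h ^ u^-1)%g \in K) = (h \in K) by rewrite memJ_norm.
have JH h : h \in H -> (h ^ u^-1)%g \in H by move=> Hh; rewrite memJ_norm.
have [a r] := cyclic_embedding R (cycle_cyclic x).
pose f h := if h \in K then a h else - a (h * z)%g.
have a1 : a 1%g = 1%:M := rot1 r.
have fdet h : h \in H -> orthogonal_mx (f h) /\ \det (f h) = if h \in K then 1 else -1.
  move=> Hh; rewrite /f; case: ifP => [Kh|/negbT nh].
    by split; [exact: (rot_orthogonal r)|exact: (rot_det r)].
  have Khz := HK h Hh nh; rewrite det3N (rot_det r Khz).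
  by split=> //; apply: orthogonalN; exact: (rot_orthogonal r).
have fz : f z = - 1%:M by rewrite /f (negPf nKz) zz a1.
have Kk0 : (u ^+ (2 ^ n2))%g \in K.
  by rewrite -(prednK n20) expnS expgM; exact: groupX.
have zu : (z ^ u = u ^+ (2 ^ n2) * z)%g.
  apply: (mulgI u); rewrite -conjgC mulgA -expgS -add1n.
  by rewrite -uz conjgE zV -!mulgA zz mulg1.
have even_K j : ~~ odd j -> (u ^+ j)%g \in K.
  by move=> oj; rewrite -(even_halfK oj) -mul2n expgM; exact: groupX.
have four_ou : (4 %| #[u]%g)%N by rewrite ou -(prednK n20) !expnS mulnA dvdn_mulr.
apply: (@swap_action_image H f u z iH nHu).
- move=> g h Hg Hh; rewrite /f.
  case: (boolP (g \in K)) => Kg; case: (boolP (h \in K)) => Kh.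
  + by rewrite groupM // (rotM r).
  + by rewrite groupMl // (negPf Kh) -mulgA (rotM r) ?HK // mulmxN.
  + rewrite groupMr // (negPf Kg) mulNmx -(rotM r) ?HK //.
    by rewrite -!mulgA (zK h Kh).
  + rewrite (index2_mul sKH iK) // mulmxN mulNmx opprK -(rotM r) ?HK //.
    by rewrite -!mulgA (zK (h * z)%g) ?HK // -!mulgA zz mulg1.
- by move=> h /fdet[].
- by move=> h Hh; rewrite (fdet _ Hh).2 (fdet _ (JH _ Hh)).2 JK.
- by rewrite /f u2x (rot_det r).
- move=> h Hh e1; have := (fdet h Hh).2; rewrite e1 det1; case: ifP => [Kh _|_ /one_neq_N1 //].
  by move: e1; rewrite /f Kh; exact: (rot_inj r).
- move=> h Hh; rewrite (fdet h Hh).2; case: ifP => [_ /one_neq_N1 //|/negbT nh _ [fh fhu]].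
  have Khz := HK h Hh nh; have [oh dh] := fdet h Hh; rewrite (negPf nh) in dh.
  have [hh h1] := (rotoreflection_fixed oh dh).1 fh; rewrite /f (negPf nh) mulmxN mulNmx opprK in hh.
  rewrite /f (negPf nh) (inj_eq oppr_inj) in h1.
  have hz2 : ((h * z) ^+ 2 = 1)%g by apply: (rot_inj r); rewrite ?groupX // expg2 (rotM r).
  have hz1 : (h * z != 1)%g by apply: contra h1 => /eqP->; rewrite a1.
  (* Since f h fixes a point, h z is an involution of the cyclic group K, hence the only one. Then h
     = z ^ u, and h acts on the other factor as z does on the first, without fixed points. *)
  have ek0 : (h * z = u ^+ (2 ^ n2))%g.
    apply: (involution_cycle Khz _ Kk0); first exact: nt_prime_order.
    by rewrite orderXdiv ou expnS ?dvdn_mull // mulnK ?expn_gt0.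
  have eh : (h = z ^ u)%g by rewrite zu -ek0 -mulgA zz mulg1.
  have e1 : (h ^ u^-1 = z)%g by rewrite eh -conjgM mulgV conjg1.
  have [oz' dz'] := fdet z Hz; rewrite (negPf nKz) in dz'.
  rewrite e1 in fhu; have [_] := (rotoreflection_fixed oz' dz').1 fhu.
  by rewrite fz eqxx.
(* An involution off H would be conjugate to some p in the Sylow 2-subgroup generated by u and z.
   For p = u^j, and also for p = u^j z with square u^(2 j (1 + 2^(n2-1))) and n2 > 1, triviality of
   p^2 forces j to be even; then p lies in the normal subgroup H. *)
- move=> g; rewrite !inE andbT => ng; apply/negP => /eqP g2.
  have NUz : z \in ('N(<[u]>))%g.
    by apply/normP/eqP; rewrite eqEcard cardJg leqnn andbT -cycleJ cycle_subG uz mem_cycle.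
  have nUz : z \notin <[u]>%g.
    by apply: contra nLz; apply: fintype.subsetP; rewrite cycle_subG.
  have U1 : (z ^+ 2)%g \in <[u]>%g by rewrite z2 group1.
  pose P := (<[u]> <*> <[z]>)%G.
  have oP : #|P| = (2 * #|(<[u]>)%g|)%N := card_join_square (K := <[u]>%G) NUz nUz U1.
  have sP : (2.-Sylow(G) P)%g.
    have eG : #|G| = (2 ^ n2.+2 * (mm * mp))%N by rewrite -oG oL (expnS 2 n2.+1); ring.
    have oP' : #|P| = (2 ^ n2.+2)%N by rewrite oP -orderE ou [RHS]expnS.
    have eG2 : ((#|G|)`_2 = 2 ^ n2.+2)%N by rewrite eG two_part // oddM o1.
    by rewrite pHallE finset.subsetT; apply/eqP; rewrite [LHS]oP'; exact: esym eG2.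
  have [y _ Py] := sylow_involution sP (finset.in_setT g) g2.
  have p2 : ((g ^ y) ^+ 2 = 1)%g by rewrite -conjXg g2 conj1g.
  have np : (g ^ y)%g \notin H by rewrite memJ_norm.
  move: (g ^ y)%g Py p2 np => p Pp p2; apply/negP; rewrite negbK.
  have sUP : <[u]>%G \subset P by exact: joing_subl.
  have iU : #|P : <[u]>%G|%g = 2%N by apply: index2_of_card.
  have Pz : z \in P by rewrite -cycle_subG; exact: joing_subr.
  have [/cycleP[j ej]|nU] := boolP (p \in <[u]>%g).
    rewrite ej; apply: (fintype.subsetP sKH); apply: even_K.
    move: p2; rewrite ej -expgM => /eqP; rewrite -order_dvdn => /(dvdn_trans four_ou).
    by rewrite -[4%N]/(2 * 2)%N dvdn_pmul2r // dvdn2.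
  have /cycleP[j ej] : (p * z)%g \in <[u]>%g by exact: (index2_mul sUP iU).
  have ep : (p = u ^+ j * z)%g by rewrite -ej -mulgA zz mulg1.
  rewrite ep groupM //; apply: (fintype.subsetP sKH); apply: even_K.
  have : (u ^+ j * (u ^+ j) ^ z = 1)%g.
    by rewrite -p2 ep expg2 conjgE zV !mulgA.
  rewrite uX -expgD => /eqP; rewrite -order_dvdn => /(dvdn_trans four_ou).
  rewrite addnA addnn -mul2n -(prednK n20) expnS mulnCA -mulnDr -[4%N]/(2 * 2)%N dvdn_pmul2l //.
  rewrite dvdn2 oddD oddM.
  have -> : odd (2 ^ n2.-1) = false by case: (n2) n21 => [|[|k]] // _; rewrite /= oddX.
  by rewrite andbF addbF.
- exact: Hz.
- by rewrite (fdet z Hz).2 (negPf nKz).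
Qed.

End ConverseActions.

Local Open Scope ring_scope.
Local Open Scope classical_set_scope.

(** * Assembly of the classification *)

Section Classification.
Variables (R : realType) (gT : finGroupType).
Local Notation G := [set: gT]%G.
Implicit Types (to : {action gT &-> S2xS2 R}).
Local Notation acts to := (linear_orientation_preserving to /\ pseudofree to).

Lemma classify1 to : acts to -> phi_image to = [set 1%:M] -> list1 G.
Proof.
case=> lin pf; have [w [A [B rep]]] := represented_exists lin.
rewrite trivial_image => /(phi_image_eqP rep (fun w e => ~~ w && ~~ e))[triv _].
exact: (forward1 rep pf triv).
Qed.

Lemma classify2 to : acts to -> phi_image to = generated_mx [set minus_id] ->
  exists n, [/\ (0 < n)%N, cyclic_of_order n (phi_ker to) & list2 G n].
Proof.
case=> lin pf; have [w [A [B rep]]] := represented_exists lin.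
rewrite generated_minus => /(phi_image_eqP rep (fun w _ => ~~ w))[nw ex].
by apply: (forward2 rep pf nw); have [g [_ eg]] := ex false true isT; exists g.
Qed.

Lemma classify3 to : acts to -> phi_image to = generated_mx [set swap_mx] ->
  [\/ list3a G, list3b G | exists2 K : {group gT}, phi_ker to = K & list3c G K].
Proof.
case=> lin pf; have [w [A [B rep]]] := represented_exists lin.
rewrite generated_swap => /(phi_image_eqP rep (fun _ e => ~~ e))[ne ex].
have exw : exists g, w g by have [g [wg _]] := ex true false isT; exists g.
case: (forward3 rep pf exw (fun g _ => ne g)) => [l|l|[K eK l]].
- by constructor 1.
- by constructor 2.
- by constructor 3; exists K => //; rewrite (phi_kerE rep) -eK.
Qed.

Lemma classify4 to : acts to -> phi_image to = generated_mx [set minus_id; swap_mx] -> list4 G.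
Proof.
case=> lin pf; have [w [A [B rep]]] := represented_exists lin.
rewrite generated_minus_swap => /(phi_image_eqP rep (fun _ _ => true))[_ ex].
have exw : exists g, w g by have [g [wg _]] := ex true false isT; exists g.
apply: (forward4 rep pf exw).
by have [g [wg eg]] := ex false true isT; exists g; rewrite ?wg ?eg.
Qed.

Lemma classify to : acts to ->
  [\/ list1 G, exists2 n, (0 < n)%N & list2 G n, list3 G | list4 G].
Proof.
case=> lin pf; have [w [A [B rep]]] := represented_exists lin.
have [exw|/forallNP nw] := pselect (exists g, w g).
  have [exe|/forall2NP ne] := pselect (exists2 g, ~~ w g & reverses A g).
    by constructor 4; exact: (forward4 rep pf exw exe).
  constructor 3; case: (forward3 rep pf exw) => [g wg|l|l|[K _ l]].
  - by case: (ne g) => [/(_ wg)|/negP].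
  - by constructor 1.
  - by constructor 2.
  - by constructor 3; exists K.
have {}nw g : ~~ w g by apply/negP; exact: nw.
have [exe|/forallNP ne] := pselect (exists g, reverses A g).
  by constructor 2; have [n [n0 _ l]] := forward2 rep pf nw exe; exists n.
by constructor 1; apply: (forward1 rep pf) => g; rewrite nw; apply/negP; exact: ne.
Qed.

End Classification.

Theorem theorem3p9 (R : realType) (gT : finGroupType) :
  let G := [set: gT]%G in
  let acts (to : {action gT &-> S2xS2 R}) :=
    linear_orientation_preserving to /\ pseudofree to in
  let acts_with_phi P to := acts to /\ phi_image to = P in
  let phi1 := [set 1%:M] in
  let phi2 := generated_mx [set minus_id] in
  let phi3 := generated_mx [set swap_mx] in
  let phi4 := generated_mx [set minus_id; swap_mx] in
  ((exists to, acts to) <->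
     [\/ list1 G, exists2 n, (0 < n)%N & list2 G n, list3 G | list4 G]) /\
  [/\ (exists to, acts_with_phi phi1 to) <-> list1 G,
      ((exists to, acts_with_phi phi2 to) <->
         exists2 n, (0 < n)%N & list2 G n) /\
      (forall to, acts_with_phi phi2 to ->
         exists n, [/\ (0 < n)%N, cyclic_of_order n (phi_ker to) & list2 G n]),
      [/\ (exists to, acts_with_phi phi3 to) <-> list3 G,
          forall to, acts_with_phi phi3 to ->
            [\/ list3a G, list3b G
              | exists2 K : {group gT}, phi_ker to = K & list3c G K]
        & forall K : {group gT}, list3c G K ->
            exists2 to, acts_with_phi phi3 to & phi_ker to = K]
    & (exists to, acts_with_phi phi4 to) <-> list4 G].
Proof.
move=> G acts acts_with_phi phi1 phi2 phi3 phi4.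
have c4 : list4 G -> exists2 to, acts to & phi_image to = phi4.
  by case=> l; [exact: converse4a|exact: converse4b].
split; last split.
- split=> [[to act]|]; first exact: classify act.
  case=> [/(converse1 R)|[n n0 /(converse2 R n0)]|/(converse3 R)|/c4] [to act _];
    by exists to.
- split=> [[to [act im]]|/(converse1 R)[to act im]]; first exact: classify1 act im.
  by exists to.
- split=> [|to [act im]]; last exact: classify2 act im.
  split=> [[to [act im]]|[n n0 /(converse2 R n0)[to act im]]]; last by exists to.
  by have [n [n0 _ l]] := classify2 act im; exists n.
- split=> [|to [act im]|K /(converse3c R)[to act [im kE]]]; last by exists to.
    split=> [[to [act im]]|/(converse3 R)[to act im]]; last by exists to.
    case: (classify3 act im) => [l|l|[K _ l]]; [by constructor 1|by constructor 2|].
    by constructor 3; exists K.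
  exact: classify3 act im.
- by split=> [[to [act im]]|/c4[to act im]]; [exact: classify4 act im|exists to].
Qed.
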